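(* Let $n \geq 3$. Then \[ (\mathbf{R}_{n} + n-1)^2\left\|\frac{P^\perp f}{|x|^2}\right\|_{2}^2 \leq \|\Delta P^\perp f\|_{2}^2 \] holds for all $f\in H^2(\mathbb{R}^n)$; equivalently, $(\mathbf{R}_{n} + n-1)^2\left\|\frac{f}{|x|^2}\right\|_{2}^2 \leq \|\Delta f\|_{2}^2$ holds for all $f\in H^2(\mathbb{R}^n)$ with $Pf=0$.
   Context: $\|\cdot\|_2$ denotes the norm of $L^2(\mathbb{R}^n)$ (Lebesgue measure). $\Delta$ is the standard Laplacian on $\mathbb{R}^n$. $\mathbf{R}_n = \frac{n(n-4)}{4}$. $H^2(\mathbb{R}^n)$ is the Sobolev space with norm $\|f\|_{H^2} = \|(1-\Delta)f\|_2$. $P$ is the orthogonal projection of $L^2(\mathbb{R}^n)$ onto radially symmetric functions, given by $Pf(x) = \frac{1}{\sigma(\mathbb{S}^{n-1})} \int_{\mathbb{S}^{n-1}} f(|x|\omega)\, \mathrm{d}\sigma(\omega)$, where $\sigma$ is the surface measure on $\mathbb{S}^{n-1}$, and $P^{\perp}=I-P$. *)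

(* Defs.v *)
From HB Require Import structures.
From mathcomp Require Import all_boot all_order all_algebra.
From mathcomp Require Import all_classical all_reals all_analysis.
From mathcomp Require Import measurable_realfun complex.
Import Order.TTheory GRing.Theory Num.Theory.
Import numFieldNormedType.Exports.
Import ComplexField.Normc.

Set Implicit Arguments.
Unset Strict Implicit.
Unset Printing Implicit Defensive.

Local Open Scope classical_set_scope.
Local Open Scope ring_scope.

(* The library has no measurable structure on 'rV[R]_n; it is given the
   sigma-algebra generated by the coordinates, that is, the Borel sets of R^n. *)
Section rV_measurable.
Context {R : realType} (n : nat).

Let coor (i : 'I_n) (x : 'rV[R]_n) : R := x ord0 i.

Let rV_set0 : g_sigma_preimage coor set0.
Proof. exact: sigma_algebra0. Qed.

Let rV_setC A : g_sigma_preimage coor A -> g_sigma_preimage coor (~` A).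
Proof. exact: sigma_algebraC. Qed.

Let rV_bigcup (F : _^nat) : (forall i, g_sigma_preimage coor (F i)) ->
  g_sigma_preimage coor (\bigcup_i (F i)).
Proof. exact: sigma_algebra_bigcup. Qed.

HB.instance Definition _ := @isMeasurable.Build default_measure_display
  'rV[R]_n (g_sigma_preimage coor) rV_set0 rV_setC rV_bigcup.

End rV_measurable.

Lemma measurable_coor (R : realType) n (i : 'I_n) :
  measurable_fun [set: 'rV[R]_n] (fun x : 'rV[R]_n => x ord0 i).
Proof.
move=> _ Y mY; rewrite setTI; apply: sub_sigma_algebra => /=.
rewrite -bigcup_seq/=; exists i => /=; first by rewrite mem_index_enum.
by exists Y => //; rewrite setTI.
Qed.

Lemma measurable_fun_rVP (R : realType) n d (T : measurableType d)
    (f : T -> 'rV[R]_n) :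
  measurable_fun [set: T] f <->
  forall i, measurable_fun [set: T] (fun x => f x ord0 i).
Proof.
split=> [mf i|mf].
  exact: (measurableT_comp (@measurable_coor R n i) mf).
suff : g_sigma_preimage (fun i x => f x ord0 i) `<=` @measurable _ T.
  move=> prefS _ A mA; rewrite setTI; apply: prefS.
  have -> := @g_sigma_preimage_comp _ _ n 'rV[R]_n
    (fun i (x : 'rV[R]_n) => x ord0 i) T f.
  by exists A => //; rewrite setTI.
apply: smallest_sub; first exact: sigma_algebra_measurable.
case: n => [|n] in f mf *; first by rewrite big_ord0.
rewrite -bigcup_mkord_ord; apply: bigcup_sub => i Ii.
by move=> A [B mB <-]; exact: mf.
Qed.

Section lebesgue_step.
Local Open Scope ereal_scope.
Context {R : realType} (n : nat).
Variable m : {sigma_finite_measure set 'rV[R]_n -> \bar R}.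

Definition cons_rV (p : measurableTypeR R * 'rV[R]_n) : 'rV[R]_n.+1 :=
  row_mx (p.1%:M : 'rV_1) p.2.

Let uncons_rV (x : 'rV[R]_n.+1) : measurableTypeR R * 'rV[R]_n :=
  (x ord0 ord0, \row_i x ord0 (lift ord0 i)).

Let cons_rV0 p : cons_rV p ord0 ord0 = p.1.
Proof.
have -> : ord0 = lshift n (ord0 : 'I_1) by exact/val_inj.
by rewrite [LHS]row_mxEl mxE eqxx.
Qed.

Let cons_rVS p i : cons_rV p ord0 (lift ord0 i) = p.2 ord0 i.
Proof.
have -> : lift ord0 i = rshift 1 i by exact/val_inj.
by rewrite [LHS]row_mxEr.
Qed.

Let cons_rVK : cancel cons_rV uncons_rV.
Proof.
move=> [a v]; congr pair; first exact: cons_rV0.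
by apply/rowP => i; rewrite mxE cons_rVS.
Qed.

Let uncons_rVK : cancel uncons_rV cons_rV.
Proof.
move=> x; apply/rowP => i.
have [->|] := eqVneq i ord0; first by rewrite cons_rV0.
rewrite eq_sym => /unlift_some[j -> _].
by rewrite cons_rVS mxE.
Qed.

Let measurable_cons_rV : measurable_fun setT cons_rV.
Proof.
apply/measurable_fun_rVP => i.
have [->|] := eqVneq i ord0.
  by under eq_fun do rewrite cons_rV0; exact: measurable_fst.
rewrite eq_sym => /unlift_some[j -> _].
under eq_fun do rewrite cons_rVS.
exact: (measurableT_comp (@measurable_coor R n j) measurable_snd).
Qed.

Let measurable_uncons_rV : measurable_fun setT uncons_rV.
Proof.
apply/measurable_fun_pairP; split.
  exact: measurable_coor.
apply/measurable_fun_rVP => i.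
rewrite (_ : (fun _ => _) = fun x : 'rV[R]_n.+1 => x ord0 (lift ord0 i)).
  exact: measurable_coor.
by apply/funext => x /=; rewrite mxE.
Qed.

Definition lebesgue_step : set 'rV[R]_n.+1 -> \bar R :=
  pushforward (lebesgue_measure \x m) cons_rV.

Let step0 : lebesgue_step set0 = 0.
Proof. by rewrite /lebesgue_step /pushforward preimage_set0 measure0. Qed.

Let step_ge0 A : 0 <= lebesgue_step A.
Proof. exact: measure_ge0. Qed.

Let step_sigma_additive : semi_sigma_additive lebesgue_step.
Proof.
move=> F mF tF mUF; rewrite /lebesgue_step /pushforward preimage_bigcup.
have mpre A : measurable A -> measurable (cons_rV @^-1` A).
  by move=> mA; rewrite -[X in measurable X]setTI; exact: measurable_cons_rV.
apply: measure_semi_sigma_additive.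
- by move=> k; exact: mpre.
- apply/trivIsetP => /= i j _ _ ij; rewrite -preimage_setI.
  by move/trivIsetP : tF => /(_ _ _ _ _ ij) ->//; rewrite preimage_set0.
- by rewrite -preimage_bigcup; exact: mpre.
Qed.

HB.instance Definition _ := isMeasure.Build _ _ _ lebesgue_step
  step0 step_ge0 step_sigma_additive.

Let step_sigma_finite : sigma_finite setT lebesgue_step.
Proof.
have /sigma_finiteP[F [TF ndF Foo]] := sigma_finiteT (@lebesgue_measure R).
have /sigma_finiteP[G [TG ndG Goo]] := sigma_finiteT m.
exists (fun k => uncons_rV @^-1` (F k `*` G k)).
  apply/esym; rewrite -subTset => x _.
  have [i _ Fi] : (\bigcup_k F k) (uncons_rV x).1 by rewrite -TF.
  have [j _ Gj] : (\bigcup_k G k) (uncons_rV x).2 by rewrite -TG.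
  exists (maxn i j) => //; split.
    by move: Fi; exact/subsetPset/ndF/leq_maxl.
  by move: Gj; exact/subsetPset/ndG/leq_maxr.
move=> k; have [mF Fk] := Foo k; have [mG Gk] := Goo k; split.
  rewrite -[X in measurable X]setTI; apply: measurable_uncons_rV => //.
  exact: measurableX.
rewrite /lebesgue_step /pushforward -comp_preimage.
rewrite (_ : uncons_rV \o cons_rV = id); last first.
  by apply/funext => p /=; exact: cons_rVK.
by rewrite preimage_id product_measure1E// lte_mul_pinfty// ge0_fin_numE.
Qed.

HB.instance Definition _ := Measure_isSigmaFinite.Build _ _ _ lebesgue_step
  step_sigma_finite.

End lebesgue_step.

(* Lebesgue measure on R^n, as the n-fold product of the one on R. *)
Fixpoint lebesgue_rV {R : realType} (n : nat) :
    {sigma_finite_measure set 'rV[R]_n -> \bar R} :=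
  match n with
  | 0 => dirac (0 : 'rV[R]_0)
  | n'.+1 => lebesgue_step (lebesgue_rV n')
  end.

(* The norm `|x| of the library on 'rV[R]_n is the sup norm. *)
Definition enorm {R : realType} n (x : 'rV[R]_n) : R :=
  Num.sqrt (\sum_i x ord0 i ^+ 2).

Lemma measurable_enorm {R : realType} n :
  measurable_fun setT (@enorm R n).
Proof.
rewrite /enorm.
apply: (measurableT_comp (f := @Num.sqrt R)) => //=.
  by apply: continuous_measurable_fun; exact: sqrt_continuous.
apply: measurable_sum => i; apply: measurable_funX; exact: measurable_coor.
Qed.

Section sphere.
Local Open Scope ereal_scope.
Context {R : realType} (n : nat).

Definition sphere : set 'rV[R]_n := [set x | enorm x = 1%R].

Definition cone (A : set 'rV[R]_n) : set 'rV[R]_n :=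
  [set x | (0 < enorm x <= 1)%R /\ A ((enorm x)^-1 *: x)].

(* The surface measure of E \subset S^(n-1) is n times the volume of the
   cone over E with apex 0 (polar coordinates). *)
Definition sphere_measure (A : set 'rV[R]_n) : \bar R :=
  n%:R%:E * lebesgue_rV n (cone A).

Let measurable_cone A : measurable A -> measurable (cone A).
Proof.
move=> mA.
have mnor : measurable_fun setT (fun x : 'rV[R]_n => ((enorm x)^-1 *: x)%R).
  apply/measurable_fun_rVP => i.
  rewrite (_ : (fun _ => _) =
      (fun x : 'rV[R]_n => (enorm x `^ (-1)) * x ord0 i)%R); last first.
    by apply/funext => x; rewrite mxE powR_inv1// sqrtr_ge0.
  apply: measurable_funM; last exact: measurable_coor.
  exact: (measurableT_comp (measurable_powR _) (@measurable_enorm R n)).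
rewrite (_ : cone A = (@enorm R n @^-1` `]0%R, 1%R]) `&`
    ((fun x : 'rV[R]_n => ((enorm x)^-1 *: x)%R) @^-1` A)).
  apply: measurableI; rewrite -[X in measurable X]setTI.
    exact: measurable_enorm.
  exact: mnor.
by apply/seteqP; split => x /=; rewrite in_itv.
Qed.

Let sphere_measure0 : sphere_measure set0 = 0.
Proof.
rewrite /sphere_measure (_ : cone set0 = set0) ?measure0 ?mule0//.
by apply/seteqP; split => x // [].
Qed.

Let sphere_measure_ge0 A : 0 <= sphere_measure A.
Proof. by rewrite mule_ge0// lee_fin. Qed.

Let sphere_measure_sigma_additive : semi_sigma_additive sphere_measure.
Proof.
move=> F mF tF mUF; rewrite /sphere_measure.
have -> : cone (\bigcup_k F k) = \bigcup_k cone (F k).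
  apply/seteqP; split => [x [x1 [k _ Fk]]|x [k _ [x1 Fk]]]; first by exists k.
  by split=> //; exists k.
rewrite (_ : (fun _ => _) = (fun k => n%:R%:E *
    \sum_(0 <= i < k) lebesgue_rV n (cone (F i)))); last first.
  by apply/funext => k; rewrite ge0_sume_distrr.
apply: cvgeZl => //; apply: measure_semi_sigma_additive.
- by move=> k; exact: measurable_cone.
- apply/trivIsetP => i j _ _ ij; apply/seteqP; split => // x [[_ Fi] [_ Fj]].
  move/trivIsetP : tF => /(_ i j Logic.I Logic.I ij) /seteqP[+ _].
  by move/(_ ((enorm x)^-1 *: x)%R); apply; split.
- by apply: bigcup_measurable => k _; exact: measurable_cone.
Qed.

HB.instance Definition _ := isMeasure.Build _ _ _ sphere_measure
  sphere_measure0 sphere_measure_ge0 sphere_measure_sigma_additive.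

End sphere.

Section test_functions.
Context {R : realType} (n : nat).
Implicit Types (phi : 'rV[R]_n -> R) (i : 'I_n) (s : seq 'I_n).

Definition partial i phi : 'rV[R]_n -> R :=
  fun x => 'D_(delta_mx ord0 i) phi x.

Definition iter_partial s phi : 'rV[R]_n -> R := foldr partial phi s.

Definition smooth phi := forall s,
  continuous (iter_partial s phi) /\
  forall i x, derivable (iter_partial s phi) x (delta_mx ord0 i).

Definition test_function phi :=
  smooth phi /\ compact (closure [set x | phi x != 0]).

Definition classical_laplacian phi : 'rV[R]_n -> R :=
  fun x => \sum_i iter_partial [:: i; i] phi x.

End test_functions.

Local Open Scope complex_scope.

(* Total: a component that is not integrable gets a conventional value. *)
Definition Cintegral {R : realType} d (T : measurableType d)
    (mu : {measure set T -> \bar R}) (D : set T) (f : T -> R[i]) : R[i] :=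
  (Rintegral mu D (fun x => complex.Re (f x))) +i*
  (Rintegral mu D (fun x => complex.Im (f x))).

Section sobolev.
Context {R : realType} (n : nat).
Implicit Types f g : 'rV[R]_n -> R[i].

(* \|f\|_2, with value +oo when f is not square integrable *)
Definition L2norm f : \bar R :=
  'N[lebesgue_rV n]_2%:E[EFin \o (@normc R \o f)].

(* Elements of L^2 are handled through Borel representatives. *)
Definition L2 f : Prop :=
  [/\ measurable_fun setT (fun x => complex.Re (f x)),
      measurable_fun setT (fun x => complex.Im (f x)) &
      (L2norm f < +oo)%E].

(* Delta f = g in the sense of distributions; by linearity it is enough to
   test against real-valued functions. *)
Definition is_laplacian f g : Prop :=
  [/\ L2 f, L2 g & forall phi : 'rV[R]_n -> R, test_function phi ->
    Cintegral (lebesgue_rV n) setT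
      (fun x => f x * (classical_laplacian phi x)%:C) =
    Cintegral (lebesgue_rV n) setT (fun x => g x * (phi x)%:C)].

(* H^2 = {f in L^2 | (1 - Delta) f in L^2} = {f in L^2 | Delta f in L^2} *)
Definition H2 f : Prop := exists g, is_laplacian f g.

(* A representative of Delta f for f in H^2; outside H^2 the value is 0, so
   that an upper bound by its norm does not become vacuous there. *)
Definition laplacian f : 'rV[R]_n -> R[i] :=
  xget (fun=> 0) [set g | is_laplacian f g].

(* For f in L^2 the integral over the sphere of radius |x| converges for
   almost every x. *)
Definition radial_proj f : 'rV[R]_n -> R[i] := fun x =>
  ((fine (sphere_measure (@sphere R n)))^-1)%:C *
  Cintegral (@sphere_measure R n) (@sphere R n)
    (fun w => f (enorm x *: w)).

Definition radial_proj_perp f : 'rV[R]_n -> R[i] :=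
  fun x => f x - radial_proj f x.

(* f / |x|^2, with value 0 at the origin *)
Definition div_sqnorm f : 'rV[R]_n -> R[i] :=
  fun x => f x / (enorm x ^+ 2)%:C.

End sobolev.

Definition rellich_const (R : realType) (n : nat) : R :=
  n%:R * (n%:R - 4) / 4.

(* Main.v *)
Require Import Defs.
From HB Require Import structures.
From mathcomp Require Import all_boot all_order all_algebra.
From mathcomp Require Import all_classical all_reals all_analysis.
From mathcomp Require Import measurable_realfun complex ring lra.
Import Order.TTheory GRing.Theory Num.Theory.
Import numFieldNormedType.Exports.
Import HBNNSimple.

Set Implicit Arguments.
Unset Strict Implicit.
Unset Printing Implicit Defensive.

Local Open Scope classical_set_scope.
Local Open Scope ring_scope.

(* Put q = |x|^2 + eps. If f is orthogonal to radial functions, then so is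
   u = f q^((n-2)/4), and the Gaussian Poincare inequality applies to u without
   a mean term for every centered Gaussian exp(-t |x|^2 / 2). Taking t = |y|^2,
   multiplying by exp(- eps |y|^2 / 2) and integrating over y in R^n turns this
   family of inequalities into a Hardy inequality whose weights are powers of q
   and whose constant accounts for the first spherical eigenvalue n - 1.
   Integrating -(Delta f) f / q by parts and using the Cauchy-Schwarz inequality,
     (n^2/4 - 1)^2 \int f^2 / q^2 <= \int (Delta f)^2
   for regular f, and n^2/4 - 1 = n(n-4)/4 + n - 1. Mollification, which
   preserves the orthogonality to radial functions, and eps -> 0 extend this to
   weak Laplacians. Finally P maps H^2 to itself and commutes with Delta, since
   the spherical mean of a translated radial mollifier is a test function. *)

(** * Tonelli's theorem and changes of variables *)

(** Expansion in spherical harmonics is avoided: the Gaussian inequality already singles out the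
    linear functions as its extremals. The exponent (n-2)/4 is the one for which, at eps = 0, u is
    linear when f = x_i |x|^(-(n-2)/2). This is the first spherical harmonic at degree (4-n)/2, the
    degree at which \int f^2 / |x|^4 is scale invariant, and there Delta f = - (n^2/4 - 1) f /
    |x|^2. Formally every inequality of the argument is an equality on it, which is why nothing is
    lost in the constant. The parameter eps bounds the weights, so that all integrations by parts
    pair functions of L^2. The spherical mean meets another obstacle: it depends on x through |x|,
    which is not smooth at the origin, so that the mean of a test function is not visibly a test
    function. For a radial kernel centered at z, a reflection turns the mean over the sphere of
    radius |x| into a superposition of translates centered on the sphere of radius |z|, in which x
    enters only by translation. *)

Section ge0_real_integral.
Context d (T : measurableType d) (R : realType) (mu : {measure set T -> \bar R}).
Implicit Types f g : T -> R.
Local Open Scope ereal_scope.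

Lemma ge0_eintegralD f g : measurable_fun setT f -> measurable_fun setT g ->
  (forall x, 0 <= f x)%R -> (forall x, 0 <= g x)%R ->
  \int[mu]_x (f x + g x)%:E = \int[mu]_x (f x)%:E + \int[mu]_x (g x)%:E.
Proof.
move=> mf mg f0 g0; rewrite -ge0_integralD//.
- by move=> x _; rewrite lee_fin.
- exact/measurable_EFinP.
- by move=> x _; rewrite lee_fin.
- exact/measurable_EFinP.
Qed.

Lemma ge0_eintegralZ (c : R) f : measurable_fun setT f -> (0 <= c)%R ->
  (forall x, 0 <= f x)%R ->
  \int[mu]_x (c * f x)%:E = c%:E * \int[mu]_x (f x)%:E.
Proof.
move=> mf c0 f0; rewrite -ge0_integralZl_EFin//.
- by move=> x _; rewrite lee_fin.
- exact/measurable_EFinP.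
Qed.

Lemma ge0_eintegral_le f g : measurable_fun setT f -> measurable_fun setT g ->
  (forall x, 0 <= f x)%R -> (forall x, f x <= g x)%R ->
  \int[mu]_x (f x)%:E <= \int[mu]_x (g x)%:E.
Proof.
move=> mf mg f0 fg; apply: ge0_le_integral => //.
- by move=> x _; rewrite lee_fin.
- exact/measurable_EFinP.
- exact/measurable_EFinP.
- by move=> x _; rewrite lee_fin.
Qed.

End ge0_real_integral.

Section tonelli.
Context d1 d2 (T1 : measurableType d1) (T2 : measurableType d2) (R : realType).
Variables (m1 : {sigma_finite_measure set T1 -> \bar R})
  (m2 : {sigma_finite_measure set T2 -> \bar R}) (f : T1 -> T2 -> \bar R).
Hypothesis mf : measurable_fun setT (fun p => f p.1 p.2).
Hypothesis f0 : forall x y, (0 <= f x y)%E.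
Local Open Scope ereal_scope.

Lemma tonelli_swap :
  \int[m1]_x \int[m2]_y f x y = \int[m2]_y \int[m1]_x f x y.
Proof. exact: (fubini_tonelli (fun p => f p.1 p.2)). Qed.

Lemma measurable_tonelli1 : measurable_fun setT (fun x => \int[m2]_y f x y).
Proof. exact: (measurable_fun_fubini_tonelli_F (fun p => f p.1 p.2)). Qed.

Lemma measurable_tonelli2 : measurable_fun setT (fun y => \int[m1]_x f x y).
Proof. exact: (measurable_fun_fubini_tonelli_G (fun p => f p.1 p.2)). Qed.

End tonelli.

Section lebesgue1.
Context {R : realType}.
Notation mu := (@lebesgue_measure R).
Local Open Scope ereal_scope.

(** Uniqueness of Lebesgue measure: [|t|] times the image of [mu] under x |-> t x + b gives each
    interval ]c, d] its length. For t < 0 the preimage of such an interval is closed on the left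
    instead of the right, hence the two cases. *)
Lemma ge0_integral_affine (t b : R) (F : measurableTypeR R -> \bar R) :
  (t != 0)%R -> measurable_fun setT F -> (forall x, 0 <= F x) ->
  \int[mu]_x F (t * x + b)%R = `|t|^-1%:E * \int[mu]_x F x.
Proof.
move=> t0 mF F0.
have mphi : measurable_fun setT
    (fun x : measurableTypeR R => (t * x + b)%R : measurableTypeR R).
  by apply: measurable_funD => //; exact: measurable_funM.
transitivity (\int[pushforward mu (fun x : measurableTypeR R =>
    (t * x + b)%R : measurableTypeR R)]_x F x).
  by rewrite ge0_integral_pushforward//= => y _; exact: F0.
have t1 : (0 <= `|t|)%R by [].
have t1' : (0 <= `|t|^-1)%R by rewrite invr_ge0.
rewrite -(@ge0_integral_mscale _ _ R mu _ measurableT (NngNum t1'))//.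
apply: eq_measure_integral => A mA _.
pose nu := pushforward (mscale (NngNum t1) mu) (fun x : measurableTypeR R =>
    (t * x + b)%R : measurableTypeR R).
have nuE : forall A, measurable A -> mu A = nu A.
  pose phi : {mfun measurableTypeR R >-> measurableTypeR R} :=
    HB.pack (fun x : measurableTypeR R =>
    (t * x + b)%R : measurableTypeR R) (isMeasurableFun.Build _ _ _ _ _ mphi).
  apply: (@lebesgue_measure_unique R (pushforward (mscale (NngNum t1) mu) phi)).
  move=> /= _ [[c d]] _ <-.
  rewrite /pushforward/= /mscale/=.
  have [tp|tn] := ltP 0%R t.
    have -> : (fun x : R => t * x + b)%R @^-1` [set` `]c, d]]
        = [set` `](c - b)%R / t, (d - b)%R / t]%R].
      apply/seteqP; split => x /=; rewrite !in_itv/=.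
        by rewrite ltr_pdivrMr// ler_pdivlMr// ltrBlDr lerBrDr (mulrC x).
      by rewrite ltr_pdivrMr// ler_pdivlMr// ltrBlDr lerBrDr (mulrC x).
    rewrite !lebesgue_measure_itv/= !lte_fin ltr_pM2r ?invr_gt0// ltrD2r.
    case: ifPn => cd; last by rewrite mule0.
    rewrite -EFinM; congr EFin; rewrite gtr0_norm// -mulrBl opprB addrA subrK.
    by rewrite mulrCA divff ?mulr1.
  have {}tn : (t < 0)%R by rewrite lt_neqAle t0.
  have -> : (fun x : R => t * x + b)%R @^-1` [set` `]c, d]]
      = [set` `[(d - b)%R / t, (c - b)%R / t[%R].
    apply/seteqP; split => x /=; rewrite !in_itv/=.
      by rewrite ltr_ndivlMr// ler_ndivrMr// ltrBlDr lerBrDr (mulrC x) andbC.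
    by rewrite ltr_ndivlMr// ler_ndivrMr// ltrBlDr lerBrDr (mulrC x) andbC.
  rewrite !lebesgue_measure_itv/= !lte_fin ltr_nM2r ?invr_lt0// ltrD2r.
  case: ifPn => cd; last by rewrite mule0.
  rewrite -EFinM; congr EFin; rewrite ltr0_norm// -mulrBl opprB addrA subrK.
  by rewrite mulNr -mulrN -mulNr opprB mulrCA divff ?mulr1.
rewrite /= /mscale/= nuE// /nu /pushforward /mscale/= muleA -EFinM mulVf ?mul1e//.
by rewrite normr_eq0.
Qed.

End lebesgue1.

Section cons_rV.
Context {R : realType} {n : nat}.
Implicit Types (a b : R) (v w : 'rV[R]_n).

Lemma cons_rV0 a v : cons_rV (a, v) ord0 ord0 = a.
Proof.
have -> : ord0 = lshift n (ord0 : 'I_1) by exact/val_inj.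
by rewrite [LHS]row_mxEl mxE eqxx.
Qed.

Lemma cons_rVS a v i : cons_rV (a, v) ord0 (lift ord0 i) = v ord0 i.
Proof.
have -> : lift ord0 i = rshift 1 i by exact/val_inj.
by rewrite [LHS]row_mxEr.
Qed.

Lemma rowP_cons (x y : 'rV[R]_n.+1) : x ord0 ord0 = y ord0 ord0 ->
  (forall i, x ord0 (lift ord0 i) = y ord0 (lift ord0 i)) -> x = y.
Proof.
move=> h0 hS; apply/rowP => i.
have [->//|] := eqVneq i ord0.
by rewrite eq_sym => /unlift_some[j -> _].
Qed.

Lemma cons_rVD a v b w : cons_rV (a + b, v + w) = cons_rV (a, v) + cons_rV (b, w).
Proof.
apply: rowP_cons => [|i]; first by rewrite [RHS]mxE !cons_rV0.
by rewrite [RHS]mxE !cons_rVS mxE.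
Qed.

Lemma cons_rVZ t a v : cons_rV (t * a, t *: v) = t *: cons_rV (a, v).
Proof.
apply: rowP_cons => [|i]; first by rewrite [RHS]mxE !cons_rV0.
by rewrite [RHS]mxE !cons_rVS mxE.
Qed.

Lemma cons_rV_delta0 a v s :
  cons_rV (s + a, v) = s *: delta_mx ord0 ord0 + cons_rV (a, v).
Proof.
apply: rowP_cons => [|i]; first by rewrite [RHS]mxE !cons_rV0 !mxE/= mulr1.
by rewrite [RHS]mxE !cons_rVS !mxE/= mulr0 add0r.
Qed.

Lemma cons_rV_deltaS a v s i : cons_rV (a, s *: delta_mx ord0 i + v) =
  s *: delta_mx ord0 (lift ord0 i) + cons_rV (a, v).
Proof.
apply: rowP_cons => [|j]; first by rewrite [RHS]mxE !cons_rV0 !mxE/= mulr0 add0r.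
by rewrite [RHS]mxE !cons_rVS !mxE/= (inj_eq lift_inj).
Qed.

Lemma exists_cons_rV (x : 'rV[R]_n.+1) : exists a v, x = cons_rV (a, v).
Proof.
exists (x ord0 ord0), (\row_i x ord0 (lift ord0 i)).
by apply: rowP_cons => [|i]; rewrite ?cons_rV0// cons_rVS mxE.
Qed.

Lemma measurable_cons_rV :
  measurable_fun setT (@cons_rV R n : measurableTypeR R * 'rV[R]_n -> _).
Proof.
apply/measurable_fun_rVP => i.
have [->|] := eqVneq i ord0.
  rewrite (_ : (fun x => _) = fst); first exact: measurable_fst.
  by apply/funext => -[a v]; rewrite cons_rV0.
rewrite eq_sym => /unlift_some[j -> _].
rewrite (_ : (fun x => _) = (fun v : 'rV[R]_n => v ord0 j) \o snd); last first.
  by apply/funext => -[a v]; rewrite cons_rVS.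
exact: (measurableT_comp (@measurable_coor R n j) measurable_snd).
Qed.

Lemma ge0_integral_cons_rV (F : 'rV[R]_n.+1 -> \bar R) :
  measurable_fun setT F -> (forall x, 0 <= F x)%E ->
  (\int[lebesgue_rV n.+1]_x F x =
   \int[lebesgue_measure]_a \int[lebesgue_rV n]_v F (cons_rV (a, v)))%E.
Proof.
move=> mF F0; rewrite /= /lebesgue_step.
rewrite ge0_integral_pushforward//=; last exact: measurable_cons_rV.
rewrite preimage_setT.
rewrite (fubini_tonelli1 (F \o @cons_rV R n)) => [//||x]; last exact: F0.
exact: (measurableT_comp mF measurable_cons_rV).
Qed.

Lemma measurable_cons_rVr a : measurable_fun setT (fun v => cons_rV (a, v)).
Proof.
exact: (measurableT_comp measurable_cons_rV (pair1_measurable _)).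
Qed.

End cons_rV.

Section rV_algebra.
Context {R : realType} {n : nat}.

Lemma measurable_rVD d (T : measurableType d) (f g : T -> 'rV[R]_n) :
  measurable_fun setT f -> measurable_fun setT g ->
  measurable_fun setT (fun x => f x + g x).
Proof.
move=> /measurable_fun_rVP mf /measurable_fun_rVP mg.
apply/measurable_fun_rVP => i; under eq_fun do rewrite mxE.
by apply: measurable_funD.
Qed.

Lemma measurable_rVZ d (T : measurableType d) (f : T -> R) (g : T -> 'rV[R]_n) :
  measurable_fun setT f -> measurable_fun setT g ->
  measurable_fun setT (fun x => f x *: g x).
Proof.
move=> mf /measurable_fun_rVP mg.
apply/measurable_fun_rVP => i; under eq_fun do rewrite mxE.
by apply: measurable_funM.
Qed.

Lemma measurable_rVN d (T : measurableType d) (g : T -> 'rV[R]_n) :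
  measurable_fun setT g -> measurable_fun setT (fun x => - g x).
Proof.
move=> /measurable_fun_rVP mg.
apply/measurable_fun_rVP => i; under eq_fun do rewrite mxE.
by apply: measurableT_comp.
Qed.

Lemma measurable_rVB d (T : measurableType d) (f g : T -> 'rV[R]_n) :
  measurable_fun setT f -> measurable_fun setT g ->
  measurable_fun setT (fun x => f x - g x).
Proof. by move=> mf mg; apply: measurable_rVD => //; exact: measurable_rVN. Qed.

End rV_algebra.

(** Induction on the dimension: Tonelli splits off the first coordinate, and every coordinate
    contributes one factor |t|^-1. *)
Lemma ge0_integral_rV_affine (R : realType) n (t : R) (b : 'rV[R]_n)
    (F : 'rV[R]_n -> \bar R) : t != 0 ->
  measurable_fun setT F -> (forall x, 0 <= F x)%E ->
  (\int[lebesgue_rV n]_x F (t *: x + b)%R =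
   (`|t|^-1 ^+ n)%:E * \int[lebesgue_rV n]_x F x)%E.
Proof.
move=> t0; elim: n => [|n IH] in b F *.
  move=> mF F0; rewrite expr0 mul1e; apply: eq_integral => x _.
  by congr F; apply/rowP => -[].
move=> mF F0; have [b0 [b1 ->]] := exists_cons_rV b.
have maff (k : nat) (c : 'rV[R]_k) : measurable_fun setT (fun x : 'rV_k => t *: x + c).
  by apply: measurable_rVD => //; apply: measurable_rVZ.
rewrite ge0_integral_cons_rV//; last first.
  exact: (measurableT_comp mF (maff _ _)).
rewrite ge0_integral_cons_rV//.
under eq_integral => a _.
  under eq_integral => v _.
    rewrite -cons_rVZ -cons_rVD.
    over.
  rewrite (IH b1 (fun w => F (cons_rV (t * a + b0, w)))%R); last 2 first.
    exact: (measurableT_comp mF (measurable_cons_rVr _)).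
    by move=> x; exact: F0.
  over.
have mG : measurable_fun setT (fun a : measurableTypeR R =>
    \int[lebesgue_rV n]_v F (cons_rV (a, v)))%E.
  apply: (measurable_fun_fubini_tonelli_F (F \o @cons_rV R n)).
    exact: (measurableT_comp mF measurable_cons_rV).
  by move=> x; exact: F0.
have tn0 : (0 <= (`|t|^-1 ^+ n)%:E)%E.
  by rewrite lee_fin exprn_ge0// invr_ge0.
have G0 (a : measurableTypeR R) : (0 <= \int[lebesgue_rV n]_v F (cons_rV (a, v)))%E.
  by apply: integral_ge0 => v _; exact: F0.
have maff1 : measurable_fun setT
    (fun x : measurableTypeR R => (t * x + b0)%R : measurableTypeR R).
  by apply: measurable_funD => //; exact: measurable_funM.
have mG1 := measurableT_comp mG maff1.
rewrite (@ge0_integralZl _ _ _ _ _ measurableT _ mG1 _ (fun x _ => G0 _) tn0).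
have -> := ge0_integral_affine b0 t0 mG G0.
by rewrite muleA -EFinM exprSr.
Qed.

(** * Euclidean geometry and reflections *)

Section sqnorm.
Context {R : realType} {n : nat}.
Implicit Types x y v : 'rV[R]_n.

Definition dot x y : R := \sum_i x ord0 i * y ord0 i.
Definition sqnorm x : R := \sum_i x ord0 i ^+ 2.

Lemma sqnormE x : sqnorm x = dot x x.
Proof. by apply: eq_bigr => i _; rewrite expr2. Qed.

Lemma sqnorm_ge0 x : 0 <= sqnorm x.
Proof. by apply: sumr_ge0 => i _; rewrite sqr_ge0. Qed.

Lemma sqr_coord_le x i : x ord0 i ^+ 2 <= sqnorm x.
Proof.
rewrite /sqnorm (bigD1 i)//= lerDl.
by apply: sumr_ge0 => j _; rewrite sqr_ge0.
Qed.

Lemma sqnorm_eq0 x : (sqnorm x == 0) = (x == 0).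
Proof.
apply/idP/eqP => [|->]; last by rewrite /sqnorm big1// => i _; rewrite mxE expr0n.
move=> /eqP h; apply/rowP => i; rewrite mxE; apply/eqP; rewrite -sqrf_eq0.
by rewrite eq_le sqr_ge0 andbT -h sqr_coord_le.
Qed.

Lemma dotC x y : dot x y = dot y x.
Proof. by apply: eq_bigr => i _; rewrite mulrC. Qed.

Lemma dotDl x y z : dot (x + y) z = dot x z + dot y z.
Proof. by rewrite -big_split; apply: eq_bigr => i _; rewrite !mxE mulrDl. Qed.

Lemma dotZl (a : R) x z : dot (a *: x) z = a * dot x z.
Proof. by rewrite mulr_sumr; apply: eq_bigr => i _; rewrite !mxE mulrA. Qed.

Lemma dotNl x z : dot (- x) z = - dot x z.
Proof. by rewrite -scaleN1r dotZl mulN1r. Qed.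

Lemma dotDr x y z : dot x (y + z) = dot x y + dot x z.
Proof. by rewrite dotC dotDl !(dotC _ x). Qed.

Lemma dotZr (a : R) x z : dot x (a *: z) = a * dot x z.
Proof. by rewrite dotC dotZl dotC. Qed.

Lemma dotNr x z : dot x (- z) = - dot x z.
Proof. by rewrite dotC dotNl dotC. Qed.

Lemma sqnormZ (a : R) x : sqnorm (a *: x) = a ^+ 2 * sqnorm x.
Proof. by rewrite !sqnormE dotZl dotZr mulrA -expr2. Qed.

Lemma sqnormN x : sqnorm (- x) = sqnorm x.
Proof. by rewrite -scaleN1r sqnormZ sqrrN expr1n mul1r. Qed.

Lemma sqnormB x y : sqnorm (x - y) = sqnorm x + sqnorm y - 2 * dot x y.
Proof. rewrite !sqnormE !(dotDl, dotDr, dotNl, dotNr) (dotC y x); ring. Qed.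

Lemma enorm_ge0 x : 0 <= enorm x. Proof. exact: sqrtr_ge0. Qed.

Lemma sqr_enorm x : enorm x ^+ 2 = sqnorm x.
Proof. by rewrite sqr_sqrtr// sqnorm_ge0. Qed.

Lemma enorm_eq0 x : (enorm x == 0) = (x == 0).
Proof. by rewrite -sqrf_eq0 sqr_enorm sqnorm_eq0. Qed.

Lemma enorm_gt0 x : (0 < enorm x) = (x != 0).
Proof. by rewrite lt_def enorm_ge0 andbT enorm_eq0. Qed.

Lemma eq_enorm x y : sqnorm x = sqnorm y -> enorm x = enorm y.
Proof. by rewrite /enorm -/(sqnorm x) -/(sqnorm y) => ->. Qed.

Lemma enormZ (a : R) x : enorm (a *: x) = `|a| * enorm x.
Proof. by rewrite /enorm -!/(sqnorm _) sqnormZ sqrtrM ?sqr_ge0// sqrtr_sqr. Qed.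

Lemma enorm_le x (r : R) : 0 <= r -> (enorm x <= r) = (sqnorm x <= r ^+ 2).
Proof. by move=> r0; rewrite -sqr_enorm ler_sqr// nnegrE// enorm_ge0. Qed.

(** The reflection in the hyperplane orthogonal to v, and the identity for v = 0 because division by
    0 yields 0. Reflections do the work of rotations throughout: one of them exchanges any two
    vectors of equal norm, and an involution is its own inverse. *)
Definition householder v x := x - (2 * dot v x / sqnorm v) *: v.

Lemma householderD v x y : householder v (x + y) = householder v x + householder v y.
Proof.
by rewrite /householder dotDr mulrDr mulrDl scalerDl opprD addrACA.
Qed.

Lemma dot_householder v x y : dot (householder v x) (householder v y) = dot x y.
Proof.
have [v0|v0] := eqVneq (sqnorm v) 0.
  by rewrite /householder v0 invr0 !mulr0 !scale0r !subr0.
rewrite /householder !(dotDl, dotDr, dotNl, dotNr, dotZl, dotZr) -sqnormE (dotC x v).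
by field.
Qed.

Lemma sqnorm_householder v x : sqnorm (householder v x) = sqnorm x.
Proof. by rewrite !sqnormE dot_householder. Qed.

Lemma householderK v : involutive (householder v).
Proof.
move=> x; have [v0|v0] := eqVneq (sqnorm v) 0.
  by rewrite /householder v0 invr0 !mulr0 !scale0r !subr0.
have dE : dot v (householder v x) = - dot v x.
  by rewrite /householder dotDr dotNr dotZr -sqnormE; field.
by rewrite {1}/householder dE /householder mulrN mulNr scaleNr opprK subrK.
Qed.

(** For |x| = |y| the inner product of x - y with x is half of |x - y|^2, so the multiple of x - y
    that is subtracted from x is exactly 1. *)
Lemma householder_swap x y : sqnorm x = sqnorm y -> householder (x - y) x = y.
Proof.
move=> xy; rewrite /householder sqnormB xy.
have [d0|d0] := eqVneq (sqnorm (x - y)) 0.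
  move/eqP: (d0); rewrite sqnorm_eq0 subr_eq0 => /eqP->.
  by rewrite subrr scaler0 subr0.
rewrite (_ : _ / _ = 1) ?scale1r ?subKr//.
rewrite dotDl dotNl -sqnormE xy (dotC y x).
move: d0; rewrite sqnormB xy => d0; field; move: d0; apply: contra => /eqP h.
by apply/eqP; rewrite -h; ring.
Qed.

Lemma measurable_dot d (T : measurableType d) (f g : T -> 'rV[R]_n) :
  measurable_fun setT f -> measurable_fun setT g ->
  measurable_fun setT (fun t => dot (f t) (g t)).
Proof.
move=> /measurable_fun_rVP mf /measurable_fun_rVP mg.
by apply: measurable_sum => i; apply: measurable_funM.
Qed.

Lemma measurable_sqnorm d (T : measurableType d) (f : T -> 'rV[R]_n) :
  measurable_fun setT f -> measurable_fun setT (fun t => sqnorm (f t)).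
Proof.
by move=> mf; under eq_fun do rewrite sqnormE; apply: measurable_dot.
Qed.

Lemma measurable_householder v : measurable_fun setT (householder v).
Proof.
apply: measurable_rVB => //; apply: measurable_rVZ => //.
by apply: measurable_funM => //; apply: measurable_funM => //; apply: measurable_dot.
Qed.

End sqnorm.

Lemma sqnorm_cons (R : realType) n (a : R) (v : 'rV[R]_n) :
  sqnorm (cons_rV (a, v)) = a ^+ 2 + sqnorm v.
Proof.
rewrite /sqnorm big_ord_recl cons_rV0; congr (_ + _).
by apply: eq_bigr => i _; rewrite cons_rVS.
Qed.

(** Extends a change of variables from nonnegative to signed integrands, since positive and negative
    parts commute with composition. *)
Lemma integral_comp_ge0P d d' (T : measurableType d) (U : measurableType d')
    (R : realType) (mu : {measure set T -> \bar R}) (nu : {measure set U -> \bar R})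
    (phi : T -> U) :
  (forall F : U -> \bar R, measurable_fun setT F -> (forall x, 0 <= F x)%E ->
    \int[mu]_x F (phi x) = \int[nu]_x F x)%E ->
  (forall F : U -> \bar R, measurable_fun setT F ->
    \int[mu]_x F (phi x) = \int[nu]_x F x)%E.
Proof.
move=> H F mF; rewrite integralE [RHS]integralE; congr (_ - _)%E.
- rewrite -(H F^\+%E (measurable_funepos mF)); last by move=> x; exact: funepos_ge0.
  by apply: eq_integral => x _; rewrite -[LHS]/(((F \o phi)^\+)%E x) funepos_comp.
- rewrite -(H F^\-%E (measurable_funeneg mF)); last by move=> x; exact: funeneg_ge0.
  by apply: eq_integral => x _; rewrite -[LHS]/(((F \o phi)^\-)%E x) funeneg_comp.
Qed.

Section lebesgue_rV.
Context {R : realType} {n : nat}.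
Notation leb := (@lebesgue_rV R n).
Local Open Scope ereal_scope.

Lemma ge0_integral_rV_shift (b : 'rV[R]_n) (F : 'rV[R]_n -> \bar R) :
  measurable_fun setT F -> (forall x, 0 <= F x) ->
  \int[leb]_x F (x + b)%R = \int[leb]_x F x.
Proof.
move=> mF F0; have := ge0_integral_rV_affine b (oner_neq0 R) mF F0.
rewrite normr1 invr1 expr1n mul1e => <-.
by apply: eq_integral => x _; rewrite scale1r.
Qed.

Lemma ge0_integral_rV_reflect (b : 'rV[R]_n) (F : 'rV[R]_n -> \bar R) :
  measurable_fun setT F -> (forall x, 0 <= F x) ->
  \int[leb]_x F (b - x)%R = \int[leb]_x F x.
Proof.
move=> mF F0; have N1 : (- 1 != 0 :> R)%R by rewrite oppr_eq0 oner_eq0.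
have := ge0_integral_rV_affine b N1 mF F0.
rewrite normrN1 invr1 expr1n mul1e => <-.
by apply: eq_integral => x _; rewrite scaleN1r addrC.
Qed.

Lemma integral_rV_shift (b : 'rV[R]_n) (F : 'rV[R]_n -> \bar R) :
  measurable_fun setT F ->
  \int[leb]_x F (x + b)%R = \int[leb]_x F x.
Proof.
apply: (integral_comp_ge0P (mu := leb) (nu := leb) (phi := fun x => (x + b)%R)).
exact: ge0_integral_rV_shift.
Qed.

End lebesgue_rV.

Definition cube (R : realType) n (r : R) : set 'rV[R]_n :=
  [set x | forall i, `|x ord0 i| <= r].

Lemma measurable_cube (R : realType) n (r : R) : measurable (@cube R n r).
Proof.
rewrite (_ : cube r = \bigcap_(i in [set: 'I_n])
    ((fun x : 'rV[R]_n => `|x ord0 i|) @^-1` `]-oo, r])); last first.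
  apply/seteqP; split => [x h i _|x h i]; first by rewrite /= in_itv/=; exact: h.
  by have := h i Logic.I; rewrite /= in_itv.
apply: fin_bigcap_measurable => // i _.
rewrite -[X in measurable X]setTI; apply: (measurableT_comp (f := @Num.norm R R)) => //.
exact: measurable_coor.
Qed.

Lemma lebesgue_cube (R : realType) n (r : R) : 0 <= r ->
  (lebesgue_rV n (@cube R n r) = ((2 * r) ^+ n)%:E)%E.
Proof.
move=> r0; elim: n => [|n IH].
  rewrite /= diracE expr0 mem_set//.
  by move=> -[].
rewrite /= /lebesgue_step /pushforward.
rewrite (_ : _ @^-1` _ = `[(- r), r]%classic `*` @cube R n r); last first.
  apply/seteqP; split => -[a v].
    move=> h; split; last by move=> i /=; rewrite -(cons_rVS a); exact: h.
    by rewrite /= in_itv/= -ler_norml -(cons_rV0 a v); exact: h.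
  case; rewrite /= in_itv/= -ler_norml => ar vr i.
  have [->|] := eqVneq i ord0; first by rewrite cons_rV0.
  by rewrite eq_sym => /unlift_some[j -> _]; rewrite cons_rVS; exact: vr.
rewrite product_measure1E//=; last exact: measurable_cube.
rewrite IH lebesgue_measure_itv/= lte_fin.
case: ifPn => [h|]; last first.
  rewrite -leNgt => h; have -> : r = 0 by apply/eqP; rewrite eq_le r0 andbT; lra.
  by rewrite !mul0e mulr0 expr0n.
rewrite -EFinB -EFinM exprS; congr (_ * _)%:E; ring.
Qed.

Section ball.
Context {R : realType} {n : nat}.
Notation leb := (@lebesgue_rV R n).

(** The parameter is the square of the radius, which keeps square roots out of the supports of bump
    functions. *)
Definition eball (r : R) : set 'rV[R]_n := [set x | sqnorm x <= r].

Lemma measurable_eball r : measurable (eball r).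
Proof.
rewrite (_ : eball r = (@sqnorm R n @^-1` `]-oo, r])).
  rewrite -[X in measurable X]setTI.
  exact: (measurable_sqnorm (f := id)).
by apply/seteqP; split => x /=; rewrite in_itv.
Qed.

Lemma eball_lty r : (leb (eball r) < +oo)%E.
Proof.
have r0 : 0 <= `|r| + 1 by rewrite addr_ge0.
apply: (@le_lt_trans _ _ (leb (cube (`|r| + 1)))); last first.
  by rewrite lebesgue_cube// ltry.
apply: le_measure; rewrite ?inE//; [exact: measurable_eball|exact: measurable_cube|].
move=> x xr i; rewrite -ler_sqr ?nnegrE// real_normK ?num_real//.
apply: (le_trans (sqr_coord_le x i)); apply: (le_trans xr).
apply: (le_trans (ler_norm r)); rewrite sqrrD1.
have := normr_ge0 r; nra.
Qed.

Lemma eball_gt0 r : 0 < r -> (0 < leb (eball r))%E.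
Proof.
(* A cube of half-side s lies in the ball because n s^2 <= r; dividing by n + 1 instead of n covers
   dimension 0. *)
move=> r0; pose s := Num.sqrt (r / n.+1%:R).
have s0 : 0 < s by rewrite sqrtr_gt0 divr_gt0.
apply: (@lt_le_trans _ _ (leb (cube s))).
  by rewrite lebesgue_cube ?(ltW s0)// lte_fin exprn_gt0// mulr_gt0.
apply: le_measure; rewrite ?inE//; [exact: measurable_cube|exact: measurable_eball|].
move=> x xs; rewrite /eball /=.
apply: (@le_trans _ _ (\sum_(i < n) (r / n.+1%:R))).
  apply: ler_sum => i _.
  have rn : 0 <= r / n.+1%:R by rewrite divr_ge0// ltW.
  rewrite -[leRHS](sqr_sqrtr rn) -/s -[leLHS]real_normK ?num_real//.
  by rewrite ler_sqr ?nnegrE ?(ltW s0)//; exact: xs.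
rewrite sumr_const card_ord -[leLHS]mulr_natr -mulrA ler_piMr ?(ltW r0)//.
by rewrite mulrC ler_pdivrMr// mul1r ler_nat.
Qed.

End ball.

Section isometry.
Context {R : realType} {n : nat}.
Notation leb := (@lebesgue_rV R n).
Variable T : 'rV[R]_n -> 'rV[R]_n.
Hypothesis mT : measurable_fun setT T.
Hypothesis TD : {morph T : x y / x + y}.
Hypothesis TK : involutive T.
Hypothesis normT : forall x, sqnorm (T x) = sqnorm x.
Local Open Scope ereal_scope.

(* The uniqueness of Haar measure: for nonnegative F and G, Tonelli's theorem
   and translation invariance give
   \int F(Tx) dx * \int G = \int G(Tx) dx * \int F. *)
Lemma ge0_integral_rV_isometry (F : 'rV[R]_n -> \bar R) :
  measurable_fun setT F -> (forall x, 0 <= F x) ->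
  \int[leb]_x F (T x) = \int[leb]_x F x.
Proof.
move=> mF F0.
(* The unit ball is a convenient G: it is invariant under [T], and its volume is finite and
   positive, so it can be cancelled at the end. *)
pose G (x : 'rV[R]_n) : \bar R := (\1_(eball 1) x)%:E.
have mG : measurable_fun setT G.
  by apply/measurable_EFinP/measurable_indic; exact: measurable_eball.
have G0 x : 0 <= G x by rewrite lee_fin.
have GT x : G (T x) = G x.
  rewrite /G !indicE (_ : (T x \in eball 1) = (x \in eball 1))//.
  by apply/idP/idP => /set_mem; rewrite /eball/= => h; apply/mem_set;
    rewrite /= ?normT// -normT.
have IG : \int[leb]_x G x = leb (eball 1).
  by rewrite integral_indic ?setIT//; exact: measurable_eball.
have mFT := measurableT_comp mF mT.
have mGT := measurableT_comp mG mT.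
have key : (\int[leb]_x F (T x)) * (\int[leb]_y G y) =
           (\int[leb]_y G y) * (\int[leb]_x F x).
  transitivity (\int[leb]_x \int[leb]_y (F (T x) * G (y + T x)%R)).
    rewrite -ge0_integralZr//; last exact: integral_ge0.
    apply: eq_integral => x _.
    rewrite ge0_integralZl//; last first.
      apply: (measurableT_comp mG); exact: measurable_rVD.
    by rewrite ge0_integral_rV_shift.
  transitivity (\int[leb]_y \int[leb]_x (F (T x) * G (y + T x)%R)).
    apply: (@tonelli_swap _ _ _ _ R leb leb (fun x y => F (T x) * G (y + T x)%R)).
      apply: emeasurable_funM; first exact: (measurableT_comp mFT measurable_fst).
      apply: (measurableT_comp mG); apply: measurable_rVD => //.
      exact: (measurableT_comp mT).
    by move=> *; exact: mule_ge0.
  (* For fixed y, translate x by - T y: as [T] is an additive involution, T x becomes T x - y. The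
     translation thus passes from G to F. *)
  transitivity (\int[leb]_y \int[leb]_x (F (T x - y)%R * G (T x))).
    apply: eq_integral => y _.
    rewrite -(ge0_integral_rV_shift (- T y)%R); last 2 first.
      apply: emeasurable_funM => //; apply: (measurableT_comp mG).
      exact: measurable_rVD.
      by move=> x; exact: mule_ge0.
    have TN z : (T (- z) = - T z)%R.
      apply/eqP; rewrite -subr_eq0 opprK -TD addNr.
      by have := TD 0%R 0%R; rewrite addr0 => /eqP; rewrite -subr_eq0 opprD addNKr oppr_eq0.
    apply: eq_integral => x _.
    by rewrite TD TN TK (addrC y) subrK.
  transitivity (\int[leb]_x \int[leb]_y (F (T x - y)%R * G (T x))).
    symmetry.
    apply: (@tonelli_swap _ _ _ _ R leb leb (fun x y => F (T x - y)%R * G (T x))).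
      apply: emeasurable_funM.
        apply: (measurableT_comp mF); apply: measurable_rVB => //.
        exact: (measurableT_comp mT).
      exact: (measurableT_comp mGT measurable_fst).
    by move=> *; exact: mule_ge0.
  rewrite -[RHS]ge0_integralZr//; last exact: integral_ge0.
  apply: eq_integral => x _; rewrite GT.
  rewrite ge0_integralZr//; last first.
    apply: (measurableT_comp mF); exact: measurable_rVB.
  by rewrite ge0_integral_rV_reflect// muleC.
have Bfin : leb (eball 1) \is a fin_num.
  by rewrite ge0_fin_numE//; exact: eball_lty.
have B0 : (0 < fine (leb (eball 1)))%R.
  by rewrite fine_gt0// eball_gt0//= eball_lty.
move: key; rewrite IG muleC -(fineK Bfin).
move=> /(congr1 (fun z => (fine (leb (eball 1)))^-1%:E * z)).
by rewrite !muleA -!EFinM mulVf ?gt_eqF// !mul1e.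
Qed.

Lemma integral_rV_isometry (F : 'rV[R]_n -> \bar R) :
  measurable_fun setT F -> \int[leb]_x F (T x) = \int[leb]_x F x.
Proof.
apply: (integral_comp_ge0P (mu := leb) (nu := leb)).
exact: ge0_integral_rV_isometry.
Qed.

End isometry.

(** * Densities and calculus on intervals *)

Section density.
Context d (T : measurableType d) (R : realType).
Variables (mu nu : {measure set T -> \bar R}) (p : T -> R).
Hypotheses (mp : measurable_fun setT p) (p0 : forall x, 0 <= p x).
Hypothesis nuE : forall A, measurable A -> nu A = (\int[mu]_(x in A) (p x)%:E)%E.
Local Open Scope ereal_scope.
Let nnsfun_density (f : {nnsfun T >-> R}) :
  \int[nu]_x (f x)%:E = \int[mu]_x ((f x)%:E * (p x)%:E).
Proof.
under [LHS]eq_integral do rewrite fimfunE -fsumEFin//.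
rewrite [LHS]ge0_integral_fsum//; last 2 first.
  - by move=> r; exact/measurable_EFinP/measurableT_comp.
  - by move=> n x _; rewrite EFinM nnfun_muleindic_ge0.
under [RHS]eq_integral.
  move=> x xD; rewrite fimfunE -fsumEFin// ge0_mule_fsuml; last first.
    by move=> r; rewrite EFinM nnfun_muleindic_ge0.
  over.
rewrite [RHS]ge0_integral_fsum//; last 2 first.
  - move=> r; apply: emeasurable_funM; last exact/measurable_EFinP.
    by apply/measurable_EFinP; apply/measurableT_comp.
  - by move=> n x _; rewrite EFinM mule_ge0// ?nnfun_muleindic_ge0// lee_fin.
apply: eq_fsbigr => r _.
rewrite integralZl_indic_nnsfun//= integral_indic// setIT nuE//.
have [r0|r0] := leP 0%R r; last first.
  rewrite preimage_nnfun0// integral_set0 mule0 integral0_eq// => x _.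
  by rewrite indicE in_set0 mulr0 mul0e.
under [RHS]eq_integral do rewrite EFinM -muleA.
rewrite [RHS]ge0_integralZl_EFin//; last 2 first.
- by move=> x _; rewrite mule_ge0// lee_fin.
- by apply: emeasurable_funM; exact/measurable_EFinP.
rewrite [in LHS]integral_mkcond; congr (_ * _); apply: eq_integral => x _.
by rewrite patchE indicE; case: ifPn; rewrite ?mul1e ?mul0e.
Qed.

(** The hypothesis [nuE] is the case of indicators; linearity extends it to simple functions and
    monotone convergence to all nonnegative ones. It turns integrals against [normal_prob] into
    Lebesgue integrals. *)
Lemma ge0_integral_density (h : T -> \bar R) :
  measurable_fun setT h -> (forall x, 0 <= h x) ->
  \int[nu]_x h x = \int[mu]_x (h x * (p x)%:E).
Proof.
move=> mh h0; pose f_ := nnsfun_approx measurableT mh.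
have fh x : (f_ n x)%:E @[n --> \oo] --> h x.
  by apply: cvg_nnsfun_approx.
have ndf x : {homo (fun n => (f_ n x)%:E) : a b / (a <= b)%N >-> a <= b}.
  by move=> a b ab; rewrite lee_fin; exact/lefP/nd_nnsfun_approx.
transitivity (lim (\int[nu]_x (f_ n x)%:E @[n --> \oo])).
  rewrite -monotone_convergence//=.
  - by apply: eq_integral => x _; apply/esym/cvg_lim => //; exact: fh.
  - by move=> n; exact/measurable_EFinP/measurable_funTS.
  - by move=> n x _; rewrite lee_fin.
rewrite (_ : (fun n => \int[nu]_x (f_ n x)%:E) =
    fun n => \int[mu]_x ((f_ n x)%:E * (p x)%:E)); last first.
  by apply/funext => n; exact: nnsfun_density.
rewrite -monotone_convergence//=.
- apply: eq_integral => x _; apply/cvg_lim => //.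
  by apply: cvgeZr => //; exact: fh.
- move=> n; apply: emeasurable_funM; exact/measurable_EFinP.
- by move=> n x _; rewrite mule_ge0// lee_fin.
- by move=> x _ a b ab; rewrite lee_wpmul2r ?lee_fin//; exact/lefP/nd_nnsfun_approx.
Qed.

End density.

Section fundamental.
Context {R : realType}.
Notation mu := (@lebesgue_measure R).

Lemma FTC_C1 (f df : R -> R) (a b : R) : a < b ->
  (forall x : R, is_derive x 1 f (df x)) -> continuous df ->
  (\int[mu]_(x in `[a, b]) (df x)%:E = (f b - f a)%:E)%E.
Proof.
move=> ab fdf cdf.
have cf : continuous f.
  move=> x; apply/differentiable_continuous/derivable1_diffP.
  by have [] := fdf x.
rewrite EFinB; apply: continuous_FTC2 => //.
- exact: continuous_subspaceT.
- split.
  + by move=> x _; have [] := fdf x.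
  + exact/cvg_at_right_filter/cf.
  + exact/cvg_at_left_filter/cf.
- by move=> x _; rewrite derive1E; have [_ ->] := fdf x.
Qed.

(** Cauchy-Schwarz on a segment, obtained by integrating the tangent line inequality df^2 >= 2 m df
    - m^2 at the mean slope m. Its right-hand side is the derivative of the explicit function [g],
    so the fundamental theorem evaluates the integral. *)
Lemma sqr_increment_le (f df : R -> R) (a b : R) : a < b ->
  (forall x : R, is_derive x 1 f (df x)) -> continuous df ->
  (((f b - f a) ^+ 2)%:E <= (b - a)%:E * \int[mu]_(x in `[a, b]) (df x ^+ 2)%:E)%E.
Proof.
move=> ab fdf cdf; pose m := (f b - f a) / (b - a).
have ba0 : 0 < b - a by rewrite subr_gt0.
have ci (g : R -> R) : continuous g -> mu.-integrable `[a, b] (EFin \o g).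
  move=> cg; apply: continuous_compact_integrable; first exact: segment_compact.
  exact: continuous_subspaceT.
have cdf2 : continuous (fun x => df x ^+ 2).
  move=> x; exact: (continuous_comp (cdf x) (@exprn_continuous R 2 _)).
pose g := fun x => 2 * m * f x - m ^+ 2 * x.
pose dg := fun x => 2 * m * df x - m ^+ 2.
have gdg (x : R) : is_derive x 1 g (dg x).
  by apply: is_derive_eq; rewrite /dg /GRing.scale/= mulr1.
have cdg : continuous dg.
  by move=> x; apply: cvgB; [apply: cvgM; [exact: cvg_cst|exact: cdf]|exact: cvg_cst].
have : (\int[mu]_(x in `[a, b]) (dg x)%:E <= \int[mu]_(x in `[a, b]) (df x ^+ 2)%:E)%E.
  apply: le_integral => //; [exact: ci|exact: ci|].
  move=> x _; rewrite lee_fin /dg -subr_ge0.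
  by rewrite (_ : _ - _ = (df x - m) ^+ 2) ?sqr_ge0//; ring.
rewrite (FTC_C1 ab gdg cdg) => /(lee_wpmul2l (ltW ba0 : 0 <= (b - a)%:E)%E).
apply: le_trans; rewrite -EFinM lee_fin le_eqVlt; apply/orP; left; apply/eqP.
by rewrite /g /m; field; rewrite gt_eqF.
Qed.

End fundamental.

(** * The Gaussian Poincare inequality *)

Section gauss1.
Context {R : realType} (s : R).
Hypothesis s0 : 0 < s.
Notation mu := (@lebesgue_measure R).
Notation p := (normal_pdf 0 s).

Let sN0 : s != 0. Proof. by rewrite gt_eqF. Qed.

Lemma normal_pdf0E x :
  p x = normal_peak s * expR (- (s ^+ 2 *+ 2)^-1 * x ^+ 2).
Proof.
rewrite normal_pdfE//; congr (_ * expR _); rewrite subr0.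
by rewrite !mulNr mulrC.
Qed.

Lemma normal_pdfN x : p (- x) = p x.
Proof. by rewrite !normal_pdf0E sqrrN. Qed.

Lemma is_derive_normal_pdf (x : R) : is_derive x 1 p (- (x / s ^+ 2) * p x).
Proof.
rewrite (_ : p = (fun x => normal_peak s * (expR \o (fun x => - (s ^+ 2 *+ 2)^-1 * x ^+ 2)) x)); last first.
  by apply/funext => y; rewrite normal_pdf0E.
apply: is_derive_eq.
rewrite /GRing.scale/= mulr1 -mulr_natr.
by field.
Qed.

Lemma normal_pdf_cvgy : p x @[x --> +oo] --> 0.
Proof.
rewrite (_ : p = (fun x => normal_peak s * expR (- ((s ^+ 2 *+ 2)^-1 * x ^+ 2)))); last first.
  by apply/funext => y; rewrite normal_pdf0E mulNr.
rewrite -[X in _ --> X](mulr0 (normal_peak s)).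
apply: cvgM; first exact: cvg_cst.
apply: (cvg_comp (fun x => (s ^+ 2 *+ 2)^-1 * x ^+ 2) (fun x => expR (- x)) _ (@cvgr_expR R)).
apply: gt0_cvgMry; last exact: cvgr_expr2.
by rewrite invr_gt0 pmulrn_lgt0// exprn_gt0.
Qed.

Local Open Scope ereal_scope.

(** From p' = - x p / s^2, the function - s^2 p is a primitive of x p, and it vanishes at
    infinity. *)
Lemma integral_x_normal_pdf (z : R) : (0 <= z)%R ->
  \int[mu]_(x in `[z, +oo[) (x * p x)%:E = (s ^+ 2 * p z)%:E.
Proof.
move=> z0; pose F x := (- s ^+ 2 * p x)%R.
have cp : continuous p by exact: continuous_normal_pdf.
have dF (x : R) : is_derive x 1%R F (x * p x)%R.
  have := is_derive_normal_pdf x => ?.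
  by apply: is_derive_eq; rewrite /GRing.scale/=; field.
have cF : continuous F by move=> x; apply: cvgM; [exact: cvg_cst|exact: cp].
rewrite (@ge0_continuous_FTC2y _ _ F _ 0)//.
- by rewrite sub0e /F mulNr -EFinN opprK.
- by move=> x zx; rewrite mulr_ge0 ?normal_pdf_ge0// (le_trans z0).
- by apply: continuous_subspaceT => x; apply: cvgM; [exact: cvg_id|exact: cp].
- rewrite -[X in _ --> X](mulr0 (- s ^+ 2)%R); apply: cvgM; [exact: cvg_cst|]; exact: normal_pdf_cvgy.
- exact/cvg_at_right_filter/cF.
- by move=> x _; rewrite derive1E; have [_ ->] := dF x.
Qed.


Notation P := (normal_prob 0%R s).
Let J (z x : R) : R := (z <= x)%R%:R.

Lemma ge0_integral_normal_prob (h : measurableTypeR R -> \bar R) :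
  measurable_fun setT h -> (forall x, 0 <= h x) ->
  \int[P]_x h x = \int[mu]_x (h x * (p x)%:E).
Proof.
apply: (ge0_integral_density (mu := mu) (nu := P)) => //.
- exact: measurable_normal_pdf.
- by move=> x; exact: normal_pdf_ge0.
Qed.

Let P_E (h : R -> R) : measurable_fun setT h -> (forall x, 0 <= h x)%R ->
  \int[P]_x (h x)%:E = \int[mu]_x (h x * p x)%:E.
Proof.
move=> mh h0; rewrite (@ge0_integral_normal_prob (fun x => (h x)%:E)).
- by apply: eq_integral => x _; rewrite EFinM.
- exact/measurable_EFinP.
- by move=> x; rewrite lee_fin.
Qed.

Let mJ d (T : measurableType d) (f g : T -> R) :
  measurable_fun setT f -> measurable_fun setT g ->
  measurable_fun setT (fun t => J (f t) (g t)).
Proof.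
move=> mf mg; rewrite /J.
apply: (measurableT_comp (f := fun b : bool => b%:R : R)) => //.
exact: measurable_fun_ler.
Qed.

Let J0 z x : (0 <= J z x)%R. Proof. by []. Qed.

Let P_reflect (h : R -> R) : measurable_fun setT h -> (forall x, 0 <= h x)%R ->
  \int[P]_x (h (- x)%R)%:E = \int[P]_x (h x)%:E.
Proof.
move=> mh h0; rewrite (P_E mh h0) (P_E (h := fun x => h (- x)%R)) //; last first.
  by apply: (measurableT_comp mh).
transitivity (\int[mu]_x (h (- 1 * x + 0)%R * p (- 1 * x + 0)%R)%:E).
  by apply: eq_integral => x _; rewrite addr0 mulN1r normal_pdfN.
rewrite (@ge0_integral_affine _ (- 1)%R 0%R (fun x => (h x * p x)%:E)).
- by rewrite normrN1 invr1 mul1e.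
- by rewrite oppr_eq0 oner_eq0.
- apply/measurable_EFinP/measurable_funM => //; exact: measurable_normal_pdf.
- by move=> x; rewrite lee_fin mulr_ge0// normal_pdf_ge0.
Qed.

Let P_tail (z : R) : (0 <= z)%R -> \int[P]_x (x * J z x)%:E = (s ^+ 2 * p z)%:E.
Proof.
move=> z0; rewrite -integral_x_normal_pdf// [RHS]integral_mkcond.
have h0 x : (0 <= x * J z x)%R.
  rewrite /J; case: (leP z x) => zx; last by rewrite mulr0.
  by rewrite mulr1 (le_trans z0).
rewrite P_E//; last by apply: measurable_funM => //; exact: mJ.
apply: eq_integral => x _; rewrite patchE /J mem_setE in_itv/= andbT.
by case: ifPn => zx; rewrite ?(mulr1, mulr0, mul0r).
Qed.

Let P_tailN (z : R) : (z <= 0)%R -> \int[P]_x (- x * J x z)%:E = (s ^+ 2 * p z)%:E.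
Proof.
move=> z0; rewrite -normal_pdfN -P_tail ?oppr_ge0//.
rewrite -P_reflect.
- by apply: eq_integral => x _; rewrite /J opprK lerNl.
- by apply: measurable_funM => //; exact: mJ.
- move=> x; rewrite /J; case: (leP x z) => zx; last by rewrite mulr0.
  by rewrite mulr1 oppr_ge0 (le_trans zx).
Qed.

Let P_set1 (z : R) : \int[P]_x ((x == z)%:R : R)%:E = 0.
Proof.
rewrite P_E//; last first.
  apply: (measurableT_comp (f := fun b : bool => b%:R : R)) => //.
  exact: measurable_fun_eqr.
transitivity (\int[mu]_(x in [set z]) (p x)%:E); last exact: integral_set1.
rewrite [RHS]integral_mkcond; apply: eq_integral => x _; rewrite patchE.
have [->|xz] := eqVneq x z; first by rewrite mem_set// mul1r.
rewrite memNset ?mul0r//= => h; move: xz; rewrite h eqxx//.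
Qed.

(** The two closed half-lines overlap at z only, and a Gaussian gives no mass to a point. *)
Let P_half (z : R) : \int[P]_x (J z x)%:E + \int[P]_x (J x z)%:E = 1.
Proof.
rewrite -ge0_eintegralD//; [|exact: mJ|exact: mJ].
transitivity (\int[P]_x (1 + (x == z)%:R)%:E).
  apply: eq_integral => x _; rewrite /J; congr (_%:E).
  by case: ltgtP => _; rewrite ?(addr0, add0r).
rewrite (@ge0_eintegralD _ _ _ P (fun=> 1%R) (fun x => (x == z)%:R))//; last first.
  apply: (measurableT_comp (f := fun b : bool => b%:R : R)) => //.
  exact: measurable_fun_eqr.
rewrite P_set1 adde0 integral_cst//= mul1e; exact: probability_setT.
Qed.

Let ge0_fin_add (a b : \bar R) (r : R) :
  0 <= a -> 0 <= b -> a + b = r%:E -> a \is a fin_num /\ b \is a fin_num.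
Proof. by move: a b => [a| |] [b| |]. Qed.

Let mZJ (c : R) : measurable_fun setT (fun x : R => ((x - c) * J c x)%R).
Proof. by apply: measurable_funM; [exact: measurable_funB|exact: mJ]. Qed.
Let mJZ (c : R) : measurable_fun setT (fun x : R => ((c - x) * J x c)%R).
Proof. by apply: measurable_funM; [exact: measurable_funB|exact: mJ]. Qed.
Let ZJ0 (c x : R) : (0 <= (x - c) * J c x)%R.
Proof. by rewrite /J; case: (leP c x) => h; rewrite ?mulr0// mulr1 subr_ge0. Qed.
Let JZ0 (c x : R) : (0 <= (c - x) * J x c)%R.
Proof. by rewrite /J; case: (leP x c) => h; rewrite ?mulr0// mulr1 subr_ge0. Qed.
Let mJl (c : R) : measurable_fun setT (fun x => J c x).
Proof. exact: mJ. Qed.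
Let mJr (c : R) : measurable_fun setT (fun x => J x c).
Proof. exact: mJ. Qed.
Let meq (c : R) : measurable_fun setT (fun x : R => (x == c)%:R : R).
Proof.
apply: (measurableT_comp (f := fun b : bool => b%:R : R)) => //.
exact: measurable_fun_eqr.
Qed.

Ltac side := solve [ done | exact: mZJ | exact: mJZ | exact: mJl | exact: mJr | exact: meq
  | apply: measurable_funM; side | apply: measurable_funD; side
  | apply: measurableT_comp; side
  | let x := fresh "x" in move=> x; repeat apply: addr_ge0; first [done | by apply: mulr_ge0] ].

(* The kernel of the integrated Cauchy-Schwarz inequality is exactly s^2 times
   the density, which is what makes the Poincare constant sharp. *)
Lemma kernel_normal (z : R) :
  \int[P]_x \int[P]_y ((x - y) * (J z x * J y z))%:E = (s ^+ 2 * p z)%:E.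
Proof.
pose Phi := \int[P]_y (J y z)%:E; pose Psi := \int[P]_x (J z x)%:E.
pose A := \int[P]_x ((x - z) * J z x)%:E.
pose B := \int[P]_y ((z - y) * J y z)%:E.
set m := (s ^+ 2 * p z)%R.
have A0 : 0 <= A by apply: integral_ge0 => x _; rewrite lee_fin.
have B0 : 0 <= B by apply: integral_ge0 => x _; rewrite lee_fin.
have Phi0 : 0 <= Phi by apply: integral_ge0 => x _; rewrite lee_fin.
have Psi0 : 0 <= Psi by apply: integral_ge0 => x _; rewrite lee_fin.
have half : Psi + Phi = 1%:E by exact: P_half.
have [fPsi fPhi] := ge0_fin_add Psi0 Phi0 half.
(* On y <= z <= x, the decomposition x - y = (x - z) + (z - y) factors the double integral into
   products of one-dimensional ones. *)
have formula : B \is a fin_num ->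
    \int[P]_x \int[P]_y ((x - y) * (J z x * J y z))%:E = A * Phi + Psi * B.
  move=> fB; rewrite (muleC A) (muleC Psi) -(fineK fPhi) -(fineK fB).
  have phi0 : (0 <= fine Phi)%R by rewrite fine_ge0.
  have b0 : (0 <= fine B)%R by rewrite fine_ge0.
  rewrite -!ge0_eintegralZ//; [|exact: mJl|exact: mZJ].
  rewrite -ge0_eintegralD//; last 4 first.
  - by apply: measurable_funM => //; exact: mZJ.
  - by apply: measurable_funM => //; exact: mJl.
  - by move=> x; rewrite mulr_ge0.
  - by move=> x; rewrite mulr_ge0.
  apply: eq_integral => x _.
  rewrite (_ : (_ + _)%:E = ((x - z) * J z x)%:E * Phi + (J z x)%:E * B); last first.
    by rewrite -[in RHS](fineK fPhi) -[in RHS](fineK fB) -!EFinM -EFinD; congr (_%:E); ring.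
  rewrite /Phi /B -!ge0_eintegralZ//; [|exact: mJZ|exact: mJr].
  rewrite -ge0_eintegralD//; last 4 first.
  - by apply: measurable_funM => //; exact: mJr.
  - by apply: measurable_funM => //; exact: mJZ.
  - by move=> y; rewrite mulr_ge0.
  - by move=> y; rewrite mulr_ge0.
  apply: eq_integral => y _; congr (_%:E); rewrite /J.
  by case: (leP z x); case: (leP y z) => _ _; rewrite ?(mulr0, mul0r, addr0)//; ring.
have fin0 : (s ^+ 2 * p 0)%:E \is a fin_num by [].
have [z0|z0] := leP 0%R z.
  have HA : A + z%:E * Psi = m%:E.
    rewrite -P_tail// /A /Psi -ge0_eintegralZ; [|side..].
    rewrite -ge0_eintegralD; [|side..].
    by apply: eq_integral => x _; congr (_%:E); ring.
  (* This says B = z Phi + m, which rests on the Gaussian having mean zero. Only nonnegative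
     integrands are handled, so the positive and negative halves of the mean, both equal to s^2
     p(0), are added on the two sides instead of being subtracted. *)
  have HB : B + (s ^+ 2 * p 0)%:E = z%:E * Phi + (s ^+ 2 * p 0)%:E + m%:E.
    rewrite -{1}(P_tail (lexx 0%R)) -(P_tailN (lexx 0%R)) -(P_tail z0).
    (* The null term z 1_{y = z} makes the identity of integrands hold at y = z as well, where both
       closed half-lines contribute. *)
    rewrite -[B]adde0 -[0](mule0 z%:E) -(P_set1 z) /A /B /Phi /Psi -!ge0_eintegralZ; [|side..].
    have h1 (x : R) : (0 <= x * J 0 x)%R.
      by rewrite /J; case: (leP 0%R x); rewrite ?mulr0// mulr1.
    have h2 (x : R) : (0 <= - x * J x 0)%R.
      by rewrite /J; case: (leP x 0%R); rewrite ?mulr0// mulr1 oppr_ge0.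
    have h3 (x : R) : (0 <= x * J z x)%R.
      by rewrite /J; case: (leP z x) => h; rewrite ?mulr0// mulr1 (le_trans z0).
    have h4 (x : R) : (0 <= z * (x == z)%:R)%R by rewrite mulr_ge0.
    have h5 (x : R) : (0 <= z * J x z)%R by rewrite mulr_ge0.
    have m1 : measurable_fun setT (fun x : R => x * J 0 x)%R by apply: measurable_funM => //; exact: mJ.
    have m2 : measurable_fun setT (fun x : R => - x * J x 0)%R.
      by apply: measurable_funM => //; apply: measurableT_comp.
    have m3 : measurable_fun setT (fun x : R => x * J z x)%R by apply: measurable_funM => //; exact: mJ.
    have m4 : measurable_fun setT (fun x : R => z * (x == z)%:R)%R.
      by apply: measurable_funM => //; exact: meq.
    have m5 : measurable_fun setT (fun x : R => z * J x z)%R by apply: measurable_funM => //; exact: mJ.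
    rewrite -ge0_eintegralD; [|side..].
    rewrite -ge0_eintegralD; [|side..].
    rewrite -ge0_eintegralD; [|side..].
    rewrite -ge0_eintegralD; [|side..].
    apply: eq_integral => y _; congr (_%:E); rewrite /J.
    have [yz|yz|yz] := ltgtP y z; have [y0|y0|y0] := ltgtP 0%R y; rewrite /= ?mulr0n ?mulr1n; lra.
  have [fA _] := ge0_fin_add A0 (mule_ge0 (z0 : 0 <= z%:E) Psi0) HA.
  have fB : B \is a fin_num.
    by move: HB; rewrite -(fineK fPhi); case: (B) B0.
  rewrite (formula fB).
  move: HA HB half; rewrite -(fineK fA) -(fineK fB) -(fineK fPsi) -(fineK fPhi).
  move: (fine A) (fine B) (fine Psi) (fine Phi) => a b psi phi.
  rewrite -!EFinM -!EFinD => -[HA] [HB] [half]; congr (_%:E).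
  (* In A Phi + Psi B = (m - z Psi) Phi + Psi (z Phi + m) the terms in z cancel, and Phi + Psi = 1
     leaves m. *)
  have -> : b = (z * phi + m)%R by lra.
  have -> : a = (m - z * psi)%R by lra.
  rewrite -[RHS]mulr1 -half; ring.
(* For z < 0 the roles of A and B are exchanged: B is read off the tail, and A needs the mean. *)
have {}z0 := ltW z0.
have z0' : (0 <= - z)%R by rewrite oppr_ge0.
have HB : B + (- z)%:E * Phi = m%:E.
  rewrite -P_tailN// /B /Phi -ge0_eintegralZ; [|side..].
  rewrite -ge0_eintegralD; [|side..].
  by apply: eq_integral => x _; congr (_%:E); ring.
have HA : A + (s ^+ 2 * p 0)%:E = (- z)%:E * Psi + (s ^+ 2 * p 0)%:E + m%:E.
  rewrite -{1}(P_tailN (lexx 0%R)) -(P_tail (lexx 0%R)) -(P_tailN z0).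
  rewrite -[A]adde0 -[0](mule0 (- z)%:E) -(P_set1 z) /A /B /Phi /Psi -!ge0_eintegralZ; [|side..].
  have h1 (x : R) : (0 <= x * J 0 x)%R.
    by rewrite /J; case: (leP 0%R x); rewrite ?mulr0// mulr1.
  have h2 (x : R) : (0 <= - x * J x 0)%R.
    by rewrite /J; case: (leP x 0%R); rewrite ?mulr0// mulr1 oppr_ge0.
  have h3 (x : R) : (0 <= - x * J x z)%R.
    by rewrite /J; case: (leP x z) => h; rewrite ?mulr0// mulr1 oppr_ge0 (le_trans _ z0).
  have h4 (x : R) : (0 <= - z * (x == z)%:R)%R by rewrite mulr_ge0.
  have h5 (x : R) : (0 <= - z * J z x)%R by rewrite mulr_ge0.
  have m1 : measurable_fun setT (fun x : R => x * J 0 x)%R by apply: measurable_funM => //; exact: mJ.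
  have m2 : measurable_fun setT (fun x : R => - x * J x 0)%R.
    by apply: measurable_funM => //; apply: measurableT_comp.
  have m3 : measurable_fun setT (fun x : R => - x * J x z)%R.
    by apply: measurable_funM => //; apply: measurableT_comp.
  have m4 : measurable_fun setT (fun x : R => - z * (x == z)%:R)%R.
    by apply: measurable_funM => //; exact: meq.
  have m5 : measurable_fun setT (fun x : R => - z * J z x)%R by apply: measurable_funM => //; exact: mJ.
  rewrite -ge0_eintegralD; [|side..].
    rewrite -ge0_eintegralD; [|side..].
  rewrite -ge0_eintegralD; [|side..].
    rewrite -ge0_eintegralD; [|side..].
  apply: eq_integral => y _; congr (_%:E); rewrite /J.
  have [yz|yz|yz] := ltgtP z y; have [y0|y0|y0] := ltgtP 0%R y; rewrite /= ?mulr0n ?mulr1n; lra.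
have [fB _] := ge0_fin_add B0 (mule_ge0 (z0' : 0 <= (- z)%:E) Phi0) HB.
have fA : A \is a fin_num.
  by move: HA; rewrite -(fineK fPsi); case: (A) A0.
rewrite (formula fB).
move: HA HB half; rewrite -(fineK fA) -(fineK fB) -(fineK fPsi) -(fineK fPhi).
move: (fine A) (fine B) (fine Psi) (fine Phi) => a b psi phi.
rewrite -!EFinM -!EFinD => -[HA] [HB] [half]; congr (_%:E).
have -> : a = (- z * psi + m)%R by lra.
have -> : b = (m + z * phi)%R by lra.
rewrite -[RHS]mulr1 -half; ring.
Qed.
End gauss1.

Section gauss_poincare1.
Context {R : realType} (s : R).
Hypothesis s0 : 0 < s.
Notation mu := (@lebesgue_measure R).
Notation P := (normal_prob 0%R s).
Local Open Scope ereal_scope.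

Let k (x y z : R) : R := ((x - y) * ((z <= x)%R%:R * (y <= z)%R%:R))%R.

Let k0 x y z : (0 <= k x y z)%R.
Proof.
rewrite /k; case: (leP z x) => zx; rewrite ?(mul0r, mulr0)// mul1r.
case: (leP y z) => yz; rewrite ?(mul0r, mulr0)// mulr1 subr_ge0.
exact: le_trans zx.
Qed.

Let mk d (T : measurableType d) (f g h : T -> R) :
  measurable_fun setT f -> measurable_fun setT g -> measurable_fun setT h ->
  measurable_fun setT (fun t => k (f t) (g t) (h t)).
Proof.
move=> mf mg mh; apply: measurable_funM; first exact: measurable_funB.
apply: measurable_funM; apply: (measurableT_comp (f := fun b : bool => b%:R : R)) => //;
  exact: measurable_fun_ler.
Qed.

(** The left side is twice the variance, in a form whose integrands are nonnegative, so that
    Tonelli's theorem applies. For y < x one has (f x - f y)^2 <= (x - y) \int_y^x f'^2; integrating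
    over x and y first leaves f'(z)^2 against the kernel of [kernel_normal]. *)
Theorem gauss_poincare1 (f df : R -> R) :
  (forall x : R, is_derive x 1%R f (df x)) -> continuous df ->
  \int[P]_x \int[P]_y ((f x - f y) ^+ 2)%:E <=
  (2 * s ^+ 2)%:E * \int[P]_x (df x ^+ 2)%:E.
Proof.
move=> fdf cdf.
have cf : continuous f.
  move=> x; apply/differentiable_continuous/derivable1_diffP.
  by have [] := fdf x.
have mf : measurable_fun setT f by exact: continuous_measurable_fun.
have mdf : measurable_fun setT df by exact: continuous_measurable_fun.
(* Of the two terms [k x y z] and [k y x z] one serves x > y and the other x < y; each contributes
   s^2 to the constant 2 s^2. *)
pose g x y z : R := ((k x y z + k y x z) * df z ^+ 2)%R.
have g0 x y z : (0 <= g x y z)%R by rewrite mulr_ge0 ?sqr_ge0 ?addr_ge0.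
have mg d (T : measurableType d) (a b c : T -> R) :
    measurable_fun setT a -> measurable_fun setT b -> measurable_fun setT c ->
    measurable_fun setT (fun t => (g (a t) (b t) (c t))%:E).
  move=> ma mb mc; apply/measurable_EFinP/measurable_funM.
    by apply: measurable_funD; exact: mk.
  by apply: measurable_funX; exact: (measurableT_comp mdf).
have mk1 (a b : R) : measurable_fun setT (fun z => k a b z * df z ^+ 2)%R.
  by apply: measurable_funM; [exact: mk|exact: measurable_funX].
have lt_le (x y : R) : (y < x)%R ->
    ((f x - f y) ^+ 2)%:E <= \int[mu]_z (k x y z * df z ^+ 2)%:E.
  move=> yx; apply: (le_trans (sqr_increment_le yx fdf cdf)).
  rewrite -ge0_integralZl_EFin//=; last 3 first.
  - by move=> z _; rewrite lee_fin sqr_ge0.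
  - by apply/measurable_EFinP; apply/measurable_funTS; apply: measurable_funX.
  - by rewrite subr_ge0 ltW.
  rewrite integral_mkcond; apply: ge0_le_integral => //.
  - by move=> z _; rewrite patchE; case: ifP => // _; rewrite lee_fin mulr_ge0 ?sqr_ge0// subr_ge0 ltW.
  - apply/(measurable_restrictT _ _).1 => //; apply: measurable_funTS.
    by apply/measurable_EFinP/measurable_funM => //; exact: measurable_funX.
  - by apply/measurable_EFinP; exact: mk1.
  - move=> z _; rewrite patchE; case: ifPn => [|_]; last by rewrite lee_fin mulr_ge0 ?sqr_ge0.
    rewrite mem_setE in_itv/= => /andP[yz zx].
    by rewrite -EFinM lee_fin /k zx yz !mulr1.
have pointwise (x y : R) :
    ((f x - f y) ^+ 2)%:E <= \int[mu]_z (g x y z)%:E.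
  have k1 (a b z : R) : (0 <= k a b z * df z ^+ 2)%R by rewrite mulr_ge0 ?sqr_ge0.
  have -> : \int[mu]_z (g x y z)%:E =
      \int[mu]_z (k x y z * df z ^+ 2)%:E + \int[mu]_z (k y x z * df z ^+ 2)%:E.
    rewrite -ge0_eintegralD; [|exact: mk1|exact: mk1|exact: k1|exact: k1].
    by apply: eq_integral => z _; rewrite /g mulrDl.
  have i0 (a b : R) : 0 <= \int[mu]_z (k a b z * df z ^+ 2)%:E.
    by apply: integral_ge0 => z _; rewrite lee_fin.
  have [xy|yx|->] := ltgtP x y.
  - by rewrite -[leLHS]add0e leeD// -sqrrN opprB lt_le.
  - by rewrite -[leLHS]adde0 leeD// lt_le.
  - by rewrite subrr expr0n adde_ge0.
have mfst := @measurable_fst _ _ (measurableTypeR R) (measurableTypeR R).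
have msnd := @measurable_snd _ _ (measurableTypeR R) (measurableTypeR R).
apply: (@le_trans _ _ (\int[P]_x \int[P]_y \int[mu]_z (g x y z)%:E)).
  have mL : measurable_fun setT (fun p : measurableTypeR R * measurableTypeR R =>
      ((f p.1 - f p.2) ^+ 2)%:E).
    apply/measurable_EFinP/measurable_funX/measurable_funB.
      exact: (measurableT_comp mf).
    exact: (measurableT_comp mf).
  have mR : measurable_fun setT (fun p : measurableTypeR R * measurableTypeR R =>
      \int[mu]_z (g p.1 p.2 z)%:E).
    apply: (@measurable_tonelli1 _ _ _ _ _ mu
      (fun (p : measurableTypeR R * measurableTypeR R) z => (g p.1 p.2 z)%:E)).
      apply: mg => //; first exact: (measurableT_comp mfst measurable_fst).
      exact: (measurableT_comp msnd measurable_fst).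
    by move=> p z; rewrite lee_fin.
  have L0 (x y : R) : 0 <= ((f x - f y) ^+ 2)%:E by rewrite lee_fin sqr_ge0.
  have R0 (x y : R) : 0 <= \int[mu]_z (g x y z)%:E.
    by apply: integral_ge0 => z _; rewrite lee_fin.
  apply: ge0_le_integral => //.
  - by move=> x _; apply: integral_ge0.
  - exact: (@measurable_tonelli1 _ _ _ _ _ P (fun x y => ((f x - f y) ^+ 2)%:E)).
  - exact: (@measurable_tonelli1 _ _ _ _ _ P (fun x y => \int[mu]_z (g x y z)%:E)).
  - move=> x _.
    have mLx := measurableT_comp mL (pair1_measurable x).
    have mRx := measurableT_comp mR (pair1_measurable x).
    apply: (@ge0_le_integral _ _ _ P setT measurableT (fun y => ((f x - f y) ^+ 2)%:E)
      (fun y => \int[mu]_z (g x y z)%:E)) => //.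
have -> : \int[P]_x \int[P]_y \int[mu]_z (g x y z)%:E =
    \int[mu]_z \int[P]_x \int[P]_y (g x y z)%:E.
  transitivity (\int[P]_x \int[mu]_z \int[P]_y (g x y z)%:E).
    apply: eq_integral => x _.
    apply: (@tonelli_swap _ _ _ _ _ P mu (fun y z => (g x y z)%:E)).
      exact: mg.
    by move=> y z; rewrite lee_fin.
  apply: (@tonelli_swap _ _ _ _ _ P mu (fun x z => \int[P]_y (g x y z)%:E)).
    apply: (@measurable_tonelli1 _ _ _ _ _ P
      (fun (p : measurableTypeR R * measurableTypeR R) y => (g p.1 y p.2)%:E)).
      apply: mg => //; first exact: (measurableT_comp mfst measurable_fst).
      exact: (measurableT_comp msnd measurable_fst).
    by move=> p z; rewrite lee_fin.
  by move=> x z; apply: integral_ge0 => y _; rewrite lee_fin.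
have kernel2 (z : R) : \int[P]_x \int[P]_y (g x y z)%:E =
    (2 * s ^+ 2 * (df z ^+ 2 * normal_pdf 0 s z))%:E.
  have swap : \int[P]_x \int[P]_y (k y x z)%:E = (s ^+ 2 * normal_pdf 0 s z)%:E.
    rewrite -kernel_normal//.
    apply: (@tonelli_swap _ _ _ _ _ P P (fun x y => (k y x z)%:E)).
      by apply/measurable_EFinP; exact: mk.
    by move=> *; rewrite lee_fin.
  have mkk d (T : measurableType d) (a b : T -> R) :
      measurable_fun setT a -> measurable_fun setT b ->
      measurable_fun setT (fun t => df z ^+ 2 * k (a t) (b t) z)%R.
    by move=> ma mb; apply: measurable_funM => //; exact: mk.
  have kk0 (a b : R) : (0 <= df z ^+ 2 * k a b z)%R by rewrite mulr_ge0 ?sqr_ge0.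
  have mI1 : measurable_fun setT (fun x => \int[P]_y (df z ^+ 2 * k x y z)%:E).
    apply: (@measurable_tonelli1 _ _ _ _ _ P (fun x y => (df z ^+ 2 * k x y z)%:E)).
      by apply/measurable_EFinP; exact: mkk.
    by move=> *; rewrite lee_fin.
  have mI2 : measurable_fun setT (fun x => \int[P]_y (df z ^+ 2 * k y x z)%:E).
    apply: (@measurable_tonelli1 _ _ _ _ _ P (fun x y => (df z ^+ 2 * k y x z)%:E)).
      by apply/measurable_EFinP; exact: mkk.
    by move=> *; rewrite lee_fin.
  transitivity (\int[P]_x (\int[P]_y (df z ^+ 2 * k x y z)%:E +
                           \int[P]_y (df z ^+ 2 * k y x z)%:E)).
    apply: eq_integral => x _.
    rewrite -ge0_eintegralD; [|exact: mkk|exact: mkk|by []|by []].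
    by apply: eq_integral => y _; rewrite /g -mulrDr mulrC.
  rewrite ge0_integralD//; [|by move=> x _; apply: integral_ge0 => y _; rewrite lee_fin
    |by move=> x _; apply: integral_ge0 => y _; rewrite lee_fin].
  have pull (h : R -> R -> R) : (forall x y, 0 <= h x y)%R ->
      measurable_fun setT (fun p : measurableTypeR R * measurableTypeR R => h p.1 p.2) ->
      \int[P]_x \int[P]_y (df z ^+ 2 * h x y)%:E =
      (df z ^+ 2)%:E * \int[P]_x \int[P]_y (h x y)%:E.
    move=> h0 mh; rewrite -ge0_integralZl_EFin//; last 3 first.
    - by move=> x _; apply: integral_ge0 => y _; rewrite lee_fin.
    - apply: (@measurable_tonelli1 _ _ _ _ _ P (fun x y => (h x y)%:E)).
        exact/measurable_EFinP.
      by move=> *; rewrite lee_fin.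
    - exact: sqr_ge0.
    apply: eq_integral => x _; rewrite -ge0_eintegralZ//; last exact: sqr_ge0.
    exact: (measurableT_comp mh (pair1_measurable x)).
  rewrite !pull//; [|exact: mk|exact: mk].
  rewrite swap kernel_normal// -!EFinM -EFinD; congr (_%:E); ring.
under eq_integral do rewrite kernel2.
have p0 := @normal_pdf_ge0 R 0%R s.
rewrite ge0_eintegralZ; last 3 first.
- apply: measurable_funM; first exact: measurable_funX.
  exact: measurable_normal_pdf.
- by rewrite mulr_ge0// sqr_ge0.
- by move=> x; rewrite mulr_ge0 ?sqr_ge0.
rewrite (@ge0_integral_normal_prob _ _ (fun x => (df x ^+ 2)%:E))//.
  by apply/measurable_EFinP; exact: measurable_funX.
by move=> x; rewrite lee_fin sqr_ge0.
Qed.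

End gauss_poincare1.

(** * Tensorization and Gaussian measures in n dimensions *)

Section product_probability.
Context d1 d2 (T1 : measurableType d1) (T2 : measurableType d2) (R : realType).
Variables (P1 : probability T1 R) (P2 : probability T2 R).
Local Open Scope ereal_scope.

Definition product_probability : set (T1 * T2)%type -> \bar R := P1 \x P2.

HB.instance Definition _ := Measure.on product_probability.

Let product_probability_setT : product_probability setT = 1.
Proof.
by rewrite /product_probability -setXTT [LHS]product_measure1E// -[RHS]mule1;
  congr (_ * _); exact: probability_setT.
Qed.

HB.instance Definition _ :=
  @Measure_isProbability.Build _ _ R product_probability product_probability_setT.

Lemma integral_product_probability (f : T1 * T2 -> \bar R) :
  measurable_fun setT f -> (forall p, 0 <= f p) ->
  \int[product_probability]_p f p = \int[P1]_a \int[P2]_b f (a, b).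
Proof.
move=> mf f0; rewrite -[RHS](fubini_tonelli1 (m1 := P1) (m2 := P2) f)//.
Qed.

End product_probability.

Section tensorization.
Context d1 d2 (T1 : measurableType d1) (T2 : measurableType d2) (R : realType).
Variables (P1 : probability T1 R) (P2 : probability T2 R) (v : T1 -> T2 -> R).
Hypothesis mv : measurable_fun setT (fun p => v p.1 p.2).
Local Open Scope ereal_scope.

Let Q1 : probability _ R := product_probability P1 P1.
Let Q2 : probability _ R := product_probability P2 P2.
Let M := Q1 \x Q2.

Let Q1E (f : T1 * T1 -> \bar R) : measurable_fun setT f -> (forall p, 0 <= f p) ->
  \int[Q1]_p f p = \int[P1]_a \int[P1]_a' f (a, a').
Proof. exact: integral_product_probability. Qed.

Let Q2E (f : T2 * T2 -> \bar R) : measurable_fun setT f -> (forall p, 0 <= f p) ->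
  \int[Q2]_p f p = \int[P2]_a \int[P2]_a' f (a, a').
Proof. exact: integral_product_probability. Qed.

Let integral_quad (F : T1 -> T1 -> T2 -> T2 -> R) :
  measurable_fun setT (fun q : (T1 * T1) * (T2 * T2) => F q.1.1 q.1.2 q.2.1 q.2.2) ->
  (forall a a' b b', 0 <= F a a' b b')%R ->
  \int[M]_q (F q.1.1 q.1.2 q.2.1 q.2.2)%:E =
  \int[P1]_a \int[P1]_a' \int[P2]_b \int[P2]_b' (F a a' b b')%:E.
Proof.
move=> mF F0.
have mFE : measurable_fun setT (fun q : (T1 * T1) * (T2 * T2) =>
   (F q.1.1 q.1.2 q.2.1 q.2.2)%:E) by apply/measurable_EFinP.
have FE0 (q : (T1 * T1) * (T2 * T2)) : 0 <= (F q.1.1 q.1.2 q.2.1 q.2.2)%:E.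
  by rewrite lee_fin.
rewrite (fubini_tonelli1 (m1 := Q1) (m2 := Q2) (fun q : (T1 * T1) * (T2 * T2) =>
  (F q.1.1 q.1.2 q.2.1 q.2.2)%:E) mFE FE0).
have mI : measurable_fun setT (fun p : T1 * T1 =>
    \int[Q2]_q (F p.1 p.2 q.1 q.2)%:E).
  apply: (@measurable_tonelli1 _ _ _ _ _ Q2 (fun p q => (F p.1 p.2 q.1 q.2)%:E)).
    exact: mFE.
  by move=> p q; rewrite lee_fin.
have I0 (p : T1 * T1) : 0 <= \int[Q2]_q (F p.1 p.2 q.1 q.2)%:E.
  by apply: integral_ge0 => q _; rewrite lee_fin.
rewrite [LHS](Q1E mI I0).
apply: eq_integral => a _; apply: eq_integral => a' _ /=.
have mFa : measurable_fun setT (fun q : T2 * T2 => (F a a' q.1 q.2)%:E).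
  exact: (measurableT_comp mFE (pair1_measurable (a, a'))).
by rewrite [LHS](Q2E mFa)// => q; rewrite lee_fin.
Qed.

Let mvc d (T : measurableType d) (f : T -> T1) (g : T -> T2) :
  measurable_fun setT f -> measurable_fun setT g ->
  measurable_fun setT (fun t => v (f t) (g t)).
Proof.
move=> mf mg; apply: (measurableT_comp mv (g := fun t => (f t, g t))).
exact: measurable_fun_pair.
Qed.

Let msq d (T : measurableType d) (f g : T -> T1) (h k : T -> T2) :
  measurable_fun setT f -> measurable_fun setT g ->
  measurable_fun setT h -> measurable_fun setT k ->
  measurable_fun setT (fun t => (v (f t) (h t) - v (g t) (k t)) ^+ 2)%R.
Proof.
by move=> mf mg mh mk; apply: measurable_funX; apply: measurable_funB; exact: mvc.
Qed.

Let integral_P_cst d (T : measurableType d) (P : probability T R) (c : \bar R) :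
  \int[P]_x c = c.
Proof. by rewrite integral_cst//= probability_setT mule1. Qed.

(* The four-point inequality
   (v a b - v a' b')^2 + (v a b' - v a' b)^2 <= sum of the four sides,
   integrated over two independent copies of (a, b). *)
Lemma two_point_tensorization :
  \int[P1]_a \int[P1]_a' \int[P2]_b \int[P2]_b' ((v a b - v a' b') ^+ 2)%:E <=
  \int[P1]_a \int[P2]_b \int[P2]_b' ((v a b - v a b') ^+ 2)%:E +
  \int[P1]_a \int[P1]_a' \int[P2]_b ((v a b - v a' b) ^+ 2)%:E.
Proof.
have f11 : measurable_fun setT (fun q : (T1 * T1) * (T2 * T2) => q.1.1).
  exact: (measurableT_comp measurable_fst measurable_fst).
have f12 : measurable_fun setT (fun q : (T1 * T1) * (T2 * T2) => q.1.2).
  exact: (measurableT_comp measurable_snd measurable_fst).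
have f21 : measurable_fun setT (fun q : (T1 * T1) * (T2 * T2) => q.2.1).
  exact: (measurableT_comp measurable_fst measurable_snd).
have f22 : measurable_fun setT (fun q : (T1 * T1) * (T2 * T2) => q.2.2).
  exact: (measurableT_comp measurable_snd measurable_snd).
set D := (X in X <= _); set D2 := (X in _ <= X + _); set D1 := (X in _ <= _ + X).
pose X1 a a' b b' := ((v a b - v a' b') ^+ 2)%R.
pose X2 a a' b b' := ((v a b' - v a' b) ^+ 2)%R.
pose Y1 (a a' : T1) b b' := ((v a b - v a b') ^+ 2)%R.
pose Y2 (a a' : T1) b b' := ((v a' b - v a' b') ^+ 2)%R.
pose Y3 a a' (b b' : T2) := ((v a b - v a' b) ^+ 2)%R.
pose Y4 a a' (b b' : T2) := ((v a b' - v a' b') ^+ 2)%R.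
pose I F := \int[M]_q (F q.1.1 q.1.2 q.2.1 q.2.2 : R)%:E.
have IX1 : I X1 = D.
  by rewrite /I integral_quad; [|exact: msq|by move=> *; exact: sqr_ge0].
have IX2 : I X2 = D.
  rewrite /I integral_quad; [|exact: msq|by move=> *; exact: sqr_ge0].
  apply: eq_integral => a _; apply: eq_integral => a' _.
  apply: (@tonelli_swap _ _ _ _ _ P2 P2 (fun b b' => ((v a b' - v a' b) ^+ 2)%:E)).
    by apply/measurable_EFinP; exact: msq.
  by move=> *; rewrite lee_fin sqr_ge0.
have IY1 : I Y1 = D2.
  rewrite /I integral_quad; [|exact: msq|by move=> *; exact: sqr_ge0].
  by rewrite /Y1; apply: eq_integral => a _; exact: (@integral_P_cst _ _ P1).
have IY2 : I Y2 = D2.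
  rewrite /I integral_quad; [|exact: msq|by move=> *; exact: sqr_ge0].
  by rewrite /Y2; exact: (@integral_P_cst _ _ P1).
have IY3 : I Y3 = D1.
  rewrite /I integral_quad; [|exact: msq|by move=> *; exact: sqr_ge0].
  apply: eq_integral => a _; apply: eq_integral => a' _.
  by rewrite /Y3; apply: eq_integral => b _; exact: (@integral_P_cst _ _ P2).
have IY4 : I Y4 = D1.
  rewrite /I integral_quad; [|exact: msq|by move=> *; exact: sqr_ge0].
  apply: eq_integral => a _; apply: eq_integral => a' _.
  by rewrite /Y4; exact: (@integral_P_cst _ _ P2).
have mX1 : measurable_fun setT (fun q : (T1 * T1) * (T2 * T2) => X1 q.1.1 q.1.2 q.2.1 q.2.2) by exact: msq.
have mX2 : measurable_fun setT (fun q : (T1 * T1) * (T2 * T2) => X2 q.1.1 q.1.2 q.2.1 q.2.2) by exact: msq.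
have mY1 : measurable_fun setT (fun q : (T1 * T1) * (T2 * T2) => Y1 q.1.1 q.1.2 q.2.1 q.2.2) by exact: msq.
have mY2 : measurable_fun setT (fun q : (T1 * T1) * (T2 * T2) => Y2 q.1.1 q.1.2 q.2.1 q.2.2) by exact: msq.
have mY3 : measurable_fun setT (fun q : (T1 * T1) * (T2 * T2) => Y3 q.1.1 q.1.2 q.2.1 q.2.2) by exact: msq.
have mY4 : measurable_fun setT (fun q : (T1 * T1) * (T2 * T2) => Y4 q.1.1 q.1.2 q.2.1 q.2.2) by exact: msq.
pose MF F := measurable_fun setT
  (fun q : (T1 * T1) * (T2 * T2) => F q.1.1 q.1.2 q.2.1 q.2.2 : R).
have ID F G : MF F -> MF G -> (forall a a' b b', 0 <= F a a' b b')%R ->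
    (forall a a' b b', 0 <= G a a' b b')%R ->
    I F + I G = I (fun a a' b b' => F a a' b b' + G a a' b b')%R.
  by move=> mF mG F0 G0; rewrite /I ge0_eintegralD.
have s0 (x : R) : (0 <= x ^+ 2)%R by exact: sqr_ge0.
(* Exchanging b and b' shows that both diagonals integrate to [D], and opposite sides have the same
   integral, so halving gives the claim. Sides minus diagonals is the square of the mixed second
   difference of v. *)
have : D + D <= D2 + D2 + (D1 + D1).
  rewrite -{1}IX1 -IX2 -{1}IY1 -IY2 -{1}IY3 -IY4.
  rewrite (ID X1 X2); [|exact: mX1|exact: mX2|by move=> *; exact: s0|by move=> *; exact: s0].
  rewrite (ID Y1 Y2); [|exact: mY1|exact: mY2|by move=> *; exact: s0|by move=> *; exact: s0].
  rewrite (ID Y3 Y4); [|exact: mY3|exact: mY4|by move=> *; exact: s0|by move=> *; exact: s0].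
  rewrite ID; last 4 first.
  - exact: (measurable_funD mY1 mY2).
  - exact: (measurable_funD mY3 mY4).
  - by move=> *; apply: addr_ge0; exact: s0.
  - by move=> *; apply: addr_ge0; exact: s0.
  apply: ge0_eintegral_le.
  - exact: (measurable_funD mX1 mX2).
  - exact: (measurable_funD (measurable_funD mY1 mY2) (measurable_funD mY3 mY4)).
  - by move=> q; apply: addr_ge0; exact: s0.
  move=> [[a a'] [b b']]; rewrite /X1 /X2 /Y1 /Y2 /Y3 /Y4/= -subr_ge0.
  rewrite (_ : (_ - _)%R = (v a b + v a' b' - v a b' - v a' b) ^+ 2)%R ?sqr_ge0//.
  ring.
have D0 : 0 <= D by do 4! (apply: integral_ge0 => ? _); rewrite lee_fin sqr_ge0.
have D20 : 0 <= D2 by do 3! (apply: integral_ge0 => ? _); rewrite lee_fin sqr_ge0.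
have D10 : 0 <= D1 by do 3! (apply: integral_ge0 => ? _); rewrite lee_fin sqr_ge0.
have half (x y z : \bar R) : 0 <= x -> 0 <= y -> 0 <= z ->
    x + x <= y + y + (z + z) -> x <= y + z.
  move: x y z => [x| |] [y| |] [z| |] //= _ _ _; rewrite ?leey//.
  rewrite -!EFinD !lee_fin => h; lra.
by move=> h; exact: (half _ _ _ D0 D20 D10 h).
Qed.

End tensorization.

Section gauss_step.
Local Open Scope ereal_scope.
Context {R : realType} (s : R) (n : nat).
Variable m : probability 'rV[R]_n R.

Definition gauss_step : set 'rV[R]_n.+1 -> \bar R :=
  pushforward (product_probability (normal_prob 0%R s) m) (@cons_rV R n).

Let gauss_step0 : gauss_step set0 = 0.
Proof. by rewrite /gauss_step /pushforward preimage_set0 measure0. Qed.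

Let gauss_step_ge0 A : 0 <= gauss_step A.
Proof. by rewrite /gauss_step /pushforward; exact: measure_ge0. Qed.

Let gauss_step_sigma_additive : semi_sigma_additive gauss_step.
Proof.
move=> F mF tF mUF; rewrite /gauss_step /pushforward preimage_bigcup.
have mpre A : measurable A -> measurable (@cons_rV R n @^-1` A).
  by move=> mA; rewrite -[X in measurable X]setTI; exact: measurable_cons_rV.
apply: measure_semi_sigma_additive.
- by move=> k; exact: mpre.
- apply/trivIsetP => /= i j _ _ ij; rewrite -preimage_setI.
  by move/trivIsetP : tF => /(_ _ _ _ _ ij) ->//; rewrite preimage_set0.
- by rewrite -preimage_bigcup; exact: mpre.
Qed.

HB.instance Definition _ := isMeasure.Build _ _ _ gauss_step
  gauss_step0 gauss_step_ge0 gauss_step_sigma_additive.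

Let gauss_step_setT : gauss_step setT = 1.
Proof.
by rewrite /gauss_step /pushforward preimage_setT; exact: probability_setT.
Qed.

HB.instance Definition _ := @Measure_isProbability.Build _ _ R gauss_step gauss_step_setT.

End gauss_step.

Fixpoint gauss_rV {R : realType} (s : R) (n : nat) : probability 'rV[R]_n R :=
  match n with
  | 0 => dirac (0 : 'rV[R]_0)
  | n'.+1 => gauss_step s (gauss_rV s n')
  end.

Section gauss_rV.
Context {R : realType} (s : R).
Hypothesis s0 : 0 < s.
Notation P := (normal_prob 0%R s).
Local Open Scope ereal_scope.

Lemma ge0_integral_gauss_cons n (F : 'rV[R]_n.+1 -> \bar R) :
  measurable_fun setT F -> (forall x, 0 <= F x) ->
  \int[gauss_rV s n.+1]_x F x =
  \int[P]_a \int[gauss_rV s n]_v F (cons_rV (a, v)).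
Proof.
move=> mF F0; rewrite /= /gauss_step.
rewrite ge0_integral_pushforward//=; last exact: measurable_cons_rV.
rewrite preimage_setT.
apply: (@integral_product_probability _ _ _ _ _ P (gauss_rV s n) (F \o @cons_rV R n)) => [|x]; last exact: F0.
exact: (measurableT_comp mF measurable_cons_rV).
Qed.

Definition gauss_pdf n (x : 'rV[R]_n) : R :=
  (normal_peak s ^+ n * expR (- (s ^+ 2 *+ 2)^-1 * sqnorm x))%R.

Lemma gauss_pdf_ge0 n (x : 'rV[R]_n) : (0 <= gauss_pdf x)%R.
Proof. by rewrite mulr_ge0 ?exprn_ge0 ?normal_peak_ge0 ?expR_ge0. Qed.

Lemma measurable_gauss_pdf n : measurable_fun setT (@gauss_pdf n).
Proof.
apply: measurable_funM => //; apply: (measurableT_comp (f := expR)) => //.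
by apply: measurable_funM => //; exact: (measurable_sqnorm (f := id)).
Qed.

Lemma gauss_pdf_cons n (a : R) (w : 'rV[R]_n) :
  gauss_pdf (cons_rV (a, w)) = (normal_pdf 0 s a * gauss_pdf w)%R.
Proof.
rewrite normal_pdf0E// /gauss_pdf sqnorm_cons mulrDr expRD exprS; ring.
Qed.

Lemma ge0_integral_gauss n (F : 'rV[R]_n -> R) :
  measurable_fun setT F -> (forall x, 0 <= F x)%R ->
  \int[gauss_rV s n]_x (F x)%:E = \int[lebesgue_rV n]_x (F x * gauss_pdf x)%:E.
Proof.
elim: n F => [|n IH] F mF F0.
  rewrite /= !integral_dirac ?diracT ?mul1e//=.
  - by rewrite /gauss_pdf /sqnorm big_ord0 mulr0 expR0 expr0 !mulr1.
  - by apply/measurable_EFinP/measurable_funM => //; exact: measurable_gauss_pdf.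
  - exact/measurable_EFinP.
have mFc a : measurable_fun setT (fun w : 'rV[R]_n => F (cons_rV (a, w))).
  exact: (measurableT_comp mF (measurable_cons_rVr a)).
rewrite ge0_integral_gauss_cons; last 2 first.
- exact/measurable_EFinP.
- by move=> x; rewrite lee_fin.
rewrite ge0_integral_cons_rV; last 2 first.
- by apply/measurable_EFinP/measurable_funM => //; exact: measurable_gauss_pdf.
- by move=> x; rewrite lee_fin mulr_ge0 ?gauss_pdf_ge0.
rewrite ge0_integral_normal_prob; last 2 first.
- apply: (@measurable_tonelli1 _ _ _ _ _ (gauss_rV s n)
    (fun (a : measurableTypeR R) w => (F (cons_rV (a, w)))%:E)).
    apply/measurable_EFinP.
    have := measurableT_comp mF (@measurable_cons_rV R n).
    by rewrite (_ : (fun p => _) = F \o @cons_rV R n)//; apply/funext => -[].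
  by move=> *; rewrite lee_fin.
- by move=> a; apply: integral_ge0 => w _; rewrite lee_fin.
apply: eq_integral => a _.
rewrite IH// muleC -ge0_eintegralZ.
- by apply: eq_integral => w _; rewrite gauss_pdf_cons; congr (_%:E); ring.
- by apply: measurable_funM => //; exact: measurable_gauss_pdf.
- exact: normal_pdf_ge0.
- by move=> w; rewrite mulr_ge0 ?gauss_pdf_ge0.
Qed.

(** Induction on n: tensorization bounds the left side by the oscillation in the first coordinate
    plus that in the others, which the one-dimensional inequality and the induction hypothesis
    control with the same constant 2 s^2. Derivatives are taken along coordinate lines only, as in
    the one-dimensional case. *)
Theorem gauss_poincare n (v : 'rV[R]_n -> R) (dv : 'I_n -> 'rV[R]_n -> R) :
  measurable_fun setT v -> (forall i, measurable_fun setT (dv i)) ->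
  (forall i x (t : R), is_derive t 1%R (fun t : R => v (t *: delta_mx ord0 i + x)%R)
                            (dv i (t *: delta_mx ord0 i + x)%R)) ->
  (forall i x, continuous (fun t : R => dv i (t *: delta_mx ord0 i + x)%R)) ->
  \int[gauss_rV s n]_x \int[gauss_rV s n]_y ((v x - v y) ^+ 2)%:E <=
  (2 * s ^+ 2)%:E * \int[gauss_rV s n]_x (\sum_i dv i x ^+ 2)%:E.
Proof.
elim: n v dv => [|n IH] v dv mv mdv dvE cdv.
  rewrite (_ : (\int[_]_x _)%E = 0).
    apply: mule_ge0; first by rewrite lee_fin mulr_ge0 ?sqr_ge0.
    by apply: integral_ge0 => x _; rewrite lee_fin big_ord0.
  apply: integral0_eq => x _; apply: integral0_eq => y _.
  by rewrite (_ : x = y) ?subrr ?expr0n//; apply/rowP => -[].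
set G := gauss_rV s n.
have mc (f : 'rV[R]_n.+1 -> R) : measurable_fun setT f ->
    measurable_fun setT (fun p : measurableTypeR R * 'rV[R]_n => f (cons_rV (p.1, p.2))).
  move=> mf; have := measurableT_comp mf (@measurable_cons_rV R n).
  by rewrite (_ : (fun p => _) = f \o @cons_rV R n)//; apply/funext => -[].
have s2 : (0 <= 2 * s ^+ 2)%R by rewrite mulr_ge0// sqr_ge0.
pose w a b := v (cons_rV (a, b)).
have LHS : \int[gauss_rV s n.+1]_x \int[gauss_rV s n.+1]_y ((v x - v y) ^+ 2)%:E =
    \int[P]_a \int[P]_a' \int[G]_b \int[G]_b' ((w a b - w a' b') ^+ 2)%:E.
  rewrite ge0_integral_gauss_cons; last 2 first.
  - apply: (@measurable_tonelli1 _ _ _ _ _ (gauss_rV s n.+1) (fun x y => ((v x - v y) ^+ 2)%:E)).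
      apply/measurable_EFinP/measurable_funX/measurable_funB; exact: (measurableT_comp mv).
    by move=> *; rewrite lee_fin sqr_ge0.
  - by move=> x; apply: integral_ge0 => y _; rewrite lee_fin sqr_ge0.
  apply: eq_integral => a _.
  transitivity (\int[G]_b \int[P]_a' \int[G]_b' ((w a b - w a' b') ^+ 2)%:E).
    apply: eq_integral => b _; rewrite ge0_integral_gauss_cons; [by []| |by move=> y; rewrite lee_fin sqr_ge0].
    by apply/measurable_EFinP/measurable_funX/measurable_funB.
  apply: (@tonelli_swap _ _ _ _ _ G P (fun b a' => \int[G]_b' ((w a b - w a' b') ^+ 2)%:E)).
    apply: (@measurable_tonelli1 _ _ _ _ _ G
      (fun (p : 'rV[R]_n * measurableTypeR R) b' => ((w a p.1 - w p.2 b') ^+ 2)%:E)).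
      apply/measurable_EFinP/measurable_funX/measurable_funB.
        apply: (measurableT_comp mv); apply: (measurableT_comp (measurable_cons_rVr a)).
        exact: (measurableT_comp measurable_fst measurable_fst).
      apply: (measurableT_comp (mc _ mv) (g := fun q : ('rV[R]_n * measurableTypeR R) * 'rV[R]_n => (q.1.2, q.2))).
      apply: measurable_fun_pair => //.
      exact: (measurableT_comp measurable_snd measurable_fst).
    by move=> *; rewrite lee_fin sqr_ge0.
  by move=> *; apply: integral_ge0 => ? _; rewrite lee_fin sqr_ge0.
rewrite LHS; apply: (le_trans (@two_point_tensorization _ _ _ _ _ P G w (mc _ mv))).
pose S x := (\sum_i dv (lift ord0 i) x ^+ 2)%R.
have S0 x : (0 <= S x)%R by apply: sumr_ge0 => i _; exact: sqr_ge0.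
have mS : measurable_fun setT S by apply: measurable_sum => i; exact: measurable_funX.
have md0 : measurable_fun setT (fun x => dv ord0 x ^+ 2)%R by exact: measurable_funX.
have d00 x : (0 <= dv ord0 x ^+ 2)%R by exact: sqr_ge0.
have RHS : \int[gauss_rV s n.+1]_x (\sum_i dv i x ^+ 2)%:E =
    \int[P]_a \int[G]_b (S (cons_rV (a, b)))%:E +
    \int[G]_b \int[P]_a (dv ord0 (cons_rV (a, b)) ^+ 2)%:E.
  transitivity (\int[gauss_rV s n.+1]_x (S x + dv ord0 x ^+ 2)%:E).
    by apply: eq_integral => x _; rewrite big_ord_recl addrC.
  rewrite ge0_eintegralD//; congr (_ + _).
    by rewrite ge0_integral_gauss_cons; [|exact/measurable_EFinP|by move=> x; rewrite lee_fin].
  rewrite ge0_integral_gauss_cons; [|exact/measurable_EFinP|by move=> x; rewrite lee_fin].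
  apply: (@tonelli_swap _ _ _ _ _ P G (fun a b => (dv ord0 (cons_rV (a, b)) ^+ 2)%:E)).
    by apply/measurable_EFinP; exact: (mc _ md0).
  by move=> *; rewrite lee_fin.
rewrite RHS ge0_muleDr; last 2 first.
- by apply: integral_ge0 => ? _; apply: integral_ge0 => ? _; rewrite lee_fin.
- by apply: integral_ge0 => ? _; apply: integral_ge0 => ? _; rewrite lee_fin.
apply: leeD.
- rewrite -ge0_integralZl_EFin//; last 2 first.
  + by move=> a _; apply: integral_ge0 => b _; rewrite lee_fin.
  + apply: (@measurable_tonelli1 _ _ _ _ _ G (fun (a : measurableTypeR R) b => (S (cons_rV (a, b)))%:E)).
      by apply/measurable_EFinP; exact: (mc _ mS).
    by move=> *; rewrite lee_fin.
  apply: ge0_le_integral => //.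
  + by move=> a _; do 2!apply: integral_ge0 => ? _; rewrite lee_fin sqr_ge0.
  + apply: (@measurable_tonelli1 _ _ _ _ _ G
      (fun (a : measurableTypeR R) b => \int[G]_b' ((w a b - w a b') ^+ 2)%:E)).
      apply: (@measurable_tonelli1 _ _ _ _ _ G
        (fun (p : measurableTypeR R * 'rV[R]_n) b' => ((w p.1 p.2 - w p.1 b') ^+ 2)%:E)).
        apply/measurable_EFinP/measurable_funX/measurable_funB.
          exact: (measurableT_comp (mc _ mv) measurable_fst).
        apply: (measurableT_comp (mc _ mv) (g := fun q : (measurableTypeR R * 'rV[R]_n) * 'rV[R]_n => (q.1.1, q.2))).
        apply: measurable_fun_pair => //.
        exact: (measurableT_comp measurable_fst measurable_fst).
      by move=> *; rewrite lee_fin sqr_ge0.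
    by move=> *; apply: integral_ge0 => ? _; rewrite lee_fin sqr_ge0.
  + apply: measurable_funeM.
    apply: (@measurable_tonelli1 _ _ _ _ _ G (fun (a : measurableTypeR R) b => (S (cons_rV (a, b)))%:E)).
      by apply/measurable_EFinP; exact: (mc _ mS).
    by move=> *; rewrite lee_fin.
  move=> a _; apply: (IH (w a) (fun i b => dv (lift ord0 i) (cons_rV (a, b)))).
  + exact: (measurableT_comp mv (measurable_cons_rVr a)).
  + move=> i; exact: (measurableT_comp (mdv _) (measurable_cons_rVr a)).
  + move=> i x t; rewrite /w; under eq_fun do rewrite cons_rV_deltaS.
    by rewrite cons_rV_deltaS; exact: dvE.
  + move=> i x; under eq_fun do rewrite cons_rV_deltaS.
    exact: cdv.
have swap : \int[P]_a \int[P]_a' \int[G]_b ((w a b - w a' b) ^+ 2)%:E =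
    \int[G]_b \int[P]_a \int[P]_a' ((w a b - w a' b) ^+ 2)%:E.
  have mwd : measurable_fun setT (fun q : (measurableTypeR R * measurableTypeR R) * 'rV[R]_n =>
      ((w q.1.1 q.2 - w q.1.2 q.2) ^+ 2)%R).
    apply: measurable_funX; apply: measurable_funB.
      apply: (measurableT_comp (mc _ mv) (g := fun q : (measurableTypeR R * measurableTypeR R) * 'rV[R]_n => (q.1.1, q.2))).
      apply: measurable_fun_pair => //; exact: (measurableT_comp measurable_fst measurable_fst).
    apply: (measurableT_comp (mc _ mv) (g := fun q : (measurableTypeR R * measurableTypeR R) * 'rV[R]_n => (q.1.2, q.2))).
    apply: measurable_fun_pair => //; exact: (measurableT_comp measurable_snd measurable_fst).
  have mwd2 : measurable_fun setT (fun q : (measurableTypeR R * 'rV[R]_n) * measurableTypeR R =>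
      ((w q.1.1 q.1.2 - w q.2 q.1.2) ^+ 2)%R).
    apply: (measurableT_comp mwd (g := fun q : (measurableTypeR R * 'rV[R]_n) * measurableTypeR R => ((q.1.1, q.2), q.1.2))).
    apply: measurable_fun_pair; last exact: (measurableT_comp measurable_snd measurable_fst).
    apply: measurable_fun_pair => //; exact: (measurableT_comp measurable_fst measurable_fst).
  transitivity (\int[P]_a \int[G]_b \int[P]_a' ((w a b - w a' b) ^+ 2)%:E).
    apply: eq_integral => a _.
    apply: (@tonelli_swap _ _ _ _ _ P G (fun a' b => ((w a b - w a' b) ^+ 2)%:E)).
      apply/measurable_EFinP.
      apply: (measurableT_comp mwd (g := fun q : measurableTypeR R * 'rV[R]_n => ((a, q.1), q.2))).
      by apply: measurable_fun_pair => //; apply: measurable_fun_pair.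
    by move=> *; rewrite lee_fin sqr_ge0.
  apply: (@tonelli_swap _ _ _ _ _ P G (fun a b => \int[P]_a' ((w a b - w a' b) ^+ 2)%:E)).
    apply: (@measurable_tonelli1 _ _ _ _ _ P
      (fun (p : measurableTypeR R * 'rV[R]_n) a' => ((w p.1 p.2 - w a' p.2) ^+ 2)%:E)).
      by apply/measurable_EFinP.
    by move=> *; rewrite lee_fin sqr_ge0.
  by move=> *; apply: integral_ge0 => ? _; rewrite lee_fin sqr_ge0.
have mI : measurable_fun setT (fun b => \int[P]_a (dv ord0 (cons_rV (a, b)) ^+ 2)%:E).
  apply: (@measurable_tonelli2 _ _ _ _ _ P (fun (a : measurableTypeR R) b => (dv ord0 (cons_rV (a, b)) ^+ 2)%:E)).
    by apply/measurable_EFinP; exact: (mc _ md0).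
  by move=> *; rewrite lee_fin.
rewrite swap -ge0_integralZl_EFin//; last first.
  by move=> b _; apply: integral_ge0 => a _; rewrite lee_fin.
apply: ge0_le_integral => //.
- by move=> b _; do 2!apply: integral_ge0 => ? _; rewrite lee_fin sqr_ge0.
- apply: (@measurable_tonelli2 _ _ _ _ _ P
    (fun (a : measurableTypeR R) b => \int[P]_a' ((w a b - w a' b) ^+ 2)%:E)).
    apply: (@measurable_tonelli1 _ _ _ _ _ P
      (fun (p : measurableTypeR R * 'rV[R]_n) a' => ((w p.1 p.2 - w a' p.2) ^+ 2)%:E)).
      apply/measurable_EFinP/measurable_funX/measurable_funB.
        exact: (measurableT_comp (mc _ mv) measurable_fst).
      apply: (measurableT_comp (mc _ mv) (g := fun q : (measurableTypeR R * 'rV[R]_n) * measurableTypeR R => (q.2, q.1.2))).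
      apply: measurable_fun_pair => //.
      exact: (measurableT_comp measurable_snd measurable_fst).
    by move=> *; rewrite lee_fin sqr_ge0.
  by move=> *; apply: integral_ge0 => ? _; rewrite lee_fin sqr_ge0.
- exact: measurable_funeM.
move=> b _; apply: (@gauss_poincare1 R s s0 (fun a => w a b) (fun a => dv ord0 (cons_rV (a, b)))).
- move=> t; rewrite /w.
  have := dvE ord0 (cons_rV (0%R, b)) t.
  under eq_fun do rewrite -cons_rV_delta0 addr0.
  by rewrite -cons_rV_delta0 addr0.
- have := cdv ord0 (cons_rV (0%R, b)).
  by under eq_fun do rewrite -cons_rV_delta0 addr0.
Qed.

End gauss_rV.

(** * The inequality for regular functions *)

Section square_integrable.
Context d (T : measurableType d) (R : realType) (mu : {measure set T -> \bar R}).
Implicit Types f g : T -> R.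

Definition sqint f := measurable_fun setT f /\ (\int[mu]_x (f x ^+ 2)%:E < +oo)%E.

Lemma sqint_le f g (c : R) : measurable_fun setT f -> sqint g ->
  (forall x, f x ^+ 2 <= c * g x ^+ 2) -> sqint f.
Proof.
move=> mf [mg ig] fg; split => //.
apply: (@le_lt_trans _ _ (\int[mu]_x (`|c| * g x ^+ 2)%:E)%E).
  apply: ge0_eintegral_le => //.
  - exact: measurable_funX.
  - by apply: measurable_funM => //; exact: measurable_funX.
  - by move=> x; exact: sqr_ge0.
  - move=> x; apply: (le_trans (fg x)); rewrite ler_wpM2r ?sqr_ge0//; exact: ler_norm.
rewrite ge0_eintegralZ//.
- by rewrite lte_mul_pinfty.
- exact: measurable_funX.
- by move=> x; exact: sqr_ge0.
Qed.

Lemma sqintD f g : sqint f -> sqint g -> sqint (fun x => f x + g x).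
Proof.
move=> [mf fi] [mg gi]; split; first exact: measurable_funD.
apply: (@le_lt_trans _ _ (\int[mu]_x (2 * f x ^+ 2 + 2 * g x ^+ 2)%:E)%E).
  apply: ge0_eintegral_le.
  - exact/measurable_funX/measurable_funD.
  - by apply: measurable_funD; apply: measurable_funM => //; exact: measurable_funX.
  - by move=> x; exact: sqr_ge0.
  - move=> x; rewrite -subr_ge0 (_ : _ - _ = (f x - g x) ^+ 2) ?sqr_ge0//; ring.
have mf2 := measurable_funX 2 mf; have mg2 := measurable_funX 2 mg.
rewrite ge0_eintegralD//.
- by rewrite !ge0_eintegralZ//; [rewrite lte_add_pinfty// lte_mul_pinfty|
    move=> x; exact: sqr_ge0|move=> x; exact: sqr_ge0].
- exact: measurable_funM.
- exact: measurable_funM.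
- by move=> x; rewrite mulr_ge0// sqr_ge0.
- by move=> x; rewrite mulr_ge0// sqr_ge0.
Qed.

Lemma sqintN f : sqint f -> sqint (fun x => - f x).
Proof.
move=> fi; apply: (sqint_le (c := 1) _ fi).
- by apply: measurableT_comp => //; case: fi.
- by move=> x; rewrite sqrrN mul1r.
Qed.

Lemma sqintB f g : sqint f -> sqint g -> sqint (fun x => f x - g x).
Proof. by move=> fi gi; apply: sqintD => //; exact: sqintN. Qed.

Lemma sqint_boundedM f g (c : R) : measurable_fun setT f -> sqint g ->
  (forall x, `|f x| <= c) -> sqint (fun x => f x * g x).
Proof.
move=> mf gi fc; apply: (sqint_le (c := c ^+ 2) _ gi).
- by apply: measurable_funM => //; case: gi.
- move=> x; rewrite exprMn ler_wpM2r ?sqr_ge0// -[leLHS]real_normK ?num_real//.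
  by rewrite ler_sqr ?nnegrE// (le_trans _ (fc x)).
Qed.

Lemma integrable_sqr f : sqint f -> mu.-integrable setT (fun x => (f x ^+ 2)%:E).
Proof.
move=> [mf fi]; apply/integrableP; split.
  by apply/measurable_EFinP; exact: measurable_funX.
by under eq_integral do rewrite /= ger0_norm ?sqr_ge0//.
Qed.

Lemma integrable_le f g : measurable_fun setT f ->
  mu.-integrable setT (EFin \o g) -> (forall x, `|f x| <= g x) ->
  mu.-integrable setT (EFin \o f).
Proof.
move=> mf gi fg; apply: (le_integrable _ _ _ gi) => //; first exact/measurable_EFinP.
by move=> x _; rewrite /= lee_fin (le_trans (fg x))// ler_norm.
Qed.

Lemma integrable_sqintM f g : sqint f -> sqint g ->
  mu.-integrable setT (fun x => (f x * g x)%:E).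
Proof.
move=> fi gi; have [mf _] := fi; have [mg _] := gi.
apply: (integrable_le (g := fun x => f x ^+ 2 + g x ^+ 2)).
- exact: measurable_funM.
- have := integrableD measurableT (integrable_sqr fi) (integrable_sqr gi).
  by apply: eq_integrable => // x _.
- move=> x; rewrite normrM -[f x ^+ 2]real_normK ?num_real//.
  rewrite -[g x ^+ 2]real_normK ?num_real//.
  have := sqr_ge0 (`|f x| - `|g x|); have := normr_ge0 (f x); have := normr_ge0 (g x).
  nra.
Qed.

End square_integrable.

Arguments sqint {d T R} mu f.

(** * Calculus along coordinate lines *)

Section lines.
Context {R : realType} {n : nat}.
Implicit Types (f : 'rV[R]_n -> R) (i : 'I_n).

(** The derivative is taken in the parameter t of a coordinate line, so that the one-dimensional
    calculus and the fundamental theorem apply directly; [has_partialP] relates it to [partial]. *)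
Definition has_partial i f (df : 'rV[R]_n -> R) := forall x (t : R),
  is_derive t 1 (fun t : R => f (t *: delta_mx ord0 i + x))
                (df (t *: delta_mx ord0 i + x)).

Definition line_continuous i f := forall x,
  continuous (fun t : R => f (t *: delta_mx ord0 i + x)).

End lines.

Section integration_by_parts.
Context {R : realType} {n : nat}.
Notation leb := (@lebesgue_rV R n).
Local Open Scope ereal_scope.

(* Translation invariance turns the integral of F(x + e_i) - F(x), which is
   that of the derivative averaged along a unit segment, into 0. *)
Lemma integral_partial_eq0 (i : 'I_n) (F dF : 'rV[R]_n -> R) :
  has_partial i F dF -> line_continuous i dF ->
  leb.-integrable setT (EFin \o F) -> leb.-integrable setT (EFin \o dF) ->
  \int[leb]_x (dF x)%:E = 0.
Proof.
move=> dFE cdF iF idF.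
have mF : measurable_fun setT F by apply/measurable_EFinP; exact: (measurable_int _ iF).
have mdF : measurable_fun setT dF by apply/measurable_EFinP; exact: (measurable_int _ idF).
pose mu := @lebesgue_measure R.
(* The indicator of [0, 1] encodes the average over the segment from x to x + e_i as an integral on
   a product space, ready for Fubini. *)
pose J (t : R) : R := \1_[set` `[0%R, 1%R]%R] t.
have mJ : measurable_fun setT J by exact: measurable_indic.
pose e := delta_mx ord0 i : 'rV[R]_n.
pose H (p : measurableTypeR R * 'rV[R]_n) : \bar R := (J p.1 * dF (p.1 *: e + p.2))%:E.
have mH : measurable_fun setT H.
  apply/measurable_EFinP/measurable_funM; first exact: (measurableT_comp mJ).
  apply: (measurableT_comp mdF); apply: measurable_rVD => //; exact: measurable_rVZ.
have J01 t : (0 <= J t)%R by rewrite /J.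
have IJ : \int[mu]_t (J t)%:E = 1.
  by rewrite integral_indic//= setIT lebesgue_measure_itv/= lte_fin ltr01 oppr0 adde0.
have iH : (mu \x leb).-integrable setT H.
  apply/(integrable12ltyP mu leb mH).
  apply: (@le_lt_trans _ _ (\int[mu]_t ((J t)%:E * \int[leb]_x `|(dF x)%:E|))).
    apply: ge0_le_integral => //.
    - by move=> t _; apply: integral_ge0 => x _.
    - apply: (@measurable_tonelli1 _ _ _ _ _ leb (fun (t : measurableTypeR R) x => `|H (t, x)|)) => //.
      exact: (measurableT_comp (@abse_measurable R setT) mH).
    - by apply: emeasurable_funM => //; exact/measurable_EFinP.
    move=> t _; rewrite -ge0_integralZl_EFin//; last first.
      by apply: measurableT_comp => //; exact/measurable_EFinP.
    rewrite le_eqVlt; apply/orP; left; apply/eqP.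
    have mA : measurable_fun setT (fun x => (J t)%:E * `|(dF x)%:E|).
      apply: emeasurable_funM => //; apply: measurableT_comp => //; exact/measurable_EFinP.
    rewrite -(ge0_integral_rV_shift (t *: e) mA); last by move=> x; rewrite mule_ge0// lee_fin.
    by apply: eq_integral => x _; rewrite /H/= normrM EFinM (ger0_norm (J01 t)) addrC.
  rewrite ge0_integralZr//.
  - by rewrite IJ mul1e; move/integrableP: idF => [].
  - exact/measurable_EFinP.
  - by move=> t _; rewrite lee_fin.
  - by apply: integral_ge0.
(* Every translate of [dF] has the same integral, and J has mass 1, so averaging over t changes
   nothing. *)
have -> : \int[leb]_x (dF x)%:E = \int[mu]_t \int[leb]_x H (t, x).
  transitivity (\int[mu]_t ((J t)%:E * \int[leb]_x (dF x)%:E)).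
    have idFfin : \int[leb]_x (dF x)%:E \is a fin_num by exact: integrable_fin_num idF.
    rewrite -(fineK idFfin) integralZr//.
    - by rewrite IJ mul1e.
    - apply/integrableP; split; first exact/measurable_EFinP.
      by under eq_integral do rewrite /= ger0_norm//; rewrite IJ ltry.
  apply: eq_integral => t _; rewrite /H/=.
  under [RHS]eq_integral do rewrite EFinM.
  rewrite integralZl//.
  - congr (_ * _); rewrite -(integral_rV_shift (t *: e)); last exact/measurable_EFinP.
    by apply: eq_integral => x _; rewrite addrC.
  - apply/integrableP; split.
      apply/measurable_EFinP/(measurableT_comp mdF); exact: measurable_rVD.
    have mA : measurable_fun setT (fun x => `|(dF x)%:E|).
      by apply: measurableT_comp => //; exact/measurable_EFinP.
    have := ge0_integral_rV_shift (t *: e) mA (fun x => abse_ge0 _).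
    under eq_integral do rewrite addrC.
    by move=> ->; move/integrableP: idF => [].
rewrite (@Fubini _ _ _ _ _ mu leb H iH).
transitivity (\int[leb]_x (F (x + e)%R - F x)%:E).
  apply: eq_integral => x _; rewrite /H/=.
  transitivity (\int[mu]_(t in `[0%R, 1%R]) (dF (t *: e + x)%R)%:E).
    rewrite [RHS]integral_mkcond; apply: eq_integral => t _.
    by rewrite patchE /J indicE; case: ifPn => _; rewrite ?mul1r ?mul0r.
  rewrite (FTC_C1 ltr01 (dFE x) (cdF x)) scale1r scale0r add0r.
  by rewrite (addrC e).
have iFs : leb.-integrable setT (fun x => (F (x + e)%R)%:E).
  apply/integrableP; split.
    apply/measurable_EFinP/(measurableT_comp mF); exact: measurable_rVD.
  have mA : measurable_fun setT (fun x => `|(F x)%:E|).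
    by apply: measurableT_comp => //; exact/measurable_EFinP.
  have -> := ge0_integral_rV_shift e mA (fun x => abse_ge0 _).
  by move/integrableP: iF => [].
under eq_integral do rewrite EFinB.
rewrite integralB//.
rewrite (integral_rV_shift e (F := EFin \o F)); last exact/measurable_EFinP.
by rewrite subee//; exact: integrable_fin_num iF.
Qed.

End integration_by_parts.

Section line_calculus.
Context {R : realType} {n : nat}.
Implicit Types (f g : 'rV[R]_n -> R) (i : 'I_n).

Lemma has_partialM i f df g dg : has_partial i f df -> has_partial i g dg ->
  has_partial i (fun x => f x * g x) (fun x => f x * dg x + g x * df x).
Proof.
move=> fdf gdg x t; have := fdf x t; have := gdg x t => ? ?.
exact: (@is_deriveM _ _ (fun t : R => f (t *: delta_mx ord0 i + x))
  (fun t : R => g (t *: delta_mx ord0 i + x))).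
Qed.

Lemma has_partialD i f df g dg : has_partial i f df -> has_partial i g dg ->
  has_partial i (fun x => f x + g x) (fun x => df x + dg x).
Proof.
move=> fdf gdg x t; have := fdf x t; have := gdg x t => ? ?.
exact: (@is_deriveD _ _ _ (fun t : R => f (t *: delta_mx ord0 i + x))
  (fun t : R => g (t *: delta_mx ord0 i + x))).
Qed.

Lemma has_partial_cst i (c : R) : @has_partial R n i (fun=> c) (fun=> 0).
Proof. by move=> x t; exact: is_derive_cst. Qed.

Lemma has_partial_comp i (phi dphi : R -> R) g dg : has_partial i g dg ->
  (forall x, is_derive (g x) 1 phi (dphi (g x))) ->
  has_partial i (fun x => phi (g x)) (fun x => dphi (g x) * dg x).
Proof.
move=> gdg pdp x t; have := gdg x t => ?.
exact: (@is_derive1_comp _ phi (fun t : R => g (t *: delta_mx ord0 i + x))).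
Qed.

Lemma has_partial_eq i f df dg : has_partial i f df ->
  (forall x, df x = dg x) -> has_partial i f dg.
Proof. by move=> fdf e x t; rewrite -e. Qed.

Lemma has_partial_coor i j : has_partial i (fun x : 'rV[R]_n => x ord0 j) (fun=> (j == i)%:R).
Proof.
move=> x t; rewrite (_ : (fun t : R => _) = fun t : R => t * (j == i)%:R + x ord0 j).
  by apply: is_derive_eq; rewrite /GRing.scale/= mulr0 add0r addr0 mulr1.
by apply/funext => u; rewrite !mxE/= eq_sym.
Qed.

Lemma has_partial_sqnorm i : @has_partial R n i sqnorm (fun x => 2 * x ord0 i).
Proof.
move=> x t.
rewrite (_ : (fun t : R => _) = fun t : R => sqnorm x + 2 * x ord0 i * t + t * t).
  by apply: is_derive_eq; rewrite /GRing.scale/= !mxE !eqxx/=; ring.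
apply/funext => u; rewrite /sqnorm (bigD1 i)//= [in RHS](bigD1 i)//= !mxE !eqxx.
rewrite (eq_bigr (fun j => x ord0 j ^+ 2)) => [|j ji]; last first.
  by rewrite !mxE (negbTE ji)/= mulr0 add0r.
rewrite /=; ring.
Qed.

Lemma line_continuousM i f g : line_continuous i f -> line_continuous i g ->
  line_continuous i (fun x => f x * g x).
Proof. by move=> cf cg x t; apply: cvgM; [exact: cf|exact: cg]. Qed.

Lemma line_continuousD i f g : line_continuous i f -> line_continuous i g ->
  line_continuous i (fun x => f x + g x).
Proof. by move=> cf cg x t; apply: cvgD; [exact: cf|exact: cg]. Qed.

Lemma line_continuous_cst i (c : R) : @line_continuous R n i (fun=> c).
Proof. by move=> x t; exact: cvg_cst. Qed.

Lemma has_partial_line_continuous i f df : has_partial i f df -> line_continuous i f.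
Proof.
move=> fdf x t; apply/differentiable_continuous/derivable1_diffP.
by have [] := fdf x t.
Qed.

Lemma line_continuous_coor i j : line_continuous i (fun x : 'rV[R]_n => x ord0 j).
Proof. exact: has_partial_line_continuous (has_partial_coor _ _). Qed.

Lemma line_continuous_comp i (phi : R -> R) g : line_continuous i g ->
  (forall x, {for g x, continuous phi}) -> line_continuous i (fun x => phi (g x)).
Proof. by move=> cg cphi x t; apply: continuous_comp; [exact: cg|exact: cphi]. Qed.

End line_calculus.

(** * Spectral gap and moments of Gaussians *)

Section spectral_gap.
Context {R : realType} {n : nat}.
Notation leb := (@lebesgue_rV R n).
Local Open Scope ereal_scope.

(** The unnormalized Gaussian of variance 1 / t. With t = |y|^2 it is symmetric in x and y, which is
    what the later integration over y exploits. *)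
Definition expsq (t : R) (x : 'rV[R]_n) : R := expR (- (t / 2) * sqnorm x).

Lemma expsq_gt0 t x : (0 < expsq t x)%R. Proof. exact: expR_gt0. Qed.

Lemma measurable_expsq d (T : measurableType d) (t : T -> R) (x : T -> 'rV[R]_n) :
  measurable_fun setT t -> measurable_fun setT x ->
  measurable_fun setT (fun y => expsq (t y) (x y)).
Proof.
move=> mt mx; apply: (measurableT_comp (f := expR)) => //.
apply: measurable_funM; last exact: measurable_sqnorm.
apply: measurableT_comp => //; exact: measurable_funM.
Qed.

Variables (t : R) (t0 : (0 < t)%R).
Let s : R := (Num.sqrt t)^-1.
Let s0 : (0 < s)%R. Proof. by rewrite invr_gt0 sqrtr_gt0. Qed.
Let G := gauss_rV s n.
Let c : R := (normal_peak s ^+ n)%R.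
Let c0 : (0 < c)%R. Proof. by rewrite exprn_gt0// normal_peak_gt0// gt_eqF. Qed.

Let s2 : (s ^+ 2 = t^-1)%R.
Proof. by rewrite /s exprVn sqr_sqrtr// ltW. Qed.

Let pdfE x : gauss_pdf s x = (c * expsq t x)%R.
Proof.
rewrite /gauss_pdf.
have -> : ((s ^+ 2 *+ 2)^-1 = t / 2)%R by rewrite s2 -mulr_natr invfM invrK.
by [].
Qed.

Let integral_G (F : 'rV[R]_n -> R) : measurable_fun setT F -> (forall x, 0 <= F x)%R ->
  \int[G]_x (F x)%:E = c%:E * \int[leb]_x (F x * expsq t x)%:E.
Proof.
move=> mF F0; rewrite /G ge0_integral_gauss// -ge0_eintegralZ.
- by apply: eq_integral => x _; rewrite pdfE mulrCA.
- by apply: measurable_funM => //; exact: measurable_expsq.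
- exact: ltW.
- by move=> x; rewrite mulr_ge0// ltW// expsq_gt0.
Qed.

(** When the Gaussian mean of v is 0, the double integral of [gauss_poincare] is 2 \int v^2. The
    variance 1 / t gives the constant t, and the normalization [c] of the density cancels. *)
Lemma gauss_spectral_gap (v : 'rV[R]_n -> R) (dv : 'I_n -> 'rV[R]_n -> R) :
  measurable_fun setT v -> (forall i, measurable_fun setT (dv i)) ->
  (forall i, has_partial i v (dv i)) -> (forall i, line_continuous i (dv i)) ->
  \int[leb]_x (v x ^+ 2 * expsq t x)%:E < +oo ->
  \int[leb]_x (v x * expsq t x)%:E = 0 ->
  t%:E * \int[leb]_x (v x ^+ 2 * expsq t x)%:E <=
  \int[leb]_x ((\sum_i dv i x ^+ 2) * expsq t x)%:E.
Proof.
move=> mv mdv vdv cdv iv2 iv.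
have mv2 := measurable_funX 2 mv.
have mS : measurable_fun setT (fun x => \sum_i dv i x ^+ 2)%R.
  by apply: measurable_sum => i; exact: measurable_funX.
have S0 x : (0 <= \sum_i dv i x ^+ 2)%R by apply: sumr_ge0 => i _; exact: sqr_ge0.
have V2 : \int[G]_x (v x ^+ 2)%:E = c%:E * \int[leb]_x (v x ^+ 2 * expsq t x)%:E.
  by apply: integral_G => // x; exact: sqr_ge0.
have sv : sqint G v.
  by split=> //; rewrite V2 lte_mul_pinfty// lee_fin ltW.
have s1 : sqint G (cst 1%R).
  split=> //; under eq_integral do rewrite expr1n.
  rewrite integral_cst//= mul1e; rewrite [X in X < _](probability_setT G) ltry//.
have iGv : G.-integrable setT (EFin \o v).
  have := integrable_sqintM sv s1; apply: eq_integrable => // x _ /=.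
  by rewrite mulr1.
(* [integral_G] concerns nonnegative functions, so the vanishing mean is transferred through
   positive and negative parts. *)
have Gv0 : \int[G]_x (v x)%:E = 0.
  pose vp x := Num.max (v x) 0%R; pose vn x := Num.max (- v x)%R 0%R.
  have mvp : measurable_fun setT vp by apply: measurable_maxr.
  have mvn : measurable_fun setT vn.
    by apply: measurable_maxr => //; exact: measurableT_comp.
  have e x := ltW (expsq_gt0 t x).
  rewrite integralE.
  have -> : \int[G]_x (EFin \o v)^\+ x = \int[G]_x (vp x)%:E.
    by apply: eq_integral => x _; rewrite funeposE /vp EFin_max.
  have -> : \int[G]_x (EFin \o v)^\- x = \int[G]_x (vn x)%:E.
    by apply: eq_integral => x _; rewrite funenegE /vn EFin_max.
  rewrite integral_G//; last by move=> x; rewrite /vp le_max lexx orbT.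
  rewrite integral_G//; last by move=> x; rewrite /vn le_max lexx orbT.
  move: iv; rewrite integralE.
  have -> : \int[leb]_x (fun x => (v x * expsq t x)%:E)^\+ x =
      \int[leb]_x (vp x * expsq t x)%:E.
    apply: eq_integral => x _; rewrite funeposE /vp -EFin_max; congr (_%:E).
    by rewrite maxr_pMl// mul0r.
  have -> : \int[leb]_x (fun x => (v x * expsq t x)%:E)^\- x =
      \int[leb]_x (vn x * expsq t x)%:E.
    apply: eq_integral => x _; rewrite funenegE /vn -EFinN -EFin_max; congr (_%:E).
    by rewrite maxr_pMl// mul0r mulNr.
  set A := (X in X - _ = _ -> _); set B := (X in _ - X = _ -> _).
  have A0 : 0 <= A by apply: integral_ge0 => x _; rewrite lee_fin mulr_ge0// /vp le_max lexx orbT.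
  have B0 : 0 <= B by apply: integral_ge0 => x _; rewrite lee_fin mulr_ge0// /vn le_max lexx orbT.
  have : forall a b : \bar R, 0 <= a -> 0 <= b -> a - b = 0 -> c%:E * a - c%:E * b = 0.
    move=> [a| |] [b| |] //= _ _ /eqP; rewrite eqe subr_eq0 => /eqP ->.
    by rewrite subee.
  by apply.
have mu_sq := @integrable_sqr _ _ _ G v sv.
pose V := fine (\int[G]_x (v x ^+ 2)%:E).
have VE : \int[G]_x (v x ^+ 2)%:E = V%:E.
  by rewrite fineK// (integrable_fin_num _ mu_sq).
have lhs : \int[G]_x \int[G]_y ((v x - v y) ^+ 2)%:E = (V + V)%:E.
  transitivity (\int[G]_x (v x ^+ 2 + V)%:E).
    apply: eq_integral => x _.
    transitivity (\int[G]_y ((v x ^+ 2 + v y ^+ 2)%:E + (- (2 * v x))%:E * (v y)%:E)).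
      by apply: eq_integral => y _; rewrite -EFinM -EFinD; congr (_%:E); ring.
    have i1 : G.-integrable setT (fun y => (v x ^+ 2 + v y ^+ 2)%:E).
      apply/integrableP; split; first exact/measurable_EFinP/measurable_funD.
      under eq_integral do rewrite /= ger0_norm ?addr_ge0 ?sqr_ge0//.
      rewrite ge0_eintegralD//; [|by move=> y; exact: sqr_ge0|by move=> y; exact: sqr_ge0].
      rewrite VE integral_cst//= lte_add_pinfty ?ltry//.
      by rewrite (_ : _ * _ = (v x ^+ 2)%:E) ?ltry// -[RHS]mule1; congr (_ * _); exact: probability_setT.
    have i2 : G.-integrable setT (fun y => (- (2 * v x))%:E * (v y)%:E).
      exact: integrableZl.
    rewrite integralD//= integralZl//= Gv0 mule0 adde0.
    rewrite ge0_eintegralD//; [|by move=> y; exact: sqr_ge0|by move=> y; exact: sqr_ge0].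
    rewrite VE EFinD; congr (_ + _); rewrite integral_cst//=.
    by rewrite -[RHS]mule1; congr (_ * _); exact: probability_setT.
  have V0 : (0 <= V)%R by rewrite fine_ge0// integral_ge0// => x _; rewrite lee_fin sqr_ge0.
  rewrite ge0_eintegralD//; last by move=> y; exact: sqr_ge0.
  rewrite VE EFinD; congr (_ + _); rewrite integral_cst//=.
  by rewrite -[RHS]mule1; congr (_ * _); exact: probability_setT.
have := @gauss_poincare R s s0 n v dv mv mdv vdv cdv.
rewrite lhs (integral_G mS S0) s2.
have := V2; rewrite VE.
have X0 : 0 <= \int[leb]_x ((\sum_i dv i x ^+ 2) * expsq t x)%:E.
  by apply: integral_ge0 => x _; rewrite lee_fin mulr_ge0// ltW// expsq_gt0.
have Y0 : 0 <= \int[leb]_x (v x ^+ 2 * expsq t x)%:E.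
  by apply: integral_ge0 => x _; rewrite lee_fin mulr_ge0 ?sqr_ge0// ltW// expsq_gt0.
move: iv2 X0 Y0; move: (\int[leb]_x (v x ^+ 2 * expsq t x)%:E)
  (\int[leb]_x ((\sum_i dv i x ^+ 2) * expsq t x)%:E) => [y| |] [x| |] //= _ _ _; last by rewrite leey.
rewrite -!EFinM => -[Vy]; rewrite !lee_fin Vy => h.
have : (2 * c / t * (t * y) <= 2 * c / t * x)%R.
  move: h; rewrite (_ : 2 * c / t * (t * y) = c * y + c * y)%R; last first.
    by field; rewrite gt_eqF.
  by rewrite (_ : 2 * c / t * x = 2 / t * (c * x))%R//; field; rewrite gt_eqF.
by rewrite ler_pM2l// divr_gt0// mulr_gt0.
Qed.

End spectral_gap.

Section gauss_moments.
Context {R : realType} {n : nat}.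
Notation leb := (@lebesgue_rV R n).
Implicit Types (t q : R).
Local Open Scope ereal_scope.

Definition gauss_const : R := (Num.sqrt (pi *+ 2) ^+ n)%R.

Lemma gauss_const_gt0 : (0 < gauss_const)%R.
Proof. by rewrite exprn_gt0// sqrtr_gt0 mulrn_wgt0// pi_gt0. Qed.

(** Read off from the total mass 1 of [gauss_rV]. The power t^(-n/2) is written as the exponential
    of a logarithm, the form in which it meets the weight [h] of the Hardy inequality. *)
Lemma integral_expsq t : (0 < t)%R ->
  \int[leb]_x (expsq t x)%:E = (gauss_const * expR (- (n%:R / 2 * ln t)))%:E.
Proof.
move=> t0; pose s : R := ((Num.sqrt t)^-1)%R.
have s0 : (0 < s)%R by rewrite invr_gt0 sqrtr_gt0.
have s2 : (s ^+ 2 = t^-1)%R by rewrite /s exprVn sqr_sqrtr// ltW.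
pose c : R := (normal_peak s ^+ n)%R.
have c0 : (0 < c)%R by rewrite exprn_gt0// normal_peak_gt0// gt_eqF.
have pdfE (x : 'rV[R]_n) : gauss_pdf s x = (c * expsq t x)%R.
  rewrite /gauss_pdf.
  have -> : ((s ^+ 2 *+ 2)^-1 = t / 2)%R by rewrite s2 -mulr_natr invfM invrK.
  by [].
have cE : (c^-1 = gauss_const * expR (- (n%:R / 2 * ln t)))%R.
  rewrite /c /normal_peak exprVn invrK /gauss_const s2 -mulrnAr.
  rewrite sqrtrM ?invr_ge0 ?ltW// mulrC exprMn; congr (_ * _)%R.
  have -> : (Num.sqrt t^-1 = expR (- (2^-1 * ln t)))%R.
    apply/eqP; rewrite -(@eqrXn2 _ 2)// ?sqrtr_ge0 ?expR_ge0//.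
    rewrite sqr_sqrtr ?invr_ge0 ?ltW// -expRM_natr mulNr mulrAC mulVf ?mul1r//.
    by rewrite expRN lnK// posrE.
  by rewrite -expRM_natr; congr expR; ring.
have : \int[gauss_rV s n]_x (1 : R)%:E = 1.
  by rewrite integral_cst//= mul1e; exact: probability_setT.
rewrite (ge0_integral_gauss s0 (F := cst 1%R))//.
under eq_integral do rewrite mul1r pdfE.
rewrite ge0_eintegralZ.
- move=> /(congr1 (fun z => c^-1%:E * z)).
  by rewrite muleA -EFinM mulVf ?gt_eqF// mul1e mule1 cE.
- exact: measurable_expsq.
- exact: ltW.
- by move=> x; rewrite ltW// expsq_gt0.
Qed.

Lemma expsq_le1 t (x : 'rV[R]_n) : (0 <= t)%R -> (expsq t x <= 1)%R.
Proof.
move=> t0; rewrite -expR0 ler_expR mulNr oppr_le0 mulr_ge0 ?sqnorm_ge0//.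
by rewrite divr_ge0.
Qed.

Lemma integrable_expsq t : (0 < t)%R -> leb.-integrable setT (EFin \o expsq t).
Proof.
move=> t0; apply/integrableP; split; first exact/measurable_EFinP/measurable_expsq.
under eq_integral do rewrite /= ger0_norm ?(ltW (expsq_gt0 _ _))//.
by rewrite integral_expsq// ltry.
Qed.

(** Half of the Gaussian absorbs |x|^2, by u <= exp u at u = t |x|^2 / 4. *)
Lemma sqnorm_expsq_le t (x : 'rV[R]_n) : (0 < t)%R ->
  (sqnorm x * expsq t x <= 4 / t * expsq (t / 2) x)%R.
Proof.
move=> t0; rewrite /expsq.
have -> : (- (t / 2) * sqnorm x = - (t / 4 * sqnorm x) + - (t / 2 / 2) * sqnorm x)%R by field.
rewrite expRD mulrA ler_pM2r ?expR_gt0// expRN ler_pdivrMr ?expR_gt0//.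
have := expR_ge1Dx (t / 4 * sqnorm x)%R => h.
rewrite -ler_pdivrMl ?divr_gt0// (_ : (4 / t)^-1 = t / 4)%R; last by rewrite invf_div.
by apply: (le_trans _ h); rewrite lerDr.
Qed.

Lemma expsq_partial t i : has_partial i (@expsq R n t)
  (fun x => - t * x ord0 i * expsq t x)%R.
Proof.
have := @has_partial_comp R n i (fun u => expR (- (t / 2) * u))%R
  (fun u => - (t / 2) * expR (- (t / 2) * u))%R _ _ (has_partial_sqnorm i).
move=> h; apply: (has_partial_eq (h _)) => x.
  by apply: is_derive_eq; rewrite /GRing.scale/= mulr1 mulrC.
by rewrite /expsq; field.
Qed.

(** The i-th derivative of x_i exp(- t |x|^2 / 2) is (1 - t x_i^2) exp(- t |x|^2 / 2), and its
    integral vanishes; summing over the n coordinates gives the factor n / t. *)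
Lemma integral_sqnorm_expsq t : (0 < t)%R ->
  \int[leb]_x (sqnorm x * expsq t x)%:E =
  (n%:R / t)%:E * \int[leb]_x (expsq t x)%:E.
Proof.
move=> t0.
have mE := measurable_expsq (t := cst t) (x := @id 'rV[R]_n)
  (measurable_cst _) (@measurable_id _ _ _).
have E0 x := ltW (@expsq_gt0 R n t x).
have iE := integrable_expsq t0.
have i2 : leb.-integrable setT (EFin \o (fun x => sqnorm x * expsq t x)%R).
  apply: (integrable_le (g := (fun x => 4 / t * expsq (t / 2) x)%R)).
  - by apply: measurable_funM => //; exact: (measurable_sqnorm (f := id)).
  - have t2 : (0 < t / 2)%R by rewrite divr_gt0.
    by have := integrableZl measurableT (4 / t)%R (integrable_expsq t2).
  - by move=> x; rewrite ger0_norm ?sqnorm_expsq_le// mulr_ge0// sqnorm_ge0.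
have ii i : leb.-integrable setT (EFin \o (fun x : 'rV[R]_n => x ord0 i ^+ 2 * expsq t x)%R).
  apply: (integrable_le _ i2).
  - apply: measurable_funM => //; apply: measurable_funX; exact: measurable_coor.
  - move=> x; rewrite ger0_norm; last by apply: mulr_ge0; [exact: sqr_ge0|exact: E0].
    by apply: ler_wpM2r; [exact: E0|exact: sqr_coord_le].
have ione i : leb.-integrable setT (EFin \o (fun x : 'rV[R]_n => x ord0 i * expsq t x)%R).
  apply: (integrable_le (g := (fun x => expsq t x + sqnorm x * expsq t x)%R)).
  - apply: measurable_funM => //; exact: measurable_coor.
  - by have := integrableD measurableT iE i2.
  - move=> x; rewrite normrM (ger0_norm (E0 x)) -[X in (X + _)%R]mul1r -mulrDl.
    apply: ler_wpM2r; first exact: E0.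
    have := sqr_coord_le x i; rewrite -[X in (X <= _)%R -> _]real_normK ?num_real//.
    have := normr_ge0 (x ord0 i); nra.
have key i : \int[leb]_x ((1 - t * x ord0 i ^+ 2) * expsq t x)%:E = 0.
  apply: (@integral_partial_eq0 R n i (fun x : 'rV[R]_n => x ord0 i * expsq t x)%R
    (fun x => (1 - t * x ord0 i ^+ 2) * expsq t x)%R).
  - refine (has_partial_eq (has_partialM (has_partial_coor i i) (expsq_partial t i)) _) => x.
    by rewrite eqxx mulr1n; ring.
  - have cE : line_continuous i (@expsq R n t) by exact: has_partial_line_continuous (expsq_partial t i).
    apply: line_continuousM => //.
    apply: (@line_continuous_comp R n i (fun u => 1 - t * u ^+ 2)%R) => [|x].
      exact: line_continuous_coor.
    apply: cvgB; first exact: cvg_cst.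
    by apply: cvgM; [exact: cvg_cst|exact: exprn_continuous].
  - exact: ione.
  - have := integrableB measurableT iE (integrableZl measurableT t (ii i)).
    apply: eq_integrable => // x _; rewrite /=; congr (_%:E); ring.
have key2 i : \int[leb]_x (x ord0 i ^+ 2 * expsq t x)%:E = t^-1%:E * \int[leb]_x (expsq t x)%:E.
  move: (key i).
  under eq_integral.
    move=> x _; rewrite (_ : _%:E = (expsq t x)%:E - t%:E * (x ord0 i ^+ 2 * expsq t x)%:E); last first.
      by rewrite -EFinM -EFinB; congr (_%:E); ring.
    over.
  rewrite integralB; [|by []|exact: iE|exact: (integrableZl measurableT t (ii i))].
  rewrite integralZl; [|by []|exact: ii].
  have f1 : \int[leb]_x (expsq t x)%:E \is a fin_num by exact: integrable_fin_num iE.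
  have f2 : \int[leb]_x (x ord0 i ^+ 2 * expsq t x)%:E \is a fin_num by exact: integrable_fin_num (ii i).
  rewrite -(fineK f1) -(fineK f2) -!EFinM -EFinB => -[h].
  by congr (_%:E); rewrite (_ : fine (\int[leb]_x (expsq t x)%:E) = t * fine (\int[leb]_x (x ord0 i ^+ 2 * expsq t x)%:E))%R;
    [rewrite mulKf// gt_eqF|apply/eqP; rewrite -subr_eq0 h].
transitivity (\sum_(i < n) \int[leb]_x (x ord0 i ^+ 2 * expsq t x)%:E).
  rewrite -(@integral_sum _ _ _ leb _ measurableT _ (fun i x => (x ord0 i ^+ 2 * expsq t x)%:E) ii).
  apply: eq_integral => x _; rewrite /sqnorm mulr_suml sumEFin//.
under eq_bigr do rewrite key2.
rewrite (_ : \int[leb]_x (expsq t x)%:E = (fine (\int[leb]_x (expsq t x)%:E))%:E); last first.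
  by rewrite fineK// (integrable_fin_num _ iE).
rewrite -EFinM sumEFin sumr_const card_ord -EFinM; congr (_%:E).
by rewrite -[LHS]mulr_natl mulrA.
Qed.

End gauss_moments.

(** Orthogonality in L^2 to the functions of |x|^2: the form of P f = 0 that mentions no surface
    integral, feeds directly into the Gaussian mean, and survives mollification. *)
Definition radial_orthogonal (R : realType) n (f : 'rV[R]_n -> R) :=
  forall phi : R -> R, measurable_fun setT phi ->
    sqint (lebesgue_rV n) (fun x => phi (sqnorm x)) ->
    (\int[lebesgue_rV n]_x (f x * phi (sqnorm x))%:E = 0)%E.

(** * Hardy inequality with powers of |x|^2 + eps *)

Section weighted_hardy.
Context {R : realType} {n : nat}.
Hypothesis n2 : (2 <= n)%N.
Notation leb := (@lebesgue_rV R n).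
Variables (f : 'rV[R]_n -> R) (df : 'I_n -> 'rV[R]_n -> R).
Hypothesis f2 : sqint leb f.
Hypothesis mdf : forall i, measurable_fun setT (df i).
Hypothesis fdf : forall i, has_partial i f (df i).
Hypothesis cdf : forall i, line_continuous i (df i).
Hypothesis f_orth : radial_orthogonal f.
Variables (eps : R) (eps0 : 0 < eps).

Let q (x : 'rV[R]_n) : R := sqnorm x + eps.
Let a : R := (n%:R - 2) / 2.
Let b : R := a / 2.
(** This is q^((n-2)/4), with gradient a x h / q and square q^a. The power a = n/2 - 1 is one less
    than the n/2 that the integration over y takes away, which leaves the weight 1 / q. *)
Let h (x : 'rV[R]_n) : R := expR (b * ln (q x)).
Let v (x : 'rV[R]_n) : R := f x * h x.
Let dv i (x : 'rV[R]_n) : R := h x * (df i x + a * x ord0 i / q x * f x).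
Let mf : measurable_fun setT f. Proof. by case: f2. Qed.

Let q0 x : 0 < q x. Proof. by rewrite ltr_wpDl// sqnorm_ge0. Qed.

Let a0 : 0 <= a. Proof. by rewrite divr_ge0// subr_ge0 ler_nat. Qed.

Let mq : measurable_fun setT q.
Proof. by apply: measurable_funD => //; exact: (measurable_sqnorm (f := id)). Qed.

Let mphi : measurable_fun setT (fun r : R => expR (b * ln (r + eps))).
Proof.
apply: (measurableT_comp (f := expR)) => //; apply: measurable_funM => //.
apply: (measurableT_comp (@measurable_ln R)).
exact: measurable_funD.
Qed.

Let mh : measurable_fun setT h.
Proof. exact: (measurableT_comp mphi (measurable_sqnorm (f := id) _)). Qed.

Let hh i : has_partial i h (fun x => a * x ord0 i / q x * h x).
Proof.
refine (has_partial_eq (@has_partial_comp R n i (fun r : R => expR (b * ln (r + eps)))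
  (fun r => b / (r + eps) * expR (b * ln (r + eps))) _ _ (has_partial_sqnorm i) _) _) => x.
  have qx := q0 x.
  have h1 : is_derive (sqnorm x) (1 : R) (fun r : R => r + eps) 1.
    by apply: is_derive_eq; rewrite addr0.
  have h2 : is_derive (sqnorm x + eps) (1 : R) (@ln R) (sqnorm x + eps)^-1.
    exact: is_derive1_ln.
  have h3 : is_derive (sqnorm x) (1 : R) (@ln R \o (fun r : R => r + eps)) ((sqnorm x + eps)^-1 * 1).
    exact: is_derive1_comp.
  have h4 : is_derive (sqnorm x) (1 : R) (fun r : R => b * ln (r + eps)) (b / (sqnorm x + eps)).
    by apply: (is_derive_eq (is_deriveZ b h3)); rewrite /GRing.scale/= mulr1.
  have h5 : is_derive (b * ln (sqnorm x + eps)) (1 : R) expR (expR (b * ln (sqnorm x + eps))).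
    exact: is_derive_expR.
  apply: (is_derive_eq (@is_derive1_comp _ expR (fun r : R => b * ln (r + eps)) _ _ _ h5 h4)).
  by rewrite mulrC.
rewrite /h /b -/(q x); field; by rewrite gt_eqF.
Qed.

Let hv i : has_partial i v (dv i).
Proof.
refine (has_partial_eq (has_partialM (fdf i) (hh i)) _) => x.
rewrite /dv; ring.
Qed.

Let mdv i : measurable_fun setT (dv i).
Proof.
apply: measurable_funM => //; apply: measurable_funD => //.
apply: measurable_funM => //; apply: measurable_funM.
  by apply: measurable_funM => //; exact: measurable_coor.
rewrite (_ : (fun x => (q x)^-1) = (fun x => q x `^ (-1))); last first.
  by apply/funext => x; rewrite powR_inv1// ltW.
exact: (measurableT_comp (measurable_powR _)).
Qed.

Let cq i : line_continuous i (fun x => (q x)^-1).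
Proof.
apply: (@line_continuous_comp R n i (fun r => r^-1)) => [|x].
  apply: line_continuousD; last exact: line_continuous_cst.
  exact: has_partial_line_continuous (has_partial_sqnorm i).
by apply: inv_continuous; rewrite gt_eqF.
Qed.

Let cdv i : line_continuous i (dv i).
Proof.
apply: line_continuousM; first exact: has_partial_line_continuous (hh i).
apply: line_continuousD; first exact: cdf.
apply: line_continuousM; last exact: has_partial_line_continuous (fdf i).
apply: line_continuousM; last exact: cq.
apply: line_continuousM; first exact: line_continuous_cst.
exact: line_continuous_coor.
Qed.

Let h2E x : h x ^+ 2 = expR (a * ln (q x)).
Proof. by rewrite /h -expRM_natr /b; congr expR; field. Qed.

(** The growth q^a is absorbed by half of the Gaussian: ln q <= l q - ln l for every l > 0, and l is
    chosen so that a l <= t / 4. The + 1 in its denominator allows a = 0. *)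
Let h2_bound (t : R) : 0 < t -> exists2 C : R, 0 <= C &
  forall x, h x ^+ 2 * expsq t x <= C * expsq (t / 2) x.
Proof.
move=> t0; pose l : R := t / (4 * (a + 1)).
have a1 : 0 < a + 1 by rewrite ltr_wpDl.
have l0 : 0 < l by rewrite divr_gt0// mulr_gt0.
exists (expR (a * (l * eps) - a * ln l)); first exact: expR_ge0.
move=> x; rewrite h2E /expsq -!expRD ler_expR.
have lnq : ln (q x) <= l * q x - ln l.
  have := ltW (ln_sublinear (mulr_gt0 l0 (q0 x))); rewrite lnM ?posrE//; lra.
have := ler_wpM2l a0 lnq.
have al : a * l <= t / 4.
  rewrite /l mulrA ler_pdivrMr ?mulr_gt0//.
  rewrite (_ : t / 4 * (4 * (a + 1)) = a * t + t); last by field.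
  by rewrite lerDl ltW.
have := ler_wpM2r (sqnorm_ge0 x) al.
rewrite /q; lra.
Qed.

(** f is orthogonal to h times the Gaussian, a square integrable function of |x|^2; this says that v
    has mean zero for the Gaussian of variance 1 / t. *)
Let radial_gap (t : R) : 0 < t ->
  (t%:E * \int[leb]_x (v x ^+ 2 * expsq t x)%:E <=
   \int[leb]_x ((\sum_i dv i x ^+ 2) * expsq t x)%:E)%E.
Proof.
move=> t0; have [C C0 hC] := h2_bound t0.
have mE := measurable_expsq (t := cst t) (x := @id 'rV[R]_n)
  (measurable_cst _) (@measurable_id _ _ _).
have E0 x := ltW (@expsq_gt0 R n t x).
have t2 : 0 < t / 2 by rewrite divr_gt0.
have mv : measurable_fun setT v by exact: measurable_funM.
apply: gauss_spectral_gap => //.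
- apply: (@le_lt_trans _ _ (\int[leb]_x (C * f x ^+ 2)%:E)%E).
    apply: ge0_eintegral_le.
    + by apply: measurable_funM => //; exact: measurable_funX.
    + by apply: measurable_funM => //; exact: measurable_funX.
    + by move=> x; apply: mulr_ge0 => //; exact: sqr_ge0.
    + move=> x; rewrite /v exprMn mulrAC -mulrA mulrC ler_wpM2r ?sqr_ge0//.
      rewrite mulrC; apply: (le_trans (hC x)); rewrite ler_piMr// expsq_le1//.
      exact: ltW.
  rewrite ge0_eintegralZ//; last by move=> x; exact: sqr_ge0.
    by rewrite lte_mul_pinfty//; case: f2.
  exact: measurable_funX.
- have := f_orth (phi := fun r => expR (b * ln (r + eps)) * expR (- (t / 2) * r)).
  move=> <-.
  + by apply: eq_integral => x _; rewrite /v /h /expsq mulrA.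
  + apply: measurable_funM => //; apply: (measurableT_comp (f := expR)) => //.
  split; first exact: (measurable_funM mh mE).
  apply: (@le_lt_trans _ _ (\int[leb]_x (C * expsq (t / 2) x)%:E)%E).
    apply: ge0_eintegral_le.
    + by apply: measurable_funX; exact: (measurable_funM mh mE).
    + by apply: measurable_funM => //; exact: measurable_expsq.
    + by move=> x; exact: sqr_ge0.
    + move=> x; apply: (le_trans _ (hC x)); rewrite -/(q x) -/(h x) -/(expsq t x).
      rewrite exprMn ler_wpM2l ?sqr_ge0// expr2 ler_piMr// expsq_le1//.
      exact: ltW.
  rewrite ge0_eintegralZ//; last by move=> x; exact/ltW/expsq_gt0.
    by rewrite integral_expsq// -EFinM ltry.
  exact: measurable_expsq.
Qed.

(** The factor exp(- eps |y|^2 / 2) completes |x|^2 |y|^2 / 2 to q(x) |y|^2 / 2, so that the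
    integral over y converges even at x = 0. *)
Let swapE (x y : 'rV[R]_n) : expsq (sqnorm y) x * expR (- (sqnorm y / 2) * eps) = expsq (q x) y.
Proof. by rewrite /expsq -expRD; congr expR; rewrite /q; field. Qed.

(* The Gaussian inequality at t = |y|^2 multiplied by exp(- eps t / 2) is
   integrated over y; since \int exp(- q |y|^2 / 2) dy is proportional to
   q^(-n/2), this produces the scale invariant weight. *)
Lemma weighted_hardy :
  (n%:R%:E * \int[leb]_x (f x ^+ 2 / (sqnorm x + eps) ^+ 2)%:E <=
   \int[leb]_x ((\sum_i (df i x + (n%:R - 2) / 2 * x ord0 i / (sqnorm x + eps) * f x) ^+ 2)
     / (sqnorm x + eps))%:E)%E.
Proof.
pose W := @gauss_const R n.
have W0 : 0 < W by exact: gauss_const_gt0.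
have IW x : (\int[leb]_y (expsq (q x) y)%:E = (W * expR (- (n%:R / 2 * ln (q x))))%:E)%E.
  exact: integral_expsq.
have mv2 : measurable_fun setT (fun x => v x ^+ 2) by apply: measurable_funX; exact: measurable_funM.
pose S x := \sum_i dv i x ^+ 2.
have S0 x : 0 <= S x by apply: sumr_ge0 => i _; exact: sqr_ge0.
have mS : measurable_fun setT S by apply: measurable_sum => i; exact: measurable_funX.
have msq := measurable_sqnorm (f := @id 'rV[R]_n) (@measurable_id _ _ _).
have mE d (T : measurableType d) (x y : T -> 'rV[R]_n) : measurable_fun setT x ->
    measurable_fun setT y -> measurable_fun setT (fun u => expsq (q (x u)) (y u)).
  by move=> mx my; apply: measurable_expsq => //; exact: (measurableT_comp mq).
have E0 (x y : 'rV[R]_n) : 0 <= expsq (q x) y by exact/ltW/expsq_gt0.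
have main : (\int[leb]_y \int[leb]_x (v x ^+ 2 * (sqnorm y * expsq (q x) y))%:E <=
    \int[leb]_y \int[leb]_x (S x * expsq (q x) y)%:E)%E.
  apply: ge0_le_integral => //.
  - move=> y _; apply: integral_ge0 => x _; rewrite lee_fin.
    by rewrite mulr_ge0 ?sqr_ge0// mulr_ge0// sqnorm_ge0.
  - apply: (@measurable_tonelli1 _ _ _ _ _ leb (fun y x => (v x ^+ 2 * (sqnorm y * expsq (q x) y))%:E)).
      apply/measurable_EFinP/measurable_funM; first exact: (measurableT_comp mv2).
      by apply: measurable_funM; [exact: (measurableT_comp msq)|exact: mE].
    by move=> y x; rewrite lee_fin mulr_ge0 ?sqr_ge0// mulr_ge0// sqnorm_ge0.
  - apply: (@measurable_tonelli1 _ _ _ _ _ leb (fun y x => (S x * expsq (q x) y)%:E)).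
      apply/measurable_EFinP/measurable_funM; first exact: (measurableT_comp mS).
      exact: mE.
    by move=> y x; rewrite lee_fin mulr_ge0.
  move=> y _.
  (* At y = 0 there is no Gaussian, but the left integrand vanishes there thanks to the factor
     |y|^2. *)
  have [y0|y0] := eqVneq (sqnorm y) 0.
    rewrite integral0_eq; last by move=> x _; rewrite y0 mul0r mulr0.
    by apply: integral_ge0 => x _; rewrite lee_fin mulr_ge0.
  have {}y0 : 0 < sqnorm y by rewrite lt_neqAle eq_sym y0 sqnorm_ge0.
  have k0 : 0 <= expR (- (sqnorm y / 2) * eps) by exact: expR_ge0.
  have mEy := measurable_expsq (t := cst (sqnorm y)) (x := @id 'rV[R]_n)
    (measurable_cst _) (@measurable_id _ _ _).
  have Ey0 x := ltW (@expsq_gt0 R n (sqnorm y) x).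
  have := lee_wpmul2l (k0 : (0 <= (expR (- (sqnorm y / 2) * eps))%:E)%E) (radial_gap y0).
  have m1 : measurable_fun setT (fun x => v x ^+ 2 * expsq (sqnorm y) x).
    exact: (measurable_funM mv2 mEy).
  have m2 : measurable_fun setT (fun x => S x * expsq (sqnorm y) x).
    exact: (measurable_funM mS mEy).
  have c1 : 0 <= expR (- (sqnorm y / 2) * eps) * sqnorm y by rewrite mulr_ge0// ltW.
  have p1 x : 0 <= v x ^+ 2 * expsq (sqnorm y) x by rewrite mulr_ge0 ?sqr_ge0.
  have p2 x : 0 <= S x * expsq (sqnorm y) x by rewrite mulr_ge0.
  rewrite muleA -EFinM -(ge0_eintegralZ _ m1 c1 p1) -(ge0_eintegralZ _ m2 k0 p2).
  have -> : (\int[leb]_x (expR (- (sqnorm y / 2) * eps) * sqnorm y *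
        (v x ^+ 2 * expsq (sqnorm y) x))%:E =
      \int[leb]_x (v x ^+ 2 * (sqnorm y * expsq (q x) y))%:E)%E.
    by apply: eq_integral => x _; rewrite -swapE; congr (_%:E); ring.
  have -> : (\int[leb]_x (expR (- (sqnorm y / 2) * eps) * (S x * expsq (sqnorm y) x))%:E =
      \int[leb]_x (S x * expsq (q x) y)%:E)%E.
    by apply: eq_integral => x _; rewrite -swapE; congr (_%:E); ring.
  by [].
move: main.
rewrite (@tonelli_swap _ _ _ _ _ leb leb (fun y x => (v x ^+ 2 * (sqnorm y * expsq (q x) y))%:E)); last 2 first.
- apply/measurable_EFinP/measurable_funM; first exact: (measurableT_comp mv2).
  by apply: measurable_funM; [exact: (measurableT_comp msq)|exact: mE].
- by move=> y x; rewrite lee_fin mulr_ge0 ?sqr_ge0// mulr_ge0// sqnorm_ge0.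
rewrite (@tonelli_swap _ _ _ _ _ leb leb (fun y x => (S x * expsq (q x) y)%:E)); last 2 first.
- apply/measurable_EFinP/measurable_funM; first exact: (measurableT_comp mS).
  exact: mE.
- by move=> y x; rewrite lee_fin mulr_ge0.
have alg x : h x ^+ 2 * expR (- (n%:R / 2 * ln (q x))) = (q x)^-1.
  rewrite h2E -expRD (_ : _ + _ = - ln (q x)); last by rewrite /a; field.
  by rewrite expRN lnK// posrE.
have miq : measurable_fun setT (fun x => (q x)^-1).
  rewrite (_ : (fun x => (q x)^-1) = (fun x => q x `^ (-1))); last first.
    by apply/funext => x; rewrite powR_inv1// ltW.
  exact: (measurableT_comp (measurable_powR _)).
have -> : (\int[leb]_x \int[leb]_y (v x ^+ 2 * (sqnorm y * expsq (q x) y))%:E =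
    (W * n%:R)%:E * \int[leb]_x (f x ^+ 2 / q x ^+ 2)%:E)%E.
  rewrite -ge0_eintegralZ.
  - apply: eq_integral => x _; rewrite ge0_eintegralZ; last 3 first.
    + by apply: measurable_funM => //; exact: mE.
    + exact: sqr_ge0.
    + by move=> y; rewrite mulr_ge0// sqnorm_ge0.
    (* The second moment brings n / q, and h^2 q^(-n/2) = 1 / q by [alg]: together the weight n /
       q^2. *)
    rewrite integral_sqnorm_expsq// IW -!EFinM; congr (_%:E).
    rewrite /v exprMn.
    transitivity (f x ^+ 2 * (n%:R / q x) * W * (h x ^+ 2 * expR (- (n%:R / 2 * ln (q x))))).
      ring.
    by rewrite alg; field; rewrite gt_eqF.
  - apply: measurable_funM; first exact: measurable_funX.
    by under eq_fun do rewrite -exprVn; exact: measurable_funX.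
  - by rewrite mulr_ge0// ltW.
  - by move=> x; rewrite divr_ge0 ?sqr_ge0.
have -> : (\int[leb]_x \int[leb]_y (S x * expsq (q x) y)%:E = W%:E *
   \int[leb]_x ((\sum_i (df i x + (n%:R - 2) / 2 * x ord0 i / (sqnorm x + eps) * f x) ^+ 2)
     / (sqnorm x + eps))%:E)%E.
  rewrite -ge0_eintegralZ.
  - apply: eq_integral => x _; rewrite ge0_eintegralZ//; last exact: mE.
    rewrite IW -EFinM; congr (_%:E); rewrite /S /dv.
    under eq_bigr do rewrite exprMn.
    rewrite -mulr_sumr -/(q x) -alg; ring.
  - apply: measurable_funM; last exact: miq.
    apply: measurable_sum => i; apply: measurable_funX; apply: measurable_funD => //.
    apply: measurable_funM => //; apply: measurable_funM; last exact: miq.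
    by apply: measurable_funM => //; exact: measurable_coor.
  - exact: ltW.
  - move=> x; rewrite divr_ge0//; last exact: ltW (q0 x).
    by apply: sumr_ge0 => i _; exact: sqr_ge0.
have Wi : (0 <= W^-1%:E)%E by rewrite lee_fin invr_ge0 ltW.
move=> /(lee_wpmul2l Wi).
by rewrite !muleA -!EFinM mulKf ?gt_eqF// mulVf ?gt_eqF// mul1e.
Qed.

End weighted_hardy.

(** * Regularized Rellich inequality *)

Section regular_rellich.
Context {R : realType} {n : nat}.
Hypothesis n3 : (3 <= n)%N.
Notation leb := (@lebesgue_rV R n).
Variables (f : 'rV[R]_n -> R) (df ddf : 'I_n -> 'rV[R]_n -> R).
Hypotheses (f2 : sqint leb f) (df2 : forall i, sqint leb (df i))
  (ddf2 : forall i, sqint leb (ddf i)).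
Hypotheses (fdf : forall i, has_partial i f (df i))
  (dfddf : forall i, has_partial i (df i) (ddf i))
  (cddf : forall i, line_continuous i (ddf i)).
Hypothesis f_orth : radial_orthogonal f.
Variables (eps : R) (eps0 : 0 < eps).

Let iq (x : 'rV[R]_n) : R := (sqnorm x + eps)^-1.
Let a : R := (n%:R - 2) / 2.
Let c : R := n%:R ^+ 2 / 4 - 1.

Let q0 (x : 'rV[R]_n) : 0 < sqnorm x + eps. Proof. by rewrite ltr_wpDl// sqnorm_ge0. Qed.
Let iq0 x : 0 < iq x. Proof. by rewrite invr_gt0. Qed.

Let a0 : 0 <= a. Proof. by rewrite divr_ge0// subr_ge0 ler_nat ltnW. Qed.
Let c0 : 0 < c.
Proof.
have : (3%:R : R) <= n%:R by rewrite ler_nat.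
rewrite /c => h; nra.
Qed.

Let miq : measurable_fun setT iq.
Proof.
rewrite (_ : iq = (fun x => (sqnorm x + eps) `^ (-1))); last first.
  by apply/funext => x; rewrite powR_inv1// ltW.
apply: (measurableT_comp (measurable_powR _)); apply: measurable_funD => //.
exact: (measurable_sqnorm (f := id)).
Qed.

Let iq_le x : iq x <= eps^-1.
Proof. by rewrite lef_pV2 ?posrE// lerDr sqnorm_ge0. Qed.

Let sq_iq x : sqnorm x * iq x <= 1.
Proof. by rewrite ler_pdivrMr// mul1r lerDl ltW. Qed.

Let coor_iq (x : 'rV[R]_n) i : `|x ord0 i * iq x| <= 1 + eps^-1.
Proof.
rewrite normrM (gtr0_norm (iq0 x)).
apply: (@le_trans _ _ ((1 + sqnorm x) * iq x)).
  rewrite ler_wpM2r ?(ltW (iq0 x))//.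
  have := sqr_coord_le x i; rewrite -[X in X <= _ -> _]real_normK ?num_real//.
  have := normr_ge0 (x ord0 i); nra.
by rewrite mulrDl mul1r addrC lerD.
Qed.

Let hiq i : has_partial i iq (fun x : 'rV[R]_n => - 2 * x ord0 i * iq x ^+ 2).
Proof.
refine (has_partial_eq (@has_partial_comp R n i (fun r : R => (r + eps)^-1)
  (fun r => - (r + eps) ^- 2) _ _ (has_partial_sqnorm i) _) _) => x.
  have h1 : is_derive (sqnorm x) (1 : R) (fun r : R => r + eps) 1.
    by apply: is_derive_eq; rewrite addr0.
  have qx : sqnorm x + eps != 0 by rewrite gt_eqF.
  apply: (is_derive_eq (@is_deriveV _ (fun r : R => r + eps) _ _ _ qx h1)).
  by rewrite /GRing.scale/= mulr1.
by rewrite /iq -exprVn; ring.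
Qed.

Let ciq i : line_continuous i iq.
Proof. exact: has_partial_line_continuous (hiq i). Qed.

Let fiq2 : sqint leb (fun x => iq x * f x).
Proof.
by apply: (sqint_boundedM (c := eps^-1)) => // x; rewrite gtr0_norm.
Qed.

Let xfiq2 i : sqint leb (fun x : 'rV[R]_n => x ord0 i * iq x * f x).
Proof.
apply: (sqint_boundedM (c := 1 + eps^-1)) => // .
by apply: measurable_funM => //; exact: measurable_coor.
Qed.

Let xdfiq2 i : sqint leb (fun x : 'rV[R]_n => x ord0 i * iq x * df i x).
Proof.
apply: (sqint_boundedM (c := 1 + eps^-1)) => // .
by apply: measurable_funM => //; exact: measurable_coor.
Qed.

Let xxfiq2 i : sqint leb (fun x : 'rV[R]_n => x ord0 i * iq x * (x ord0 i * iq x * f x)).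
Proof.
apply: (sqint_boundedM (c := 1 + eps^-1)) => // .
by apply: measurable_funM => //; exact: measurable_coor.
Qed.

Let integrableD_real (g k : 'rV[R]_n -> R) : leb.-integrable setT (EFin \o g) ->
  leb.-integrable setT (EFin \o k) ->
  leb.-integrable setT (EFin \o (fun x => g x + k x)).
Proof. by move=> ig ik; have := integrableD measurableT ig ik. Qed.

Let integrableZ_real (r : R) (g : 'rV[R]_n -> R) : leb.-integrable setT (EFin \o g) ->
  leb.-integrable setT (EFin \o (fun x => r * g x)).
Proof. by move=> ig; have := integrableZl measurableT r ig. Qed.

(** [dF1 i] is the i-th derivative of f (d_i f) / q, and [dF2 i] below that of x_i f^2 / q^2. The
    bracketing displays each term as a product of two square integrable functions. *)
Let dF1 i (x : 'rV[R]_n) : R := (df i x * (df i x * iq x) + ddf i x * (iq x * f x)) +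
  (- 2) * ((x ord0 i * iq x * df i x) * (iq x * f x)).

Let dF2 i (x : 'rV[R]_n) : R := ((iq x * f x) * (iq x * f x) +
  2 * ((x ord0 i * iq x * f x) * (iq x * df i x))) +
  (- 4) * ((x ord0 i * iq x * (x ord0 i * iq x * f x)) * (iq x * f x)).

Let dfiq2 i : sqint leb (fun x => iq x * df i x).
Proof.
by apply: (sqint_boundedM (c := eps^-1)) => // x; rewrite gtr0_norm.
Qed.

Let idF1 i : leb.-integrable setT (EFin \o dF1 i).
Proof.
apply: integrableD_real; last first.
  by apply: integrableZ_real; exact: integrable_sqintM.
apply: integrableD_real; last exact: integrable_sqintM.
have := integrable_sqintM (df2 i) (dfiq2 i); apply: eq_integrable => // x _ /=.
by rewrite (mulrC (iq x)).
Qed.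

Let idF2 i : leb.-integrable setT (EFin \o dF2 i).
Proof.
apply: integrableD_real; last first.
  by apply: integrableZ_real; exact: integrable_sqintM.
apply: integrableD_real; first exact: integrable_sqintM.
by apply: integrableZ_real; exact: integrable_sqintM.
Qed.

Let cf i : line_continuous i f. Proof. exact: has_partial_line_continuous (fdf i). Qed.
Let cdf i : line_continuous i (df i).
Proof. exact: has_partial_line_continuous (dfddf i). Qed.

Ltac lcont := match goal with
  | |- line_continuous _ (fun x => @?F x + @?G x) =>
      apply: (@line_continuousD _ _ _ F G); lcont
  | |- line_continuous _ (fun x => @?F x * @?G x) =>
      apply: (@line_continuousM _ _ _ F G); lcont
  | |- line_continuous _ (fun x => fun_of_matrix x ord0 _) => exact: line_continuous_coor
  | |- line_continuous _ (fun x => iq x) => exact: ciq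
  | |- line_continuous _ (fun x => f x) => exact: cf
  | |- line_continuous _ (fun x => df _ x) => exact: cdf
  | |- line_continuous _ (fun x => ddf _ x) => exact: cddf
  | |- line_continuous _ ?F => first [exact: line_continuous_cst | idtac F; fail 2]
  end.

Let int_dF1 i : (\int[leb]_x (dF1 i x)%:E = 0)%E.
Proof.
apply: (@integral_partial_eq0 R n i (fun x => (iq x * f x) * df i x)) => //.
- refine (has_partial_eq (has_partialM (has_partialM (hiq i) (fdf i)) (dfddf i)) _) => x.
  by rewrite /dF1; ring.
- by rewrite /dF1 /dF2; lcont.
- exact: (integrable_sqintM fiq2 (df2 i)).
Qed.

Let int_dF2 i : (\int[leb]_x (dF2 i x)%:E = 0)%E.
Proof.
apply: (@integral_partial_eq0 R n i (fun x : 'rV[R]_n => (x ord0 i * iq x * f x) * (iq x * f x))) => //.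
- refine (has_partial_eq (has_partialM (has_partialM (has_partialM (has_partial_coor i i) (hiq i)) (fdf i))
    (has_partialM (hiq i) (fdf i))) _) => x.
  by rewrite /dF2 eqxx mulr1n; ring.
- by rewrite /dF1 /dF2; lcont.
- exact: (integrable_sqintM (xfiq2 i) fiq2).
Qed.

Let Lap (x : 'rV[R]_n) : R := \sum_i ddf i x.

Let Lap2 : sqint leb Lap.
Proof.
rewrite /Lap; elim: (index_enum _) => [|i s IH].
  split; first by under eq_fun do rewrite big_nil; exact: measurable_cst.
  by rewrite integral0_eq// => x _; rewrite big_nil expr0n.
have := sqintD (ddf2 i) IH.
by under eq_fun do rewrite -(big_cons 0 +%R i s xpredT).
Qed.

(** The integrand H of the Hardy inequality is at most Bf + D, where D is a combination of
    derivatives, hence of integral 0, and Bf involves only (Delta f)^2 and f^2 / q^2. With A = \int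
    f^2 / q^2 and B = \int (Delta f)^2 this reads n A <= B / (2 c) + (n - c / 2) A, that is c^2 A <=
    B. *)
Theorem regular_rellich :
  ((c ^+ 2)%:E * \int[leb]_x (f x ^+ 2 / (sqnorm x + eps) ^+ 2)%:E <=
   \int[leb]_x (Lap x ^+ 2)%:E)%E.
Proof.
have hardy := @weighted_hardy R n (ltnW n3) f df f2 (fun i => (df2 i).1) fdf cdf f_orth eps eps0.
have mf2 : measurable_fun setT (fun x => (iq x * f x) ^+ 2).
  by apply: measurable_funX; case: fiq2.
have e1 : (\int[leb]_x (f x ^+ 2 / (sqnorm x + eps) ^+ 2)%:E =
           \int[leb]_x ((iq x * f x) ^+ 2)%:E)%E.
  by apply: eq_integral => x _; rewrite exprMn /iq exprVn mulrC.
rewrite e1; move: hardy; rewrite e1.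
pose A := fine (\int[leb]_x ((iq x * f x) ^+ 2)%:E)%E.
pose B := fine (\int[leb]_x (Lap x ^+ 2)%:E)%E.
have AE : (\int[leb]_x ((iq x * f x) ^+ 2)%:E = A%:E)%E.
  by rewrite fineK// (integrable_fin_num _ (integrable_sqr fiq2)).
have BE : (\int[leb]_x (Lap x ^+ 2)%:E = B%:E)%E.
  by rewrite fineK// (integrable_fin_num _ (integrable_sqr Lap2)).
(* The coefficient 1 + a makes the terms in x . grad f agree with those of H: - 2 + 2 (1 + a) = 2
   a. *)
pose D x := \sum_i dF1 i x + (1 + a) * \sum_i dF2 i x.
have isum (G : 'I_n -> 'rV[R]_n -> R) : (forall i, leb.-integrable setT (EFin \o G i)) ->
    (forall i, \int[leb]_x (G i x)%:E = 0)%E ->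
    leb.-integrable setT (EFin \o (fun x => \sum_i G i x)) /\
    (\int[leb]_x (\sum_i G i x)%:E = 0)%E.
  move=> iG G0; split.
    have := @integrable_sum _ _ _ leb _ measurableT _ (index_enum _) xpredT
      (fun i x => (G i x)%:E) (fun i _ => iG i).
    by apply: eq_integrable => // x _; rewrite /= sumEFin.
  transitivity (\int[leb]_x (\sum_i (G i x)%:E))%E.
    by apply: eq_integral => x _; rewrite sumEFin.
  rewrite (@integral_sum _ _ _ leb _ measurableT _ (fun i x => (G i x)%:E) iG).
  by rewrite big1.
have [i1 z1] := isum _ idF1 int_dF1; have [i2 z2] := isum _ idF2 int_dF2.
have iD : leb.-integrable setT (EFin \o D).
  by apply: integrableD_real => //; exact: integrableZ_real.
have D0 : (\int[leb]_x (D x)%:E = 0)%E.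
  under eq_integral do rewrite EFinD EFinM.
  rewrite integralD; [|by []|exact: i1|exact: (integrableZl measurableT (1 + a) i2)].
  by rewrite integralZl; [|by []|exact: i2]; rewrite z1 z2 mule0 adde0.
pose Bf x := c^-1 / 2 * Lap x ^+ 2 + (c / 2 + (n%:R - c)) * (iq x * f x) ^+ 2.
have iA := integrable_sqr fiq2; have iB := integrable_sqr Lap2.
have iBf : leb.-integrable setT (EFin \o Bf).
  by apply: integrableD_real; apply: integrableZ_real.
have IBf : (\int[leb]_x (Bf x)%:E = (c^-1 / 2 * B + (c / 2 + (n%:R - c)) * A)%:E)%E.
  transitivity (\int[leb]_x ((c^-1 / 2)%:E * (Lap x ^+ 2)%:E +
      (c / 2 + (n%:R - c))%:E * ((iq x * f x) ^+ 2)%:E))%E; first by [].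
  rewrite integralD; [|by []|exact: (integrableZl measurableT (c^-1 / 2) iB)|
    exact: (integrableZl measurableT (c / 2 + (n%:R - c)) iA)].
  rewrite integralZl; [|by []|exact: iB].
  by rewrite integralZl; [|by []|exact: iA]; rewrite AE BE -!EFinM.
pose H x := (\sum_i (df i x + a * x ord0 i / (sqnorm x + eps) * f x) ^+ 2) / (sqnorm x + eps).
rewrite AE BE.
have HB x : H x <= Bf x + D x.
  rewrite /H -/(iq x).
  have -> : \sum_i (df i x + a * x ord0 i / (sqnorm x + eps) * f x) ^+ 2 =
      \sum_i df i x ^+ 2 + 2 * a * iq x * f x * \sum_i (x ord0 i * df i x) +
      a ^+ 2 * iq x ^+ 2 * f x ^+ 2 * sqnorm x.
    rewrite /sqnorm 2!mulr_sumr -!big_split/=; apply: eq_bigr => i _.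
    by rewrite -/(sqnorm x) -/(iq x); ring.
  have DE : D x = iq x * \sum_i df i x ^+ 2 + f x * iq x * Lap x
      - 2 * iq x ^+ 2 * f x * \sum_i (x ord0 i * df i x)
      + (1 + a) * (n%:R * (iq x * f x) ^+ 2 + 2 * iq x ^+ 2 * f x * \sum_i (x ord0 i * df i x)
      - 4 * (iq x ^+ 3 * f x ^+ 2 * sqnorm x)).
    rewrite /D /Lap /sqnorm !mulr_sumr; congr (_ + _).
      rewrite -sumrN -!big_split/=; apply: eq_bigr => i _; rewrite /dF1; ring.
    rewrite -mulr_sumr; congr (_ * _).
    rewrite -[n in n%:R]card_ord mulr_natl -sumr_const -sumrN -!big_split/=.
    by apply: eq_bigr => i _; rewrite /dF2; ring.
  rewrite DE /Bf.
  have h1 := sq_iq x.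
  set S1 := \sum_i df i x ^+ 2; set X := \sum_i (x ord0 i * df i x).
  set L := Lap x; set u := iq x * f x.
  (* Balanced with the constant c, so that equality occurs for Delta f = - c f / q. *)
  have amgm : - (u * L) <= c^-1 / 2 * L ^+ 2 + c / 2 * u ^+ 2.
    rewrite -subr_ge0 (_ : _ - _ = (c^-1 / 2) * (L + c * u) ^+ 2).
      by rewrite mulr_ge0 ?sqr_ge0// divr_ge0// invr_ge0 ltW.
    by field; rewrite gt_eqF.
  have ca : n%:R - c = a ^+ 2 + 4 * (1 + a) - (1 + a) * n%:R.
    by rewrite /c /a; field.
  have k0 : 0 <= (a ^+ 2 + 4 * (1 + a)) * u ^+ 2.
    by rewrite mulr_ge0 ?sqr_ge0// addr_ge0 ?sqr_ge0// mulr_ge0// addr_ge0.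
  (* The term in |x|^2 / q is bounded by its limit for eps -> 0; its coefficient is nonnegative
     because a >= 0, and [ca] collects what remains into n - c. *)
  have := ler_wpM2l k0 h1; rewrite mulr1 => h2.
  rewrite -subr_ge0.
  rewrite (_ : _ - _ = (c^-1 / 2 * L ^+ 2 + c / 2 * u ^+ 2 - - (u * L)) +
    ((a ^+ 2 + 4 * (1 + a)) * u ^+ 2 - (a ^+ 2 + 4 * (1 + a)) * u ^+ 2 * (sqnorm x * iq x))).
    by rewrite addr_ge0// subr_ge0.
  by rewrite ca /u; ring.
have H0 x : 0 <= H x.
  rewrite divr_ge0 ?(ltW (q0 x))//; apply: sumr_ge0 => i _; exact: sqr_ge0.
have mH : measurable_fun setT H.
  apply: measurable_funM => //; apply: measurable_sum => i; apply: measurable_funX.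
  apply: measurable_funD; first by case: (df2 i).
  apply: measurable_funM; last by case: f2.
  apply: measurable_funM => //; apply: measurable_funM => //; exact: measurable_coor.
have iBD := integrableD_real iBf iD.
have iH : leb.-integrable setT (EFin \o H).
  by apply: (integrable_le mH iBD) => x; rewrite ger0_norm.
move=> hardy.
have : (\int[leb]_x (H x)%:E <= \int[leb]_x (Bf x + D x)%:E)%E.
  by apply: le_integral => // x _; rewrite lee_fin.
have -> : (\int[leb]_x (Bf x + D x)%:E = \int[leb]_x (Bf x)%:E)%E.
  under eq_integral do rewrite EFinD.
  by rewrite integralD; [|by []|exact: iBf|exact: iD]; rewrite D0 adde0.
move/(le_trans hardy); rewrite IBf -!EFinM !lee_fin => fin.
rewrite -subr_ge0.
have : 0 <= 2 * c * (c^-1 / 2 * B + (c / 2 + (n%:R - c)) * A - n%:R * A).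
  by rewrite mulr_ge0 ?mulr_ge0 ?(ltW c0)// subr_ge0.
by rewrite (_ : 2 * c * _ = B - c ^+ 2 * A)//; field; rewrite gt_eqF.
Qed.

End regular_rellich.

(** * Bump functions and mollification *)

Section continuity.
Context {R : realType} {n : nat}.
Implicit Types (f : 'rV[R]_n -> R) (i : 'I_n).

Lemma ball_rV (x : 'rV[R]_n) (e : R) (y : 'rV[R]_n) : 0 < e ->
  (forall i, `|x ord0 i - y ord0 i| < e) -> ball x e y.
Proof. by move=> e0 H; split => // i j; rewrite ord1; exact: H. Qed.

(* An open set is the union of the rational boxes that it contains. *)
Lemma open_measurable_rV (U : set 'rV[R]_n) : open U -> measurable U.
Proof.
move=> oU; pose box (p : 'rV[rat]_n * nat) : set 'rV[R]_n :=
  [set y | forall i, `|y ord0 i - ratr (p.1 ord0 i)| < (p.2.+1%:R)^-1 / 2].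
have mbox p : measurable (box p).
  rewrite (_ : box p = \bigcap_(i in [set: 'I_n])
     [set y : 'rV[R]_n | `|y ord0 i - ratr (p.1 ord0 i)| < (p.2.+1%:R)^-1 / 2]); last first.
    by apply/seteqP; split => y /= H i; [move=> _; exact: H|exact: H].
  apply: fin_bigcap_measurable => // i _.
  have mf : measurable_fun setT
    (fun y : 'rV[R]_n => `|y ord0 i - ratr (p.1 ord0 i)|).
    apply: measurableT_comp => //; apply: measurable_funB => //; exact: measurable_coor.
  rewrite (_ : mkset _ = setT `&` (fun y : 'rV[R]_n => `|y ord0 i - ratr (p.1 ord0 i)|) @^-1`
      `]-oo, (p.2.+1%:R)^-1 / 2[%classic); first exact: mf.
  by rewrite setTI; apply/seteqP; split => y /=; rewrite in_itv.
rewrite (_ : U = \bigcup_(p in [set: 'rV[rat]_n * nat])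
    (if `[< box p `<=` U >] then box p else set0)); last first.
  apply/seteqP; split => [x Ux|x [p _]]; last by case: asboolP => // + px; exact.
  have /nbhs_ballP[e /= e0 xeU] : nbhs x U by exact: open_nbhs_nbhs.
  have [k ke] : exists k, (k.+1%:R)^-1 < e.
    by have [k _ H] := near_infty_natSinv_lt (PosNum e0); exists k; exact: (H k (leqnn k)).
  have k0 : 0 < (k.+1%:R : R)^-1 / 2 by rewrite divr_gt0// invr_gt0.
  have /choice[q qP] : forall i, exists q, `|x ord0 i - ratr q| < (k.+1%:R)^-1 / 2.
    move=> i; have : x ord0 i - (k.+1%:R)^-1 / 2 < x ord0 i + (k.+1%:R)^-1 / 2.
      by rewrite ltrD2l (lt_trans _ k0)// oppr_lt0.
    move=> /rat_in_itvoo[q]; rewrite in_itv/= => /andP[q1 q2]; exists q.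
    by rewrite ltr_norml; move: (_ / 2) q1 q2 => a; lra.
  exists (\row_i q i, k) => //; rewrite asboolT /=.
    by move=> i /=; rewrite mxE.
  move=> y /= H; apply: xeU; apply: ball_rV => // i.
  apply: (lt_trans _ ke); move: (H i) (qP i); rewrite mxE => Hi qi.
  rewrite (_ : x ord0 i - y ord0 i = (x ord0 i - ratr (q i)) - (y ord0 i - ratr (q i))); last by ring.
  by apply: (le_lt_trans (ler_normB _ _)); move: (_^-1) Hi qi => a; lra.
apply: countable_bigcupT_measurable => [|p]; first exact: countableP.
by case: ifP.
Qed.

Lemma continuous_measurable_rV f : continuous f -> measurable_fun setT f.
Proof.
move=> cf; apply: (measurability _ (RGenOpens.measurableE R)) => _ [_ [a [b ->]] <-].
rewrite setTI; apply: open_measurable_rV.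
by apply: open_comp => // x _; exact: cf.
Qed.

Lemma partial_increment i f df (M : R) x (t : R) : has_partial i f df ->
  (forall y, `|df y| <= M) -> `|f (t *: delta_mx ord0 i + x) - f x| <= M * `|t|.
Proof.
move=> fd dfM.
have drv (s : R) : is_derive s 1 (fun t : R => f (t *: delta_mx ord0 i + x)) (df (s *: delta_mx ord0 i + x)).
  exact: fd.
have cont (a b : R) : {within `[a, b], continuous (fun t : R => f (t *: delta_mx ord0 i + x))}.
  by apply: derivable_within_continuous => s _; have [] := drv s.
have f0 : f (0 *: delta_mx ord0 i + x) = f x by rewrite scale0r add0r.
have [t0|t0] := leP 0 t.
  have [c _] := MVT_segment t0 (fun s _ => drv s) (cont _ _).
  by rewrite f0 => ->; rewrite normrM subr0 ler_wpM2r.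
have [c _] := MVT_segment (ltW t0) (fun s _ => drv s) (cont _ _).
rewrite f0 => fe; rewrite distrC fe normrM sub0r normrN ler_wpM2r//.
Qed.

(** Change one coordinate at a time, with the mean value theorem on each coordinate line. Joint
    continuity of functions known only along lines comes from this bound. *)
Lemma bounded_partial_lipschitz f (df : 'I_n -> 'rV[R]_n -> R) (M : R) x h :
  (forall i, has_partial i f (df i)) -> (forall i y, `|df i y| <= M) ->
  `|f (h + x) - f x| <= M * \sum_i `|h ord0 i|.
Proof.
move=> fd dfM; rewrite [h in f (h + x)]row_sum_delta.
elim/big_rec2: _ => [|i a v _ IH]; first by rewrite add0r subrr normr0 mulr0.
rewrite mulrDr -addrA.
have := partial_increment (v + x) (h ord0 i) (fd i) (dfM i).
set z := f (v + x) in IH *; set w := f (_ + _) => Hw.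
rewrite (_ : w - f x = (w - z) + (z - f x)); last by ring.
by apply: (le_trans (ler_normD _ _)); exact: lerD.
Qed.

Lemma bounded_partial_continuous f (df : 'I_n -> 'rV[R]_n -> R) (M : R) :
  (forall i, has_partial i f (df i)) -> (forall i y, `|df i y| <= M) -> continuous f.
Proof.
move=> fd dfM x; apply: (proj2 (@cvgrPdist_lt R R^o 'rV[R]_n (nbhs x) (nbhs_filter x) f (f x))) => e e0.
have M1 : 0 < `|M| * n%:R + 1 by rewrite ltr_wpDl// mulr_ge0.
apply/nbhs_ballP; exists (e / (`|M| * n%:R + 1)) => /=; first by rewrite divr_gt0.
move=> y [_ xy]; rewrite distrC.
have := bounded_partial_lipschitz x (y - x) fd dfM; rewrite subrK => H.
apply: (le_lt_trans H).
apply: (@le_lt_trans _ _ (`|M| * n%:R * (e / (`|M| * n%:R + 1)))); last first.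
  rewrite mulrA ltr_pdivrMr// mulrC ltr_pM2l//; lra.
apply: (@le_trans _ _ (`|M| * \sum_(i < n) `|(y - x) ord0 i|)).
  by rewrite ler_wpM2r ?ler_norm// sumr_ge0.
rewrite -mulrA ler_wpM2l// mulr_natl -[X in _ *+ X]card_ord -sumr_const.
apply: ler_sum => i _; have := xy ord0 i; rewrite /ball/= => /ltW.
by rewrite !mxE distrC.
Qed.


Lemma line_quotient i f x (t : R) :
  (fun h : R => h^-1 *: (((fun s : R => f (s *: delta_mx ord0 i + x)) \o shift t) (h *: (1 : R))
     - f (t *: delta_mx ord0 i + x))) =
  (fun h : R => h^-1 *: ((f \o shift (t *: delta_mx ord0 i + x)) (h *: delta_mx ord0 i)
     - f (t *: delta_mx ord0 i + x))).
Proof. by apply/funext => h /=; rewrite [_ *: 1]mulr1 scalerDl addrA. Qed.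

Lemma has_partialP i f df : has_partial i f df <->
  forall x, derivable f x (delta_mx ord0 i) /\ partial i f x = df x.
Proof.
split=> [fd x|fd x t].
  have [] := fd x 0; rewrite /derivable /derive line_quotient scale0r add0r.
  by [].
have [df1 df2] := fd (t *: delta_mx ord0 i + x); split.
  by rewrite /derivable line_quotient; exact: df1.
by rewrite /derive line_quotient -df2.
Qed.

Lemma smooth_has_partial f i s : smooth f ->
  has_partial i (iter_partial s f) (iter_partial (i :: s) f).
Proof. by move=> sf; apply/has_partialP => x; split => //; exact: (sf s).2. Qed.

Lemma partialE i f df : has_partial i f df -> partial i f = df.
Proof. by move=> /has_partialP fd; apply/funext => x; exact: (fd x).2. Qed.

(** A coinductive criterion: stability of a class of continuous functions under a single partial
    derivative replaces an induction over iterated derivatives in every application. *)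
Lemma smooth_class (C : ('rV[R]_n -> R) -> Prop) :
  (forall f, C f -> continuous f) ->
  (forall f i, C f -> exists2 df, C df & has_partial i f df) ->
  forall f, C f -> smooth f.
Proof.
move=> Cc Cd f Cf.
have Cs s : C (iter_partial s f).
  by elim: s => //= i s IH; have [df Cdf /partialE ->] := Cd _ i IH.
move=> s; split=> [|i x]; first exact: Cc.
have [df _ /has_partialP fd] := Cd _ i (Cs s); exact: (fd x).1.
Qed.

End continuity.

(** * Flat functions and bumps *)

Section flat_function.
Context {R : realType}.
Implicit Types (p : {poly R}) (s : R).

(* p(1/s) exp(-1/s): these functions are closed under differentiation. *)
Definition flat p s : R := if s <= 0 then 0 else p.[s^-1] * expR (- s^-1).

(** In the variable y = 1/s one has d/ds = - y^2 d/dy, which sends p(y) exp(-y) to y^2 (p - p')(y)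
    exp(-y). *)
Definition flat_deriv p : {poly R} := 'X ^+ 2 * (p - p^`()).

(** The extra power y^m carries the induction on p: the product of p by the variable, at m, is p at
    m + 1, and a constant c contributes at most |c| m!. *)
Lemma poly_expR_bound p m : exists2 C : R, 0 <= C &
  forall y, 0 < y -> `|p.[y]| * y ^+ m * expR (- y) <= C.
Proof.
elim/poly_ind: p m => [|p c IH] m.
  by exists 0 => // y _; rewrite horner0 normr0 !mul0r.
have [C C0 HC] := IH m.+1.
exists (C + `|c| * m`!%:R) => [|y y0]; first by rewrite addr_ge0// mulr_ge0.
have e0 : 0 <= y ^+ m * expR (- y) by rewrite mulr_ge0 ?expR_ge0// exprn_ge0// ltW.
rewrite -mulrA hornerMXaddC.
apply: (@le_trans _ _ ((`|p.[y]| * y + `|c|) * (y ^+ m * expR (- y)))).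
  rewrite ler_wpM2r//; apply: (le_trans (ler_normD _ _)).
  by rewrite normrM (gtr0_norm y0).
rewrite mulrDl; apply: lerD.
  by apply: le_trans (HC _ y0); rewrite exprS !mulrA.
rewrite ler_wpM2l// expRN ler_pdivrMr ?expR_gt0//.
case: m {IH C C0 HC e0} => [|m].
  by rewrite expr0 fact0 mul1r -(expR0) ler_expR ltW.
have /= := expR_ge1Dxn m (ltW y0).
have f0 : 0 < (m.+1)`!%:R :> R by rewrite ltr0n fact_gt0.
move=> /(le_trans _) H; rewrite mulrC -ler_pdivrMr//; apply: H.
by rewrite lerDr.
Qed.

(** Flatness at 0 to every order m: the case m = 0 gives boundedness and m = 2 the vanishing
    derivative at 0. *)
Lemma flat_bound p m : exists2 C : R, 0 <= C & forall s, `|flat p s| <= C * `|s| ^+ m.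
Proof.
have [C C0 HC] := poly_expR_bound p m; exists C => // s.
rewrite /flat; have [s0|s0] := leP s 0; first by rewrite normr0 mulr_ge0// exprn_ge0.
have := HC s^-1; rewrite invr_gt0 => /(_ s0).
rewrite normrM (gtr0_norm (expR_gt0 _)) (gtr0_norm s0) => H.
rewrite -ler_pdivrMr ?exprn_gt0//.
by apply: le_trans H; rewrite exprVn mulrAC.
Qed.

Lemma flat_bounded p : exists2 C : R, 0 <= C & forall s, `|flat p s| <= C.
Proof. by have [C C0 HC] := flat_bound p 0; exists C => // s; rewrite -[C]mulr1. Qed.

Lemma is_derive_flat p s : is_derive s 1 (flat p) (flat (flat_deriv p) s).
Proof.
have [s0|s0|->] := ltgtP s 0.
- rewrite [in flat (flat_deriv _) _]/flat (ltW s0)/=.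
  apply: (@near_eq_is_derive _ _ _ (fun=> 0)).
  by near=> t; rewrite /flat ifT//; apply/ltW; near: t; exact: lt_nbhsl.
- rewrite [in flat (flat_deriv _) _]/flat leNgt s0/=.
  have iV : is_derive s 1 (fun t : R => t^-1) (- s ^- 2).
    have := @is_deriveV R id s 1 1 _ (is_derive_id s 1).
    by rewrite gt_eqF// => /(_ isT); rewrite [_ *: 1]mulr1.
  have iN : is_derive s 1 (fun t : R => - t^-1) (s ^- 2).
    by apply: is_derive_eq; rewrite opprK.
  have ip := is_derive1_comp (is_derive_poly p s^-1) iV.
  have ie := @is_derive1_comp R expR (fun t : R => - t^-1) s _ _ (is_derive_expR (- s^-1)) iN.
  have ipe : is_derive s 1 (fun t => p.[t^-1] * expR (- t^-1))
      ((flat_deriv p).[s^-1] * expR (- s^-1)).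
    apply: (is_derive_eq (is_deriveM ip ie)).
    rewrite /flat_deriv !hornerE /GRing.scale/= exprVn; ring.
  apply: (near_eq_is_derive _ ipe).
  by near=> t; rewrite /flat ifF//; apply/negbTE; rewrite -ltNge; near: t; exact: lt_nbhsr.
- rewrite [in flat (flat_deriv _) _]/flat lexx/=.
  have [C C0 HC] := flat_bound p 2.
  have H : (h^-1 *: ((flat p \o shift 0) (h *: (1 : R)) - flat p 0)) @[h --> (0:R)^'] --> (0 : R).
    apply: (@cvg_to_0_linear _ _ C 1) => // h /andP[h0 _] /=.
    rewrite [h *: 1]mulr1 addr0 [flat p 0]/flat lexx subr0 normrM normfV mulrC.
    by rewrite ler_pdivrMr//; apply: le_trans (HC h) _; rewrite expr2 mulrA.
  by split; [apply/cvg_ex; exists 0|exact: cvg_lim H].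
Unshelve. all: by end_near. Qed.

Lemma continuous_flat p : continuous (flat p).
Proof.
move=> s; apply: differentiable_continuous; apply/derivable1_diffP.
by have [] := is_derive_flat p s.
Qed.

Lemma flat_ge0 s : 0 <= flat 1 s.
Proof. by rewrite /flat; case: (leP s 0) => // _; rewrite hornerC mul1r expR_ge0. Qed.

Lemma flatZ (c : R) p s : flat (c *: p) s = c * flat p s.
Proof. by rewrite /flat; case: (leP s 0) => _; rewrite ?mulr0// hornerZ mulrA. Qed.

End flat_function.

Section bump.
Context {R : realType} {n : nat} (r : R).

(** A class containing the radial mollifier, stable under partial derivatives and supported in |x|^2
    <= r. The constructors are what the chain and product rules produce, so each property is proved
    by induction on the construction. *)
Inductive bump : ('rV[R]_n -> R) -> Prop :=
| bump_flat p : bump (fun x => flat p (r - sqnorm x))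
| bump_coor j N : bump N -> bump (fun x => x ord0 j * N x)
| bumpD N N' : bump N -> bump N' -> bump (fun x => N x + N' x)
| bumpZ (c : R) N : bump N -> bump (fun x => c * N x).

Lemma bump_eq0 N x : bump N -> r <= sqnorm x -> N x = 0.
Proof.
move=> bN rx; elim: bN => [p|j N' _ ->|N1 N2 _ -> _ ->|c N' _ ->]; rewrite ?mulr0 ?addr0//.
by rewrite /flat subr_le0 rx.
Qed.

Lemma bump_bounded N : bump N -> exists2 M : R, 0 <= M & forall x, `|N x| <= M.
Proof.
elim=> [p|j N' bN [M M0 HM]|N1 N2 _ [M1 M10 HM1] _ [M2 M20 HM2]|c N' _ [M M0 HM]].
- by have [C C0 HC] := flat_bounded p; exists C => // x; exact: HC.
- exists ((1 + `|r|) * M) => [|x]; first by rewrite mulr_ge0// addr_ge0.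
  have [rx|xr] := leP r (sqnorm x).
    by rewrite (bump_eq0 bN rx) mulr0 normr0 mulr_ge0// addr_ge0.
  rewrite normrM ler_pM//.
  apply: (@le_trans _ _ (1 + sqnorm x)); last by rewrite lerD2l (le_trans (ltW xr))// ler_norm.
  apply: (@le_trans _ _ (1 + `|x ord0 j| ^+ 2)).
    have := sqr_ge0 (`|x ord0 j| - 2^-1); rewrite !expr2; lra.
  by rewrite lerD2l real_normK ?num_real// sqr_coord_le.
- exists (M1 + M2) => [|x]; first exact: addr_ge0.
  by apply: (le_trans (ler_normD _ _)); exact: lerD.
- exists (`|c| * M) => [|x]; first exact: mulr_ge0.
  by rewrite normrM ler_wpM2l.
Qed.

Lemma measurable_bump N : bump N -> measurable_fun setT N.
Proof.
elim=> [p|j N' _ mN|N1 N2 _ m1 _ m2|c N' _ mN].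
- apply: (measurableT_comp (continuous_measurable_fun (@continuous_flat R p))).
  by apply: measurable_funB => //; exact: (measurable_sqnorm (f := id)).
- by apply: measurable_funM => //; exact: measurable_coor.
- exact: measurable_funD.
- exact: measurable_funM.
Qed.

Lemma bump_has_partial N i : bump N -> exists2 dN, bump dN & has_partial i N dN.
Proof.
elim=> [p|j N' bN [dN bdN pN]|N1 N2 _ [d1 b1 p1] _ [d2 b2 p2]|c N' _ [dN bdN pN]].
- exists (fun x : 'rV[R]_n => x ord0 i * flat ((-2) *: flat_deriv p) (r - sqnorm x)).
    exact/bump_coor/bump_flat.
  have ps : has_partial i (fun x : 'rV[R]_n => r - sqnorm x) (fun x => -1 * (2 * x ord0 i)).
    have := has_partialD (@has_partial_cst R n i r)
      (has_partialM (@has_partial_cst R n i (-1)) (@has_partial_sqnorm R n i)).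
    rewrite (_ : (fun _ => r + _) = fun x => r - sqnorm x); last first.
      by apply/funext => x; rewrite mulN1r.
    by move=> H; refine (has_partial_eq H _) => x; ring.
  have pf := @has_partial_comp R n i (flat p) (flat (flat_deriv p)) _ _ ps
    (fun x => is_derive_flat p _).
  by refine (has_partial_eq pf _) => x; rewrite flatZ; ring.
- exists (fun x : 'rV[R]_n => (j == i)%:R * N' x + x ord0 j * dN x).
    by apply: bumpD; [exact: bumpZ|exact: bump_coor].
  by refine (has_partial_eq (has_partialM (@has_partial_coor R n i j) pN) _) => x; ring.
- by exists (fun x => d1 x + d2 x); [exact: bumpD|exact: has_partialD].
- exists (fun x => c * dN x); first exact: bumpZ.
  refine (has_partial_eq (has_partialM (@has_partial_cst R n i c) pN) _) => x.
  by ring.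
Qed.

End bump.

Lemma sqnormD_le (R : realType) n (x y : 'rV[R]_n) :
  sqnorm (x + y) <= 2 * sqnorm x + 2 * sqnorm y.
Proof.
have h0 := sqnorm_ge0 (x - y).
have := sqnormB x (- y); rewrite opprK sqnormN dotNr => ->.
by move: h0; rewrite sqnormB; lra.
Qed.

(** * Superpositions of translated bumps *)

Section superposition.
Context {R : realType} {n : nat} d (T : measurableType d).
Variables (mu : {measure set T -> \bar R}) (Z : T -> 'rV[R]_n) (w : T -> R).
Hypothesis mZ : measurable_fun setT Z.
Hypothesis mw : measurable_fun setT w.

(** Uniformity in the center y makes superpositions of bumps bounded, and so continuous through the
    boundedness of their partial derivatives. *)
Definition uniformly_locally_integrable := forall r : R, exists B : R, forall y,
  (\int[mu]_t (`|w t| * \1_(eball r) (y - Z t)%R)%:E <= B%:E)%E.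

Hypothesis wB : uniformly_locally_integrable.

(* The convolution of N with the image measure of w mu under Z: the usual
   convolution for Z = id, a spherical mean of translates of N when Z maps to a
   sphere. *)
Definition superposition (N : 'rV[R]_n -> R) (y : 'rV[R]_n) : R :=
  \int[mu]_t (N (y - Z t) * w t).

Let measurable_shift (y : 'rV[R]_n) : measurable_fun setT (fun t => y - Z t).
Proof. by apply: measurable_rVB => //; exact: measurable_cst. Qed.

Let measurable_ball (r : R) (y : 'rV[R]_n) :
  measurable_fun setT (fun t => `|w t| * \1_(eball r) (y - Z t)).
Proof.
apply: measurable_funM; first exact: measurableT_comp.
have mi : measurable_fun setT (\1_(eball r) : 'rV[R]_n -> R).
  by apply: measurable_indic; exact: measurable_eball.
exact: (measurableT_comp mi (measurable_shift y)).
Qed.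

Let integrable_ball (r : R) (y : 'rV[R]_n) :
  mu.-integrable setT (fun t => (`|w t| * \1_(eball r) (y - Z t))%:E).
Proof.
have [B wBr] := wB r; apply/integrableP; split.
  by apply/measurable_EFinP; exact: measurable_ball.
apply: (@le_lt_trans _ _ B%:E); last exact: ltry.
apply: le_trans (wBr y); apply: ge0_le_integral => //.
- by apply: measurableT_comp => //; apply/measurable_EFinP; exact: measurable_ball.
- by apply/measurable_EFinP; exact: measurable_ball.
- by move=> t _; rewrite gee0_abs// lee_fin mulr_ge0.
Qed.

Let integrand_le r N M (y : 'rV[R]_n) t : bump r N -> (forall x, `|N x| <= M) ->
  `|N (y - Z t) * w t| <= M * (`|w t| * \1_(eball r) (y - Z t)).
Proof.
move=> bN NM; have M0 : 0 <= M by apply: le_trans (NM 0).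
rewrite indicE; have [yr|yr] := leP (sqnorm (y - Z t)) r.
  by rewrite mem_set// mulr1 normrM ler_wpM2r.
by rewrite (bump_eq0 bN (ltW yr)) mul0r normr0 !mulr_ge0.
Qed.

Lemma measurable_superposition_integrand r N (y : 'rV[R]_n) : bump r N ->
  measurable_fun setT (fun t => N (y - Z t) * w t).
Proof.
move=> bN; apply: measurable_funM => //.
exact: (measurableT_comp (measurable_bump bN) (measurable_shift y)).
Qed.

Lemma integrable_superposition r N (y : 'rV[R]_n) : bump r N ->
  mu.-integrable setT (fun t => (N (y - Z t) * w t)%:E).
Proof.
move=> bN; have [M M0 NM] := bump_bounded bN.
have := integrableZl measurableT M (integrable_ball r y).
apply: le_integrable => //.
  by apply/measurable_EFinP; exact: measurable_superposition_integrand bN.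
move=> t _; rewrite /= lee_fin.
apply: (le_trans (integrand_le y t bN NM)); exact: ler_norm.
Qed.

Lemma superposition_bounded r N : bump r N -> exists M : R, forall y, `|superposition N y| <= M.
Proof.
move=> bN; have [M M0 NM] := bump_bounded bN; have [B wBr] := wB r.
exists (M * B) => y.
have iN := integrable_superposition y bN.
rewrite -lee_fin; apply: (@le_trans _ _ (\int[mu]_t `|(N (y - Z t) * w t)%:E|)%E).
  rewrite /superposition /Rintegral -abse_EFin fineK ?integrable_fin_num//.
  by apply: le_abse_integral => //; exact: (measurable_int mu).
apply: (@le_trans _ _ (\int[mu]_t (M * (`|w t| * \1_(eball r) (y - Z t)%R))%:E)%E).
  apply: ge0_le_integral => //.
  - by apply: measurableT_comp => //; exact: (measurable_int mu iN).
  - by apply/measurable_EFinP; apply: measurable_funM => //; exact: measurable_ball.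
  - by move=> t _; rewrite abse_EFin lee_fin; exact: integrand_le.
rewrite ge0_eintegralZ//.
by rewrite EFinM; apply: lee_wpmul2l.
Qed.

Lemma superposition_has_partial r N dN i : bump r N -> bump r dN ->
  has_partial i N dN -> has_partial i (superposition N) (superposition dN).
Proof.
move=> bN bdN NdN x t.
have [M M0 dNM] := bump_bounded bdN.
pose f (s : R) u := N (s *: delta_mx ord0 i + x - Z u) * w u.
have df (s : R) u : is_derive s 1 (f ^~ u) (dN (s *: delta_mx ord0 i + x - Z u) * w u).
  have := NdN (x - Z u) s; rewrite addrA => H.
  rewrite /f (_ : (fun s : R => _) = (fun s => N (s *: delta_mx ord0 i + (x - Z u)) * w u)).
    by apply: is_derive_eq; rewrite /GRing.scale/= mulr0 add0r mulrC.
  by apply/funext => s'; rewrite addrA.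
have E1 s u : partial1of2 f s u = dN (s *: delta_mx ord0 i + x - Z u) * w u.
  by rewrite partial1of2E; have [_ ->] := df s u.
(* If |s - t| <= 1 and |s e_i + x - Z u|^2 <= r, then |t e_i + x - Z u|^2 <= 2 r + 2; one fixed ball
   thus dominates the derivatives for all s near t. *)
pose rr := 2 * r + 2.
pose G u := M * (`|w u| * \1_(eball rr) (t *: delta_mx ord0 i + x - Z u)).
have Itt : `]t - 1, t + 1[%classic t by rewrite /= in_itv/=; lra.
have intf s : `]t - 1, t + 1[%classic s -> mu.-integrable setT (EFin \o f s).
  by move=> _; exact: (integrable_superposition _ bN).
have derf s u : `]t - 1, t + 1[%classic s -> setT u -> derivable (f ^~ u) s 1.
  by move=> _ _; have [] := df s u.
have G0 u : 0 <= G u by rewrite !mulr_ge0.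
have intG : mu.-integrable setT (EFin \o G).
  have := integrableZl measurableT M (integrable_ball rr (t *: delta_mx ord0 i + x)).
  by apply: eq_integrable => //= u _; rewrite EFinM.
have Gub s u : `]t - 1, t + 1[%classic s -> setT u -> `|partial1of2 f s u| <= G u.
  rewrite /= in_itv/= => /andP[s1 s2] _; rewrite E1 normrM /G [X in M * X]mulrC mulrA ler_wpM2r// indicE.
  have [sr|sr] := leP r (sqnorm (s *: delta_mx ord0 i + x - Z u)).
    by rewrite (bump_eq0 bdN sr) normr0 mulr_ge0.
  rewrite mem_set ?mulr1//= /eball/= /rr.
  rewrite (_ : t *: delta_mx ord0 i + x - Z u =
    (s *: delta_mx ord0 i + x - Z u) + (t - s) *: delta_mx ord0 i); last first.
    by apply/rowP => j; rewrite !mxE; ring.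
  apply: (le_trans (sqnormD_le _ _)); apply: lerD; first by rewrite ler_pM2l// ltW.
  rewrite sqnormZ /sqnorm (bigD1 i)//= big1 ?addr0; last first.
    by move=> j ji; rewrite mxE eqxx (negbTE ji) expr0n.
  rewrite mxE !eqxx expr1n mulr1 -[leRHS]mulr1 ler_pM2l//.
  by rewrite -real_normK ?num_real// exprn_ile1// ler_norml; lra.
have := @derivable_under_integral R _ _ mu f setT measurableT t _ _ Itt intf derf G G0 intG Gub.
have := @differentiation_under_integral R _ _ mu f setT measurableT t _ _ Itt intf derf G G0 intG Gub.
rewrite derive1E => D1 D2; split => //.
rewrite [LHS]D1; apply: eq_Rintegral => u _; exact: E1.
Qed.

Lemma superposition_continuous r N : bump r N -> continuous (superposition N).
Proof.
move=> bN; pose dN i := sval (cid2 (bump_has_partial i bN)).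
have dP i : bump r (dN i) /\ has_partial i N (dN i).
  by rewrite /dN; case: cid2.
have /choice[M MP] : forall i, exists M, forall y, `|superposition (dN i) y| <= M.
  by move=> i; exact: superposition_bounded (dP i).1.
apply: (@bounded_partial_continuous _ _ _ (fun i => superposition (dN i)) (\sum_i `|M i|)).
  by move=> i; exact: (superposition_has_partial bN (dP i).1 (dP i).2).
move=> i y; apply: (le_trans (MP i y)); apply: (le_trans (ler_norm _)).
by rewrite (bigD1 i)//= lerDl sumr_ge0.
Qed.

Lemma superposition_smooth r N : bump r N -> smooth (superposition N).
Proof.
move=> bN; apply: (@smooth_class _ _ (fun f => exists2 N, bump r N & f = superposition N)).
- by move=> _ [N' bN' ->]; exact: superposition_continuous bN'.
- move=> _ i [N' bN' ->]; have [dN bdN pN] := bump_has_partial i bN'.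
  exists (superposition dN); [by exists dN|].
  exact: (superposition_has_partial bN' bdN pN).
- by exists N.
Qed.

End superposition.

(** * Convolution and mollifiers on L^2 *)

Section weighted_cauchy_schwarz.
Context d (T : measurableType d) {R : realType} (mu : {measure set T -> \bar R}).

(** Cauchy-Schwarz for a weight |N| of mass at most m, shared by convolutions and spherical means.
    With b = \int N F and q = \int |N| F^2, integrating |N| (F - sg(N) a)^2 >= 0 gives 2 a b <= q +
    a^2 m, and a = b / m is the best choice. *)
Lemma sqr_integral_le (N F : T -> R) (m : R) :
  measurable_fun setT N -> measurable_fun setT F -> 0 < m ->
  (\int[mu]_t (`|N t|)%:E <= m%:E)%E ->
  (((\int[mu]_t (N t * F t))%R ^+ 2)%:E <=
   m%:E * \int[mu]_t (`|N t| * F t ^+ 2)%:E)%E.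
Proof.
move=> mN mF m0 Nm.
have mNa : measurable_fun setT (fun t => `|N t|) by exact: measurableT_comp.
have mNF : measurable_fun setT (fun t => `|N t| * F t ^+ 2).
  by apply: measurable_funM => //; exact: measurable_funX.
have NF0 t : 0 <= `|N t| * F t ^+ 2 by rewrite mulr_ge0// sqr_ge0.
have [qoo|] := eqVneq (\int[mu]_t (`|N t| * F t ^+ 2)%:E)%E +oo%E.
  by rewrite qoo gt0_muley ?lte_fin// leey.
rewrite -ltey => qlt.
have iN : mu.-integrable setT (EFin \o (fun t => `|N t|)).
  apply/integrableP; split; first exact/measurable_EFinP.
  under eq_integral do rewrite /= normr_id.
  by apply: le_lt_trans Nm _; exact: ltry.
have iq : mu.-integrable setT (EFin \o (fun t => `|N t| * F t ^+ 2)).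
  apply/integrableP; split; first exact/measurable_EFinP.
  by under eq_integral do rewrite /= ger0_norm//.
have iNF : mu.-integrable setT (EFin \o (fun t => N t * F t)).
  apply: (integrable_le (g := fun t => `|N t| + `|N t| * F t ^+ 2)).
  - exact: measurable_funM.
  - by have := integrableD measurableT iN iq; apply: eq_integrable => // t _.
  - move=> t; rewrite normrM -[F t ^+ 2]real_normK ?num_real// -{2}[`|N t|]mulr1 -mulrDr.
    rewrite ler_wpM2l//; have := sqr_ge0 (`|F t| - 2^-1); rewrite !expr2; lra.
set b := (\int[mu]_t (N t * F t))%R.
pose q := (\int[mu]_t (`|N t| * F t ^+ 2))%R.
have qE : (\int[mu]_t (`|N t| * F t ^+ 2)%:E)%E = q%:E.
  by rewrite /q /Rintegral fineK//; exact: integrable_fin_num.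
rewrite qE -EFinM lee_fin.
have key a : 2 * a * b <= q + a ^+ 2 * m.
  have i1 : mu.-integrable setT (EFin \o (fun t => 2 * a * (N t * F t))).
    by have := integrableZl measurableT (2 * a) iNF; apply: eq_integrable.
  have i2 : mu.-integrable setT (EFin \o (fun t => a ^+ 2 * `|N t|)).
    by have := integrableZl measurableT (a ^+ 2) iN; apply: eq_integrable.
  have i3 : mu.-integrable setT (EFin \o (fun t => `|N t| * F t ^+ 2 + a ^+ 2 * `|N t|)).
    by have := integrableD measurableT iq i2; apply: eq_integrable.
  have : (\int[mu]_t (2 * a * (N t * F t)) <= \int[mu]_t (`|N t| * F t ^+ 2 + a ^+ 2 * `|N t|))%R.
    apply: le_Rintegral => // t _.
    have := mulr_ge0 (normr_ge0 (N t)) (sqr_ge0 (F t - Num.sg (N t) * a)).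
    rewrite sqrrB exprMn sqr_sg [X in 0 <= X](_ : _ = `|N t| * F t ^+ 2 -
      2 * a * ((Num.sg (N t) * `|N t|) * F t) + `|N t| * (N t != 0)%:R * a ^+ 2); last by ring.
    rewrite -numEsg; have [->|N0] := eqVneq (N t) 0; first by rewrite normr0 !(mulr0, mul0r); lra.
    by rewrite mulr1; lra.
  rewrite RintegralZl// RintegralD// RintegralZl// => H; apply: (le_trans H).
  rewrite lerD2l ler_wpM2l ?sqr_ge0// -lee_fin /Rintegral fineK//.
  exact: integrable_fin_num.
have := key (b / m).
rewrite -(ler_pM2r m0); rewrite (_ : 2 * (b / m) * b * m = 2 * b ^+ 2); last by field; rewrite gt_eqF.
rewrite (_ : (q + (b / m) ^+ 2 * m) * m = q * m + b ^+ 2); last by field; rewrite gt_eqF.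
lra.
Qed.

End weighted_cauchy_schwarz.

Section convolution.
Context {R : realType} {n : nat}.
Notation leb := (@lebesgue_rV R n).
Implicit Types (F G : 'rV[R]_n -> R).

Definition convol (N F : 'rV[R]_n -> R) := superposition leb id F N.

(** By |F| 1_B <= F^2 + 1_B, where the volume of the ball B does not depend on its center. *)
Lemma sqint_locally_integrable F : sqint leb F -> uniformly_locally_integrable leb id F.
Proof.
move=> [mF iF] r.
have mi : measurable_fun setT (\1_(eball r) : 'rV[R]_n -> R).
  by apply: measurable_indic; exact: measurable_eball.
have mib (y : 'rV[R]_n) : measurable_fun setT (fun t : 'rV[R]_n => \1_(eball r) (y - t) : R).
  apply: (measurableT_comp mi); apply: measurable_rVB; [exact: measurable_cst|exact: measurable_id].
exists (fine (\int[leb]_t (F t ^+ 2)%:E + leb (eball r))) => y.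
rewrite fineK; last first.
  rewrite fin_numD !ge0_fin_numE//; first by rewrite iF; exact: eball_lty.
  by apply: integral_ge0 => t _; rewrite lee_fin sqr_ge0.
apply: (@le_trans _ _ (\int[leb]_t (F t ^+ 2 + \1_(eball r) (y - t)%R)%:E)%E).
  apply: ge0_eintegral_le.
  - by apply: measurable_funM => //; exact: measurableT_comp.
  - by apply: measurable_funD => //; exact: measurable_funX.
  - by move=> t; rewrite mulr_ge0.
  - move=> t; rewrite indicE; case: (_ \in _); rewrite ?mulr1n ?mulr0n ?mulr1 ?mulr0 ?addr0 ?sqr_ge0//.
    rewrite -[F t ^+ 2]real_normK ?num_real//.
    have := sqr_ge0 (`|F t| - 2^-1); rewrite !expr2; lra.
rewrite ge0_eintegralD//; last 2 first.
- exact: measurable_funX.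
- by move=> t; rewrite sqr_ge0.
apply: leeD => //.
rewrite (@ge0_integral_rV_reflect _ _ y (fun t : 'rV[R]_n => (\1_(eball r) t)%:E)).
- by rewrite integral_indic ?setIT//; exact: measurable_eball.
- exact/measurable_EFinP.
- by move=> t; rewrite lee_fin.
Qed.

Lemma bump_norm_integral_lty r N : bump r N ->
  exists2 m : R, 0 < m & (\int[leb]_t (`|N t|)%:E <= m%:E)%E.
Proof.
move=> bN; have [M M0 NM] := bump_bounded bN.
have mi : measurable_fun setT (\1_(eball r) : 'rV[R]_n -> R).
  by apply: measurable_indic; exact: measurable_eball.
exists (M * fine (leb (eball r)) + 1).
  by rewrite ltr_wpDl// mulr_ge0// fine_ge0.
apply: (@le_trans _ _ (\int[leb]_t (M * \1_(eball r) t)%:E)%E).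
  apply: ge0_eintegral_le.
  - by apply: measurableT_comp => //; exact: measurable_bump bN.
  - exact: measurable_funM.
  - by move=> t.
  - move=> t; rewrite indicE; have [tr|tr] := leP (sqnorm t) r.
      by rewrite mem_set// mulr1.
    by rewrite (bump_eq0 bN (ltW tr)) normr0 mulr_ge0.
rewrite ge0_eintegralZ//.
rewrite integral_indic ?setIT//; last exact: measurable_eball.
rewrite EFinD EFinM fineK; last by rewrite ge0_fin_numE//; exact: eball_lty.
by rewrite leeDl.
Qed.

Lemma convol_continuous r N F : bump r N -> sqint leb F -> continuous (convol N F).
Proof.
move=> bN sF; exact: (superposition_continuous (@measurable_id _ _ setT) sF.1 (sqint_locally_integrable sF) bN).
Qed.

Lemma convol_has_partial r N dN F i : bump r N -> bump r dN -> has_partial i N dN ->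
  sqint leb F -> has_partial i (convol N F) (convol dN F).
Proof.
move=> bN bdN pN sF; exact: (superposition_has_partial (@measurable_id _ _ setT) sF.1 (sqint_locally_integrable sF) bN bdN pN).
Qed.

Lemma measurable_convol r N F : bump r N -> sqint leb F ->
  measurable_fun setT (convol N F).
Proof. by move=> bN sF; apply: continuous_measurable_rV; exact: convol_continuous bN sF. Qed.

Lemma integrable_convol r N F y : bump r N -> sqint leb F ->
  leb.-integrable setT (fun t => (N (y - t)%R * F t)%:E).
Proof.
move=> bN sF; exact: (integrable_superposition (@measurable_id _ _ setT) sF.1 (sqint_locally_integrable sF) y bN).
Qed.

(** Young's inequality for L^1 and L^2: the weighted Cauchy-Schwarz inequality at each y, followed
    by Tonelli's theorem and translation invariance. *)
Lemma convol_sqr_le r N F (m : R) : bump r N -> sqint leb F -> 0 < m ->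
  (\int[leb]_t (`|N t|)%:E <= m%:E)%E ->
  (\int[leb]_y (convol N F y ^+ 2)%:E <= (m ^+ 2)%:E * \int[leb]_t (F t ^+ 2)%:E)%E.
Proof.
move=> bN sF m0 Nm; have [mF iF] := sF.
have mN := measurable_bump bN.
have mNs (y : 'rV[R]_n) : measurable_fun setT (fun t : 'rV[R]_n => N (y - t)).
  by apply: (measurableT_comp mN); apply: measurable_rVB; [exact: measurable_cst|exact: measurable_id].
have mNa : measurable_fun setT (fun t => `|N t|) by exact: measurableT_comp.
have m2 : measurable_fun setT (fun p : 'rV[R]_n * 'rV[R]_n => (`|N (p.1 - p.2)| * F p.2 ^+ 2)%:E).
  apply/measurable_EFinP; apply: measurable_funM.
    apply: (measurableT_comp mNa); apply: measurable_rVB; [exact: measurable_fst|exact: measurable_snd].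
  by apply: measurable_funX; exact: (measurableT_comp mF measurable_snd).
have p2 (y t : 'rV[R]_n) : (0 <= (`|N (y - t)| * F t ^+ 2)%:E)%E.
  by rewrite lee_fin mulr_ge0// sqr_ge0.
apply: (@le_trans _ _ (\int[leb]_y (m%:E * \int[leb]_t (`|N (y - t)%R| * F t ^+ 2)%:E))%E).
  apply: ge0_le_integral => //.
  - by move=> y _; rewrite lee_fin sqr_ge0.
  - by apply/measurable_EFinP/measurable_funX; exact: measurable_convol bN sF.
  - apply: emeasurable_funM; first exact: measurable_cst.
    exact: (@measurable_tonelli1 _ _ _ _ _ leb (fun y t : 'rV[R]_n => (`|N (y - t)| * F t ^+ 2)%:E)).
  - move=> y _; apply: sqr_integral_le => //.
    rewrite (@ge0_integral_rV_reflect _ _ y (fun t => (`|N t|)%:E))//.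
    exact/measurable_EFinP.
rewrite ge0_integralZl//; last 3 first.
- exact: (@measurable_tonelli1 _ _ _ _ _ leb (fun y t : 'rV[R]_n => (`|N (y - t)| * F t ^+ 2)%:E)).
- by move=> y _; apply: integral_ge0 => t _; exact: p2.
- by rewrite lee_fin ltW.
rewrite expr2 EFinM -muleA; apply: lee_wpmul2l; first by rewrite lee_fin ltW.
rewrite (@tonelli_swap _ _ _ _ _ leb leb (fun y t : 'rV[R]_n => (`|N (y - t)| * F t ^+ 2)%:E))//.
rewrite -ge0_eintegralZ//; last 3 first.
- exact: measurable_funX.
- by rewrite ltW.
- by move=> t; rewrite sqr_ge0.
apply: ge0_le_integral => //.
- by move=> t _; apply: integral_ge0 => y _; exact: p2.
- exact: (@measurable_tonelli2 _ _ _ _ _ leb (fun y t : 'rV[R]_n => (`|N (y - t)| * F t ^+ 2)%:E)).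
- by apply/measurable_EFinP/measurable_funM => //; exact: measurable_funX.
- move=> t _; rewrite (_ : (fun y => _) = (fun y : 'rV[R]_n => (F t ^+ 2 * `|N (y - t)|)%:E)); last first.
    by apply/funext => y; rewrite mulrC.
  rewrite ge0_eintegralZ; last 3 first.
  + apply: (measurableT_comp mNa); apply: measurable_rVB; [exact: measurable_id|exact: measurable_cst].
  + exact: sqr_ge0.
  + by move=> y; exact: normr_ge0.
  rewrite [(m * _)%R]mulrC [in leRHS]EFinM; apply: lee_wpmul2l; first by rewrite lee_fin sqr_ge0.
  rewrite (@ge0_integral_rV_shift _ _ (- t) (fun t => (`|N t|)%:E))//.
  exact/measurable_EFinP.
Qed.

Lemma sqint_convol r N F : bump r N -> sqint leb F -> sqint leb (convol N F).
Proof.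
move=> bN sF; split; first exact: measurable_convol bN sF.
have [m m0 Nm] := bump_norm_integral_lty bN.
apply: (le_lt_trans (convol_sqr_le bN sF m0 Nm)).
by rewrite lte_mul_pinfty//; [rewrite lee_fin sqr_ge0|exact: sF.2].
Qed.

End convolution.

Section mollifier.
Context {R : realType} {n : nat}.
Notation leb := (@lebesgue_rV R n).
Implicit Types (F G : 'rV[R]_n -> R).

Definition bump_mass (r : R) : R := fine (\int[leb]_x (flat 1 (r - sqnorm x))%:E).

Definition mollifier (r : R) (x : 'rV[R]_n) : R := (bump_mass r)^-1 * flat 1 (r - sqnorm x).

Lemma bump_massE r : (\int[leb]_x (flat 1 (r - sqnorm x))%:E = (bump_mass r)%:E)%E.
Proof.
rewrite /bump_mass fineK// ge0_fin_numE; last first.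
  by apply: integral_ge0 => x _; rewrite lee_fin flat_ge0.
have [m _] := bump_norm_integral_lty (@bump_flat R n r 1).
under eq_integral do rewrite ger0_norm ?flat_ge0//.
by move=> /le_lt_trans; apply; exact: ltry.
Qed.

Lemma bump_mass_gt0 r : 0 < r -> 0 < bump_mass r.
Proof.
move=> r0; rewrite -lte_fin -bump_massE.
have r2 : 0 < r / 2 by rewrite divr_gt0.
have [C C0 HC] : exists2 c : R, 0 < c & forall x : 'rV[R]_n, eball (r / 2) x -> c <= flat 1 (r - sqnorm x).
  exists (expR (- (r / 2)^-1)) => [|x /= xr]; first exact: expR_gt0.
  rewrite /flat ifF; last by apply/negbTE; rewrite -ltNge subr_gt0 (le_lt_trans xr)//; lra.
  have xr' : sqnorm x <= r / 2 := xr.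
  rewrite hornerC mul1r ler_expR lerN2 lef_pV2 ?posrE//; lra.
apply: (@lt_le_trans _ _ (\int[leb]_x (C * \1_(eball (r / 2)) x)%:E)%E).
  have mi : measurable_fun setT (\1_(eball (r / 2)) : 'rV[R]_n -> R).
    by apply: measurable_indic; exact: measurable_eball.
  rewrite ge0_eintegralZ ?ltW// integral_indic ?setIT//; last exact: measurable_eball.
  by rewrite mule_gt0// eball_gt0.
apply: ge0_eintegral_le.
- by apply: measurable_funM => //; apply: measurable_indic; exact: measurable_eball.
- exact: (measurable_bump (@bump_flat R n r 1)).
- by move=> x; rewrite mulr_ge0// ltW.
- move=> x; rewrite indicE; have [xr|xr] := boolP (x \in eball (r / 2)).
    by rewrite mulr1 HC//; exact: set_mem.
  by rewrite mulr0 flat_ge0.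
Qed.

Lemma bump_mollifier r : bump r (mollifier r).
Proof. exact/bumpZ/bump_flat. Qed.

Lemma mollifier_ge0 r x : 0 <= mollifier r x.
Proof.
rewrite mulr_ge0 ?flat_ge0// invr_ge0 fine_ge0//.
by apply: integral_ge0 => y _; rewrite lee_fin flat_ge0.
Qed.

Lemma integral_mollifier r : 0 < r -> (\int[leb]_x (mollifier r x)%:E = 1)%E.
Proof.
move=> r0; have m0 := bump_mass_gt0 r0.
rewrite ge0_eintegralZ; last 3 first.
- exact: (measurable_bump (@bump_flat R n r 1)).
- by rewrite invr_ge0 ltW.
- by move=> x; exact: flat_ge0.
by rewrite bump_massE -EFinM mulVf// gt_eqF.
Qed.

Lemma mollifier_sqnorm r x y : sqnorm x = sqnorm y -> mollifier r x = mollifier r y.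
Proof. by rewrite /mollifier => ->. Qed.

Lemma mollifierN r x : mollifier r (- x) = mollifier r x.
Proof. by apply: mollifier_sqnorm; rewrite sqnormN. Qed.

Lemma convol_mollifier_le r F : 0 < r -> sqint leb F ->
  (\int[leb]_y (convol (mollifier r) F y ^+ 2)%:E <= \int[leb]_t (F t ^+ 2)%:E)%E.
Proof.
move=> r0 sF; have := convol_sqr_le (bump_mollifier r) sF ltr01.
rewrite expr1n mul1e; apply.
under eq_integral do rewrite ger0_norm ?mollifier_ge0//.
by rewrite integral_mollifier.
Qed.

End mollifier.

Section kernel_fubini.
Context d1 d2 (T1 : measurableType d1) (T2 : measurableType d2) {R : realType}.
Variables (m1 : {sigma_finite_measure set T1 -> \bar R})
  (m2 : {sigma_finite_measure set T2 -> \bar R}).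
Variables (K : T1 -> T2 -> R) (H : T1 -> R) (F : T2 -> R) (m : R).
Hypothesis m0 : 0 <= m.
Hypothesis mK : measurable_fun setT (fun p => K p.1 p.2).
Hypotheses (sH : sqint m1 H) (sF : sqint m2 F).
Hypothesis K1 : forall y, (\int[m2]_t (`|K y t|)%:E <= m%:E)%E.
Hypothesis K2 : forall t, (\int[m1]_y (`|K y t|)%:E <= m%:E)%E.

Let mKa : measurable_fun setT (fun p => `|K p.1 p.2|).
Proof. exact: measurableT_comp. Qed.

Let mA : measurable_fun setT (fun p => H p.1 ^+ 2 * `|K p.1 p.2|).
Proof.
apply: measurable_funM => //; apply: measurable_funX.
exact: (measurableT_comp sH.1 measurable_fst).
Qed.

Let mB : measurable_fun setT (fun p => F p.2 ^+ 2 * `|K p.1 p.2|).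
Proof.
apply: measurable_funM => //; apply: measurable_funX.
exact: (measurableT_comp sF.1 measurable_snd).
Qed.

Let lA : (\int[m1]_y \int[m2]_t (H y ^+ 2 * `|K y t|)%:E < +oo)%E.
Proof.
have [mH iH] := sH.
apply: (@le_lt_trans _ _ (\int[m1]_y (m * (H y ^+ 2))%:E)%E); last first.
  rewrite ge0_eintegralZ//; first by rewrite lte_mul_pinfty.
  - exact: measurable_funX.
  - by move=> y; exact: sqr_ge0.
apply: ge0_le_integral => //.
- by move=> y _; apply: integral_ge0 => t _; rewrite lee_fin mulr_ge0// sqr_ge0.
- apply: (@measurable_tonelli1 _ _ _ _ _ m2 (fun y t => (H y ^+ 2 * `|K y t|)%:E)).
    exact/measurable_EFinP.
  by move=> y t; rewrite lee_fin mulr_ge0// sqr_ge0.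
- by apply/measurable_EFinP/measurable_funM => //; exact: measurable_funX.
- move=> y _; rewrite ge0_eintegralZ ?sqr_ge0//; last first.
    exact: (measurableT_comp mKa (measurable_pair1 y)).
  by rewrite mulrC [leRHS]EFinM; apply: lee_wpmul2l; [rewrite lee_fin sqr_ge0|exact: K1].
Qed.

Let lB : (\int[m2]_t \int[m1]_y (F t ^+ 2 * `|K y t|)%:E < +oo)%E.
Proof.
have [mF iF] := sF.
apply: (@le_lt_trans _ _ (\int[m2]_t (m * (F t ^+ 2))%:E)%E); last first.
  rewrite ge0_eintegralZ//; first by rewrite lte_mul_pinfty.
  - exact: measurable_funX.
  - by move=> y; exact: sqr_ge0.
apply: ge0_le_integral => //.
- by move=> y _; apply: integral_ge0 => t _; rewrite lee_fin mulr_ge0// sqr_ge0.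
- apply: (@measurable_tonelli2 _ _ _ _ _ m1 (fun y t => (F t ^+ 2 * `|K y t|)%:E)).
    exact/measurable_EFinP.
  by move=> y t; rewrite lee_fin mulr_ge0// sqr_ge0.
- by apply/measurable_EFinP/measurable_funM => //; exact: measurable_funX.
- move=> y _; rewrite ge0_eintegralZ ?sqr_ge0//; last first.
    exact: (measurableT_comp mKa (measurable_pair2 y)).
  by rewrite mulrC [leRHS]EFinM; apply: lee_wpmul2l; [rewrite lee_fin sqr_ge0|exact: K2].
Qed.

(** A crude form of Schur's test: |H K F| <= |K| (H^2 + F^2), and the bounds on the marginals of |K|
    make each term integrable. *)
Lemma integrable_kernel : (m1 \x m2)%E.-integrable setT
  (EFin \o (fun p => H p.1 * (K p.1 p.2 * F p.2))).
Proof.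
have [mH iH] := sH; have [mF iF] := sF.
have iA : (m1 \x m2)%E.-integrable setT (EFin \o (fun p => H p.1 ^+ 2 * `|K p.1 p.2|)).
  apply/integrable12ltyP; first exact/measurable_EFinP.
  apply: le_lt_trans lA; rewrite le_eqVlt; apply/orP; left; apply/eqP/eq_integral => y _; apply: eq_integral => t _.
  by rewrite /= ger0_norm// mulr_ge0// sqr_ge0.
have iB : (m1 \x m2)%E.-integrable setT (EFin \o (fun p => F p.2 ^+ 2 * `|K p.1 p.2|)).
  apply/integrable21ltyP; first exact/measurable_EFinP.
  apply: le_lt_trans lB; rewrite le_eqVlt; apply/orP; left; apply/eqP/eq_integral => y _; apply: eq_integral => t _.
  by rewrite /= ger0_norm// mulr_ge0// sqr_ge0.
apply: (integrable_le (g := fun p => H p.1 ^+ 2 * `|K p.1 p.2| + F p.2 ^+ 2 * `|K p.1 p.2|)).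
- apply: measurable_funM; first exact: (measurableT_comp mH measurable_fst).
  by apply: measurable_funM => //; exact: (measurableT_comp mF measurable_snd).
- by have := integrableD measurableT iA iB; apply: eq_integrable => // p _.
- move=> p; rewrite -mulrDl mulrCA normrM mulrC ler_wpM2r// normrM.
  rewrite -[H p.1 ^+ 2]real_normK ?num_real// -[F p.2 ^+ 2]real_normK ?num_real//.
  have := sqr_ge0 (`|H p.1| - `|F p.2|); have := normr_ge0 (H p.1); have := normr_ge0 (F p.2).
  nra.
Qed.

Lemma kernel_fubini :
  (forall y, m2.-integrable setT (fun t => (K y t * F t)%:E)) ->
  (forall t, m1.-integrable setT (fun y => (K y t * H y)%:E)) ->
  (\int[m1]_y (H y * \int[m2]_t (K y t * F t))%R%:E =
   \int[m2]_t (F t * \int[m1]_y (K y t * H y))%R%:E)%E.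
Proof.
move=> i1 i2; have := Fubini integrable_kernel.
rewrite (eq_integral (fun y => (H y * \int[m2]_t (K y t * F t))%R%:E)); last first.
  move=> y _; rewrite EFinM /Rintegral fineK; last exact: integrable_fin_num.
  by rewrite -integralZl//; apply: eq_integral => t _; rewrite /= EFinM.
move=> ->; apply: eq_integral => t _.
rewrite EFinM /Rintegral fineK; last exact: integrable_fin_num.
by rewrite -integralZl//; apply: eq_integral => y _; rewrite /= -EFinM; congr EFin; ring.
Qed.

End kernel_fubini.

Section test_functions.
Context {R : realType} {n : nat}.
Implicit Types (phi : 'rV[R]_n -> R).

Lemma compact_support phi (M : R) : (forall x i, phi x != 0 -> `|x ord0 i| <= M) ->
  compact (closure [set x | phi x != 0]).
Proof.
move=> phiM; apply: bounded_closed_compact; last exact: closed_closure.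
pose C := [set x : 'rV[R]_n | `|x| <= `|M|].
have cB : closed C.
  apply: (@closed_comp _ _ (fun x : 'rV[R]_n => `|x|) [set y : R | y <= `|M|]).
    by move=> x _; exact: norm_continuous.
  exact: (@closed_le R `|M|).
exists `|M|; split; first exact: num_real.
move=> b Mb x; rewrite closureEbigcap => /(_ C); rewrite /C/= => xC.
apply: (le_trans _ (ltW Mb)); apply: xC; split=> // y /= py.
change (mx_norm y <= `|M|); rewrite mx_normrE; apply: bigmax_le => // -[i j] _ /=.
by rewrite ord1 (le_trans (phiM y j py))// ler_norm.
Qed.

Lemma has_partial_reflect i phi dphi (z : 'rV[R]_n) : has_partial i phi dphi ->
  has_partial i (fun y => phi (z - y)) (fun y => - dphi (z - y)).
Proof.
move=> pd x t.
have e s : z - (s *: delta_mx ord0 i + x) = (- s) *: delta_mx ord0 i + (z - x).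
  by rewrite opprD scaleNr addrCA.
have := pd (z - x) (- t); rewrite -e => H.
have := @is_derive1_comp R (fun s : R => phi (s *: delta_mx ord0 i + (z - x))) -%R t _ _ H
  (is_deriveN (is_derive_id t 1)).
rewrite mulrN1 => H1; apply: (near_eq_is_derive _ H1).
by near=> s; rewrite /= e.
Unshelve. all: by end_near. Qed.

Lemma bump_partials (r : R) N : @bump R n r N -> exists dN : 'I_n -> 'rV[R]_n -> R,
  forall i, bump r (dN i) /\ has_partial i N (dN i).
Proof.
move=> bN; exists (fun i => sval (cid2 (bump_has_partial i bN))) => i.
by case: cid2.
Qed.

Lemma smooth_bump_reflect (r : R) N z : @bump R n r N -> smooth (fun y => N (z - y)).
Proof.
move=> bN; apply: (@smooth_class _ _ (fun f => exists2 N, bump r N & f = fun y => N (z - y))).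
- move=> _ [N' bN' ->].
  have [dN dNP] := bump_partials bN'.
  have /choice[M MP] : forall i, exists M, forall y, `|dN i y| <= M.
    by move=> i; have [M _ HM] := bump_bounded (dNP i).1; exists M.
  apply: (@bounded_partial_continuous _ _ _ (fun i y => - dN i (z - y)) (\sum_i `|M i|)).
    by move=> i; apply: has_partial_reflect; exact: (dNP i).2.
  move=> i y; rewrite normrN; apply: (le_trans (MP i _)); apply: (le_trans (ler_norm _)).
  by rewrite (bigD1 i)//= lerDl sumr_ge0.
- move=> _ i [N' bN' ->]; have [dN bdN pN] := bump_has_partial i bN'.
  exists (fun y => - dN (z - y)); last exact: has_partial_reflect.
  exists (fun x => -1 * dN x); first exact: bumpZ.
  by apply/funext => y; rewrite mulN1r.
- by exists N.
Qed.

Lemma classical_laplacian_eq phi (d dd : 'I_n -> 'rV[R]_n -> R) :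
  (forall i, has_partial i phi (d i)) -> (forall i, has_partial i (d i) (dd i)) ->
  classical_laplacian phi = fun x => \sum_i dd i x.
Proof.
move=> pd pdd; apply/funext => x; apply: eq_bigr => i _.
by rewrite /iter_partial/= (partialE (pd i)) (partialE (pdd i)).
Qed.

Lemma test_bump_reflect (r : R) N z : @bump R n r N -> test_function (fun y => N (z - y)).
Proof.
move=> bN; split; first exact: smooth_bump_reflect bN.
apply: (@compact_support _ (\sum_i `|z ord0 i| + (1 + `|r|))) => x i Nx.
have zx : sqnorm (z - x) < r.
  by rewrite ltNge; apply: contra Nx => rx; rewrite (bump_eq0 bN rx).
have := le_lt_trans (sqr_coord_le (z - x) i) zx.
rewrite !mxE => zxr; have zi : `|z ord0 i| <= \sum_i `|z ord0 i|.
  by rewrite (bigD1 i)//= lerDl sumr_ge0.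
rewrite -[x ord0 i](subKr (z ord0 i)); apply: (le_trans (ler_normB _ _)); apply: lerD => //.
have : `|z ord0 i - x ord0 i| ^+ 2 < `|r|.
  by rewrite real_normK ?num_real// (lt_le_trans zxr)// ler_norm.
by have := sqr_ge0 (`|z ord0 i - x ord0 i| - 2^-1); rewrite !expr2; lra.
Qed.

End test_functions.

Lemma Rintegral_sum d (T : measurableType d) (R : realType) (mu : {measure set T -> \bar R})
  (I : Type) (s : seq I) (f : I -> T -> R) :
  (forall i, mu.-integrable setT (EFin \o f i)) ->
  mu.-integrable setT (EFin \o (fun x => \sum_(i <- s) f i x)) /\
  \int[mu]_x (\sum_(i <- s) f i x) = \sum_(i <- s) \int[mu]_x f i x.
Proof.
move=> fi; elim: s => [|i s [IHi IH]].
  rewrite big_nil; under [X in EFin \o X]eq_fun do rewrite big_nil.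
  split; first exact: integrable0.
  by under eq_Rintegral do rewrite big_nil; rewrite Rintegral_cst// mul0r.
under [X in EFin \o X]eq_fun do rewrite big_cons.
under eq_Rintegral do rewrite big_cons.
rewrite big_cons -IH RintegralD//; split=> //.
by have := integrableD measurableT (fi i) IHi; apply: eq_integrable.
Qed.

(** * Weak Laplacians of mollified functions *)

Section weak_laplacian.
Context {R : realType} {n : nat}.
Notation leb := (@lebesgue_rV R n).
Implicit Types (F G phi : 'rV[R]_n -> R).

Definition weak_laplacian F G := [/\ sqint leb F, sqint leb G &
  forall phi, test_function phi ->
    \int[leb]_x (F x * classical_laplacian phi x) = \int[leb]_x (G x * phi x)].

Lemma laplacian_reflect N (d dd : 'I_n -> 'rV[R]_n -> R) z :
  (forall i, has_partial i N (d i)) -> (forall i, has_partial i (d i) (dd i)) ->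
  classical_laplacian (fun y => N (z - y)) = fun y => \sum_i dd i (z - y).
Proof.
move=> Nd ddd; rewrite (@classical_laplacian_eq _ _ _ (fun i y => - d i (z - y))
  (fun i y => dd i (z - y)))// => i; first exact: has_partial_reflect.
have := has_partialM (@has_partial_cst R n i (-1)) (has_partial_reflect z (ddd i)).
rewrite (_ : (fun y => -1 * _) = (fun y => - d i (z - y))); last first.
  by apply/funext => y; rewrite mulN1r.
by move=> H; refine (has_partial_eq H _) => y; ring.
Qed.

(** For each z the reflected translate y |-> N(z - y) is a test function; testing the weak equation
    with it gives Delta (N * F) = N * G pointwise. *)
Lemma weak_laplacian_convol F G r N (d dd : 'I_n -> 'rV[R]_n -> R) z :
  weak_laplacian F G -> bump r N -> (forall i, bump r (dd i)) ->
  (forall i, has_partial i N (d i)) -> (forall i, has_partial i (d i) (dd i)) ->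
  \sum_i convol (dd i) F z = convol N G z.
Proof.
move=> [sF sG FG] bN bdd Nd ddd.
have := FG _ (test_bump_reflect z bN); rewrite (laplacian_reflect z Nd ddd) => FGz.
have [_ <-] := @Rintegral_sum _ _ R leb _ (index_enum 'I_n) (fun i t => dd i (z - t) * F t)
  (fun i => integrable_convol z (bdd i) sF).
rewrite /convol /superposition; under [RHS]eq_Rintegral do rewrite mulrC.
rewrite -FGz; apply: eq_Rintegral => t _.
by rewrite mulrC mulr_suml.
Qed.

Lemma convol_mollifier_adjoint r F H : 0 < r -> sqint leb F -> sqint leb H ->
  (\int[leb]_y (H y * convol (mollifier r) F y)%:E =
   \int[leb]_t (F t * convol (mollifier r) H t)%:E)%E.
Proof.
move=> r0 sF sH; have bM := @bump_mollifier R n r.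
have mM := measurable_bump bM.
have mMs : measurable_fun setT (fun p : 'rV[R]_n * 'rV[R]_n => mollifier r (p.1 - p.2)).
  by apply: (measurableT_comp mM); apply: measurable_rVB; [exact: measurable_fst|exact: measurable_snd].
have sym (y t : 'rV[R]_n) : mollifier r (y - t) = mollifier r (t - y).
  by rewrite -mollifierN opprB.
have M1 y : (\int[leb]_t (`|mollifier r (y - t)|)%:E <= 1%:E)%E.
  rewrite (@ge0_integral_rV_reflect _ _ y (fun t => (`|mollifier r t|)%:E)) //.
    under eq_integral do rewrite ger0_norm ?mollifier_ge0//.
    by rewrite integral_mollifier.
  by apply/measurable_EFinP; exact: measurableT_comp.
have M2 t : (\int[leb]_y (`|mollifier r (y - t)|)%:E <= 1%:E)%E.
  by under eq_integral do rewrite sym; exact: M1.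
rewrite /convol /superposition.
have i2 (t : 'rV[R]_n) : leb.-integrable setT (fun y => (mollifier r (y - t)%R * H y)%:E).
  by have := integrable_convol t bM sH; apply: eq_integrable => // y _; rewrite /= sym.
have := @kernel_fubini _ _ _ _ R leb leb (fun y t : 'rV[R]_n => mollifier r (y - t)) H F 1
  ler01 mMs sH sF M1 M2 (fun y => integrable_convol y bM sF) i2.
cbv beta => E; rewrite [LHS]E {E}; apply: eq_integral => t _.
suff -> : (\int[leb]_y (mollifier r (y - t) * H y))%R = (\int[leb]_y (mollifier r (t - y) * H y))%R by [].
apply: eq_Rintegral => y _; rewrite sym; reflexivity.
Qed.

(** By evenness the mollifier moves onto the radial function phi(|x|^2). The convolution of two
    radial functions is again radial, because the reflection exchanging two points of equal norm
    preserves Lebesgue measure. *)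
Lemma radial_orthogonal_convol r F : (0 < n)%N -> 0 < r -> sqint leb F ->
  radial_orthogonal F -> radial_orthogonal (convol (mollifier r) F).
Proof.
move=> n0 r0 sF oF phi mphi sphi.
under eq_integral do rewrite mulrC.
rewrite (convol_mollifier_adjoint r0 sF sphi).
set H := fun x : 'rV[R]_n => phi (sqnorm x).
have bM := @bump_mollifier R n r.
have rad (x y : 'rV[R]_n) : sqnorm x = sqnorm y ->
    convol (mollifier r) H x = convol (mollifier r) H y.
  move=> xy; pose T := householder (x - y).
  rewrite /convol /superposition /Rintegral.
  have mg : measurable_fun setT (fun t : 'rV[R]_n => (mollifier r (y - t) * H t)%:E).
    by have [m _ _] := integrableP _ _ _ (integrable_convol y bM sphi); exact: m.
  have := @integral_rV_isometry _ _ T (measurable_householder _) (householderD _)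
    (householderK _) (sqnorm_householder _) _ mg.
  move=> E; refine (etrans _ (congr1 fine E)); apply: (congr1 fine).
  apply: eq_integral => t _.
  rewrite /H sqnorm_householder; suff -> : mollifier r (x - t) = mollifier r (y - T t) by [].
  apply: mollifier_sqnorm.
  rewrite -(householder_swap xy) -/T -(sqnorm_householder (x - y) (x - t)); congr sqnorm.
  by apply: (addIr (T t)); rewrite subrK /T -householderD subrK.
pose e : 'rV[R]_n := delta_mx ord0 (Ordinal n0).
(* A radial function becomes a function of |x|^2 by evaluating it on a fixed ray. *)
pose psi s := convol (mollifier r) H (Num.sqrt s *: e).
have e1 : sqnorm e = 1.
  rewrite /sqnorm (bigD1 (Ordinal n0))//= big1 ?addr0.
    by rewrite /e mxE !eqxx expr1n.
  by move=> j jn; rewrite /e mxE eqxx (negbTE jn) expr0n.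
have psiE x : convol (mollifier r) H x = psi (sqnorm x).
  by apply: rad; rewrite sqnormZ sqr_sqrtr ?sqnorm_ge0// e1 mulr1.
under eq_integral do rewrite psiE.
apply: oF.
  have mc := measurable_convol bM sphi.
  apply: (measurableT_comp mc); apply: measurable_rVZ; last exact: measurable_cst.
  by apply: continuous_measurable_fun; exact: sqrt_continuous.
rewrite (_ : (fun x => psi (sqnorm x)) = convol (mollifier r) H); last first.
  by apply/funext => x; rewrite psiE.
exact: sqint_convol bM sphi.
Qed.

Lemma mollified_rellich r F G eps : (3 <= n)%N -> 0 < r -> 0 < eps ->
  weak_laplacian F G -> radial_orthogonal F ->
  (((n%:R ^+ 2 / 4 - 1) ^+ 2)%:E *
     \int[leb]_x (convol (mollifier r) F x ^+ 2 / (sqnorm x + eps) ^+ 2)%:E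
   <= \int[leb]_x (G x ^+ 2)%:E)%E.
Proof.
move=> n3 r0 e0 FG oF; have [sF sG _] := FG.
have bM := @bump_mollifier R n r.
have [d dP] := bump_partials bM.
have /choice[dd ddP] : forall i, exists ddi, [/\ bump r ddi & has_partial i (d i) ddi].
  by move=> i; have [dd ? ?] := bump_has_partial i (dP i).1; exists dd.
have bd i := (dP i).1; have pd i := (dP i).2.
have bdd i : bump r (dd i) by have [] := ddP i.
have pdd i : has_partial i (d i) (dd i) by have [] := ddP i.
have := @regular_rellich R n n3 (convol (mollifier r) F) (fun i => convol (d i) F)
  (fun i => convol (dd i) F) (sqint_convol bM sF) (fun i => sqint_convol (bd i) sF)
  (fun i => sqint_convol (bdd i) sF) (fun i => convol_has_partial bM (bd i) (pd i) sF)
  (fun i => convol_has_partial (bd i) (bdd i) (pdd i) sF) _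
  (radial_orthogonal_convol (ltn_trans _ n3) r0 sF oF) _ e0.
move=> H; apply: (le_trans (H _ _)) => //.
  move=> i; have [ddd bddd pddd] := bump_has_partial i (bdd i).
  exact: has_partial_line_continuous (convol_has_partial (bdd i) bddd pddd sF).
rewrite (eq_integral (fun x => (convol (mollifier r) G x ^+ 2)%:E)).
  exact: convol_mollifier_le.
by move=> x _; rewrite (weak_laplacian_convol _ FG bM bdd pd pdd).
Qed.

End weak_laplacian.

(** * Density of Lipschitz functions in L^2 *)

Section flat_limits.
Context {R : realType}.

Lemma flat_le1 (s : R) : flat 1 s <= 1.
Proof.
rewrite /flat; case: (leP s 0) => // s0.
by rewrite hornerC mul1r -[leRHS]expR0 ler_expR oppr_le0 invr_ge0 ltW.
Qed.

Lemma cvg_flat1 (u : nat -> R) : u k @[k --> \oo] --> +oo ->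
  flat 1 (u k) @[k --> \oo] --> (1 : R).
Proof.
move=> uoo; apply/cvgrPdist_le => e e0.
near=> k.
have uk : e^-1 <= u k by near: k; exact: cvgry_ge.
have u0 : 0 < u k by apply: lt_le_trans uk; rewrite invr_gt0.
have ue : (u k)^-1 <= e by rewrite -[e]invrK lef_pV2// posrE ?invr_gt0.
rewrite ger0_norm ?subr_ge0 ?flat_le1// /flat ifF; last by apply/negbTE; rewrite -ltNge.
by rewrite hornerC mul1r; have := expR_ge1Dx (- (u k)^-1); lra.
Unshelve. all: by end_near. Qed.

Lemma cvg_flat_indic (s : R) : flat 1 (k%:R * s) @[k --> \oo] --> ((0 < s)%R%:R : R).
Proof.
have [s0|s0] := ltP 0 s.
  apply: cvg_flat1; apply/cvgryPge => A.
  near=> k; rewrite -ler_pdivrMr//; near: k; exact: nbhs_infty_ger.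
rewrite (_ : (fun k => _) = fun=> 0); first exact: cvg_cst.
by apply/funext => k; rewrite /flat ifT// mulr_ge0_le0.
Unshelve. all: by end_near. Qed.

Lemma cvg_flat_sub (c : R) : flat 1 (k%:R - c) @[k --> \oo] --> (1 : R).
Proof.
apply: cvg_flat1; apply/cvgryPge => A.
near=> k; rewrite lerBrDr; near: k; exact: nbhs_infty_ger.
Unshelve. all: by end_near. Qed.

End flat_limits.

Section lipschitz_approximation.
Context {R : realType} {n : nat}.
Notation leb := (@lebesgue_rV R n).
Implicit Types (f g h : 'rV[R]_n -> R).

(** Approximants with an explicit modulus: mollification moves them by at most C n sqrt r, and the
    class is stable under sums and products. Increments are measured in the l^1 norm to fit
    [bounded_partial_lipschitz]. *)
Definition bounded_lipschitz g := measurable_fun setT g /\ exists C : R,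
  [/\ 0 <= C, forall x, `|g x| <= C &
      forall x h : 'rV[R]_n, `|g (h + x) - g x| <= C * \sum_i `|h ord0 i|].

Definition small_support g := exists M : R, forall x, M < sqnorm x -> g x = 0.

Lemma bounded_lipschitzM f g : bounded_lipschitz f -> bounded_lipschitz g ->
  bounded_lipschitz (fun x => f x * g x).
Proof.
move=> [mf [C [C0 fC fL]]] [mg [D [D0 gD gL]]]; split; first exact: measurable_funM.
exists (C * D + C * D); split => [|x|x h]; first by rewrite addr_ge0// mulr_ge0.
  by rewrite normrM (le_trans (ler_pM _ _ (fC x) (gD x)))// lerDl mulr_ge0.
rewrite (_ : _ - _ = f (h + x) * (g (h + x) - g x) + (f (h + x) - f x) * g x); last by ring.
apply: (le_trans (ler_normD _ _)); rewrite [leRHS]mulrDl !normrM; apply: lerD.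
  by rewrite -mulrA; exact: ler_pM.
by rewrite mulrAC; exact: ler_pM.
Qed.

Lemma bounded_lipschitzD f g : bounded_lipschitz f -> bounded_lipschitz g ->
  bounded_lipschitz (fun x => f x + g x).
Proof.
move=> [mf [C [C0 fC fL]]] [mg [D [D0 gD gL]]]; split; first exact: measurable_funD.
exists (C + D); split => [|x|x h]; first exact: addr_ge0.
  by apply: (le_trans (ler_normD _ _)); exact: lerD.
rewrite (_ : _ - _ = (f (h + x) - f x) + (g (h + x) - g x)); last by ring.
by apply: (le_trans (ler_normD _ _)); rewrite mulrDl; exact: lerD.
Qed.

Lemma bounded_lipschitz_cst (c : R) : bounded_lipschitz (fun=> c).
Proof.
split; first exact: measurable_cst.
exists `|c|; split => // x h; by rewrite subrr normr0 mulr_ge0// sumr_ge0.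
Qed.

Lemma bounded_lipschitz_bump r N : bump r N -> bounded_lipschitz N.
Proof.
move=> bN; split; first exact: measurable_bump bN.
have [M M0 HM] := bump_bounded bN.
have [dN dNP] := bump_partials bN.
have /choice[D DP] : forall i, exists M, forall y, `|dN i y| <= M.
  by move=> i; have [D _ HD] := bump_bounded (dNP i).1; exists D.
exists (M + \sum_i `|D i|); split => [|x|x h].
- by rewrite addr_ge0// sumr_ge0.
- by rewrite (le_trans (HM x))// lerDl sumr_ge0.
apply: (@le_trans _ _ ((\sum_i `|D i|) * \sum_i `|h ord0 i|)).
  apply: (@bounded_partial_lipschitz _ _ _ dN) => [i|i y]; first exact: (dNP i).2.
  apply: (le_trans (DP i y)); apply: (le_trans (ler_norm _)).
  by rewrite (bigD1 i)//= lerDl sumr_ge0.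
by rewrite ler_wpM2r ?sumr_ge0// lerDr.
Qed.

Lemma bounded_lipschitz_flat (k a : R) i : bounded_lipschitz (fun x => flat 1 (k * (x ord0 i - a))).
Proof.
have [C C0 HC] := flat_bounded (flat_deriv (1 : {poly R})).
have pk j : has_partial j (fun x : 'rV[R]_n => k * (x ord0 i - a)) (fun=> k * (i == j)%:R).
  have := has_partialM (@has_partial_cst R n j k)
    (has_partialD (@has_partial_coor R n j i) (@has_partial_cst R n j (- a))).
  by move=> H; refine (has_partial_eq H _) => x; ring.
have pf j := @has_partial_comp R n j (flat 1) (flat (flat_deriv 1)) _ _ (pk j)
  (fun x => is_derive_flat 1 _).
split.
  apply: (measurableT_comp (continuous_measurable_fun (@continuous_flat R 1))).
  by apply: measurable_funM => //; apply: measurable_funB => //; exact: measurable_coor.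
exists (1 + C * `|k|); split => [|x|x h].
- by rewrite addr_ge0// mulr_ge0.
- by rewrite ger0_norm ?flat_ge0// (le_trans (flat_le1 _))// lerDl mulr_ge0.
apply: (@le_trans _ _ ((C * `|k|) * \sum_i `|h ord0 i|)).
  apply: (bounded_partial_lipschitz _ _ pf) => j y.
  rewrite normrM ler_pM// normrM ler_piMr//.
  by case: (i == j); rewrite ?normr1 ?normr0.
by rewrite ler_wpM2r ?sumr_ge0// lerDr.
Qed.

Definition lip_approx f := measurable_fun setT f /\ forall e : R, 0 < e ->
  exists g, [/\ bounded_lipschitz g, small_support g &
    (\int[leb]_x ((f x - g x) ^+ 2)%:E <= e%:E)%E].

Lemma integral_sqr_addD_le f g : measurable_fun setT f -> measurable_fun setT g ->
  (\int[leb]_x ((f x + g x) ^+ 2)%:E <=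
   2%:E * (\int[leb]_x (f x ^+ 2)%:E + \int[leb]_x (g x ^+ 2)%:E))%E.
Proof.
move=> mf mg; have mf2 := measurable_funX 2 mf; have mg2 := measurable_funX 2 mg.
rewrite -ge0_eintegralD//; last 2 first.
- by move=> x; exact: sqr_ge0.
- by move=> x; exact: sqr_ge0.
rewrite -ge0_eintegralZ//; last 2 first.
- exact: measurable_funD.
- by move=> x; rewrite addr_ge0// sqr_ge0.
apply: ge0_eintegral_le.
- exact/measurable_funX/measurable_funD.
- by apply: measurable_funM => //; exact: measurable_funD.
- by move=> x; exact: sqr_ge0.
- by move=> x; have := sqr_ge0 (f x - g x); rewrite !expr2; lra.
Qed.

Lemma lip_approx_lip g : bounded_lipschitz g -> small_support g -> lip_approx g.
Proof.
move=> lg sg; split; first exact: lg.1.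
move=> e e0; exists g; split => //.
by under eq_integral do rewrite subrr expr0n/=; rewrite integral0 lee_fin ltW.
Qed.

Lemma lip_approxD f g : lip_approx f -> lip_approx g -> lip_approx (fun x => f x + g x).
Proof.
move=> [mf af] [mg ag]; split; first exact: measurable_funD.
move=> e e0; have e4 : 0 < e / 4 by rewrite divr_gt0.
have [f' [lf [M fM] ff]] := af _ e4; have [g' [lg [D gD] gg]] := ag _ e4.
exists (fun x => f' x + g' x); split; first exact: bounded_lipschitzD.
  exists (Num.max M D) => x; rewrite gt_max => /andP[Mx Dx].
  by rewrite fM// gD// addr0.
rewrite (eq_integral (fun x => (((f x - f' x) + (g x - g' x)) ^+ 2)%:E)); last first.
  by move=> x _; congr EFin; congr (_ ^+ 2); ring.
apply: (le_trans (integral_sqr_addD_le _ _)).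
- by apply: measurable_funB => //; exact: lf.1.
- by apply: measurable_funB => //; exact: lg.1.
apply: (@le_trans _ _ (2%:E * ((e / 4)%:E + (e / 4)%:E))%E).
  by apply: lee_wpmul2l; rewrite ?lee_fin//; apply: leeD.
by rewrite -EFinD -EFinM lee_fin; lra.
Qed.

Lemma lip_approxZ (c : R) f : lip_approx f -> lip_approx (fun x => c * f x).
Proof.
move=> [mf af]; split; first exact: measurable_funM.
move=> e e0; have c1 : 0 < c ^+ 2 + 1 by rewrite ltr_wpDl// sqr_ge0.
have [f' [lf [M fM] ff]] := af _ (divr_gt0 e0 c1).
exists (fun x => c * f' x); split.
- by apply: bounded_lipschitzM => //; exact: bounded_lipschitz_cst.
- by exists M => x Mx; rewrite fM// mulr0.
rewrite (eq_integral (fun x => (c ^+ 2 * (f x - f' x) ^+ 2)%:E)); last first.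
  by move=> x _; congr EFin; ring.
rewrite ge0_eintegralZ ?sqr_ge0//; last 2 first.
- by apply/measurable_funX/measurable_funB => //; exact: lf.1.
- by move=> x; exact: sqr_ge0.
apply: (@le_trans _ _ ((c ^+ 2)%:E * (e / (c ^+ 2 + 1))%:E)%E).
  by apply: lee_wpmul2l; rewrite ?lee_fin ?sqr_ge0.
by rewrite -EFinM lee_fin mulrA ler_pdivrMr// mulrC ler_pM2l// lerDl.
Qed.

(** Stability under dominated pointwise limits; it leads from ramps to half-spaces, from increasing
    unions of sets to their union, and from simple functions to all of L^2. *)
Lemma lip_approx_lim (f_ : nat -> 'rV[R]_n -> R) f h :
  (forall k, lip_approx (f_ k)) -> sqint leb h -> measurable_fun setT f ->
  (forall k x, `|f_ k x| <= h x) -> (forall x, `|f x| <= h x) ->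
  (forall x, f_ k x @[k --> \oo] --> f x) -> lip_approx f.
Proof.
move=> af sh mf fh0 fh cf; split=> // e e0.
have mfk k := (af k).1.
have mk k : measurable_fun setT (fun x => (((f x - f_ k x) ^+ 2)%:E)).
  by apply/measurable_EFinP/measurable_funX/measurable_funB.
have cv : (\int[leb]_x ((f x - f_ k x) ^+ 2)%:E)%E @[k --> \oo] --> (\int[leb]_x (cst 0 x))%E.
  apply: (@dominated_cvg _ _ _ leb setT measurableT _ _ (fun x => (4 * h x ^+ 2)%:E)) => //.
  - move=> x _; apply: cvg_EFin; first exact: nearW.
    have : (f x - f_ k x) ^+ 2 @[k --> \oo] --> (f x - f x) ^+ 2.
      by apply: (@cvg_comp _ _ _ (fun k => f x - f_ k x) (fun y => y ^+ 2)); [apply: cvgB; [exact: cvg_cst|exact: cf]|exact: exprn_continuous].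
    by rewrite subrr expr0n.
  - by have := integrableZl measurableT 4 (integrable_sqr sh); apply: eq_integrable.
  - move=> k x _; rewrite /= lee_fin ger0_norm ?sqr_ge0//.
    have := fh0 k x; have := fh x; rewrite !ler_norml => /andP[? ?] /andP[? ?].
    rewrite (_ : 4 * h x ^+ 2 = (2 * h x) ^+ 2); last by ring.
    rewrite -subr_ge0 (_ : _ - _ = (2 * h x - (f x - f_ k x)) * (2 * h x + (f x - f_ k x))).
      by apply: mulr_ge0; lra.
    by ring.
have e4 : 0 < e / 4 by rewrite divr_gt0.
have lt0 : nbhs (\int[leb]_x (cst 0 x))%E [set y : \bar R | (y < (e / 4)%:E)%E].
  by rewrite integral0; apply: open_nbhs_nbhs; split; [exact: open_ereal_lt_ereal|rewrite /= lte_fin].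
have [k _ Hk] := cv _ lt0.
have [g [lg sg fg]] := (af k).2 _ e4.
exists g; split => //.
rewrite (eq_integral (fun x => (((f x - f_ k x) + (f_ k x - g x)) ^+ 2)%:E)); last first.
  by move=> x _; congr EFin; congr (_ ^+ 2); ring.
apply: (le_trans (integral_sqr_addD_le _ _)).
- exact: measurable_funB.
- by apply: measurable_funB => //; exact: lg.1.
apply: (@le_trans _ _ (2%:E * ((e / 4)%:E + (e / 4)%:E))%E).
  apply: lee_wpmul2l; first by rewrite lee_fin.
  by apply: leeD => //; apply: ltW; exact: (Hk k (leqnn k)).
by rewrite -EFinD -EFinM lee_fin; lra.
Qed.

Definition cutoff (k : nat) (x : 'rV[R]_n) : R := flat 1 (k%:R - sqnorm x).

Lemma bump_cutoff k : bump k%:R (cutoff k). Proof. exact: bump_flat. Qed.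

Lemma measurable_cutoff k : measurable_fun setT (cutoff k).
Proof. exact: measurable_bump (bump_cutoff k). Qed.

Lemma cutoff_support k : small_support (cutoff k).
Proof. by exists k%:R => x kx; rewrite (bump_eq0 (bump_cutoff k))// ltW. Qed.

Lemma cutoff_ge0 k x : 0 <= cutoff k x. Proof. exact: flat_ge0. Qed.

Lemma cutoff_le1 k x : cutoff k x <= 1. Proof. exact: flat_le1. Qed.

Lemma sqint_indic_eball r : sqint leb (\1_(eball r) : 'rV[R]_n -> R).
Proof.
have mi : measurable_fun setT (\1_(eball r) : 'rV[R]_n -> R).
  by apply: measurable_indic; exact: measurable_eball.
split => //; rewrite (eq_integral (fun x => (\1_(eball r) x)%:E)); last first.
  by move=> x _; rewrite indicE; case: (_ \in _); rewrite ?expr1n ?expr0n.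
by rewrite integral_indic ?setIT//; [exact: eball_lty|exact: measurable_eball].
Qed.

Lemma sqint_cutoff k : sqint leb (cutoff k).
Proof.
apply: (sqint_le (c := 1) _ (sqint_indic_eball k%:R)); first exact: measurable_cutoff.
move=> x; rewrite mul1r indicE; have [xk|xk] := leP (sqnorm x) k%:R.
  by rewrite mem_set//= expr1n expr_le1// ?cutoff_ge0 ?cutoff_le1.
by rewrite (bump_eq0 (bump_cutoff k) (ltW xk)) expr0n sqr_ge0.
Qed.

Let indic_cutoff_le (A : set 'rV[R]_n) k x : `|\1_A x * cutoff k x| <= cutoff k x.
Proof.
rewrite indicE; case: (x \in A); rewrite ?mul1r ?mul0r ?normr0 ?cutoff_ge0//.
by rewrite ger0_norm ?cutoff_ge0.
Qed.

Let halfspaces (s : seq ('I_n * R)) : set 'rV[R]_n :=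
  [set x | all (fun p => p.2 < x ord0 p.1) s].

Let halfspace_system : set (set 'rV[R]_n) := [set A | exists s, A = halfspaces s].

Let ramp (s : seq ('I_n * R)) (m : nat) (x : 'rV[R]_n) : R :=
  \prod_(p <- s) flat 1 (m%:R * (x ord0 p.1 - p.2)).

Let ramp01 s m x : 0 <= ramp s m x <= 1.
Proof.
rewrite /ramp; elim/big_rec: _ => [|p y _ /andP[y0 y1]]; first by rewrite ler01 lexx.
by rewrite mulr_ge0 ?flat_ge0//= mulr_ile1 ?flat_ge0 ?flat_le1.
Qed.

Let bounded_lipschitz_ramp s m : bounded_lipschitz (ramp s m).
Proof.
rewrite /ramp; elim: s => [|p s' IH].
  by under eq_fun do rewrite big_nil; exact: bounded_lipschitz_cst.
under eq_fun do rewrite big_cons.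
by apply: bounded_lipschitzM => //; exact: bounded_lipschitz_flat.
Qed.

Let measurable_halfspaces s : measurable (halfspaces s).
Proof.
elim: s => [|p s' IH].
  by have -> : halfspaces [::] = setT by apply/seteqP; split.
have -> : halfspaces (p :: s') = (setT `&`
    (fun x : 'rV[R]_n => x ord0 p.1) @^-1` `]p.2, +oo[%classic) `&` halfspaces s'.
  by rewrite setTI; apply/seteqP; split => x; rewrite /halfspaces/= in_itv/= andbT;
    [move=> /andP[]|move=> [-> ->]].
by apply: measurableI => //; exact: measurable_coor.
Qed.

Let cvg_ramp s x : ramp s m x @[m --> \oo] --> (\1_(halfspaces s) x : R).
Proof.
rewrite indicE /halfspaces; set b := (_ \in _).
have -> : b = all (fun p => p.2 < x ord0 p.1) s by rewrite /b; apply/idP/idP; rewrite inE.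
rewrite /ramp {b}; elim: s => [|p s' IH] /=.
  by under eq_fun do rewrite big_nil; exact: cvg_cst.
under eq_fun do rewrite big_cons.
have -> : ((p.2 < x ord0 p.1) && all (fun p => p.2 < x ord0 p.1) s')%:R =
  (0 < x ord0 p.1 - p.2)%R%:R * (all (fun p => p.2 < x ord0 p.1) s')%:R :> R.
  by rewrite subr_gt0; case: (_ < _); rewrite ?mul1r ?mul0r.
by apply: cvgM => //; exact: cvg_flat_indic.
Qed.

Let halfspaces_approx s k :
  lip_approx (fun x => \1_(halfspaces s) x * cutoff k x).
Proof.
apply: (@lip_approx_lim (fun m x => ramp s m x * cutoff k x) _ (cutoff k)).
- move=> m; apply: lip_approx_lip.
    by apply: bounded_lipschitzM => //; exact: bounded_lipschitz_bump (bump_cutoff k).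
  by have [M HM] := cutoff_support k; exists M => x /HM ->; rewrite mulr0.
- exact: sqint_cutoff.
- by apply: measurable_funM; [exact: measurable_indic|exact: measurable_cutoff].
- move=> m x; have /andP[v0 v1] := ramp01 s m x.
  by rewrite ger0_norm ?mulr_ge0 ?cutoff_ge0// ler_piMl ?cutoff_ge0.
- by move=> x; exact: indic_cutoff_le.
- by move=> x; apply: cvgMl; exact: cvg_ramp.
Qed.

(* Finite intersections of half-spaces, whose indicators are limits of ramps,
   form a pi-system generating the Borel sets. *)
Lemma indic_approx (A : set 'rV[R]_n) k : measurable A ->
  lip_approx (fun x => \1_A x * cutoff k x).
Proof.
pose H (B : set 'rV[R]_n) := measurable B /\ lip_approx (fun x => \1_B x * cutoff k x).
have setIG : setI_closed halfspace_system.
  move=> _ _ [s ->] [t ->]; exists (s ++ t); apply/seteqP; split => x; rewrite /halfspaces/= all_cat.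
    by move=> [-> ->].
  by move=> /andP[].
have lH : lambda_system setT H.
  split => //.
  - split => //; have := halfspaces_approx [::] k.
    by rewrite (_ : halfspaces [::] = setT)//; apply/seteqP; split.
  - move=> B C CB [mB aB] [mC aC]; split; first exact: measurableD.
    rewrite (_ : (fun x => _) = fun x => \1_B x * cutoff k x + -1 * (\1_C x * cutoff k x)).
      by apply: lip_approxD => //; exact: lip_approxZ.
    apply/funext => x; rewrite !indicE in_setD.
    have [xC|xC] := boolP (x \in C); last by rewrite !mul0r mulr0 addr0 andbT.
    by rewrite (mem_set (CB _ (set_mem xC)))/= mul0r; ring.
  - move=> B nB HB; have mB i := (HB i).1; split; first exact: bigcup_measurable.
    apply: (@lip_approx_lim (fun m x => \1_(B m) x * cutoff k x) _ (cutoff k)).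
    + by move=> m; exact: (HB m).2.
    + exact: sqint_cutoff.
    + by apply: measurable_funM; [apply: measurable_indic; exact: bigcup_measurable|exact: measurable_cutoff].
    + by move=> m x; exact: indic_cutoff_le.
    + by move=> x; exact: indic_cutoff_le.
    + move=> x; apply: cvgMl.
      have [xB|xB] := pselect ((\bigcup_i B i) x).
        have [i _ Bi] := xB; apply: cvg_near_cst; near=> m.
        have Bm : B m x.
          suff : (B i <= B m)%O by move=> /subsetPset; apply.
          by apply: nB; near: m; exact: nbhs_infty_ge.
        by rewrite !indicE !mem_set.
      rewrite (_ : (fun m => _) = fun=> 0); first by rewrite indicE memNset//; exact: cvg_cst.
      by apply/funext => m; rewrite indicE memNset// => Bm; apply: xB; exists m.
have GH : halfspace_system `<=` H.
  by move=> _ [s ->]; split; [exact: measurable_halfspaces|exact: halfspaces_approx].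
have sub := lambda_system_subset setIG lH GH (fun X _ => @subsetT _ X).
move=> mA; suff : <<s halfspace_system >> A by move=> /sub[].
(* The coordinates are measurable for the sigma-algebra generated by the half-spaces, so it contains
   every Borel set. *)
pose T := g_sigma_algebraType halfspace_system.
have mc i : measurable_fun (setT : set T) (fun x : T => (x : 'rV[R]_n) ord0 i).
  apply: (measurability _ (RGenOInfty.measurableE R)) => _ [_ [a ->] <-].
  rewrite setTI; apply: sub_sigma_algebra; exists [:: (i, a)].
  by apply/seteqP; split => x; rewrite /halfspaces/= in_itv/= !andbT.
have mid : measurable_fun (setT : set T) (fun x : T => (x : 'rV[R]_n)).
  exact/measurable_fun_rVP.
by have := mid measurableT A mA; rewrite setTI.
Unshelve. all: by end_near. Qed.

End lipschitz_approximation.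

Section density.
Context {R : realType} {n : nat}.
Notation leb := (@lebesgue_rV R n).
Implicit Types (F G f g h : 'rV[R]_n -> R).

Lemma lip_approx0 : lip_approx (fun _ : 'rV[R]_n => 0 : R).
Proof.
apply: lip_approx_lip; first exact: bounded_lipschitz_cst.
by exists 0.
Qed.

Lemma lip_approx_sum (I : Type) (s : seq I) (f : I -> 'rV[R]_n -> R) :
  (forall i, lip_approx (f i)) -> lip_approx (fun x => \sum_(i <- s) f i x).
Proof.
move=> fi; elim: s => [|i s IH].
  by under eq_fun do rewrite big_nil; exact: lip_approx0.
by under eq_fun do rewrite big_cons; exact: lip_approxD.
Qed.

Lemma ge0_sqint_lip_approx F : sqint leb F -> (forall x, 0 <= F x) -> lip_approx F.
Proof.
move=> sF F0; have mF : measurable_fun setT (EFin \o F) by apply/measurable_EFinP; exact: sF.1.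
have FE0 : forall x, setT x -> (0 <= (EFin \o F) x)%E by move=> x _; rewrite lee_fin.
pose u := nnsfun_approx measurableT mF.
have cu x : u k x @[k --> \oo] --> F x.
  by have /fine_cvgP[] := cvg_nnsfun_approx measurableT mF FE0 (x := x) Logic.I.
have u_le k x : u k x <= F x.
  rewrite -(cvg_lim (@Rhausdorff R) (cu x)).
  apply: (@nondecreasing_cvgn_le _ (fun k => u k x)); last by apply/cvg_ex; exists (F x).
  by move=> i j ij; have /asboolP := nd_nnsfun_approx measurableT mF ij; exact.
have u0 k x : 0 <= u k x by exact: fun_ge0.
apply: (@lip_approx_lim _ _ (fun k x => u k x * cutoff k x) F F) => //.
- move=> k; rewrite (_ : (fun x => _) = fun x =>
    \sum_(y <- finmap.enum_fset (fset_set (range (u k))))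
      y * (\1_(u k @^-1` [set y]) x * cutoff k x)); last first.
    apply/funext => x; rewrite {1}(fimfunE (u k)) fsbig_finite//= mulr_suml.
    by apply: eq_bigr => y _; rewrite mulrA.
  apply: lip_approx_sum => y; apply: lip_approxZ; apply: indic_approx.
  exact: measurable_sfunP.
- exact: sF.1.
- move=> k x; rewrite ger0_norm ?mulr_ge0 ?cutoff_ge0//.
  by apply: le_trans (u_le k x); rewrite ler_piMr ?cutoff_le1.
- by move=> x; rewrite ger0_norm.
- move=> x; rewrite -[X in _ --> X]mulr1; apply: cvgM; last exact: cvg_flat_sub.
  exact: cu.
Qed.

Lemma sqint_lip_approx F : sqint leb F -> lip_approx F.
Proof.
move=> sF; have mF := sF.1.
have mm (G : 'rV[R]_n -> R) : measurable_fun setT G ->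
    measurable_fun setT (fun x => Num.max (G x) 0).
  by move=> mG; apply: measurable_maxr => //; exact: measurable_cst.
have hp (G : 'rV[R]_n -> R) : sqint leb G -> lip_approx (fun x => Num.max (G x) 0).
  move=> sG; apply: ge0_sqint_lip_approx; last by move=> x; rewrite le_max lexx orbT.
  apply: (sqint_le (c := 1) _ sG); first by apply: mm; exact: sG.1.
  by move=> x; rewrite mul1r; case: (leP (G x) 0) => _; rewrite ?expr0n ?sqr_ge0.
have := lip_approxD (hp _ sF) (lip_approxZ (-1) (hp _ (sqintN sF))).
rewrite (_ : (fun x => _ + _) = F)//; apply/funext => x.
by case: (leP (F x) 0) => ?; case: (leP (- F x) 0) => ?; lra.
Qed.

(** The mollifier lives in |x - t|^2 <= r, so the difference is at most C n sqrt r. For r < 1 it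
    vanishes outside |x|^2 <= 2 M + 2, by |x|^2 <= 2 |x - t|^2 + 2 |t|^2. The squared error is
    therefore of order r. *)
Lemma convol_lip_cvg g : bounded_lipschitz g -> small_support g ->
  forall e : R, 0 < e -> exists2 r0 : R, 0 < r0 & forall r, 0 < r < r0 ->
  (\int[leb]_x ((convol (mollifier r) g x - g x) ^+ 2)%:E <= e%:E)%E.
Proof.
move=> [mg [C [C0 gC gL]]] [M gM] e e0.
have sg : sqint leb g.
  apply: (sqint_le (c := C ^+ 2) mg (sqint_indic_eball M)) => x.
  rewrite indicE; have [xM|xM] := leP (sqnorm x) M.
    by rewrite mem_set//= expr1n mulr1 -[g x ^+ 2]real_normK ?num_real// ler_sqr ?nnegrE.
  by rewrite gM// expr0n mulr_ge0 ?sqr_ge0.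
pose M' := 2 * M + 2; pose V := fine (leb (eball M')).
have V0 : 0 <= V by exact: fine_ge0.
pose D := (C * n%:R) ^+ 2 * V + 1.
have D0 : 0 < D by rewrite ltr_wpDl// mulr_ge0// sqr_ge0.
exists (Num.min 1 (e / D)); first by rewrite lt_min ltr01 divr_gt0.
move=> r /andP[r0]; rewrite lt_min => /andP[r1 re].
have bM := @bump_mollifier R n r.
have key x : (convol (mollifier r) g x - g x) ^+ 2 <= (C * n%:R) ^+ 2 * r * \1_(eball M') x.
  have iM : leb.-integrable setT (EFin \o (fun t : 'rV[R]_n => mollifier r (x - t))).
    apply/integrableP; split.
      apply/measurable_EFinP; apply: (measurableT_comp (measurable_bump bM)).
      by apply: measurable_rVB; [exact: measurable_cst|exact: measurable_id].
    rewrite (eq_integral (fun t : 'rV[R]_n => (mollifier r (x - t))%:E)); last first.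
      by move=> t _; rewrite /= ger0_norm ?mollifier_ge0.
    rewrite (@ge0_integral_rV_reflect _ _ x (fun t : 'rV[R]_n => (mollifier r t)%:E)).
    - by rewrite integral_mollifier// ltry.
    - by apply/measurable_EFinP; exact: (measurable_bump bM).
    - by move=> t; rewrite lee_fin mollifier_ge0.
  have M1 : \int[leb]_t mollifier r (x - t) = 1.
    rewrite /Rintegral (@ge0_integral_rV_reflect _ _ x (fun t : 'rV[R]_n => (mollifier r t)%:E)).
    - by rewrite integral_mollifier.
    - by apply/measurable_EFinP; exact: (measurable_bump bM).
    - by move=> t; rewrite lee_fin mollifier_ge0.
  have iMg := integrable_convol x bM sg.
  have iMgx : leb.-integrable setT (EFin \o (fun t : 'rV[R]_n => g x * mollifier r (x - t))).
    by have := integrableZl measurableT (g x) iM; apply: eq_integrable.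
  have dE : convol (mollifier r) g x - g x = \int[leb]_t (mollifier r (x - t) * g t - g x * mollifier r (x - t)).
    by rewrite RintegralB// RintegralZl// M1 mulr1.
  have n0 : 0 <= C * n%:R * Num.sqrt r by rewrite !mulr_ge0 ?sqrtr_ge0.
  have dle : `|convol (mollifier r) g x - g x| <= C * n%:R * Num.sqrt r.
    rewrite dE; apply: (le_trans (le_normr_Rintegral _ _)) => //.
      by have := integrableB measurableT iMg iMgx; apply: eq_integrable.
    set K := leRHS; rewrite -[K]mulr1 -M1 -RintegralZl//; apply: le_Rintegral => //.
    - by have := integrable_abse (integrableB measurableT iMg iMgx); apply: eq_integrable.
    - by have := integrableZl measurableT K iM; apply: eq_integrable.
    - move=> t _; rewrite [_ * g t]mulrC -mulrBl normrM (ger0_norm (mollifier_ge0 _ _)).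
      have [rt|rt] := leP r (sqnorm (x - t)).
        by rewrite (bump_eq0 bM rt) !mulr0.
      rewrite ler_wpM2r ?mollifier_ge0// /K.
      have := gL x (t - x); rewrite subrK => /le_trans; apply.
      rewrite -mulrA ler_wpM2l// mulr_natl -[X in _ *+ X]card_ord -sumr_const.
      apply: ler_sum => i _; rewrite -(@ler_pXn2r _ 2) ?nnegrE ?sqrtr_ge0//.
      rewrite real_normK ?num_real// sqr_sqrtr ?ltW//.
      by rewrite -[t - x]opprB mxE sqrrN; exact: le_lt_trans (sqr_coord_le _ _) rt.
  rewrite indicE; have [xM|xM] := leP (sqnorm x) M'.
    rewrite mem_set// mulr1 -[leLHS]real_normK ?num_real//.
    apply: (@le_trans _ _ ((C * n%:R * Num.sqrt r) ^+ 2)); first by rewrite ler_sqr ?nnegrE.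
    by rewrite exprMn sqr_sqrtr// ltW.
  rewrite memNset ?mulr0; last by move=> /= /le_lt_trans/(_ xM); rewrite ltxx.
  have far t : mollifier r (x - t) * g t = 0.
    have [rt|rt] := leP r (sqnorm (x - t)); first by rewrite (bump_eq0 bM rt) mul0r.
    rewrite gM ?mulr0// ltNge; apply/negP => tM.
    have := sqnormD_le (x - t) t; rewrite subrK => H.
    by move: xM; rewrite /M' ltNge => /negP; apply; apply: (le_trans H); lra.
  have gx : g x = 0.
    (* M may be negative, in which case g vanishes everywhere; otherwise M < M'. *)
    apply: gM; have [M0|M0] := leP 0 M; last exact: lt_le_trans (sqnorm_ge0 x).
    by apply: le_lt_trans xM; rewrite /M'; lra.
  rewrite gx subr0 /convol /superposition; under eq_Rintegral do rewrite far.
  by rewrite Rintegral_cst// mul0r expr0n.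
apply: (@le_trans _ _ (\int[leb]_x ((C * n%:R) ^+ 2 * r * \1_(eball M') x)%:E)%E).
  apply: ge0_eintegral_le => //.
  - apply: measurable_funX; apply: measurable_funB => //.
    exact: measurable_convol bM sg.
  - by apply: measurable_funM => //; apply: measurable_indic; exact: measurable_eball.
  - by move=> x; exact: sqr_ge0.
rewrite ge0_eintegralZ; last 3 first.
- by apply: measurable_indic; exact: measurable_eball.
- by rewrite mulr_ge0 ?sqr_ge0// ltW.
- by move=> x; rewrite indicE; case: (_ \in _).
rewrite integral_indic ?setIT//; last exact: measurable_eball.
apply: (@le_trans _ _ (((C * n%:R) ^+ 2 * r)%:E * V%:E)%E).
  apply: lee_wpmul2l; first by rewrite lee_fin mulr_ge0 ?sqr_ge0// ltW.
  by rewrite /V fineK// ge0_fin_numE//; exact: eball_lty.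
rewrite -EFinM lee_fin mulrAC.
apply: (@le_trans _ _ (D * r)); first by rewrite ler_wpM2r ?ltW// /D; lra.
by rewrite mulrC -ler_pdivlMr// ltW.
Qed.

(** Mollification is a contraction of L^2, so replacing F by a nearby Lipschitz function costs the
    same before and after it. *)
Lemma convol_mollifier_cvg F : sqint leb F ->
  forall e : R, 0 < e -> exists2 r0 : R, 0 < r0 & forall r, 0 < r < r0 ->
  (\int[leb]_x ((convol (mollifier r) F x - F x) ^+ 2)%:E <= e%:E)%E.
Proof.
(* Two uses of (a + b)^2 <= 2 a^2 + 2 b^2 combine the three errors into 2 (2 (e/10 + e/10) + e/10) =
   e. *)
move=> sF e e0; have e10 : 0 < e / 10 by rewrite divr_gt0.
have [g [lg sg Fg]] := (sqint_lip_approx sF).2 _ e10.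
have [r0 r00 Hr] := convol_lip_cvg lg sg e10.
have [M gM] := sg; have [mg [C [C0 gC _]]] := lg.
have sqg : sqint leb g.
  apply: (sqint_le (c := C ^+ 2) mg (sqint_indic_eball M)) => x.
  rewrite indicE; have [xM|xM] := leP (sqnorm x) M.
    by rewrite mem_set//= expr1n mulr1 -[g x ^+ 2]real_normK ?num_real// ler_sqr ?nnegrE.
  by rewrite gM// expr0n mulr_ge0 ?sqr_ge0.
exists r0 => // r rr; have bM := @bump_mollifier R n r.
have /andP[rp _] := rr.
have cB x : convol (mollifier r) F x - convol (mollifier r) g x =
    convol (mollifier r) (fun t => F t - g t) x.
  rewrite /convol /superposition -RintegralB//; last 2 first.
  - exact: integrable_convol bM sF.
  - exact: integrable_convol bM sqg.
  by apply: eq_Rintegral => t _; ring.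
have sFg := sqintB sF sqg.
have mcF := measurable_convol bM sF; have mcg := measurable_convol bM sqg.
rewrite (eq_integral (fun x => (((convol (mollifier r) (fun t => F t - g t) x +
  (convol (mollifier r) g x - g x)) + (g x - F x)) ^+ 2)%:E)); last first.
  by move=> x _; rewrite -cB; congr EFin; congr (_ ^+ 2); ring.
have mc1 := measurable_convol bM sFg.
have mc2 : measurable_fun setT (fun x => convol (mollifier r) g x - g x) by exact: measurable_funB.
have mF := sF.1.
apply: (le_trans (integral_sqr_addD_le _ _)).
- exact: measurable_funD.
- exact: measurable_funB.
apply: (@le_trans _ _ (2%:E * ((2%:E * ((e / 10)%:E + (e / 10)%:E)) + (e / 10)%:E))%E); last first.
  by rewrite -?(EFinD, EFinM) lee_fin; lra.
apply: lee_wpmul2l; first by rewrite lee_fin.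
apply: leeD; last first.
  rewrite (eq_integral (fun x => ((F x - g x) ^+ 2)%:E)); first exact: Fg.
  by move=> x _; rewrite -sqrrN opprB.
apply: (le_trans (integral_sqr_addD_le mc1 mc2)).
apply: lee_wpmul2l; first by rewrite lee_fin.
apply: leeD; last exact: Hr.
exact: le_trans (convol_mollifier_le rp sFg) _.
Qed.

End density.

(** * Weak Laplacians *)

Section weak_rellich.
Context {R : realType} {n : nat}.
Notation leb := (@lebesgue_rV R n).
Implicit Types (F G : 'rV[R]_n -> R).

Lemma measurable_inv d (T : measurableType d) (f : T -> R) :
  measurable_fun setT f -> (forall x, 0 <= f x) -> measurable_fun setT (fun x => (f x)^-1).
Proof.
move=> mf f0; rewrite (_ : (fun x => _) = fun x => f x `^ (-1)).
  exact: (measurableT_comp (measurable_powR _) mf).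
by apply/funext => x; rewrite powR_inv1.
Qed.

Lemma measurable_div_sqnorm F (e : R) : 0 <= e -> measurable_fun setT F ->
  measurable_fun setT (fun x => F x ^+ 2 / (sqnorm x + e) ^+ 2).
Proof.
move=> e0 mF; apply: measurable_funM; first exact: measurable_funX.
apply: measurable_inv => [|x]; last exact: sqr_ge0.
apply: measurable_funX; apply: measurable_funD; last exact: measurable_cst.
exact: (measurable_sqnorm (f := id)).
Qed.

(** For fixed e the weight is at most e^-2, so convergence of the mollifications in L^2 suffices.
    The inequality F^2 <= (1 + eta) f^2 + (1 + 1/eta) (f - F)^2 preserves the sharp constant as eta
    -> 0. *)
Lemma weak_rellich_eps F G (e : R) : (3 <= n)%N -> 0 < e ->
  weak_laplacian F G -> radial_orthogonal F ->
  (((n%:R ^+ 2 / 4 - 1) ^+ 2)%:E *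
     \int[leb]_x (F x ^+ 2 / (sqnorm x + e) ^+ 2)%:E
   <= \int[leb]_x (G x ^+ 2)%:E)%E.
Proof.
move=> n3 e0 FG oF; have [sF sG _] := FG.
set c := (_ - 1) ^+ 2; have c0 : 0 <= c by exact: sqr_ge0.
set A := (\int[leb]_x (G x ^+ 2)%:E)%E.
have A0 : (0 <= A)%E by apply: integral_ge0 => x _; rewrite lee_fin sqr_ge0.
have Afin : A \is a fin_num by rewrite ge0_fin_numE//; exact: sG.2.
pose a := fine A; have a0 : 0 <= a by exact: fine_ge0.
have AE : A = a%:E by rewrite /a fineK.
apply/lee_addgt0Pr => d d0.
(* The factor 1 + eta costs eta a <= d / 2; the mollification radius is then chosen so that the term
   in (f - F)^2 costs at most d / 2 too. *)
pose eta := d / (2 * (a + 1)).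
have eta0 : 0 < eta by rewrite divr_gt0// mulr_gt0// ltr_wpDl.
have K1 : 0 <= (1 + eta^-1) / e ^+ 2 by rewrite divr_ge0 ?sqr_ge0// addr_ge0// invr_ge0 ltW.
pose K := c * ((1 + eta^-1) / e ^+ 2).
have K0 : 0 <= K by exact: mulr_ge0.
have dK : 0 < d / (2 * (K + 1)) by rewrite divr_gt0// mulr_gt0// ltr_wpDl.
have [r0 r00 Hr] := convol_mollifier_cvg sF dK.
pose r := r0 / 2; have rr : 0 < r < r0 by rewrite /r; lra.
have /andP[rp _] := rr; have {Hr} Hr := Hr r rr.
have bM := @bump_mollifier R n r.
set f := convol (mollifier r) F in Hr.
have mf : measurable_fun setT f := measurable_convol bM sF.
have HM := mollified_rellich n3 rp e0 FG oF.
have q0 (x : 'rV[R]_n) : 0 < sqnorm x + e by rewrite ltr_wpDl// sqnorm_ge0.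
have mq : measurable_fun setT (fun x => f x ^+ 2 / (sqnorm x + e) ^+ 2).
  by apply: measurable_div_sqnorm => //; exact: ltW.
have md : measurable_fun setT (fun x => (f x - F x) ^+ 2).
  by apply/measurable_funX/measurable_funB => //; exact: sF.1.
have pos x : 0 <= f x ^+ 2 / (sqnorm x + e) ^+ 2 by rewrite divr_ge0 ?sqr_ge0.
have eta1 : 0 <= 1 + eta by rewrite addr_ge0// ltW.
apply: (@le_trans _ _ (c%:E * \int[leb]_x ((1 + eta) * (f x ^+ 2 / (sqnorm x + e) ^+ 2) +
    (1 + eta^-1) / e ^+ 2 * (f x - F x) ^+ 2)%:E)%E).
  apply: lee_wpmul2l; first by rewrite lee_fin.
  apply: ge0_eintegral_le.
  - by apply: measurable_div_sqnorm; [exact: ltW|exact: sF.1].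
  - by apply: measurable_funD; apply: measurable_funM.
  - by move=> x; rewrite divr_ge0 ?sqr_ge0.
  move=> x; have qe : e ^+ 2 <= (sqnorm x + e) ^+ 2.
    by rewrite ler_sqr ?nnegrE ?(ltW e0) ?(ltW (q0 x))// lerDr sqnorm_ge0.
  apply: (@le_trans _ _ ((1 + eta) * (f x ^+ 2 / (sqnorm x + e) ^+ 2) +
     (1 + eta^-1) * (f x - F x) ^+ 2 / (sqnorm x + e) ^+ 2)).
    rewrite mulrA -mulrDl ler_wpM2r ?invr_ge0 ?sqr_ge0//.
    have : 0 <= eta^-1 * (eta * f x - (F x - f x)) ^+ 2 by rewrite mulr_ge0 ?sqr_ge0// invr_ge0 ltW.
    rewrite (_ : eta^-1 * _ = eta * f x ^+ 2 - 2 * f x * (F x - f x) + eta^-1 * (f x - F x) ^+ 2).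
      by rewrite !mulrDl !mul1r => H; rewrite !expr2 in H *; lra.
    by field; rewrite gt_eqF.
  rewrite lerD2l [leRHS]mulrAC ler_wpM2l//.
    by rewrite mulr_ge0 ?sqr_ge0// addr_ge0// invr_ge0 ltW.
  by rewrite lef_pV2// posrE exprn_gt0.
rewrite ge0_eintegralD; [|exact: measurable_funM|exact: measurable_funM| |]; last 2 first.
- by move=> x; exact: mulr_ge0.
- by move=> x; rewrite mulr_ge0// sqr_ge0.
rewrite (ge0_eintegralZ _ mq)// (ge0_eintegralZ _ md)//; last by move=> x; exact: sqr_ge0.
rewrite ge0_muleDr; last 2 first.
- by rewrite mule_ge0// integral_ge0// => x _; rewrite lee_fin.
- by rewrite mule_ge0// integral_ge0// => x _; rewrite lee_fin sqr_ge0.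
apply: (@le_trans _ _ (((1 + eta) * a)%:E + (K * (d / (2 * (K + 1))))%:E)%E).
  apply: leeD.
    by rewrite muleCA [leRHS]EFinM -AE; apply: lee_wpmul2l; rewrite ?lee_fin.
  rewrite muleA -EFinM -/K [leRHS]EFinM.
  by apply: lee_wpmul2l; rewrite ?lee_fin.
rewrite AE -!EFinD lee_fin mulrDl mul1r -addrA lerD2l.
rewrite [leRHS](_ : d = d / 2 + d / 2); last by lra.
have half z : 0 <= z -> d / 2 * (z / (z + 1)) <= d / 2.
  move=> z0; rewrite ler_piMr ?(divr_ge0 (ltW d0))// ler_pdivrMr ?mul1r ?lerDl//.
  by rewrite ltr_wpDl.
apply: lerD.
  rewrite (_ : eta * a = d / 2 * (a / (a + 1))); first exact: half.
  by rewrite /eta; field; rewrite gt_eqF// ltr_wpDl.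
rewrite (_ : K * _ = d / 2 * (K / (K + 1))); first exact: half.
by field; rewrite gt_eqF// ltr_wpDl.
Qed.

Lemma weak_rellich F G : (3 <= n)%N -> weak_laplacian F G -> radial_orthogonal F ->
  (((n%:R ^+ 2 / 4 - 1) ^+ 2)%:E * \int[leb]_x (F x ^+ 2 / sqnorm x ^+ 2)%:E
   <= \int[leb]_x (G x ^+ 2)%:E)%E.
Proof.
move=> n3 FG oF; have [sF sG _] := FG.
set c := (_ - 1) ^+ 2.
have c0 : 0 < c.
  rewrite /c exprn_even_gt0//= subr_eq0 gt_eqF// ltr_pdivlMr// mul1r.
  apply: (@lt_le_trans _ _ (3%:R ^+ 2)); first by rewrite -natrX ltr_nat.
  by rewrite ler_sqr ?nnegrE// ler_nat.
have mF2 : measurable_fun setT (fun x => F x ^+ 2 / sqnorm x ^+ 2).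
  have := measurable_div_sqnorm (lexx 0) sF.1.
  by under eq_fun do rewrite addr0.
(* At x = 0 the quotient F^2 / |x|^4 is 0 by convention, while F^2 / (|x|^2 + e)^2 blows up there as
   e -> 0 if F(0) is not 0. The factor (|x|^2 / (|x|^2 + e))^2 vanishes at 0 and makes the
   convergence monotone to the right limit everywhere. *)
pose g (k : nat) (x : 'rV[R]_n) := F x ^+ 2 / sqnorm x ^+ 2 * (sqnorm x / (sqnorm x + k.+1%:R^-1)) ^+ 2.
have p0 (k : nat) (x : 'rV[R]_n) : 0 < sqnorm x + k.+1%:R^-1.
  by rewrite ltr_wpDl ?sqnorm_ge0// invr_gt0.
have g0 k x : 0 <= g k x by rewrite mulr_ge0 ?sqr_ge0// divr_ge0 ?sqr_ge0.
have mg k : measurable_fun setT (g k).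
  apply: measurable_funM => //; apply: measurable_funX; apply: measurable_funM.
    exact: (measurable_sqnorm (f := id)).
  apply: measurable_inv => [|x]; last exact: ltW.
  by apply: measurable_funD => //; exact: (measurable_sqnorm (f := id)).
have gle k x : g k x <= F x ^+ 2 / (sqnorm x + k.+1%:R^-1) ^+ 2.
  rewrite /g; have [->|x0] := eqVneq (sqnorm x) 0.
    by rewrite mul0r expr0n mulr0 divr_ge0 ?sqr_ge0.
  rewrite le_eqVlt; apply/orP; left; apply/eqP.
  have := p0 k x; move: (sqnorm x) (k.+1%:R^-1) x0 => s z s0 /gt_eqF/negbT sz.
  by field; rewrite s0 sz.
have ndg x : setT x -> {homo (fun k => (g k x)%:E) : i j / (i <= j)%N >-> (i <= j)%E}.
  move=> _ i j ij; rewrite lee_fin ler_wpM2l ?divr_ge0 ?sqr_ge0//.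
  have d0 m : 0 <= sqnorm x / (sqnorm x + m.+1%:R^-1).
    by rewrite divr_ge0 ?sqnorm_ge0// ltW.
  rewrite ler_sqr ?nnegrE// ler_wpM2l ?sqnorm_ge0//.
  by rewrite lef_pV2 ?posrE// lerD2l lef_pV2 ?posrE// ler_nat.
have cg x : (g k x)%:E @[k --> \oo] --> (F x ^+ 2 / sqnorm x ^+ 2)%:E.
  apply: cvg_EFin; first exact: nearW.
  rewrite /g /comp/=; have [->|x0] := eqVneq (sqnorm x) 0.
    under eq_fun do rewrite mul0r expr0n mulr0.
    by rewrite expr0n invr0 mulr0; exact: cvg_cst.
  rewrite -[X in _ --> X]mulr1; apply: cvgMr.
  have e1 : sqnorm x / (sqnorm x + 0) = 1 by rewrite addr0 divff.
  have H : sqnorm x / (sqnorm x + k.+1%:R^-1) @[k --> \oo] --> (1 : R).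
    rewrite -[X in _ --> X]e1; apply: cvgMr; apply: cvgV; first by rewrite addr0.
    have Hh : (k.+1%:R^-1 : R) @[k --> \oo] --> (0 : R) by exact: (@cvg_harmonic R).
    exact: (cvgD (cvg_cst _) Hh).
  by have := cvgM H H; rewrite mulr1; exact.
have -> : (\int[leb]_x (F x ^+ 2 / sqnorm x ^+ 2)%:E =
    limn (fun k => \int[leb]_x (g k x)%:E))%E.
  rewrite -(@monotone_convergence _ _ _ leb setT measurableT (fun k x => (g k x)%:E)).
  - by apply: eq_integral => x _; apply/esym/cvg_lim => //; exact: cg.
  - by move=> k; apply/measurable_EFinP.
  - by move=> k x _; rewrite lee_fin.
  - exact: ndg.
rewrite muleC -lee_pdivlMr//; apply: lime_le.
  apply/cvg_ex; eexists; apply: ereal_nondecreasing_cvgn => i j ij.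
  apply: ge0_eintegral_le => // x; have := ndg x Logic.I i j ij; by rewrite lee_fin.
near=> k; rewrite lee_pdivlMr// muleC.
have k0 : 0 < (k.+1%:R : R)^-1 by rewrite invr_gt0.
apply: le_trans (weak_rellich_eps n3 k0 FG oF).
apply: lee_wpmul2l; first by rewrite lee_fin ltW.
apply: ge0_eintegral_le => //.
by apply: measurable_div_sqnorm => //; exact: sF.1.
Unshelve. all: by end_near. Qed.

End weak_rellich.

(** * Test functions and the mollified equation *)

Section test_function_theory.
Context {R : realType} {n : nat}.
Notation leb := (@lebesgue_rV R n).
Variable phi : 'rV[R]_n -> R.
Hypothesis tphi : test_function phi.

Lemma test_continuous s : continuous (iter_partial s phi).
Proof. exact: (tphi.1 s).1. Qed.

Lemma test_measurable s : measurable_fun setT (iter_partial s phi).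
Proof. by apply: continuous_measurable_rV; exact: test_continuous. Qed.

Let K := closure [set x | phi x != 0].

Lemma test_eq0 s x : ~ K x -> iter_partial s phi x = 0.
Proof.
have oK : open (~` K) by rewrite openC; exact: closed_closure.
elim: s x => [|i s IH] x xK /=.
  by apply/eqP/negPn/negP => phix; apply: xK; exact: subset_closure.
rewrite /partial (@near_eq_derive _ _ _ _ (fun=> 0)) ?derive_cst//.
have : nbhs x (~` K) by exact: open_nbhs_nbhs.
by apply: filterS => y /IH.
Qed.

Lemma test_bounded s : exists C M : R, forall x, `|iter_partial s phi x| <= C * \1_(eball M) x.
Proof.
have cK : compact K := tphi.2.
have /compact_bounded[M [_ HM]] := cK.
have cfK : compact ((iter_partial s phi) @` K).
  by apply: continuous_compact => //; apply: continuous_subspaceT; exact: test_continuous.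
have /compact_bounded[C [_ HC]] := cfK.
have M1 : M < `|M| + 1 by rewrite (le_lt_trans (ler_norm _))// ltrDl.
have C1 : C < `|C| + 1 by rewrite (le_lt_trans (ler_norm _))// ltrDl.
exists (`|C| + 1), (n%:R * (`|M| + 1) ^+ 2) => x; rewrite indicE.
have [xK|xK] := pselect (K x); last by rewrite test_eq0// normr0 mulr_ge0// addr_ge0.
rewrite mem_set ?mulr1; first by apply: (HC _ C1); exists x.
rewrite /eball/= /sqnorm mulr_natl -[X in _ *+ X]card_ord -sumr_const.
apply: ler_sum => i _; rewrite -real_normK ?num_real// ler_sqr ?nnegrE ?addr_ge0//.
apply: le_trans (HM _ M1 x xK).
change (`|x ord0 i| <= mx_norm x); rewrite mx_normrE.
exact: (@le_bigmax _ _ _ _ (fun ij : 'I_1 * 'I_n => `|x ij.1 ij.2|) (ord0, i)).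
Qed.

Lemma integrable_indic_eball (M : R) : leb.-integrable setT (EFin \o (\1_(eball M) : 'rV[R]_n -> R)).
Proof.
have := integrable_sqr (@sqint_indic_eball R n M); apply: eq_integrable => // x _.
by rewrite /= indicE; case: (_ \in _); rewrite ?expr1n ?expr0n.
Qed.

Lemma integrable_bounded_test s (f : 'rV[R]_n -> R) (C : R) :
  measurable_fun setT f -> (forall x, `|f x| <= C) ->
  leb.-integrable setT (EFin \o (fun x => f x * iter_partial s phi x)).
Proof.
move=> mf fC; have [D [M DM]] := test_bounded s.
apply: (integrable_le (g := fun x => C * D * \1_(eball M) x)).
- by apply: measurable_funM => //; exact: test_measurable.
- by have := integrableZl measurableT (C * D) (integrable_indic_eball M); apply: eq_integrable.
- by move=> x; rewrite normrM -mulrA ler_pM.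
Qed.

Lemma sqint_test s : sqint leb (iter_partial s phi).
Proof.
have [D [M DM]] := test_bounded s.
apply: (sqint_le (c := D ^+ 2) (test_measurable s) (sqint_indic_eball M)) => x.
rewrite -real_normK ?num_real// -exprMn ler_sqr ?nnegrE//.
exact: le_trans (DM x).
Qed.

Lemma sqint_sum (I : Type) (r : seq I) (f : I -> 'rV[R]_n -> R) :
  (forall i, sqint leb (f i)) -> sqint leb (fun x => \sum_(i <- r) f i x).
Proof.
move=> sf; elim: r => [|i r IH].
  under eq_fun do rewrite big_nil; split; first exact: measurable_cst.
  by under eq_integral do rewrite expr0n; rewrite integral0.
by under eq_fun do rewrite big_cons; exact: sqintD.
Qed.

Lemma sqint_test_laplacian : sqint leb (classical_laplacian phi).
Proof. by apply: sqint_sum => i; exact: sqint_test. Qed.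

Lemma has_partial_shift i (N dN : 'rV[R]_n -> R) (y : 'rV[R]_n) :
  has_partial i N dN -> has_partial i (fun z => N (z - y)) (fun z => dN (z - y)).
Proof.
move=> pN x t; have := pN (x - y) t.
by under eq_fun do rewrite addrA; rewrite addrA.
Qed.

Lemma bump_test_ibp r (N dN : 'rV[R]_n -> R) y i s : bump r N -> bump r dN ->
  has_partial i N dN ->
  \int[leb]_z (dN (z - y) * iter_partial s phi z) =
  - \int[leb]_z (N (z - y) * iter_partial (i :: s) phi z).
Proof.
move=> bN bdN pN.
have msh (f : 'rV[R]_n -> R) : measurable_fun setT f -> measurable_fun setT (fun z : 'rV[R]_n => f (z - y)).
  move=> mf; apply: (measurableT_comp mf).
  by apply: measurable_rVB; [exact: measurable_id|exact: measurable_cst].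
have [C _ NC] := bump_bounded bN; have [D _ dND] := bump_bounded bdN.
have iN t : leb.-integrable setT (EFin \o (fun z : 'rV[R]_n => N (z - y) * iter_partial t phi z)).
  by apply: (@integrable_bounded_test _ _ C) => //; apply: msh; exact: measurable_bump bN.
have idN t : leb.-integrable setT (EFin \o (fun z : 'rV[R]_n => dN (z - y) * iter_partial t phi z)).
  by apply: (@integrable_bounded_test _ _ D) => //; apply: msh; exact: measurable_bump bdN.
have P : has_partial i (fun z : 'rV[R]_n => N (z - y) * iter_partial s phi z)
   (fun z : 'rV[R]_n => N (z - y) * iter_partial (i :: s) phi z + iter_partial s phi z * dN (z - y)).
  apply: has_partialM; first exact: has_partial_shift.
  exact: smooth_has_partial tphi.1.
have iS : leb.-integrable setT (EFin \o (fun z : 'rV[R]_n => N (z - y) * iter_partial (i :: s) phi z +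
    iter_partial s phi z * dN (z - y))).
  have := integrableD measurableT (iN (i :: s)) (idN s); apply: eq_integrable => // z _.
  by rewrite /= [_ * dN _]mulrC.
have [ddN bddN pdN] := bump_has_partial i bdN.
have lc : line_continuous i (fun z : 'rV[R]_n => N (z - y) * iter_partial (i :: s) phi z +
    iter_partial s phi z * dN (z - y)).
  apply: line_continuousD; apply: line_continuousM.
  - exact: has_partial_line_continuous (has_partial_shift y pN).
  - exact: has_partial_line_continuous (smooth_has_partial i (i :: s) tphi.1).
  - exact: has_partial_line_continuous (smooth_has_partial i s tphi.1).
  - exact: has_partial_line_continuous (has_partial_shift y pdN).
have := integral_partial_eq0 P lc (iN s) iS => H.
apply/eqP; rewrite -addr_eq0 addrC.
rewrite -RintegralD//; apply/eqP.
transitivity (fine (\int[leb]_z (N (z - y) * iter_partial (i :: s) phi z +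
    iter_partial s phi z * dN (z - y))%R%:E)).
  by apply: eq_Rintegral => z _; rewrite [_ * dN _]mulrC.
by rewrite H.
Qed.

End test_function_theory.

Section mollified_equation.
Context {R : realType} {n : nat}.
Notation leb := (@lebesgue_rV R n).
Implicit Types (U V : 'rV[R]_n -> R).

(** The pairing error is at most (2 eta)^-1 \int (f - U)^2 + eta / 2 \int psi^2; eta = e / (b + 1)
    and \int (f - U)^2 <= eta e make both terms at most e / 2. *)
Lemma mollified_pairing_cvg U (psi : 'rV[R]_n -> R) (e : R) : sqint leb U -> sqint leb psi ->
  0 < e -> exists2 r0 : R, 0 < r0 & forall r, 0 < r < r0 ->
  `|\int[leb]_x (convol (mollifier r) U x * psi x) - \int[leb]_x (U x * psi x)| <= e.
Proof.
move=> sU sp e0.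
pose b := fine (\int[leb]_x (psi x ^+ 2)%:E).
have b0 : 0 <= b by apply: fine_ge0; apply: integral_ge0 => x _; rewrite lee_fin sqr_ge0.
have bE : (\int[leb]_x (psi x ^+ 2)%:E = b%:E)%E.
  by rewrite /b fineK// ge0_fin_numE ?sp.2//; apply: integral_ge0 => x _; rewrite lee_fin sqr_ge0.
pose eta := e / (b + 1).
have b1 : 0 < b + 1 by rewrite ltr_wpDl.
have eta0 : 0 < eta by rewrite divr_gt0.
have [r0 r00 Hr] := convol_mollifier_cvg sU (mulr_gt0 eta0 e0).
exists r0 => // r rr; have {Hr} Hr := Hr r rr.
have sf := sqint_convol (@bump_mollifier R n r) sU.
set f := convol (mollifier r) U in sf Hr *.
have i1 := integrable_sqintM sf sp; have i2 := integrable_sqintM sU sp.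
have sfU := sqintB sf sU.
have ifU := integrable_sqintM sfU sp.
rewrite -RintegralB//; under eq_Rintegral do rewrite -mulrBl.
have iq1 : leb.-integrable setT (EFin \o (fun x => (2 * eta)^-1 * (f x - U x) ^+ 2)).
  by have := integrableZl measurableT (2 * eta)^-1 (integrable_sqr sfU); apply: eq_integrable.
have iq2 : leb.-integrable setT (EFin \o (fun x => eta / 2 * psi x ^+ 2)).
  by have := integrableZl measurableT (eta / 2) (integrable_sqr sp); apply: eq_integrable.
apply: (@le_trans _ _ (\int[leb]_x ((2 * eta)^-1 * (f x - U x) ^+ 2 + eta / 2 * psi x ^+ 2))).
  apply: (le_trans (le_normr_Rintegral _ _)) => //.
  apply: le_Rintegral => //.
  - by have := integrable_abse ifU; apply: eq_integrable.
  - by have := integrableD measurableT iq1 iq2; apply: eq_integrable.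
  - move=> x _; rewrite normrM -[(f x - U x) ^+ 2]real_normK ?num_real//.
    rewrite -[psi x ^+ 2]real_normK ?num_real//.
    have : 0 <= (2 * eta)^-1 * (`|f x - U x| - eta * `|psi x|) ^+ 2.
      by rewrite mulr_ge0 ?sqr_ge0// invr_ge0 mulr_ge0// ltW.
    rewrite (_ : _^-1 * (_ - _) ^+ 2 = (2 * eta)^-1 * `|f x - U x| ^+ 2 + eta / 2 * `|psi x| ^+ 2
      - `|f x - U x| * `|psi x|); first by rewrite subr_ge0.
    by field; rewrite gt_eqF.
rewrite RintegralD// !RintegralZl//; last 2 first.
- exact: integrable_sqr.
- exact: integrable_sqr.
have psiE : \int[leb]_x (psi x ^+ 2) = b by [].
have fUle : \int[leb]_x ((f x - U x) ^+ 2) <= eta * e.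
  rewrite -lee_fin /Rintegral fineK//.
  by have := integrable_fin_num measurableT (integrable_sqr sfU).
rewrite psiE; apply: (@le_trans _ _ ((2 * eta)^-1 * (eta * e) + eta / 2 * b)).
  by rewrite lerD2r ler_wpM2l// invr_ge0 mulr_ge0// ltW.
rewrite (_ : _^-1 * _ = e / 2); last by field; rewrite gt_eqF.
have : eta * b <= e.
  by rewrite /eta mulrAC ler_pdivrMr// ler_pM2l// lerDl.
by move: (eta) => z; lra.
Qed.

Lemma bump_sum r (I : Type) (s : seq I) (N : I -> 'rV[R]_n -> R) :
  (forall i, bump r (N i)) -> bump r (fun x => \sum_(i <- s) N i x).
Proof.
move=> bN; elim: s => [|i s IH].
  rewrite (_ : (fun x => _) = fun x => 0 * flat 1 (r - sqnorm x)); first exact/bumpZ/bump_flat.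
  by apply/funext => x; rewrite big_nil mul0r.
by under eq_fun do rewrite big_cons; exact: bumpD.
Qed.

(* The hypothesis says that the mollified equation holds pointwise; integrated
   against phi, it becomes the equation for phi up to an L^2-small error. *)
Lemma weak_laplacian_mollifier U V : sqint leb U -> sqint leb V ->
  (forall r z, 0 < r ->
    \int[leb]_t (U t * classical_laplacian (fun y => mollifier r (z - y)) t) =
    \int[leb]_t (V t * mollifier r (z - t))) ->
  weak_laplacian U V.
Proof.
move=> sU sV H; split=> // phi tphi.
have sphi : sqint leb phi := sqint_test tphi [::].
have sLphi := sqint_test_laplacian tphi.
(* Write M for the mollifier and L for its Laplacian. Then \int (M * U) Delta phi = \int U (M *
   Delta phi) = \int U (L * phi) = \int (L * U) phi, and the hypothesis says L * U = M * V. *)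
have key r : 0 < r -> \int[leb]_x (convol (mollifier r) U x * classical_laplacian phi x) =
    \int[leb]_x (convol (mollifier r) V x * phi x).
  move=> r0; have bM := @bump_mollifier R n r.
  have [d dP] := bump_partials bM.
  have /choice[dd ddP] : forall i, exists ddi, bump r ddi /\ has_partial i (d i) ddi.
    by move=> i; have [dd ? ?] := bump_has_partial i (dP i).1; exists dd.
  have bd i := (dP i).1; have pd i := (dP i).2.
  have bdd i := (ddP i).1; have pdd i := (ddP i).2.
  have neg (y t : 'rV[R]_n) : mollifier r (y - t) = mollifier r (t - y).
    by rewrite -mollifierN opprB.
  pose L x := \sum_i dd i x.
  have bL : bump r L by exact: bump_sum.
  have VL y : convol (mollifier r) V y = convol L U y.
    rewrite /convol /superposition.
    transitivity (\int[leb]_t (V t * mollifier r (y - t))).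
      by apply: eq_Rintegral => t _; rewrite mulrC.
    rewrite -H// (laplacian_reflect y pd pdd).
    by apply: eq_Rintegral => t _; rewrite mulrC.
  have Lphi t : \int[leb]_y (L (y - t) * phi y) = convol (mollifier r) (classical_laplacian phi) t.
    transitivity (\sum_i \int[leb]_y (dd i (y - t) * phi y)).
      have [C HC] : exists C : 'I_n -> R, forall i x, `|dd i x| <= C i.
        have /choice[C HC] : forall i, exists C, forall x, `|dd i x| <= C.
          by move=> i; have [C _ HC] := bump_bounded (bdd i); exists C.
        by exists C.
      have msh i : measurable_fun setT (fun y : 'rV[R]_n => dd i (y - t)).
        apply: (measurableT_comp (measurable_bump (bdd i))).
        by apply: measurable_rVB; [exact: measurable_id|exact: measurable_cst].
      have [_ <-] := @Rintegral_sum _ _ R leb _ (index_enum 'I_n) (fun i y => dd i (y - t) * phi y)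
        (fun i => integrable_bounded_test tphi [::] (msh i) (fun x => HC i _)).
      by apply: eq_Rintegral => y _; rewrite /L mulr_suml.
    rewrite /convol /superposition.
    have [C _ HC] := bump_bounded bM.
    have msh : measurable_fun setT (fun y : 'rV[R]_n => mollifier r (t - y)).
      apply: (measurableT_comp (measurable_bump bM)).
      by apply: measurable_rVB; [exact: measurable_cst|exact: measurable_id].
    have [_ E] := @Rintegral_sum _ _ R leb _ (index_enum 'I_n)
      (fun i y => mollifier r (t - y) * iter_partial [:: i; i] phi y)
      (fun i => integrable_bounded_test tphi [:: i; i] msh (fun x => HC _)).
    transitivity (\sum_i \int[leb]_y (mollifier r (t - y) * iter_partial [:: i; i] phi y)).
      apply: eq_bigr => i _.
      refine (etrans (bump_test_ibp tphi t [::] (bd i) (bdd i) (pdd i)) _).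
      refine (etrans (congr1 -%R (bump_test_ibp tphi t [:: i] bM (bd i) (pd i))) _).
      by rewrite opprK; apply: eq_Rintegral => y _; rewrite neg.
    rewrite -E; apply: eq_Rintegral => y _.
    by rewrite -mulr_sumr.
  have [m m0 Lm] := bump_norm_integral_lty bL.
  have mL := measurable_bump bL.
  have mLs : measurable_fun setT (fun p : 'rV[R]_n * 'rV[R]_n => L (p.1 - p.2)).
    by apply: (measurableT_comp mL); apply: measurable_rVB; [exact: measurable_fst|exact: measurable_snd].
  have mLa : measurable_fun setT (fun t => (`|L t|)%:E).
    by apply/measurable_EFinP; exact: measurableT_comp.
  have K1 (y : 'rV[R]_n) : (\int[leb]_t (`|L (y - t)%R|)%:E <= m%:E)%E.
    by rewrite (@ge0_integral_rV_reflect _ _ y (fun t => (`|L t|)%:E)).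
  have K2 (t : 'rV[R]_n) : (\int[leb]_y (`|L (y - t)%R|)%:E <= m%:E)%E.
    by rewrite (@ge0_integral_rV_shift _ _ (- t) (fun t => (`|L t|)%:E)).
  have i2 (t : 'rV[R]_n) : leb.-integrable setT (fun y => (L (y - t)%R * phi y)%:E).
    have [C _ HC] := bump_bounded bL.
    apply: (integrable_bounded_test tphi [::] (C := C)) => //.
    by apply: (measurableT_comp mL); apply: measurable_rVB; [exact: measurable_id|exact: measurable_cst].
  have E1 := convol_mollifier_adjoint r0 sU sLphi.
  have E2 := @kernel_fubini _ _ _ _ R leb leb (fun y t : 'rV[R]_n => L (y - t)) phi U m
    (ltW m0) mLs sphi sU K1 K2 (fun y => integrable_convol y bL sU) i2.
  transitivity (fine (\int[leb]_y (classical_laplacian phi y * convol (mollifier r) U y)%:E)).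
    by apply: eq_Rintegral => y _; rewrite mulrC.
  rewrite [in LHS]E1.
  transitivity (fine (\int[leb]_t (U t * \int[leb]_y (L (y - t) * phi y))%R%:E)).
    by apply: eq_Rintegral => t _; rewrite Lphi.
  rewrite -[in LHS]E2.
  by apply: eq_Rintegral => y _; rewrite VL mulrC.
apply/eqP/negPn/negP => neq.
(* Each side moves by at most a third of the supposed gap under mollification, while the mollified
   pairings coincide: a contradiction. *)
pose e := `|\int[leb]_x (U x * classical_laplacian phi x) - \int[leb]_x (V x * phi x)| / 3.
have e0 : 0 < e by rewrite divr_gt0// normr_gt0 subr_eq0.
have [r1 r10 H1] := mollified_pairing_cvg sU sLphi e0.
have [r2 r20 H2] := mollified_pairing_cvg sV sphi e0.
pose r := Num.min r1 r2 / 2.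
have m0 : 0 < Num.min r1 r2 by rewrite lt_min r10.
have r0 : 0 < r by rewrite divr_gt0.
have rm : r < Num.min r1 r2 by rewrite /r; lra.
have /andP[ra rb] : (r < r1) && (r < r2) by rewrite -lt_min.
have {}H1 := H1 r; have {}H2 := H2 r; rewrite r0 ra in H1; rewrite r0 rb in H2.
have := H1 isT; have := H2 isT; rewrite (key r r0).
set a := \int[leb]_x (convol _ V x * _); rewrite /e.
set u := \int[leb]_x (U x * _); set v := \int[leb]_x (V x * _) => h1 h2.
have : `|u - v| <= `|a - v| + `|a - u|.
  by rewrite (_ : u - v = (a - v) - (a - u)); [exact: ler_normB|ring].
have : 0 < `|u - v| by move: e0; rewrite /e -/u -/v; lra.
lra.
Qed.

End mollified_equation.

(** * Spherical means *)

Section sphere_integral.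
Context {R : realType} {n : nat}.
Notation leb := (@lebesgue_rV R n).
Notation sph := (@sphere_measure R n).
Implicit Types (x y z : 'rV[R]_n).

Definition unitv y := (enorm y)^-1 *: y.

Definition pball : set 'rV[R]_n := [set y | 0 < enorm y <= 1].

Lemma measurable_enormT d (T : measurableType d) (f : T -> 'rV[R]_n) :
  measurable_fun setT f -> measurable_fun setT (fun t => enorm (f t)).
Proof. by move=> mf; apply: measurableT_comp => //; exact: measurable_enorm. Qed.

Lemma measurable_unitv : measurable_fun setT unitv.
Proof.
apply: measurable_rVZ; last exact: measurable_id.
by apply: measurable_inv; [exact: measurable_enorm|move=> x; exact: enorm_ge0].
Qed.

Lemma measurable_pball : measurable pball.
Proof.
rewrite (_ : pball = setT `&` @enorm R n @^-1` `]0, 1]%classic).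
  exact: measurable_enorm.
by rewrite setTI; apply/seteqP; split => x /=; rewrite in_itv.
Qed.

Lemma measurable_sphere : measurable (@sphere R n).
Proof.
rewrite (_ : @sphere R n = setT `&` @enorm R n @^-1` [set 1]); last by rewrite setTI.
by apply: measurable_enorm => //; exact: measurable_set1.
Qed.

Lemma enorm_unitv y : y != 0 -> enorm (unitv y) = 1.
Proof.
move=> y0; rewrite enormZ ger0_norm ?invr_ge0 ?enorm_ge0// mulVf// gt_eqF//.
by rewrite enorm_gt0.
Qed.

(** Radial projection of the punctured ball, extended by 0 outside it, so that the preimage of the
    sphere is exactly [pball]. *)
Let ray y : 'rV[R]_n := \1_pball y *: unitv y.

Let measurable_ray : measurable_fun setT ray.
Proof.
apply: measurable_rVZ; last exact: measurable_unitv.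
by apply: measurable_indic; exact: measurable_pball.
Qed.

Let ray_sphere : ray @^-1` (@sphere R n) = pball.
Proof.
apply/seteqP; split => y; rewrite /sphere/= /ray indicE.
  have [/set_mem//|_] := boolP (y \in pball).
  by rewrite scale0r /enorm big1 ?sqrtr0 => [/eqP|i _]; rewrite ?mxE ?expr0n// eq_sym oner_eq0.
by move=> yB; rewrite mem_set// scale1r enorm_unitv// -enorm_gt0; case/andP: yB.
Qed.

(** For A inside the sphere, [cone A] is the preimage of A under [ray]: the surface measure is n
    times an image of Lebesgue measure. *)
Lemma ge0_sphere_integral (h : 'rV[R]_n -> R) : measurable_fun setT h ->
  (forall w, 0 <= h w) ->
  (\int[sph]_(w in @sphere R n) (h w)%:E =
   n%:R%:E * \int[leb]_y (\1_pball y * h (unitv y))%:E)%E.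
Proof.
move=> mh h0.
pose pf0 : {measure set 'rV[R]_n -> \bar R} := pushforward leb ray.
pose pf : {measure set 'rV[R]_n -> \bar R} := mscale (NngNum (ler0n R n)) (pf0 measurable_ray).
rewrite (@eq_measure_integral _ _ _ _ pf); last first.
  move=> A mA AS; rewrite /pf /pf0 /mscale/= /sphere_measure /pushforward.
  suff -> : cone A = ray @^-1` A by [].
  apply/seteqP; split => y.
    by move=> [y1 Ay]; rewrite /= /ray indicE mem_set// scale1r.
  move=> Ay; have : (ray @^-1` (@sphere R n)) y by exact: AS.
  by rewrite ray_sphere => yB; split => //; move: Ay; rewrite /= /ray indicE mem_set// scale1r.
rewrite ge0_integral_mscale; [|exact: measurable_sphere|apply: measurable_funTS; exact/measurable_EFinP|
  by move=> x _; rewrite lee_fin].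
congr (_ * _)%E.
rewrite ge0_integral_pushforward; [|exact: measurable_ray|exact: measurable_sphere|
  apply: measurable_funTS; exact/measurable_EFinP|by move=> x _; rewrite lee_fin].
rewrite ray_sphere integral_mkcond; apply: eq_integral => y _.
rewrite /patch indicE /comp /ray indicE.
by case: (y \in pball); rewrite ?scale1r ?mul1r ?mul0r.
Qed.

Lemma sphere_Rintegral (h : 'rV[R]_n -> R) : (0 < n)%N -> measurable_fun setT h ->
  \int[sph]_(w in @sphere R n) h w = n%:R * \int[leb]_y (\1_pball y * h (unitv y)).
Proof.
move=> n0 mh; rewrite /Rintegral integralE [in RHS]integralE.
have mhu : measurable_fun setT (fun y => h (unitv y)).
  exact: (measurableT_comp mh measurable_unitv).
have mp (f : 'rV[R]_n -> R) : measurable_fun setT f -> measurable_fun setT (fun w => Num.max (f w) 0).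
  by move=> mf; apply: measurable_maxr => //; exact: measurable_cst.
have mN : measurable_fun setT (fun w => - h w) by exact: measurableT_comp.
have pE (f : 'rV[R]_n -> R) w : (EFin \o f)^\+%E w = (Num.max (f w) 0)%:E.
  by rewrite funeposE /= EFin_max.
have nE (f : 'rV[R]_n -> R) w : (EFin \o f)^\-%E w = (Num.max (- f w) 0)%:E.
  by rewrite funenegE /= EFin_max.
have -> : (\int[sph]_(x in @sphere R n) ((fun w => (h w)%:E)^\+)%E x =
    n%:R%:E * \int[leb]_y (((fun y => (\1_pball y * h (unitv y))%:E)^\+)%E y))%E.
  rewrite (eq_integral (fun w => (Num.max (h w) 0)%:E)); last by move=> w _; exact: pE.
  rewrite ge0_sphere_integral; [|exact: mp|by move=> w; rewrite le_max lexx orbT].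
  congr (_ * _)%E; apply: eq_integral => y _; rewrite [RHS]pE indicE.
  by case: (y \in pball); rewrite ?mul1r ?mul0r ?maxxx.
have -> : (\int[sph]_(x in @sphere R n) ((fun w => (h w)%:E)^\-)%E x =
    n%:R%:E * \int[leb]_y (((fun y => (\1_pball y * h (unitv y))%:E)^\-)%E y))%E.
  rewrite (eq_integral (fun w => (Num.max (- h w) 0)%:E)); last by move=> w _; exact: nE.
  rewrite ge0_sphere_integral; [|exact: mp|by move=> w; rewrite le_max lexx orbT].
  congr (_ * _)%E; apply: eq_integral => y _; rewrite [RHS]nE indicE.
  by case: (y \in pball); rewrite ?mul1r ?mul0r ?oppr0 ?maxxx.
set a := (\int[leb]_y _)%E; set b := (\int[leb]_y _)%E.
have a0 : (0 <= a)%E by apply: integral_ge0 => y _; exact: funepos_ge0.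
have b0 : (0 <= b)%E by apply: integral_ge0 => y _; exact: funeneg_ge0.
have nR : 0 < n%:R :> R by rewrite ltr0n.
(* [fine] sends infinite values to 0, so both sides are 0 as soon as one of the two parts is
   infinite. *)
case: a a0 => [a| |] a0 //; case: b b0 => [b| |] b0 //=.
- by rewrite -mulrBr.
- by rewrite gt0_muley ?lte_fin//= mulr0.
- by rewrite gt0_muley ?lte_fin//= mulr0.
- by rewrite gt0_muley ?lte_fin//= mulr0.
Qed.

Lemma sphere_measure_sphere : sph (@sphere R n) = (n%:R%:E * leb pball)%E.
Proof.
rewrite /sphere_measure; suff -> : cone (@sphere R n) = pball by [].
apply/seteqP; split => [y []//|y yB]; split => //.
by apply: enorm_unitv; rewrite -enorm_gt0; case/andP: yB.
Qed.

End sphere_integral.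

(** * Polar coordinates *)

Section polar.
Context {R : realType} {n : nat}.
Hypothesis n0 : (0 < n)%N.
Notation leb := (@lebesgue_rV R n).
Implicit Types (x y z : 'rV[R]_n).

Lemma lebesgue_rV_point0 : leb [set 0] = 0%E.
Proof.
apply/eqP; rewrite eq_le measure_ge0 andbT; apply/lee_addgt0Pr => e e0; rewrite add0e.
pose r := Num.min 1 e / 2.
have m0 : 0 < Num.min 1 e by rewrite lt_min ltr01.
have r0 : 0 < r by rewrite divr_gt0.
have r1 : 2 * r <= 1 by rewrite /r mulrC divfK// ge_min lexx.
have re : 2 * r <= e by rewrite /r mulrC divfK// ge_min lexx orbT.
apply: (@le_trans _ _ (leb (cube r))).
  apply: le_measure; rewrite ?inE.
  - rewrite (_ : [set 0] = eball 0); first exact: measurable_eball.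
    apply/seteqP; split => x /=; first by move=> ->; rewrite /eball/= sqnormE /dot big1// => i _; rewrite mxE mul0r.
    by rewrite /eball/= => x0; apply/eqP; rewrite -sqnorm_eq0 eq_le x0 sqnorm_ge0.
  - exact: measurable_cube.
  - by move=> x -> i; rewrite mxE normr0 ltW.
rewrite lebesgue_cube ?(ltW r0)// lee_fin; apply: le_trans re.
by rewrite -[leRHS]expr1 ler_wiXn2l// mulr_ge0// ltW.
Qed.

(** The dilations below divide by |z| or |x|; their identities hold off the origin, a null set since
    n > 0. *)
Lemma ge0_integral_eq_neq0 (f g : 'rV[R]_n -> \bar R) :
  measurable_fun setT f -> measurable_fun setT g ->
  (forall x, 0 <= f x)%E -> (forall x, 0 <= g x)%E -> (forall x, x != 0 -> f x = g x) ->
  (\int[leb]_x f x = \int[leb]_x g x)%E.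
Proof.
move=> mf mg f0 g0 fg; apply: ge0_ae_eq_integral => //.
exists [set 0]; split; [|exact: lebesgue_rV_point0|].
  rewrite (_ : [set 0] = @cube R n 0); first exact: measurable_cube.
  apply/seteqP; split => [x -> i|x x0]; first by rewrite mxE normr0.
  by apply/rowP => i; apply/eqP; rewrite mxE -normr_le0.
by move=> x /= H; apply/eqP/negPn/negP => x0; apply: H => _; exact: fg.
Qed.

Lemma enormZ_ge0 (t : R) x : 0 <= t -> enorm (t *: x) = t * enorm x.
Proof. by move=> t0; rewrite enormZ ger0_norm. Qed.

Lemma unitvZ y : y != 0 -> enorm y *: unitv y = y.
Proof. by move=> y0; rewrite scalerA divff ?scale1r// gt_eqF// enorm_gt0. Qed.

Lemma measurable_enorm_inv d (T : measurableType d) (f : T -> 'rV[R]_n) :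
  measurable_fun setT f -> measurable_fun setT (fun t => (enorm (f t))^-1).
Proof.
by move=> mf; apply: measurable_inv; [exact: measurable_enormT|move=> t; exact: enorm_ge0].
Qed.

Lemma measurable_indic_pball d (T : measurableType d) (f : T -> 'rV[R]_n) :
  measurable_fun setT f -> measurable_fun setT (fun t => \1_pball (f t) : R).
Proof.
move=> mf; have mi : measurable_fun setT (\1_pball : 'rV[R]_n -> R).
  by apply: measurable_indic; exact: measurable_pball.
exact: (measurableT_comp mi mf).
Qed.

Section polar_integral.
Variable H : 'rV[R]_n -> R.
Hypotheses (mH : measurable_fun setT H) (H0 : forall x, 0 <= H x).

Let f1 x y := \1_pball y * H (enorm x *: unitv y).
Let f2 y z := \1_pball y * enorm y ^+ n * H (enorm z *: y).
Let ker z x : R := (enorm z)^-1 ^+ n * (\1_pball ((enorm z)^-1 *: x) * ((enorm z)^-1 * enorm x) ^+ n).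
(** The kernel [ker z x] at z = |x| v, multiplied by the Jacobian |x|^n: it no longer depends on
    x. *)
Let k1 (v : 'rV[R]_n) : R := (enorm v)^-1 ^+ n * ((0 < (enorm v)^-1 <= 1)%R%:R * (enorm v)^-1 ^+ n).
Let f3 z x := ker z x * H x.

Let ind0 x : 0 <= \1_pball x :> R. Proof. by rewrite indicE. Qed.
Let e0 x : 0 <= (enorm x)^-1. Proof. by rewrite invr_ge0 enorm_ge0. Qed.
Let ker0 z x : 0 <= ker z x.
Proof. by rewrite mulr_ge0 ?exprn_ge0// mulr_ge0// exprn_ge0// mulr_ge0// enorm_ge0. Qed.
Let f10 x y : (0 <= (f1 x y)%:E)%E. Proof. by rewrite lee_fin mulr_ge0. Qed.
Let f20 x y : (0 <= (f2 x y)%:E)%E.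
Proof. by rewrite lee_fin mulr_ge0// mulr_ge0// exprn_ge0// enorm_ge0. Qed.
Let f30 x y : (0 <= (f3 x y)%:E)%E. Proof. by rewrite lee_fin mulr_ge0. Qed.

Let mfst := @measurable_fst _ _ 'rV[R]_n 'rV[R]_n.
Let msnd := @measurable_snd _ _ 'rV[R]_n 'rV[R]_n.

Let mf1 : measurable_fun setT (fun p => (f1 p.1 p.2)%:E).
Proof.
apply/measurable_EFinP; apply: measurable_funM; first exact: measurable_indic_pball.
apply: (measurableT_comp mH); apply: measurable_rVZ; first exact: measurable_enormT.
exact: (measurableT_comp measurable_unitv msnd).
Qed.

Let mf2 : measurable_fun setT (fun p => (f2 p.1 p.2)%:E).
Proof.
apply/measurable_EFinP; apply: measurable_funM.
  apply: measurable_funM; first exact: measurable_indic_pball.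
  by apply: measurable_funX; exact: measurable_enormT.
by apply: (measurableT_comp mH); apply: measurable_rVZ => //; exact: measurable_enormT.
Qed.

Let mker : measurable_fun setT (fun p => ker p.1 p.2).
Proof.
have mi := measurable_enorm_inv mfst.
apply: measurable_funM; first exact: measurable_funX.
apply: measurable_funM; first by apply: measurable_indic_pball; exact: measurable_rVZ.
by apply: measurable_funX; apply: measurable_funM => //; exact: measurable_enormT.
Qed.

Let mf3 : measurable_fun setT (fun p => (f3 p.1 p.2)%:E).
Proof.
by apply/measurable_EFinP; apply: measurable_funM => //; exact: (measurableT_comp mH msnd).
Qed.

(** The substitution x = |y| z, after which |x| y / |y| = |z| y. *)
Let step1 y : (\int[leb]_x (f1 x y)%:E = \int[leb]_z (f2 y z)%:E)%E.
Proof.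
have [yB|yB] := boolP (y \in pball); last first.
  rewrite (eq_integral (fun=> 0%E)); last by move=> x _; rewrite /f1 indicE (negbTE yB) mul0r.
  rewrite [RHS](eq_integral (fun=> 0%E)); last by move=> x _; rewrite /f2 indicE (negbTE yB) !mul0r.
  reflexivity.
have yp : 0 < enorm y by have /set_mem/= /andP[] := yB.
have mF : measurable_fun setT (fun x => (f1 x y)%:E) := measurableT_comp mf1 (measurable_pair2 y).
have A := ge0_integral_rV_affine 0 (lt0r_neq0 yp) mF (fun x => f10 x y).
have mFt : measurable_fun setT (fun z : 'rV[R]_n => f1 (enorm y *: z + 0) y).
  apply/measurable_EFinP; apply: (measurableT_comp (f := fun x => (f1 x y)%:E)) => //.
  by apply: measurable_rVD; [apply: measurable_rVZ; [exact: measurable_cst|exact: measurable_id]|exact: measurable_cst].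
rewrite [RHS](eq_integral (fun z => ((enorm y ^+ n) * (f1 (enorm y *: z + 0) y))%:E)); last first.
  move=> z _; rewrite /f2 /f1 addr0 enormZ_ge0 ?enorm_ge0// [enorm y * _]mulrC -scalerA unitvZ.
    by congr EFin; ring.
  by rewrite -enorm_gt0.
rewrite ge0_eintegralZ; [|exact: mFt|by rewrite exprn_ge0// enorm_ge0|
  by move=> z; rewrite -lee_fin].
rewrite [in RHS]A muleA -EFinM (ger0_norm (enorm_ge0 _)) exprVn divff ?mul1e//.
by rewrite expf_neq0// gt_eqF.
Qed.

(** The substitution y = x / |z|, which frees the argument of H. *)
Let step2 z : z != 0 -> (\int[leb]_y (f2 y z)%:E = \int[leb]_x (f3 z x)%:E)%E.
Proof.
rewrite -enorm_gt0 => zp.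
pose F x := \1_pball ((enorm z)^-1 *: x) * ((enorm z)^-1 * enorm x) ^+ n * H x.
have F0 x : 0 <= F x.
  by rewrite mulr_ge0// mulr_ge0// exprn_ge0// mulr_ge0// enorm_ge0.
have mF : measurable_fun setT F.
  apply: measurable_funM => //; apply: measurable_funM.
    by apply: measurable_indic_pball; apply: measurable_rVZ; [exact: measurable_cst|exact: measurable_id].
  by apply: measurable_funX; apply: measurable_funM => //; exact: measurable_enorm.
have mFE : measurable_fun setT (fun x => (F x)%:E) by exact/measurable_EFinP.
have A := ge0_integral_rV_affine 0 (lt0r_neq0 zp) mFE (fun x => F0 x).
rewrite (eq_integral (fun y => (F (enorm z *: y + 0))%:E)); last first.
  move=> y _; rewrite /f2 /F addr0 scalerA mulVf ?gt_eqF// scale1r enormZ_ge0 ?enorm_ge0//.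
  by rewrite mulrA mulVf ?gt_eqF// mul1r.
rewrite [LHS]A (ger0_norm (enorm_ge0 _)) -ge0_eintegralZ; [|exact: mF|by rewrite exprn_ge0|exact: F0].
by apply: eq_integral => x _; rewrite /f3 /ker /F; congr EFin; ring.
Qed.

Let step3 x : x != 0 -> (\int[leb]_z (ker z x)%:E = \int[leb]_v (k1 v)%:E)%E.
Proof.
rewrite -enorm_gt0 => xp.
have mF : measurable_fun setT (fun z => (ker z x)%:E).
  by apply/measurable_EFinP; exact: (measurableT_comp mker (measurable_pair2 x)).
have A := ge0_integral_rV_affine 0 (lt0r_neq0 xp) mF (fun z => ker0 z x).
have mFt : measurable_fun setT (fun v : 'rV[R]_n => ker (enorm x *: v + 0) x).
  apply/measurable_EFinP; apply: (measurableT_comp (f := fun z => (ker z x)%:E)) => //.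
  by apply: measurable_rVD; [apply: measurable_rVZ; [exact: measurable_cst|exact: measurable_id]|exact: measurable_cst].
rewrite [RHS](eq_integral (fun v : 'rV[R]_n => (enorm x ^+ n * ker (enorm x *: v + 0) x)%:E)); last first.
  move=> v _; rewrite /k1 /ker addr0 enormZ_ge0 ?enorm_ge0//; congr EFin.
  have [->|v0] := eqVneq (enorm v) 0.
    by rewrite mulr0 invr0 expr0n (gtn_eqF n0) !mul0r mulr0.
  have -> : \1_pball ((enorm x * enorm v)^-1 *: x) = (0 < (enorm v)^-1 <= 1)%R%:R :> R.
    rewrite indicE; congr (_%:R); rewrite /pball.
    have -> : (((enorm x * enorm v)^-1 *: x) \in [set y | 0 < enorm y <= 1]) =
       (0 < enorm ((enorm x * enorm v)^-1 *: x) <= 1).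
      by apply/idP/idP; rewrite inE.
    rewrite enormZ_ge0 ?invr_ge0 ?mulr_ge0 ?enorm_ge0// invfM mulrAC mulVf ?gt_eqF// mul1r.
    reflexivity.
  rewrite !invfM !exprMn; move: (_%:R) => b.
  have xn : enorm x ^+ n != 0 by rewrite expf_neq0// gt_eqF.
  have vn : enorm v ^+ n != 0 by rewrite expf_neq0.
  by rewrite !exprVn; field; rewrite xn vn.
rewrite ge0_eintegralZ; [|exact: mFt|by rewrite exprn_ge0// enorm_ge0|exact: (fun v => ker0 _ x)].
rewrite [in RHS]A muleA -EFinM (ger0_norm (enorm_ge0 _)) exprVn divff ?mul1e//.
by rewrite expf_neq0// gt_eqF.
Qed.

(* The dilations x = |y| z, then y = x / |z|, then z = |x| v separate the
   variables, with an unspecified constant (later computed from a ball). *)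
Lemma polar_const : (\int[leb]_x \int[leb]_y (\1_pball y * H (enorm x *: unitv y))%:E =
  \int[leb]_v (k1 v)%:E * \int[leb]_x (H x)%:E)%E.
Proof.
rewrite (@tonelli_swap _ _ _ _ _ leb leb (fun x y => (f1 x y)%:E) mf1 f10).
under eq_integral do rewrite step1.
rewrite (@tonelli_swap _ _ _ _ _ leb leb (fun x y => (f2 x y)%:E) mf2 f20).
have I30 z : (0 <= \int[leb]_x (f3 z x)%:E)%E by apply: integral_ge0 => x _; exact: f30.
have I20 z : (0 <= \int[leb]_y (f2 y z)%:E)%E by apply: integral_ge0 => x _; exact: f20.
rewrite (ge0_integral_eq_neq0
  (@measurable_tonelli2 _ _ _ _ _ leb (fun x y => (f2 x y)%:E) mf2 f20)
  (@measurable_tonelli1 _ _ _ _ _ leb (fun x y => (f3 x y)%:E) mf3 f30) I20 I30 step2).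
rewrite (@tonelli_swap _ _ _ _ _ leb leb (fun x y => (f3 x y)%:E) mf3 f30).
have C0 : (0 <= \int[leb]_v (k1 v)%:E)%E.
  by apply: integral_ge0 => v _; rewrite lee_fin mulr_ge0 ?exprn_ge0// mulr_ge0// exprn_ge0.
have mHE : measurable_fun setT (fun x => (H x)%:E) by exact/measurable_EFinP.
rewrite -ge0_integralZl//; last by move=> x _; rewrite lee_fin.
apply: ge0_integral_eq_neq0.
- exact: (@measurable_tonelli2 _ _ _ _ _ leb (fun x y => (f3 x y)%:E) mf3 f30).
- by apply: emeasurable_funM => //; exact: measurable_cst.
- by move=> x; apply: integral_ge0 => z _; exact: f30.
- by move=> x; rewrite mule_ge0// lee_fin.
move=> x x0; rewrite -(step3 x0) muleC.
rewrite -ge0_eintegralZ; [|exact: (measurableT_comp mker (measurable_pair2 x))|by []|exact: (fun z => ker0 z x)].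
by apply: eq_integral => z _; rewrite /f3 mulrC.
Qed.

End polar_integral.

End polar.

Section radial_average.
Context {R : realType} {n : nat}.
Hypothesis n0 : (0 < n)%N.
Notation leb := (@lebesgue_rV R n).
Implicit Types (x y z : 'rV[R]_n).

Definition pvol : R := fine (leb pball).

Lemma lebesgue_pball : leb pball = pvol%:E.
Proof.
rewrite /pvol fineK// ge0_fin_numE//; apply: le_lt_trans (@eball_lty R n 1).
apply: le_measure; rewrite ?inE; [exact: measurable_pball|exact: measurable_eball|].
by move=> x /andP[_]; rewrite enorm_le// expr1n.
Qed.

Lemma pvol_gt0 : 0 < pvol.
Proof.
rewrite -lte_fin -lebesgue_pball.
have m0 : measurable [set 0 : 'rV[R]_n].
  rewrite (_ : [set 0] = @cube R n 0); first exact: measurable_cube.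
  apply/seteqP; split => [x -> i|x x0]; first by rewrite mxE normr0.
  by apply/rowP => i; apply/eqP; rewrite mxE -normr_le0.
apply: (@lt_le_trans _ _ (leb (pball `|` [set 0]))).
  apply: lt_le_trans (@eball_gt0 R n 1 ltr01) _.
  apply: le_measure; rewrite ?inE; [exact: measurable_eball| |].
    by apply: measurableU => //; exact: measurable_pball.
  move=> x; rewrite /eball/= => x1; have [->|x0] := eqVneq x 0; first by right.
  by left; rewrite /pball/= enorm_gt0 x0/= enorm_le// expr1n.
apply: le_trans (measureU2 _ _ _) _ => //; first exact: measurable_pball.
by rewrite [X in (_ + X)%E](lebesgue_rV_point0 n0) adde0.
Qed.

(* Under the probability density radw, unitv is uniform on the sphere. *)
Definition radw y : R := pvol^-1 * \1_pball y.

Lemma measurable_radw : measurable_fun setT radw.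
Proof. by apply: measurable_funM => //; apply: measurable_indic; exact: measurable_pball. Qed.

Lemma radw_ge0 y : 0 <= radw y.
Proof. by rewrite mulr_ge0 ?indicE// invr_ge0 ltW// pvol_gt0. Qed.

Lemma integral_radw : (\int[leb]_y (radw y)%:E = 1)%E.
Proof.
rewrite ge0_eintegralZ.
- rewrite integral_indic ?setIT//; last exact: measurable_pball.
  by rewrite [X in (_ * X)%E]lebesgue_pball -EFinM mulVf// gt_eqF// pvol_gt0.
- by apply: measurable_indic; exact: measurable_pball.
- by rewrite invr_ge0 ltW// pvol_gt0.
- by move=> y; rewrite indicE.
Qed.

Lemma radw_neq0 y : radw y != 0 -> pball y.
Proof.
by rewrite /radw indicE; case: (boolP (y \in pball)) => [/set_mem//|_]; rewrite mulr0 eqxx.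
Qed.

Lemma enorm_scale_unitv (t : R) y : 0 <= t -> pball y -> enorm (t *: unitv y) = t.
Proof.
by move=> t0 /andP[yp _]; rewrite enormZ_ge0// enorm_unitv ?mulr1// -enorm_gt0.
Qed.

(** The constant of [polar_const] does not depend on H. The indicator of the unit ball is radial, so
    both of its integrals are explicit; comparing them identifies the constant as [pvol]. *)
Lemma polar (H : 'rV[R]_n -> R) : measurable_fun setT H -> (forall x, 0 <= H x) ->
  (\int[leb]_x \int[leb]_y (radw y * H (enorm x *: unitv y))%:E = \int[leb]_x (H x)%:E)%E.
Proof.
move=> mH H0.
pose C := (\int[leb]_v ((enorm v)^-1 ^+ n * ((0 < (enorm v)^-1 <= 1)%R%:R * (enorm v)^-1 ^+ n))%:E)%E.
have PC (K : 'rV[R]_n -> R) : measurable_fun setT K -> (forall x, 0 <= K x) ->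
  (\int[leb]_x \int[leb]_y (\1_pball y * K (enorm x *: unitv y))%:E = C * \int[leb]_x (K x)%:E)%E.
  by move=> mK K0; exact: polar_const.
have CE : C = pvol%:E.
  have mi : measurable_fun setT (\1_(eball 1) : 'rV[R]_n -> R).
    by apply: measurable_indic; exact: measurable_eball.
  have i0 (x : 'rV[R]_n) : 0 <= \1_(eball 1) x :> R by rewrite indicE.
  have := PC _ mi i0.
  have L1 : (\int[leb]_x (\1_(eball 1) x)%:E = (fine (leb (eball 1)))%:E)%E.
    rewrite integral_indic ?setIT//; last exact: measurable_eball.
    by rewrite fineK// ge0_fin_numE//; exact: eball_lty.
  have l0 : 0 < fine (leb (eball 1)).
    by rewrite -lte_fin -L1 integral_indic ?setIT//; [exact: eball_gt0|exact: measurable_eball].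
  rewrite (eq_integral (fun x => (pvol * \1_(eball 1) x)%:E)); last first.
    move=> x _; rewrite (eq_integral (fun y => (\1_(eball 1) x * \1_pball y)%:E)); last first.
      move=> y _; rewrite mulrC !indicE.
      have [yB|yB] := boolP (y \in pball); last by rewrite !mulr0.
      rewrite !mulr1; congr ((nat_of_bool _)%:R)%:E.
      have E : sqnorm (enorm x *: unitv y) = sqnorm x.
        by rewrite -!sqr_enorm enorm_scale_unitv ?enorm_ge0//; exact: set_mem.
      by apply/idP/idP; rewrite !inE /eball/= E.
    rewrite ge0_eintegralZ.
    - rewrite integral_indic ?setIT//; last exact: measurable_pball.
      by rewrite [X in (_ * X)%E]lebesgue_pball -EFinM mulrC.
    - by apply: measurable_indic; exact: measurable_pball.
    - by rewrite indicE.
    - by move=> y; rewrite indicE.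
  rewrite ge0_eintegralZ; [|exact: mi|exact: ltW pvol_gt0|by move=> x; rewrite indicE].
  rewrite L1; case: C {PC} => [c| |] /=.
  - by rewrite -!EFinM => -[] /(mulIf (lt0r_neq0 l0)) ->.
  - by rewrite gt0_mulye ?lte_fin// -EFinM.
  - by rewrite gt0_mulNye ?lte_fin// -EFinM.
have b0 := pvol_gt0.
rewrite (eq_integral (fun x => (pvol^-1)%:E * \int[leb]_y (\1_pball y * H (enorm x *: unitv y))%:E))%E.
  rewrite ge0_integralZl//.
  - by rewrite PC// CE muleA -EFinM mulVf ?mul1e// gt_eqF.
  - apply: (@measurable_tonelli1 _ _ _ _ _ leb (fun x y => (\1_pball y * H (enorm x *: unitv y))%:E)).
      apply/measurable_EFinP; apply: measurable_funM; first exact: measurable_indic_pball.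
      apply: (measurableT_comp mH); apply: measurable_rVZ; first exact: measurable_enormT.
      exact: (measurableT_comp measurable_unitv measurable_snd).
    by move=> x y; rewrite lee_fin mulr_ge0// indicE.
  - by move=> x _; apply: integral_ge0 => y _; rewrite lee_fin mulr_ge0// indicE.
  - by rewrite lee_fin invr_ge0 ltW.
move=> x _; rewrite -ge0_eintegralZ.
- by apply: eq_integral => y _; rewrite /radw mulrA.
- apply: measurable_funM; first by apply: measurable_indic; exact: measurable_pball.
  apply: (measurableT_comp mH); apply: measurable_rVZ; first exact: measurable_cst.
  exact: measurable_unitv.
- by rewrite invr_ge0 ltW.
- by move=> y; rewrite mulr_ge0// indicE.
Qed.

End radial_average.

Section Rintegral_total.
Context d (T : measurableType d) {R : realType} (mu : {measure set T -> \bar R}).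

Lemma Rintegral_not_integrable (f : T -> R) : measurable_fun setT f ->
  ~ mu.-integrable setT (EFin \o f) -> \int[mu]_x f x = 0.
Proof.
move=> mf nf; rewrite /Rintegral integralE.
have mE : measurable_fun setT (EFin \o f) by exact/measurable_EFinP.
have : (\int[mu]_x `|(EFin \o f) x| = +oo)%E.
  by apply/eqP; rewrite eq_le leey leNgt; apply/negP => h; apply: nf; apply/integrableP.
rewrite (eq_integral (fun x => (EFin \o f)^\+ x + (EFin \o f)^\- x)%E); last first.
  by move=> x _; rewrite -[LHS]/((abse \o (EFin \o f)) x) fune_abse.
rewrite ge0_integralD//; [|exact: measurable_funepos|exact: measurable_funeneg].
set a := (\int[mu]_x _)%E; set b := (\int[mu]_x _)%E.
have a0 : (0 <= a)%E by apply: integral_ge0 => x _; exact: funepos_ge0.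
have b0 : (0 <= b)%E by apply: integral_ge0 => x _; exact: funeneg_ge0.
by case: a a0 => [a| |] a0 //; case: b b0 => [b| |] b0.
Qed.

(** For a function that is not integrable both sides are 0, by the convention of [fine]. This lets
    spherical means be rescaled at every x, convergent or not. *)
Lemma RintegralZl_total (c : R) (f : T -> R) : measurable_fun setT f ->
  \int[mu]_x (c * f x) = c * \int[mu]_x f x.
Proof.
move=> mf; have [->|c0] := eqVneq c 0.
  by rewrite mul0r; under eq_Rintegral do rewrite mul0r; rewrite Rintegral_cst// mul0r.
have [fi|nfi] := pselect (mu.-integrable setT (EFin \o f)); first by rewrite RintegralZl.
rewrite [in RHS]Rintegral_not_integrable// mulr0 Rintegral_not_integrable//.
  exact: measurable_funM.
move=> H; apply: nfi; have := integrableZl measurableT c^-1 H.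
by apply: eq_integrable => // x _; rewrite /= -EFinM mulrA mulVf// mul1r.
Qed.

End Rintegral_total.

(** * The spherical mean as a projection of L^2 *)

Section average.
Context {R : realType} {n : nat}.
Hypothesis n0 : (0 < n)%N.
Notation leb := (@lebesgue_rV R n).
Notation sph := (@sphere_measure R n).
Implicit Types (x y z : 'rV[R]_n) (F G H : 'rV[R]_n -> R).

(** P F as a volume integral: the direction of a uniform point of the punctured ball is uniform on
    the sphere. Lebesgue measure brings Tonelli's theorem and the invariance under reflections. *)
Definition avg F x : R := \int[leb]_y (radw y * F (enorm x *: unitv y)).

Definition radial F := forall x y, enorm x = enorm y -> F x = F y.

Lemma radial_avg F : radial (avg F).
Proof. by move=> x y xy; rewrite /avg xy. Qed.

Lemma measurable_on_ray F x : measurable_fun setT F ->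
  measurable_fun setT (fun y => F (enorm x *: unitv y)).
Proof.
move=> mF; apply: (measurableT_comp mF); apply: measurable_rVZ; first exact: measurable_cst.
exact: measurable_unitv.
Qed.

Lemma measurable_polar F : measurable_fun setT F ->
  measurable_fun setT (fun p : 'rV[R]_n * 'rV[R]_n => radw p.2 * F (enorm p.1 *: unitv p.2)).
Proof.
move=> mF; apply: measurable_funM; first exact: (measurableT_comp measurable_radw measurable_snd).
apply: (measurableT_comp mF); apply: measurable_rVZ; first exact: measurable_enormT.
exact: (measurableT_comp measurable_unitv measurable_snd).
Qed.

Lemma sphere_average F x : measurable_fun setT F ->
  (fine (sph (@sphere R n)))^-1 * \int[sph]_(w in @sphere R n) F (enorm x *: w) = avg F x.
Proof.
move=> mF; rewrite sphere_Rintegral//; last first.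
  by apply: (measurableT_comp mF); apply: measurable_rVZ; [exact: measurable_cst|exact: measurable_id].
rewrite sphere_measure_sphere [X in (_ * X)%E]lebesgue_pball -EFinM /= invfM mulrAC mulrA.
rewrite mulVf ?pnatr_eq0 -?lt0n// mul1r mulrC -RintegralZl_total; last first.
  by apply: measurable_funM; [apply: measurable_indic; exact: measurable_pball|exact: measurable_on_ray].
by apply: eq_Rintegral => y _; rewrite /radw mulrA.
Qed.

Lemma measurable_avg F : measurable_fun setT F -> measurable_fun setT (avg F).
Proof.
move=> mF; have mP := measurable_polar mF.
pose Q (p : 'rV[R]_n * 'rV[R]_n) := radw p.2 * F (enorm p.1 *: unitv p.2).
have mPE : measurable_fun setT (EFin \o Q) by exact/measurable_EFinP.
have mp := measurable_funepos mPE; have mn := measurable_funeneg mPE.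
rewrite /avg /Rintegral; apply: (measurableT_comp (f := fine)) => //.
under eq_fun do rewrite integralE.
apply: emeasurable_funB.
- apply: (@measurable_tonelli1 _ _ _ _ _ leb (fun x y => ((fun y => (radw y * F (enorm x *: unitv y))%:E)^\+)%E y)).
    by rewrite (_ : (fun p => _) = (EFin \o Q)^\+%E)//; apply/funext => p; rewrite !funeposE.
  by move=> x y; exact: funepos_ge0.
- apply: (@measurable_tonelli1 _ _ _ _ _ leb (fun x y => ((fun y => (radw y * F (enorm x *: unitv y))%:E)^\-)%E y)).
    by rewrite (_ : (fun p => _) = (EFin \o Q)^\-%E)//; apply/funext => p; rewrite !funenegE.
  by move=> x y; exact: funeneg_ge0.
Qed.

Lemma avg_sqr_le F x : measurable_fun setT F ->
  ((avg F x ^+ 2)%:E <= \int[leb]_y (radw y * F (enorm x *: unitv y) ^+ 2)%:E)%E.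
Proof.
move=> mF; have := @sqr_integral_le _ _ R leb radw (fun y => F (enorm x *: unitv y)) 1
  measurable_radw (measurable_on_ray x mF) ltr01.
have E : (\int[leb]_t (`|radw t|)%:E <= 1%:E)%E.
  by under eq_integral do rewrite ger0_norm ?radw_ge0//; rewrite integral_radw.
move=> /(_ E); rewrite mul1e => /le_trans; apply.
rewrite le_eqVlt; apply/orP; left; apply/eqP/eq_integral => y _.
by rewrite ger0_norm ?radw_ge0.
Qed.

Lemma integral_avg_sqr_le F : measurable_fun setT F ->
  (\int[leb]_x (avg F x ^+ 2)%:E <= \int[leb]_x (F x ^+ 2)%:E)%E.
Proof.
move=> mF; have mF2 : measurable_fun setT (fun x => F x ^+ 2) by exact: measurable_funX.
rewrite -(polar n0 mF2); last by move=> x; exact: sqr_ge0.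
apply: ge0_le_integral => //.
- by move=> x _; rewrite lee_fin sqr_ge0.
- by apply/measurable_EFinP/measurable_funX; exact: measurable_avg.
- apply: (@measurable_tonelli1 _ _ _ _ _ leb (fun x y => (radw y * F (enorm x *: unitv y) ^+ 2)%:E)).
    by apply/measurable_EFinP; exact: measurable_polar mF2.
  by move=> x y; rewrite lee_fin mulr_ge0 ?sqr_ge0 ?radw_ge0.
- by move=> x _; exact: avg_sqr_le.
Qed.

Lemma sqint_avg F : sqint leb F -> sqint leb (avg F).
Proof.
move=> [mF iF]; split; first exact: measurable_avg.
exact: le_lt_trans (integral_avg_sqr_le mF) iF.
Qed.

Lemma integral_avg H : leb.-integrable setT (EFin \o H) ->
  (\int[leb]_x (avg H x)%:E = \int[leb]_x (H x)%:E)%E.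
Proof.
move=> iH; have mH : measurable_fun setT H by apply/measurable_EFinP; exact: (measurable_int _ iH).
pose P (f : 'rV[R]_n -> R) (p : 'rV[R]_n * 'rV[R]_n) := (radw p.2 * f (enorm p.1 *: unitv p.2))%:E.
have mP (f : 'rV[R]_n -> R) : measurable_fun setT f -> measurable_fun setT (P f).
  by move=> mf; apply/measurable_EFinP; exact: measurable_polar.
pose Hp x := Num.max (H x) 0; pose Hn x := Num.max (- H x) 0.
have mHp : measurable_fun setT Hp by apply: measurable_maxr => //; exact: measurable_cst.
have mHn : measurable_fun setT Hn.
  by apply: measurable_maxr; [exact: measurableT_comp|exact: measurable_cst].
have Hp0 x : 0 <= Hp x by rewrite le_max lexx orbT.
have Hn0 x : 0 <= Hn x by rewrite le_max lexx orbT.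
have HE x : H x = Hp x - Hn x.
  by rewrite /Hp /Hn; case: (leP (H x) 0) => ?; case: (leP (- H x) 0) => ?; lra.
have iHp : leb.-integrable setT (EFin \o Hp).
  apply: (le_integrable _ _ _ iH) => //; first exact/measurable_EFinP.
  move=> x _; rewrite /= lee_fin ger0_norm// /Hp.
  by case: (leP (H x) 0) => // _; exact: ler_norm.
have iHn : leb.-integrable setT (EFin \o Hn).
  apply: (le_integrable _ _ _ iH) => //; first exact/measurable_EFinP.
  move=> x _; rewrite /= lee_fin ger0_norm// /Hn.
  by case: (leP (- H x) 0) => // _; rewrite -normrN; exact: ler_norm.
have iP (f : 'rV[R]_n -> R) : measurable_fun setT f -> (forall x, 0 <= f x) ->
    leb.-integrable setT (EFin \o f) -> (leb \x leb)%E.-integrable setT (P f) /\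
    (\int[leb \x leb]_p P f p = \int[leb]_x (f x)%:E)%E.
  move=> mf f0 if_; have P0 p : (0 <= P f p)%E by rewrite lee_fin mulr_ge0 ?radw_ge0.
  have E : (\int[leb \x leb]_p P f p = \int[leb]_x (f x)%:E)%E.
    by rewrite (fubini_tonelli1 _ (mP _ mf) P0) -(polar n0 mf f0).
  split=> //; apply/integrableP; split; first exact: mP.
  rewrite (eq_integral (P f)); last by move=> p _; rewrite gee0_abs.
  rewrite E; have /integrableP[_] := if_; apply: le_lt_trans.
  by rewrite le_eqVlt; apply/orP; left; apply/eqP/eq_integral => x _; rewrite /= ger0_norm.
have [iPp EPp] := iP _ mHp Hp0 iHp; have [iPn EPn] := iP _ mHn Hn0 iHn.
have PE p : P H p = (P Hp p - P Hn p)%E by rewrite /P HE mulrBr EFinB.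
have iPH : (leb \x leb)%E.-integrable setT (P H).
  by have := integrableB measurableT iPp iPn; apply: eq_integrable => // p _; rewrite PE.
(* [avg] is the [fine] part of the inner integral, which Fubini shows to be finite only for almost
   every x. *)
transitivity (\int[leb]_x \int[leb]_y (P H (x, y)))%E.
  apply: ae_eq_integral => //.
  - by apply/measurable_EFinP; exact: measurable_avg.
  - exact: (measurable_fubini_F iPH).
  - have := ae_integrable1 iPH; apply: filterS => x ix _.
    by rewrite /avg /Rintegral fineK//; exact: integrable_fin_num.
rewrite [LHS](integral12_prod_meas1 iPH).
rewrite (eq_integral (fun p => P Hp p - P Hn p)%E); last by move=> p _; rewrite PE.
rewrite integralB// EPp EPn -integralB//.
by apply: eq_integral => x _; rewrite HE EFinB.
Qed.

Lemma avg_radialM (k : 'rV[R]_n -> R) H x : radial k -> measurable_fun setT H ->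
  avg (fun x => k x * H x) x = k x * avg H x.
Proof.
move=> rk mH; rewrite /avg -RintegralZl_total; last first.
  by apply: measurable_funM; [exact: measurable_radw|exact: measurable_on_ray].
apply: eq_Rintegral => y _; have [->|/radw_neq0 yB] := eqVneq (radw y) 0.
  by rewrite !mul0r mulr0.
rewrite (rk (enorm x *: unitv y) x); first by rewrite mulrCA.
by rewrite enorm_scale_unitv// enorm_ge0.
Qed.

Lemma avg_radial (k : 'rV[R]_n -> R) x : radial k -> measurable_fun setT k -> avg k x = k x.
Proof.
move=> rk mk; rewrite (_ : k = fun x => k x * 1); last by apply/funext => y; rewrite mulr1.
rewrite avg_radialM//; suff -> : avg (fun=> 1) x = 1 by [].
rewrite /avg.
under eq_Rintegral do rewrite mulr1.
by rewrite /Rintegral integral_radw.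
Qed.

(** Both sides equal the integral of avg F times avg H: taking means preserves integrals, and a
    radial factor comes out of the mean. *)
Lemma avg_adjoint F H : sqint leb F -> sqint leb H ->
  (\int[leb]_x (avg F x * H x)%:E = \int[leb]_x (F x * avg H x)%:E)%E.
Proof.
move=> sF sH; have sAF := sqint_avg sF; have sAH := sqint_avg sH.
rewrite -(integral_avg (integrable_sqintM sAF sH)).
have i2 := integrable_sqintM sAH sF.
have -> : (\int[leb]_x (F x * avg H x)%:E = \int[leb]_x (avg H x * F x)%:E)%E.
  by apply: eq_integral => x _; rewrite mulrC.
rewrite -(integral_avg i2).
apply: eq_integral => x _.
rewrite (avg_radialM _ (@radial_avg F) sH.1) (avg_radialM _ (@radial_avg H) sF.1).
by rewrite mulrC.
Qed.

End average.

(** * Commutation of the spherical mean with the Laplacian *)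

Section radial_kernel.
Context {R : realType} {n : nat}.
Hypothesis n0 : (0 < n)%N.
Notation leb := (@lebesgue_rV R n).
Implicit Types (x y z : 'rV[R]_n) (F G H : 'rV[R]_n -> R).

(** The Laplacian of the radial mollifier is itself a function [ell] of |x|^2; this form allows
    [avg_rotate] to treat it like the mollifier. *)
Lemma mollifier_laplacian_radial (r : R) :
  exists (d dd : 'I_n -> 'rV[R]_n -> R) (ell : R -> R),
  [/\ forall i, bump r (d i) /\ has_partial i (mollifier r) (d i),
      forall i, bump r (dd i) /\ has_partial i (d i) (dd i),
      measurable_fun setT ell & forall x, \sum_i dd i x = ell (sqnorm x)].
Proof.
set c := (@bump_mass R n r)^-1.
pose e1 : {poly R} := flat_deriv 1; pose e2 := flat_deriv e1.
have pq i : has_partial i (fun x : 'rV[R]_n => r - sqnorm x) (fun x => - (2 * x ord0 i)).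
  have := has_partialD (@has_partial_cst R n i r)
    (has_partialM (@has_partial_cst R n i (-1)) (@has_partial_sqnorm R n i)).
  rewrite (_ : (fun _ => r + _) = fun x => r - sqnorm x); last first.
    by apply/funext => x; rewrite mulN1r.
  by move=> H; refine (has_partial_eq H _) => x; ring.
have pf i p := @has_partial_comp R n i (flat p) (flat (flat_deriv p)) _ _ (pq i)
    (fun x => is_derive_flat p _).
exists (fun i x => (-2 * c) * (x ord0 i * flat e1 (r - sqnorm x))).
exists (fun i x => (-2 * c) * flat e1 (r - sqnorm x) +
  (4 * c) * (x ord0 i * (x ord0 i * flat e2 (r - sqnorm x)))).
exists (fun s => n%:R * ((-2 * c) * flat e1 (r - s)) + (4 * c) * (s * flat e2 (r - s))).
split.
- move=> i; split; first exact/bumpZ/bump_coor/bump_flat.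
  by refine (has_partial_eq (has_partialM (@has_partial_cst R n i c) (pf i 1)) _) => x; rewrite -/e1; ring.
- move=> i; split.
    by apply: bumpD; [exact/bumpZ/bump_flat|exact/bumpZ/bump_coor/bump_coor/bump_flat].
  refine (has_partial_eq (has_partialM (@has_partial_cst R n i (-2 * c))
    (has_partialM (@has_partial_coor R n i i) (pf i e1))) _) => x.
  by rewrite eqxx mulr1n -/e2; ring.
- have mf p : measurable_fun setT (fun s : R => flat p (r - s)).
    apply: (measurableT_comp (continuous_measurable_fun (@continuous_flat R p))).
    exact: measurable_funB.
  by apply: measurable_funD; apply: measurable_funM => //; apply: measurable_funM.
- move=> x; rewrite big_split/= sumr_const card_ord; congr (_ + _); first by rewrite [RHS]mulr_natl.
  by rewrite /sqnorm mulr_suml mulr_sumr; apply: eq_bigr => i _; ring.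
Qed.

Lemma householderZ (v : 'rV[R]_n) (a : R) x : householder v (a *: x) = a *: householder v x.
Proof. by rewrite /householder dotZr scalerBr scalerA; congr (_ - _ *: _); ring. Qed.

(* The reflection exchanging the directions of x and z moves the average from
   the sphere of radius |x| to the sphere of radius |z|. *)
Lemma avg_rotate (ell : R -> R) x z : measurable_fun setT ell ->
  avg (fun y => ell (sqnorm (z - y))) x =
  \int[leb]_y (ell (sqnorm (x - enorm z *: unitv y)) * radw y).
Proof.
(* Both vectors have norm |x| |z|, so the reflection exchanges them; x = 0 and z = 0 are
   included. *)
move=> ml; pose T := householder (enorm z *: x - enorm x *: z).
have TE : T (enorm z *: x) = enorm x *: z.
  by apply: householder_swap; rewrite !sqnormZ !sqr_enorm mulrC.
have mg : measurable_fun setT (fun y : 'rV[R]_n =>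
    (radw y * ell (sqnorm (z - enorm x *: unitv y)))%:E).
  apply/measurable_EFinP; apply: measurable_funM; first exact: measurable_radw.
  apply: (measurableT_comp ml); apply: measurable_sqnorm.
  apply: measurable_rVB; first exact: measurable_cst.
  by apply: measurable_rVZ; [exact: measurable_cst|exact: measurable_unitv].
have E := @integral_rV_isometry _ _ T (measurable_householder _) (householderD _)
    (householderK _) (sqnorm_householder _) _ mg.
refine (etrans (congr1 fine (esym E)) _).
rewrite /Rintegral; apply: (congr1 fine); apply: eq_integral => y _.
have rT : radw (T y) = radw y.
  rewrite /radw !indicE; congr (_ * (nat_of_bool _)%:R).
  have e : enorm (T y) = enorm y by apply: eq_enorm; exact: sqnorm_householder.
  by apply/idP/idP; rewrite !inE /pball/= e.
have uT : unitv (T y) = T (unitv y).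
  have e : enorm (T y) = enorm y by apply: eq_enorm; exact: sqnorm_householder.
  by rewrite /unitv e /T householderZ.
rewrite rT uT mulrC; have [->|/radw_neq0 yB] := eqVneq (radw y) 0; first by rewrite !mulr0.
have u1 : sqnorm (unitv y) = 1.
  have y0 : y != 0 by rewrite -enorm_gt0; case/andP: yB.
  by have := sqr_enorm (unitv y); rewrite (enorm_unitv y0) expr1n.
suff -> : sqnorm (z - enorm x *: T (unitv y)) = sqnorm (x - enorm z *: unitv y) by [].
move: (unitv y) u1 => u u1; have Tu : sqnorm (T u) = 1 by rewrite sqnorm_householder.
(* |x| z . T u = T(|z| x) . T u = |z| x . u; the squared norms of the two differences then agree. *)
have dE : dot z (enorm x *: T u) = dot x (enorm z *: u).
  by rewrite dotZr -dotZl -TE /T dot_householder dotZl dotZr.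
rewrite !sqnormB dE !sqnormZ Tu u1 !sqr_enorm; ring.
Qed.

Lemma sqint_bump_reflect r N z : bump r N -> sqint leb (fun t => N (z - t)).
Proof.
move=> bN; have [M M0 HM] := bump_bounded bN.
have mN : measurable_fun setT (fun t : 'rV[R]_n => N (z - t)).
  apply: (measurableT_comp (measurable_bump bN)).
  by apply: measurable_rVB; [exact: measurable_cst|exact: measurable_id].
have mN2 : measurable_fun setT (fun t : 'rV[R]_n => (N t ^+ 2)%:E).
  by apply/measurable_EFinP/measurable_funX; exact: measurable_bump bN.
split=> //.
rewrite (@ge0_integral_rV_reflect _ _ z (fun t => (N t ^+ 2)%:E) mN2); last first.
  by move=> x; rewrite lee_fin sqr_ge0.
apply: (proj2 (sqint_le (c := M ^+ 2) (measurable_bump bN) (@sqint_indic_eball R n r) _)) => x.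
rewrite indicE; have [xr|xr] := leP (sqnorm x) r.
  by rewrite mem_set//= expr1n mulr1 -[N x ^+ 2]real_normK ?num_real// ler_sqr ?nnegrE.
by rewrite (bump_eq0 bN (ltW xr)) expr0n mulr_ge0 ?sqr_ge0.
Qed.

(** By [weak_laplacian_mollifier] it is enough to test with t |-> mollifier r (z - t).
    Self-adjointness moves the mean from F and G onto this function and its Laplacian. As [avg] the
    result depends on x through |x|; [avg_rotate] rewrites it as a superposition K of mollifiers
    centered on the sphere of radius |z|, a test function whose Laplacian is the mean of the
    Laplacian. The equation for F and G then applies to K. *)
Lemma weak_laplacian_avg F G : weak_laplacian F G -> weak_laplacian (avg F) (avg G).
Proof.
move=> [sF sG FG]; apply: weak_laplacian_mollifier; [exact: sqint_avg|exact: sqint_avg|].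
move=> r z r0; have bM := @bump_mollifier R n r.
have [d [dd [ell [dP ddP ml LE]]]] := mollifier_laplacian_radial r.
have pd i := (dP i).2; have pdd i := (ddP i).2.
have bd i := (dP i).1; have bdd i := (ddP i).1.
rewrite (laplacian_reflect z pd pdd).
pose L x := \sum_i dd i x.
have bL : bump r L by exact: bump_sum.
pose Z y := enorm z *: unitv y.
have mZ : measurable_fun setT Z.
  by apply: measurable_rVZ; [exact: measurable_cst|exact: measurable_unitv].
have ulr : uniformly_locally_integrable leb Z radw.
  move=> s; exists 1 => y; rewrite -(integral_radw n0).
  apply: ge0_eintegral_le.
  - apply: measurable_funM; first by apply: measurableT_comp => //; exact: measurable_radw.
    have mi : measurable_fun setT (\1_(eball s) : 'rV[R]_n -> R).
      by apply: measurable_indic; exact: measurable_eball.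
    by apply: (measurableT_comp mi); apply: measurable_rVB; [exact: measurable_cst|].
  - exact: measurable_radw.
  - by move=> t; rewrite mulr_ge0 ?indicE.
  - by move=> t; rewrite (ger0_norm (radw_ge0 n0 _)) ler_piMr ?radw_ge0// indicE; case: (_ \in _).
pose K := superposition leb Z radw (mollifier r).
have tK : test_function K.
  split; first exact: (superposition_smooth mZ (@measurable_radw R n) ulr bM).
  apply: (@compact_support _ _ _ (enorm z + (1 + `|r|))) => x i; apply: contra_neqT => xi.
  transitivity (\int[leb]_(y in [set: 'rV[R]_n]) (0 : R)); last by rewrite Rintegral_cst// mul0r.
  apply: eq_Rintegral => y _; have [->|/radw_neq0 yB] := eqVneq (radw y) 0; first by rewrite mulr0.
  rewrite (bump_eq0 bM) ?mul0r// leNgt; apply: contra xi => xr.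
  have h1 : `|(x - Z y) ord0 i| ^+ 2 < r.
    by rewrite real_normK ?num_real//; exact: le_lt_trans (sqr_coord_le _ _) xr.
  have h2 : `|Z y ord0 i| <= enorm z.
    rewrite -(@ler_pXn2r _ 2) ?nnegrE ?enorm_ge0// real_normK ?num_real// sqr_enorm.
    apply: le_trans (sqr_coord_le _ _) _.
    by rewrite -!sqr_enorm enorm_scale_unitv// enorm_ge0.
  have h3 := ler_norm r.
  rewrite -[x ord0 i](subrK (Z y ord0 i)); apply: (le_trans (ler_normD _ _)).
  rewrite addrC lerD//; move: h1; rewrite !mxE.
  by have := sqr_ge0 (`|x ord0 i - (enorm z *: unitv y) ord0 i| - 2^-1); rewrite !mxE !expr2; lra.
have psiE : avg (fun t => \sum_i dd i (z - t)) = classical_laplacian K.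
  rewrite (classical_laplacian_eq (d := fun i => superposition leb Z radw (d i))
     (dd := fun i => superposition leb Z radw (dd i))); last 2 first.
  - by move=> i; exact: (superposition_has_partial mZ (@measurable_radw R n) ulr bM (bd i) (pd i)).
  - by move=> i; exact: (superposition_has_partial mZ (@measurable_radw R n) ulr (bd i) (bdd i) (pdd i)).
  apply/funext => x.
  rewrite (_ : (fun t => _) = fun t => ell (sqnorm (z - t))); last by apply/funext => t; rewrite LE.
  rewrite avg_rotate//.
  have [_ E] := @Rintegral_sum _ _ R leb _ (index_enum 'I_n)
    (fun i y => dd i (x - Z y) * radw y)
    (fun i => integrable_superposition mZ (@measurable_radw R n) ulr x (bdd i)).
  refine (etrans _ E); apply: eq_Rintegral => y _.
  by rewrite -LE mulr_suml.
have KE : avg (fun t => mollifier r (z - t)) = K.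
  apply/funext => x; pose ell0 s := (@bump_mass R n r)^-1 * flat 1 (r - s).
  have ml0 : measurable_fun setT ell0.
    apply: measurable_funM => //.
    apply: (measurableT_comp (continuous_measurable_fun (@continuous_flat R 1))).
    exact: measurable_funB.
  exact: (avg_rotate x z ml0).
have sL := sqint_bump_reflect z bL; have sM := sqint_bump_reflect z bM.
refine (etrans (congr1 fine (avg_adjoint n0 sF sL)) _).
refine (etrans _ (esym (congr1 fine (avg_adjoint n0 sG sM)))).
rewrite KE psiE; exact: FG.
Qed.

(** A radial function is its own mean, so by self-adjointness F and its mean have the same pairing
    with it. *)
Lemma radial_orthogonal_sub_avg F : sqint leb F -> radial_orthogonal (fun x => F x - avg F x).
Proof.
move=> sF phi mphi sphi; have sA := sqint_avg n0 sF.
have i1 := integrable_sqintM sF sphi; have i2 := integrable_sqintM sA sphi.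
rewrite (eq_integral (fun x => (F x * phi (sqnorm x))%:E - (avg F x * phi (sqnorm x))%:E)%E); last first.
  by move=> x _; rewrite mulrBl EFinB.
rewrite integralB//.
have E := avg_adjoint n0 sF sphi.
have EP : (\int[leb]_x (F x * avg (fun y => phi (sqnorm y)) x)%:E =
    \int[leb]_x (F x * phi (sqnorm x))%:E)%E.
  apply: eq_integral => x _; rewrite avg_radial//; last exact: sphi.1.
  by move=> y w yw; rewrite -!sqr_enorm yw.
rewrite [X in (_ - X)%E]E [X in (_ - X)%E]EP subee//; exact: integrable_fin_num.
Qed.

Lemma radial_orthogonal_avg0 F : sqint leb F -> {ae leb, forall x, avg F x = 0} ->
  radial_orthogonal F.
Proof.
move=> sF F0 phi mphi sphi; have sA := sqint_avg n0 sF.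
have EP : (\int[leb]_x (F x * phi (sqnorm x))%:E =
    \int[leb]_x (F x * avg (fun y => phi (sqnorm y)) x)%:E)%E.
  apply: eq_integral => x _; rewrite avg_radial//; last exact: sphi.1.
  by move=> y w yw; rewrite -!sqr_enorm yw.
rewrite [LHS]EP -[LHS](avg_adjoint n0 sF sphi) -[RHS](integral0 leb setT).
apply: ae_eq_integral => //.
- by apply/measurable_EFinP; apply: measurable_funM; [exact: sA.1|exact: sphi.1].
- by apply: filterS F0 => x -> _; rewrite mul0r.
Qed.

Lemma weak_laplacianB F G F' G' : weak_laplacian F G -> weak_laplacian F' G' ->
  weak_laplacian (fun x => F x - F' x) (fun x => G x - G' x).
Proof.
move=> [sF sG FG] [sF' sG' FG']; split; [exact: sqintB|exact: sqintB|].
move=> phi tphi; have sp := sqint_test tphi [::]; have sL := sqint_test_laplacian tphi.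
have i1 := integrable_sqintM sF sL; have i2 := integrable_sqintM sF' sL.
have i3 := integrable_sqintM sG sp; have i4 := integrable_sqintM sG' sp.
transitivity (\int[leb]_x (F x * classical_laplacian phi x - F' x * classical_laplacian phi x)).
  by apply: eq_Rintegral => x _; rewrite mulrBl.
transitivity (\int[leb]_x (G x * phi x - G' x * phi x)); last first.
  by apply: eq_Rintegral => x _; rewrite mulrBl.
by rewrite !RintegralB// FG// FG'.
Qed.

End radial_kernel.

(** * Complex-valued functions *)

Section complex_functions.
Import ComplexField.Normc.
Local Open Scope complex_scope.
Context {R : realType} {n : nat}.
Notation leb := (@lebesgue_rV R n).
Implicit Types (f g : 'rV[R]_n -> R[i]).

Local Notation re f := (fun x => complex.Re (f x)).
Local Notation im f := (fun x => complex.Im (f x)).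

Lemma sqr_normc (z : R[i]) : normc z ^+ 2 = complex.Re z ^+ 2 + complex.Im z ^+ 2.
Proof. by case: z => a b /=; rewrite sqr_sqrtr// addr_ge0// sqr_ge0. Qed.

Lemma poweR2 (x : \bar R) : (0 <= x)%E -> (x `^ 2 = x ^+ 2)%E.
Proof.
case: x => [r| |] // r0; first by rewrite poweR_EFin powR_mulrn.
by rewrite poweRyr// expe2 mulyy.
Qed.

Lemma L2norm_sqr f : (L2norm f ^+ 2 = \int[leb]_x (normc (f x) ^+ 2)%:E)%E.
Proof.
rewrite -poweR2; last exact: Lnorm_ge0.
rewrite /L2norm poweR_Lnorm//; apply: eq_integral => x _.
by rewrite poweR2 ?abse_ge0// expe2 /= -EFinM -expr2 real_normK ?num_real.
Qed.

Lemma L2norm_sqrD f : measurable_fun setT (re f) -> measurable_fun setT (im f) ->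
  (L2norm f ^+ 2 = \int[leb]_x (complex.Re (f x) ^+ 2)%:E +
                   \int[leb]_x (complex.Im (f x) ^+ 2)%:E)%E.
Proof.
move=> mr mi; rewrite L2norm_sqr -ge0_eintegralD.
- by apply: eq_integral => x _; rewrite sqr_normc.
- exact: measurable_funX.
- exact: measurable_funX.
- by move=> x; exact: sqr_ge0.
- by move=> x; exact: sqr_ge0.
Qed.

Lemma L2_sqint f : L2 f <-> sqint leb (re f) /\ sqint leb (im f).
Proof.
have lt2 (x : \bar R) : (0 <= x)%E -> (x < +oo)%E <-> (x ^+ 2 < +oo)%E.
  by case: x => [r| |] // _; rewrite ?expe2 ?mulyy// -EFinM !ltry.
split=> [[mr mi /(lt2 _ (Lnorm_ge0 _ _ _))]|[[mr ir] [mi ii]]].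
  rewrite -/(L2norm f) L2norm_sqrD// => H; split; split => //; apply: le_lt_trans H.
    by rewrite leeDl// integral_ge0// => x _; rewrite lee_fin sqr_ge0.
  by rewrite leeDr// integral_ge0// => x _; rewrite lee_fin sqr_ge0.
split=> //; apply/(lt2 _ (Lnorm_ge0 _ _ _)).
by rewrite -/(L2norm f) L2norm_sqrD// lte_add_pinfty.
Qed.

Lemma Re_mulrC (z : R[i]) (r : R) : complex.Re (z * r%:C) = complex.Re z * r.
Proof. by case: z => a b /=; rewrite mulr0 subr0. Qed.

Lemma Im_mulrC (z : R[i]) (r : R) : complex.Im (z * r%:C) = complex.Im z * r.
Proof. by case: z => a b /=; rewrite mulr0 add0r. Qed.

(** Test functions are real, so the complex equation is a pair of independent real ones. *)
Lemma is_laplacianP f g : is_laplacian f g <->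
  weak_laplacian (re f) (re g) /\ weak_laplacian (im f) (im g).
Proof.
have E h k (phi psi : 'rV[R]_n -> R) :
  Cintegral leb setT (fun x => h x * (phi x)%:C) = Cintegral leb setT (fun x => k x * (psi x)%:C) <->
  (\int[leb]_x (complex.Re (h x) * phi x) = \int[leb]_x (complex.Re (k x) * psi x)) /\
  (\int[leb]_x (complex.Im (h x) * phi x) = \int[leb]_x (complex.Im (k x) * psi x)).
  have re_ l r : \int[leb]_x complex.Re (l x * (r x)%:C) = \int[leb]_x (complex.Re (l x) * r x).
    by apply: eq_Rintegral => x _; rewrite Re_mulrC.
  have im_ l r : \int[leb]_x complex.Im (l x * (r x)%:C) = \int[leb]_x (complex.Im (l x) * r x).
    by apply: eq_Rintegral => x _; rewrite Im_mulrC.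
  rewrite /Cintegral !re_ !im_; split => [[-> ->]//|[-> ->]//].
split=> [[/L2_sqint[? ?] /L2_sqint[? ?] H]|[[? ? H1] [? ? H2]]].
  by split; split => // phi tphi; have /E[] := H phi tphi.
split; [exact/L2_sqint|exact/L2_sqint|] => phi tphi.
by apply/E; split; [exact: H1|exact: H2].
Qed.

Lemma radial_projE f : (0 < n)%N -> L2 f -> radial_proj f = fun x => avg (re f) x +i* avg (im f) x.
Proof.
move=> n0 [mr mi _]; apply/funext => x; rewrite /radial_proj /Cintegral.
rewrite -(sphere_average n0 x mr) -(sphere_average n0 x mi).
by apply/eqP; rewrite eq_complex /= !mul0r subr0 addr0 !eqxx.
Qed.

Lemma L2norm_div_sqnorm f : measurable_fun setT (re f) -> measurable_fun setT (im f) ->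
  (L2norm (div_sqnorm f) ^+ 2 =
   \int[leb]_x (complex.Re (f x) ^+ 2 / sqnorm x ^+ 2)%:E +
   \int[leb]_x (complex.Im (f x) ^+ 2 / sqnorm x ^+ 2)%:E)%E.
Proof.
move=> mr mi; rewrite L2norm_sqr -ge0_eintegralD.
- apply: eq_integral => x _; rewrite /div_sqnorm normcM normcV exprMn sqr_normc sqr_enorm.
  rewrite -mulrDl; congr (_ * _)%:E; rewrite exprVn; congr (_^-1).
  by rewrite sqr_normc /= expr0n addr0.
- by have := measurable_div_sqnorm (lexx 0) mr; under eq_fun do rewrite addr0.
- by have := measurable_div_sqnorm (lexx 0) mi; under eq_fun do rewrite addr0.
- by move=> x; rewrite divr_ge0// sqr_ge0.
- by move=> x; rewrite divr_ge0// sqr_ge0.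
Qed.

Lemma complex_rellich f g : (3 <= n)%N -> is_laplacian f g ->
  radial_orthogonal (re f) -> radial_orthogonal (im f) ->
  (((n%:R ^+ 2 / 4 - 1) ^+ 2)%:E * L2norm (div_sqnorm f) ^+ 2 <= L2norm g ^+ 2)%E.
Proof.
move=> n3 /is_laplacianP[Lr Li] or oi.
have [[mr _] [mgr _] _] := Lr; have [[mi _] [mgi _] _] := Li.
rewrite L2norm_div_sqnorm// L2norm_sqrD// ge0_muleDr; last 2 first.
- by apply: integral_ge0 => x _; rewrite lee_fin divr_ge0// sqr_ge0.
- by apply: integral_ge0 => x _; rewrite lee_fin divr_ge0// sqr_ge0.
by apply: leeD; exact: weak_rellich.
Qed.

End complex_functions.

Theorem mainTheorem7 (R : realType) (n : nat) (hn : (3 <= n)%N) :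
  (forall f : 'rV[R]_n -> R[i], H2 f ->
    (((rellich_const R n + n%:R - 1) ^+ 2)%:E *
       L2norm (div_sqnorm (radial_proj_perp f)) ^+ 2
     <= L2norm (laplacian (radial_proj_perp f)) ^+ 2)%E) /\
  (forall f : 'rV[R]_n -> R[i], H2 f ->
    {ae lebesgue_rV n, forall x, radial_proj f x = 0} ->
    (((rellich_const R n + n%:R - 1) ^+ 2)%:E * L2norm (div_sqnorm f) ^+ 2
     <= L2norm (laplacian f) ^+ 2)%E).
Proof.
have n0 : (0 < n)%N by exact: ltn_trans hn.
have -> : rellich_const R n + n%:R - 1 = n%:R ^+ 2 / 4 - 1.
  by rewrite /rellich_const; field.
(* On [H2] the default value in [laplacian] is not reached: the choice is a genuine representative
   of Delta h. *)
have lapP (h : 'rV[R]_n -> R[i]) : H2 h -> is_laplacian h (laplacian h) by exact: xgetPex.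
split=> f Hf.
- have [g fg] := Hf; have fL2 : L2 f by case: fg.
  have [Lr Li] := (is_laplacianP f g).1 fg.
  have [sr _ _] := Lr; have [si _ _] := Li.
  have pE : radial_proj_perp f = fun x => ((complex.Re (f x) - avg (fun x => complex.Re (f x)) x) +i*
      (complex.Im (f x) - avg (fun x => complex.Im (f x)) x))%C.
    apply/funext => x; rewrite /radial_proj_perp radial_projE//.
    by apply/eqP; rewrite eq_complex; case: (f x) => a b /=; rewrite !eqxx.
  apply: complex_rellich => //.
  (* The function with P removed is again in H^2: its Laplacian is g minus the spherical mean of
     g. *)
  + apply: lapP; rewrite pE.
    exists (fun x => ((complex.Re (g x) - avg (fun x => complex.Re (g x)) x) +i*
      (complex.Im (g x) - avg (fun x => complex.Im (g x)) x))%C).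
    apply/is_laplacianP; split => /=; apply: weak_laplacianB => //; exact: weak_laplacian_avg.
  + by rewrite pE; exact: radial_orthogonal_sub_avg.
  + by rewrite pE; exact: radial_orthogonal_sub_avg.
- have fg := lapP f Hf; have fL2 : L2 f by case: fg.
  have [Lr Li] := (is_laplacianP _ _).1 fg.
  have [sr _ _] := Lr; have [si _ _] := Li.
  rewrite radial_projE// => f0.
  apply: complex_rellich => //.
  + by apply: radial_orthogonal_avg0 => //; apply: filterS f0 => x [].
  + by apply: radial_orthogonal_avg0 => //; apply: filterS f0 => x [].
Qed.
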